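(* Let $\tilde D$ be a $d\times d$ dilation matrix and consider the standard multiresolution structure with index $m$ on $L^2(\mathbb{R}^d)$ corresponding to $\tilde D$, with translation group $\Gamma=\mathbb{Z}^d$ and dilation $D$. Let $n$ be an integer and let $X_n\subset L^2(\mathbb{R}^d)$ and $\hat X_n\subset L^2(\widehat{\mathbb{R}^d})$ be the $n$th level wavelet Hilbert modules defined in the context. Then: 1. The space $C_c(\mathbb{R}^d)$ is an inner product $C_c(\mathbb{Z}^d)$-module with operations $[\cdot,\cdot]_n$ and $\circ_n$, and $\|\cdot\|_{X_n}$ is equal to the Hilbert module norm on $C_c(\mathbb{R}^d)$. 2. The space $X_n$ is a full Hilbert $C^*(\mathbb{Z}^d)$-module with the inner product $[\cdot,\cdot]_n$. The module action of $C^*(\mathbb{Z}^d)$ on $X_n$ has the property that for $f\in X_n$ and $a\in l^1(\mathbb{Z}^d)\subset C^*(\mathbb{Z}^d)$, the module action of $a$ on $f$ is given by $f\circ_n a$. Furthermore, if $(f_k)_{k\in\mathbb{N}}$ is a convergent sequence in $X_n$, then it is a convergent sequence in $L^2(\mathbb{R}^d)$. 3. The operations $[\![\cdot,\cdot]\!]_n$ and $\widehat{\circ_n}$ make $\hat X_n$ into a full Hilbert $C(\mathbb{T}^d)$-module. 4. If the isomorphic $C^*$-algebras $C^*(\mathbb{Z}^d)$ and $C(\mathbb{T}^d)$ are identified, then the Fourier transform on $\mathbb{R}^d$ is a unitary isomorphism between $X_n$ and $\hat X_n$.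
   Context: Conventions. $\mathbb{T}^d=\mathbb{R}^d/\mathbb{Z}^d$ with normalised Haar measure; $\widehat{\mathbb{R}^d}$ is identified with $\mathbb{R}^d$ through $(x,\xi)=e^{2\pi i x\cdot\xi}$; $(\gamma,\zeta)=e^{2\pi i\gamma\cdot\zeta}$ for $\gamma\in\mathbb{Z}^d,\zeta\in\mathbb{T}^d$. The Fourier transform on $\mathbb{R}^d$ is $\hat f(\xi)=\int f(x)(x,\xi)\,dx$ (extended to $L^2$), and on $\mathbb{Z}^d$ it is $\hat a(\zeta)=\sum_\gamma a(\gamma)(\gamma,\zeta)$; the latter extends to the identification $C^*(\mathbb{Z}^d)\cong C(\mathbb{T}^d)$, through which elements of $C^*(\mathbb{Z}^d)$ are also regarded as functions on $\mathbb{Z}^d$ (Fourier coefficients). Dilation. A dilation matrix is an integer $d\times d$ matrix $\tilde D$ all of whose eigenvalues are greater than $1$ in absolute value. The standard multiresolution structure has Hilbert space $L^2(\mathbb{R}^d)$, translation group $\Gamma=\mathbb{Z}^d$ acting by $(\gamma f)(x)=f(x-\gamma)$, and dilation $(Df)(x)=\sqrt m\,f(\tilde Dx)$, where $m=|\det\tilde D|$ is its index (the index of $D^{-1}\Gamma D$ in $\Gamma$). Operations. Let $\iota_n(\gamma)=\tilde D^{-n}\gamma\in\mathbb{R}^d$ for $\gamma\in\mathbb{Z}^d$, and $\hat\iota_n(\xi)=\hat\iota(\tilde D^{*-n}\xi)\in\mathbb{T}^d$ for $\xi\in\widehat{\mathbb{R}^d}$, where $\hat\iota:\widehat{\mathbb{R}^d}\to\mathbb{T}^d$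 is the quotient map and $\tilde D^*$ the adjoint of $\tilde D$. Define $[f,g]_n(\gamma)=\int_{\mathbb{R}^d}\overline{f(x-\tilde D^{-n}\gamma)}g(x)\,dx$ and $(f\circ_n a)(x)=\sum_{\gamma\in\mathbb{Z}^d}a(\gamma)f(x-\tilde D^{-n}\gamma)$; for $p,q\in L^2(\widehat{\mathbb{R}^d})$ and $b\in C(\mathbb{T}^d)$, $[\![p,q]\!]_n(\zeta)=m^n\sum_{\hat\iota_n(\xi)=\zeta}\overline{p(\xi)}q(\xi)$ and $(p\,\widehat{\circ_n}\,b)(\xi)=p(\xi)b(\hat\iota_n(\xi))$. Modules. For $f\in C_c(\mathbb{R}^d)$, $\|f\|_{X_n}=\sup_{\zeta\in\mathbb{T}^d}\sqrt{\widehat{[f,f]_n}(\zeta)}$. $X_n$ is the completion of $C_c(\mathbb{R}^d)$ in this norm, regarded as a subspace of $L^2(\mathbb{R}^d)$ via the continuous extension of the inclusion (one has $\|f\|_2\le\|f\|_{X_n}$), with operations $[\cdot,\cdot]_n$, $\circ_n$ extended by continuity; $\hat X_n$ is its image under the Fourier transform on $\mathbb{R}^d$, with operations $[\![\cdot,\cdot]\!]_n$, $\widehat{\circ_n}$. Hilbert modules. For a $C^*$-algebra $\mathcal{A}$, an inner product $\mathcal{A}$-module is a right $\mathcal{A}$-module $X$ (a linear space with compatible scalar multiplication) with an $\mathcal{A}$-valued inner product, linear in the second variable, with $[x,ya]=[x,y]a$, $[x,y]^*=[y,x]$, $[x,x]\ge0$, $[x,x]=0\Rightarrow x=0$. The Hilbert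 module norm is $\|x\|=\|[x,x]\|^{1/2}$; a complete inner product $\mathcal{A}$-module is a Hilbert $\mathcal{A}$-module. The same axioms define an inner product $\mathcal{A}_0$-module for a dense $*$-subalgebra $\mathcal{A}_0\subset\mathcal{A}$, with positivity and norms taken in $\mathcal{A}$; here $\mathcal{A}_0=C_c(\mathbb{Z}^d)$ (with convolution and $a^*(\gamma)=\overline{a(-\gamma)}$) in $\mathcal{A}=C^*(\mathbb{Z}^d)$. A Hilbert module is full if $[X,X]$ is dense in $\mathcal{A}$. A map $t:E\to F$ is adjointable if there is $t^*:F\to E$ with $[tx,y]=[x,t^*y]$; a unitary isomorphism is an adjointable $u$ with $u^*u=\mathrm{Id}$, $uu^*=\mathrm{Id}$. *)

(* Defs.v *)
From HB Require Import structures.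
From mathcomp Require Import all_boot all_order all_algebra.
From mathcomp Require Import all_classical all_reals all_analysis.
From mathcomp Require showcase.summability.
From mathcomp Require Import measurable_realfun complex ring_quotient ring.

Set Implicit Arguments.
Unset Strict Implicit.
Unset Printing Implicit Defensive.

Import Order.TTheory GRing.Theory Num.Theory.
Import numFieldNormedType.Exports.
Import Normc.

Local Open Scope classical_set_scope.
Local Open Scope ring_scope.
Local Open Scope complex_scope.

(* The regular algebra (R[i])^o is the copy of R[i] that carries the topology
   and the structure of a normed algebra over R[i]; complex-valued functions
   take their values there. *)
Local Notation C R := ((R[i])^o).

Definition cexp (R : realType) (t : R) : C R := cos t +i* sin t.

Section cV_measurable.
Context (R : realType) (d : nat).

Definition cV_coord (i : 'I_d) (v : 'cV[R]_d) : measurableTypeR R := v i 0.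

HB.instance Definition _ := @isMeasurable.Build default_measure_display
  'cV[R]_d (g_sigma_preimage cV_coord) (@sigma_algebra0 _ _ _)
  (@sigma_algebraC _ _) (@sigma_algebra_bigcup _ _ _).

Lemma measurable_cV_coord (i : 'I_d) : measurable_fun setT (cV_coord i).
Proof.
move=> _ Y mY; rewrite setTI; apply: sub_sigma_algebra => /=.
rewrite -bigcup_seq/=; exists i => /=; first by rewrite mem_index_enum.
by exists Y => //; rewrite setTI.
Qed.

End cV_measurable.

Section cV_measurable_fun.
Context (R : realType) d1 (T : measurableType d1) (d : nat).

Lemma measurable_fun_cV (f : T -> 'cV[R]_d) :
  (forall i, measurable_fun setT (cV_coord i \o f)) -> measurable_fun setT f.
Proof.
move=> mf; apply: (measurability (\big[setU/set0]_(i < d)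
  preimage_set_system setT (@cV_coord R d i) measurable)) => //.
move=> _ [A HA <-]; move: HA; rewrite -bigcup_seq/= => -[i _ [B mB <-]].
by rewrite !setTI; have := mf i measurableT B mB; rewrite setTI.
Qed.

End cV_measurable_fun.

Section cV_cons.
Context (R : realType) (d : nat).

Definition cV_cons (vx : 'cV[R]_d * measurableTypeR R) : 'cV[R]_(1 + d) :=
  col_mx (vx.2)%:M vx.1.

Lemma measurable_cV_cons : measurable_fun setT cV_cons.
Proof.
apply: measurable_fun_cV => i.
have [k ->|k ->] := split_ordP i.
  rewrite (_ : _ \o _ = snd); first exact: measurable_snd.
  by apply/funext => -[v x] /=; rewrite /cV_coord /cV_cons /= col_mxEu mxE ord1 mulr1n.
rewrite (_ : _ \o _ = cV_coord k \o fst).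
  by apply: measurableT_comp; [exact: measurable_cV_coord|exact: measurable_fst].
by apply/funext => -[v x] /=; rewrite /cV_coord /cV_cons /= col_mxEd.
Qed.

Definition cV_lebesgue_succ (mu : {measure set 'cV[R]_d -> \bar R}) :
    set 'cV[R]_(1 + d) -> \bar R :=
  pushforward (mu \x @lebesgue_measure R)%E cV_cons.

HB.instance Definition _ (mu : {measure set 'cV[R]_d -> \bar R}) :=
  Measure.copy (cV_lebesgue_succ mu)
    (measure_function_pushforward__canonical__measure_function_Measure
       (mu \x @lebesgue_measure R)%E measurable_cV_cons).

End cV_cons.

Fixpoint cV_lebesgue (R : realType) (d : nat) :
    {measure set 'cV[R]_d -> \bar R} :=
  match d with
  | 0 => \d_(0 : 'cV[R]_0)
  | d'.+1 => cV_lebesgue_succ (cV_lebesgue R d')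
  end.

Section complex_functions.
Context (R : realType) (d : nat).
Implicit Types f g : 'cV[R]_d -> C R.

Definition cmeasurable f : Prop :=
  measurable_fun setT (fun x => complex.Re (f x)) /\
  measurable_fun setT (fun x => complex.Im (f x)).

Definition cLp (p : nat) f : Prop :=
  cmeasurable f /\
  (\int[cV_lebesgue R d]_x (normc (f x) ^+ p)%:E < +oo)%E.

Definition cintegral f : C R :=
  (\int[cV_lebesgue R d]_x complex.Re (f x)) +i*
  (\int[cV_lebesgue R d]_x complex.Im (f x)).

Definition dotc (x y : 'cV[R]_d) : R := \sum_i x i 0 * y i 0.

Definition fourier1 f (xi : 'cV[R]_d) : C R :=
  cintegral (fun x => f x * cexp (2 * pi * dotc x xi)).

(* f is in C_c(R^d). *)
Definition Ccr f : Prop :=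
  continuous f /\ compact (closure [set x | f x != 0]).

End complex_functions.

Section L2.
Context (R : realType) (d : nat).
Local Notation mu := (cV_lebesgue R d).
Local Notation F := ('cV[R]_d -> C R).

Definition L2_pred : {pred F} := [pred f | `[< cLp 2 f >]].

Lemma normc_sqr (z : C R) :
  normc z ^+ 2 = complex.Re z ^+ 2 + complex.Im z ^+ 2.
Proof. by case: z => a b; rewrite sqr_sqrtr// addr_ge0// sqr_ge0. Qed.

Lemma measurable_normc_sqr (f : F) : cmeasurable f ->
  measurable_fun setT (EFin \o (fun x => normc (f x) ^+ 2 : R)).
Proof.
move=> [mr mi]; apply/measurable_EFinP.
under eq_fun do rewrite normc_sqr.
by apply: measurable_funD; exact: measurable_funX.
Qed.

Lemma L2_submod_closed : submod_closed L2_pred.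
Proof.
split=> [|a f g /asboolP[mf If] /asboolP[mg Ig]]; apply/asboolP.
  split; first by split; exact: measurable_cst.
  rewrite integral0_eq ?ltry// => x _.
  by rewrite normc_sqr /= expr0n addr0.
have mafg : cmeasurable (a *: f + g).
  case: a => a1 a2; split.
    rewrite (_ : (fun _ => _) = fun x => a1 * complex.Re (f x)
      - a2 * complex.Im (f x) + complex.Re (g x)).
      by apply: measurable_funD; [apply: measurable_funB;
        apply: measurable_funM => //; by [case: mf|exact: measurable_cst]
        |case: mg].
    by apply/funext => x; rewrite /GRing.add/= /GRing.scale/=; case: (f x) (g x) => [? ?] [? ?].
  rewrite (_ : (fun _ => _) = fun x => a1 * complex.Im (f x)
      + a2 * complex.Re (f x) + complex.Im (g x)).
    by apply: measurable_funD; [apply: measurable_funD;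
      apply: measurable_funM => //; by [case: mf|exact: measurable_cst]
      |case: mg].
  by apply/funext => x; rewrite /GRing.add/= /GRing.scale/=; case: (f x) (g x) => [? ?] [? ?].
split=> //.
have [mf2 mg2] := (measurable_normc_sqr mf, measurable_normc_sqr mg).
have sq0 (h : F) x : (0 <= (normc (h x) ^+ 2)%:E)%E by rewrite lee_fin sqr_ge0.
pose b := (2 * normc a ^+ 2)%:E; pose h x := (b * (normc (f x) ^+ 2)%:E +
  2%:E * (normc (g x) ^+ 2)%:E)%E.
have b0 : (0 <= b)%E by rewrite lee_fin mulr_ge0// sqr_ge0.
apply: (@le_lt_trans _ _ (\int[mu]_x h x)%E).
  apply: ge0_le_integral => //.
  - exact: measurable_normc_sqr.
  - by apply: emeasurable_funD; exact: measurable_funeM.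
  move=> x _; rewrite /h /b -!EFinM -EFinD lee_fin.
  have -> : (a *: f + g) x = a * f x + g x by [].
  rewrite !normc_sqr; case: a {b b0 h mafg} (f x) (g x) => [a1 a2] [f1 f2] [g1 g2] /=.
  rewrite -subr_ge0 (_ : _ - _ = (a1 * f1 - a2 * f2 - g1) ^+ 2
     + (a1 * f2 + a2 * f1 - g2) ^+ 2); first by rewrite addr_ge0// sqr_ge0.
  by ring.
rewrite ge0_integralD//; last 4 first.
- by move=> x _; rewrite mule_ge0.
- exact: measurable_funeM.
- by move=> x _; rewrite mule_ge0.
- exact: measurable_funeM.
rewrite !ge0_integralZl//.
by rewrite lte_add_pinfty// lte_mul_pinfty.
Qed.

HB.instance Definition _ := GRing.isSubmodClosed.Build _ _ L2_pred
  (GRing.submod_closed_semi L2_submod_closed).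
HB.instance Definition _ := GRing.isOppClosed.Build _ L2_pred
  (GRing.zmod_closedN (GRing.submod_closedB L2_submod_closed)).

Record L2fun := MkL2fun { L2fun_val :> F ; _ : L2fun_val \in L2_pred }.
HB.instance Definition _ := [isSub for L2fun_val].
HB.instance Definition _ := [Choice of L2fun by <:].
HB.instance Definition _ := [SubChoice_isSubLmodule of L2fun by <:].

Definition ae0_pred : {pred L2fun} :=
  [pred f : L2fun | `[< {ae mu, forall x, f x = 0} >]].

Lemma ae0_zmod_closed : zmod_closed ae0_pred.
Proof.
split=> [|f g /asboolP f0 /asboolP g0]; apply/asboolP; first exact: aeW.
by apply: filterS2 f0 g0 => x /= fx gx; rewrite /= [LHS](_ : _ = f x - g x)// fx gx subrr.
Qed.

HB.instance Definition _ := GRing.isZmodClosed.Build _ ae0_pred ae0_zmod_closed.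

Definition L2 : Type := Quotient.quot ae0_pred.
HB.instance Definition _ := EqQuotient.on L2.
HB.instance Definition _ := GRing.Zmodule.on L2.

Local Open Scope quotient_scope.

Definition L2scale (a : R[i]) (u : L2) : L2 := \pi_L2 (a *: repr u).

Lemma ae0_scale a (f : L2fun) : f \in ae0_pred -> a *: f \in ae0_pred.
Proof.
move=> /asboolP f0; apply/asboolP; apply: filterS f0 => x fx.
by rewrite [LHS](_ : _ = a * f x)// fx mulr0.
Qed.

Lemma pi_L2scale a (f : L2fun) : \pi_L2 (a *: f) = L2scale a (\pi_L2 f).
Proof.
apply/eqP; rewrite -Quotient.idealrBE -scalerBr; apply: ae0_scale.
by rewrite Quotient.idealrBE reprK.
Qed.

Let pi_L2D (f g : L2fun) : \pi_L2 (f + g) = \pi_L2 f + \pi_L2 g :> L2.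
Proof. exact: Quotient.pi_add. Qed.

Let L2scaleA a b u : L2scale a (L2scale b u) = L2scale (a * b) u.
Proof.
elim/quotW: u => f.
by rewrite -(pi_L2scale b f) -(pi_L2scale a) -(pi_L2scale _ f) scalerA.
Qed.

Let L2scale1 : left_id 1 L2scale.
Proof. by elim/quotW => f; rewrite -(pi_L2scale 1 f) scale1r. Qed.

Let L2scaleDr : right_distributive L2scale +%R.
Proof.
move=> a; elim/quotW => f; elim/quotW => g.
by rewrite -pi_L2D -(pi_L2scale a (f + g)) -(pi_L2scale a f)
  -(pi_L2scale a g) -pi_L2D scalerDr.
Qed.

Let L2scaleDl u : {morph L2scale^~ u : a b / a + b}.
Proof.
elim/quotW: u => f a b.
by rewrite -(pi_L2scale _ f) -(pi_L2scale a f) -(pi_L2scale b f) -pi_L2D scalerDl.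
Qed.

HB.instance Definition _ :=
  GRing.Zmodule_isLmodule.Build R[i] L2 L2scaleA L2scale1 L2scaleDr L2scaleDl.

Definition L2rep (u : L2) : F := L2fun_val (repr u).

(* The class of f; 0 when f is not square-integrable. *)
Definition toL2 (f : F) : L2 := \pi_L2 (insubd (0 : L2fun) f).

Definition L2norm (u : L2) : R :=
  Num.sqrt (\int[mu]_x (normc (L2rep u x) ^+ 2)).

End L2.

Section convergence.
Context (R : realType) (V : zmodType) (nrm : V -> R).

Definition cvg_for (u : nat -> V) (l : V) : Prop :=
  (fun k => nrm (u k - l)) @ \oo --> (0 : R).

Definition cauchy_for (u : nat -> V) : Prop :=
  forall e : R, 0 < e -> exists N : nat,
    forall k l, (N <= k)%N -> (N <= l)%N -> nrm (u k - u l) < e.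

End convergence.

Section Fourier_L2.
Context (R : realType) (d : nat).

(* The extension of [fourier1] to L^2(R^d): v is the transform of u when
   fourier1 (w k) tends to v for all w k in L^1 and L^2 tending to u. *)
Definition fourierL2 (u : L2 R d) : L2 R d :=
  xget 0 [set v | forall w : nat -> L2 R d,
    (forall k, cLp 1 (L2rep (w k))) -> cvg_for (@L2norm R d) w u ->
    cvg_for (@L2norm R d) (fun k => toL2 (fourier1 (L2rep (w k)))) v].

End Fourier_L2.

Section torus.
Context (R : realType) (d : nat).

Definition lattice_pred : {pred 'cV[R]_d} :=
  [pred v : 'cV[R]_d | [forall i, v i 0 \is a Num.int]].

Lemma lattice_zmod_closed : zmod_closed lattice_pred.
Proof.
split=> [|u v /forallP uZ /forallP vZ]; apply/forallP => i; rewrite !mxE.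
  exact: rpred0.
exact: rpredB.
Qed.

HB.instance Definition _ :=
  GRing.isZmodClosed.Build _ lattice_pred lattice_zmod_closed.

Definition torus : Type := quotient_topology (Quotient.quot lattice_pred).
HB.instance Definition _ := Topological.on torus.
HB.instance Definition _ := Pointed.on torus.
HB.instance Definition _ := Quotient.on torus.

Local Open Scope quotient_scope.

Definition torus_proj (x : 'cV[R]_d) : torus := \pi_torus x.
Definition torus_repr (z : torus) : 'cV[R]_d := repr z.

End torus.

Section fct_algebra.
Context (K : comNzRingType) (T : pointedType) (B : algType K).

Let fct_scalerAl (a : K) (f g : T -> B) : a *: (f * g) = (a *: f) * g.
Proof. by apply/funext => x; exact: scalerAl. Qed.

HB.instance Definition _ :=
  GRing.Lmodule_isLalgebra.Build K (T -> B) fct_scalerAl.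

Let fct_scalerAr (a : K) (f g : T -> B) : a *: (f * g) = f * (a *: g).
Proof. by apply/funext => x; exact: scalerAr. Qed.

HB.instance Definition _ :=
  GRing.Lalgebra_isAlgebra.Build K (T -> B) fct_scalerAr.

End fct_algebra.

Lemma continuous_conjc (R : realType) (T : topologicalType) (f : T -> C R) :
  continuous f -> continuous (fun z => conjc (f z) : C R).
Proof.
move=> cf z; apply/cvgrPdist_lt => e e0.
have /cvgrPdist_lt/(_ e e0) := cf z; apply: filterS => w.
have -> : (conjc (f z) : C R) - conjc (f w) = conjc (f z - f w).
  by case: (f z) (f w) => [a b] [a' b']; congr Complex => /=; rewrite opprD.
by rewrite (normcJ (f z - f w)).
Qed.

Section continuous_functions.
Context (R : realType) (d : nat).
Local Notation F := (torus R d -> C R).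

Definition CT_pred : {pred F} := [pred f : F | `[< continuous f >]].

Lemma CT_subalg_closed : subalg_closed CT_pred.
Proof.
split=> [|a f g /asboolP cf /asboolP cg|f g /asboolP cf /asboolP cg];
  apply/asboolP.
- exact: cst_continuous.
- by move=> x; apply: continuousD; [apply: continuousM; [exact: cst_continuous|exact: cf]|exact: cg].
- by move=> x; apply: continuousM; [exact: cf|exact: cg].
Qed.

HB.instance Definition _ := GRing.isSubalgClosed.Build _ _ CT_pred
  (GRing.subalg_closed_semi CT_subalg_closed).

Record CT := MkCT { CT_val :> F ; _ : CT_val \in CT_pred }.
HB.instance Definition _ := [isSub for CT_val].
HB.instance Definition _ := [Choice of CT by <:].
HB.instance Definition _ := [SubChoice_isSubAlgebra of CT by <:].

Lemma CT_star_subproof (f : CT) : (fun z => conjc (f z)) \in CT_pred.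
Proof. exact/asboolP/continuous_conjc/asboolP/(valP f). Qed.

Definition CT_star (f : CT) : CT := MkCT (CT_star_subproof f).

Definition CT_norm (f : CT) : R := sup [set normc (f z) | z in setT].

End continuous_functions.

Section cstar.
Context (R : realType) (A : algType R[i]) (star : A -> A) (nrm : A -> R).

Record is_cstar_algebra : Prop := {
  cstar_norm_eq0 : forall a, nrm a = 0 -> a = 0;
  cstar_normD : forall a b, nrm (a + b) <= nrm a + nrm b;
  cstar_normZ : forall k a, nrm (k *: a) = normc k * nrm a;
  cstar_normM : forall a b, nrm (a * b) <= nrm a * nrm b;
  cstar_starD : forall a b, star (a + b) = star a + star b;
  cstar_starZ : forall k a, star (k *: a) = conjc k *: star a;
  cstar_starM : forall a b, star (a * b) = star b * star a;
  cstar_starK : forall a, star (star a) = a;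
  cstar_identity : forall a, nrm (star a * a) = nrm a ^+ 2;
  cstar_complete : forall u : nat -> A,
    cauchy_for nrm u -> exists l, cvg_for nrm u l }.

Definition cstar_pos (a : A) : Prop := exists b, a = star b * b.

Section modules.
Context (V : lmodType R[i]) (X : set V) (ip : V -> V -> A) (act : V -> A -> V).

(* X is an inner product module over the *-subalgebra A0 of A; positivity is
   taken in A. *)
Record inner_product_module (A0 : set A) : Prop := {
  ipm_0 : X 0;
  ipm_D : forall x y, X x -> X y -> X (x + y);
  ipm_Z : forall k x, X x -> X (k *: x);
  ipm_act : forall x a, X x -> A0 a -> X (act x a);
  ipm_act1 : forall x, X x -> act x 1 = x;
  ipm_actM : forall x a b, X x -> A0 a -> A0 b ->
    act x (a * b) = act (act x a) b;
  ipm_actDl : forall x y a, X x -> X y -> A0 a ->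
    act (x + y) a = act x a + act y a;
  ipm_actDr : forall x a b, X x -> A0 a -> A0 b ->
    act x (a + b) = act x a + act x b;
  ipm_actZl : forall k x a, X x -> A0 a -> act (k *: x) a = k *: act x a;
  ipm_actZr : forall k x a, X x -> A0 a -> act x (k *: a) = k *: act x a;
  ipm_ip : forall x y, X x -> X y -> A0 (ip x y);
  ipm_ipD : forall x y z, X x -> X y -> X z ->
    ip x (y + z) = ip x y + ip x z;
  ipm_ipZ : forall k x y, X x -> X y -> ip x (k *: y) = k *: ip x y;
  ipm_ip_act : forall x y a, X x -> X y -> A0 a ->
    ip x (act y a) = ip x y * a;
  ipm_ip_star : forall x y, X x -> X y -> star (ip x y) = ip y x;
  ipm_ip_pos : forall x, X x -> cstar_pos (ip x x);
  ipm_ip_eq0 : forall x, X x -> ip x x = 0 -> x = 0 }.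

Definition hilbert_norm (x : V) : R := Num.sqrt (nrm (ip x x)).

Definition hilbert_module : Prop :=
  inner_product_module setT /\
  (forall u : nat -> V, (forall k, X (u k)) -> cauchy_for hilbert_norm u ->
    exists2 l, X l & cvg_for hilbert_norm u l).

Definition full_module : Prop :=
  forall (a : A) (e : R), 0 < e ->
    exists x y, [/\ X x, X y & nrm (ip x y - a) < e].

End modules.
End cstar.

Definition cstar_isomorphism (R : realType)
    (A : algType R[i]) (starA : A -> A) (nrmA : A -> R)
    (B : algType R[i]) (starB : B -> B) (nrmB : B -> R) (Phi : A -> B) : Prop :=
  [/\ bijective Phi, linear Phi,
      Phi 1 = 1 /\ {morph Phi : a b / a * b},
      {morph Phi : a / starA a >-> starB a} &
      forall a, nrmB (Phi a) = nrmA a].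

(* u : X -> Y is a unitary isomorphism of Hilbert modules, where Phi identifies
   the algebra of coefficients of X with the one of Y. *)
Definition unitary_isomorphism (R : realType) (A B : algType R[i])
    (Phi : A -> B) (V W : lmodType R[i]) (X : set V) (ipX : V -> V -> A)
    (Y : set W) (ipY : W -> W -> B) (u : V -> W) : Prop :=
  (forall x, X x -> Y (u x)) /\
  exists us : W -> V,
    [/\ forall y, Y y -> X (us y),
        forall x y, X x -> Y y -> ipY (u x) y = Phi (ipX x (us y)),
        forall x, X x -> us (u x) = x &
        forall y, Y y -> u (us y) = y].

Section group_algebra.
Context (R : realType) (d : nat).
Implicit Types a b : 'cV[int]_d -> C R.

(* a is in C_c(Z^d). *)
Definition Ccz a : Prop := finite_set [set g | a g != 0].

Definition deltaZ : 'cV[int]_d -> C R := fun g => (g == 0)%:R.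

Definition convZ a b : 'cV[int]_d -> C R :=
  fun g => \sum_(h \in [set: 'cV[int]_d]) a h * b (g - h).

Definition starZ a : 'cV[int]_d -> C R := fun g => conjc (a (- g)).

(* The character (g, z) of Z^d, which does not depend on the representative
   of z in R^d *)
Definition charZ (g : 'cV[int]_d) (z : torus R d) : C R :=
  cexp (2 * pi * dotc (map_mx intr g) (torus_repr z)).

Definition fourierZ a (z : torus R d) : C R :=
  \sum_(g \in [set: 'cV[int]_d]) a g * charZ g z.

Section morphisms.
Context (A : algType R[i]) (star : A -> A) (nrm : A -> R)
  (j : ('cV[int]_d -> C R) -> A).

Record star_morphism : Prop := {
  smorph1 : j deltaZ = 1;
  smorphD : forall a b, Ccz a -> Ccz b -> j (a + b) = j a + j b;
  smorphZ : forall k a, Ccz a -> j (k *: a) = k *: j a;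
  smorphM : forall a b, Ccz a -> Ccz b -> j (convZ a b) = j a * j b;
  smorph_star : forall a, Ccz a -> j (starZ a) = star (j a) }.

End morphisms.

(* (A, j) is a model of C^*(Z^d), the completion of C_c(Z^d) in the largest norm
   given by a *-representation in a C*-algebra; it is unique up to a unique
   isomorphism. *)
Record group_cstar_algebra (A : algType R[i]) (star : A -> A) (nrm : A -> R)
    (j : ('cV[int]_d -> C R) -> A) : Prop := {
  gcstar_cstar : is_cstar_algebra star nrm;
  gcstar_morphism : star_morphism star j;
  gcstar_dense : forall (x : A) (e : R), 0 < e ->
    exists2 a, Ccz a & nrm (j a - x) < e;
  gcstar_max : forall (B : algType R[i]) (starB : B -> B) (nrmB : B -> R)
    (p : ('cV[int]_d -> C R) -> B),
    is_cstar_algebra starB nrmB -> star_morphism starB p ->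
    forall a, Ccz a -> nrmB (p a) <= nrm (j a) }.

Definition l1norm a : \bar R :=
  (\esum_(g in [set: 'cV[int]_d]) (normc (a g))%:E)%E.

Section embeddings.
Context (A : algType R[i]) (nrm : A -> R) (j : ('cV[int]_d -> C R) -> A).

Definition Ccz_of (x : A) : 'cV[int]_d -> C R :=
  xget 0 [set a | Ccz a /\ j a = x].

(* The inclusion of l^1(Z^d) in C^*(Z^d) extends j by continuity. *)
Definition l1_embed a : A :=
  xget 0 [set x | forall b : nat -> ('cV[int]_d -> C R),
    (forall k, Ccz (b k)) ->
    (fun k => l1norm (b k - a)) @ \oo --> 0%E ->
    cvg_for nrm (fun k => j (b k)) x].

End embeddings.
End group_algebra.

Definition usum (R : realType) (I : choiceType) (S : set I) (F : I -> C R) :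
    C R :=
  summability.sum (fun i => if i \in S then F i else 0).

Definition mxpow (K : comUnitRingType) (d : nat) (M : 'M[K]_d) (n : int) :
    'M[K]_d :=
  match n with
  | Posz k => M ^+ k
  | Negz k => invmx M ^+ k.+1
  end.

Definition dilation_matrix (R : realType) (d : nat) (D : 'M[int]_d) : Prop :=
  forall l : R[i], eigenvalue (map_mx intr D) l -> 1 < `|l|.

Section wavelet_modules.
Context (R : realType) (d : nat) (D : 'M[int]_d) (n : int).
Local Notation F := ('cV[R]_d -> C R).

Definition dilation_index : nat := `|\det D|%N.
Definition index_pow : C R := (dilation_index%:R : R[i]) ^ n.

Definition iota_n (g : 'cV[int]_d) : 'cV[R]_d :=
  mxpow (map_mx intr D) (- n) *m map_mx intr g.

Definition iota_hat_n (xi : 'cV[R]_d) : torus R d :=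
  torus_proj (mxpow (map_mx intr D)^T (- n) *m xi).

Definition bracket (f g : F) : 'cV[int]_d -> C R :=
  fun c => cintegral (fun x => conjc (f (x - iota_n c)) * g x).

Definition circ (f : F) (a : 'cV[int]_d -> C R) : F :=
  fun x => usum setT (fun c => a c * f (x - iota_n c)).

Definition Xnorm (f : F) : R :=
  sup [set Num.sqrt (complex.Re (fourierZ (bracket f f) z)) | z in setT].

(* The Cauchy sequence f represents an element of the completion of C_c(R^d)
   in the norm Xnorm, and u is its image in L^2(R^d). *)
Definition Xapprox (f : nat -> F) (u : L2 R d) : Prop :=
  [/\ forall k, Ccr (f k), cauchy_for Xnorm f &
      cvg_for (@L2norm R d) (fun k => toL2 (f k)) u].

Definition Xn : set (L2 R d) := [set u | exists f, Xapprox f u].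

Section operations.
Context (A : algType R[i]) (nrm : A -> R) (j : ('cV[int]_d -> C R) -> A).

(* [u, v]_n, extended by continuity from C_c(R^d) to X_n *)
Definition Xn_ip (u v : L2 R d) : A :=
  xget 0 [set x | forall f g, Xapprox f u -> Xapprox g v ->
    cvg_for nrm (fun k => j (bracket (f k) (g k))) x].

(* The action, extended by continuity from C_c(R^d) and C_c(Z^d) to X_n and
   C^*(Z^d) *)
Definition Xn_act (u : L2 R d) (x : A) : L2 R d :=
  xget 0 [set w | forall (f : nat -> F) (a : nat -> ('cV[int]_d -> C R)),
    Xapprox f u -> (forall k, Ccz (a k)) -> cvg_for nrm (fun k => j (a k)) x ->
    Xapprox (fun k => circ (f k) (a k)) w].

End operations.

Definition Xn_hat : set (L2 R d) := [set fourierL2 u | u in Xn].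

(* [[p, q]]_n is the continuous function given by the formula for almost every
   point of T^d.  The null sets of T^d are those whose inverse image in R^d is
   a Lebesgue null set. *)
Definition Xn_hat_ip (p q : L2 R d) : CT R d :=
  xget 0 [set h : CT R d | {ae cV_lebesgue R d, forall x,
    h (torus_proj x) = index_pow *
      usum [set xi | iota_hat_n xi = torus_proj x]
        (fun xi => conjc (L2rep p xi) * L2rep q xi)}].

Definition Xn_hat_act (p : L2 R d) (b : CT R d) : L2 R d :=
  toL2 (fun xi => L2rep p xi * b (iota_hat_n xi)).

End wavelet_modules.

(* Main.v *)
(* Everything on the Fourier side is reduced to one identity.  For f, g in
   C_c(R^d), the bracket [f, g]_n is a finitely supported function on Z^d whose
   Fourier transform at x is, by Poisson summation (after the linear change of
   variables y = D^-n x, whose Jacobian gives the factor m^n), the sum of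
   conj f^ * g^ over the fibre of iota_hat_n.  Hence the matrix of brackets is
   pointwise positive semidefinite on T^d, and Cauchy-Schwarz at each point of
   the torus gives |[f, g]_n| <= |f|_{X_n} |g|_{X_n}; brackets and actions
   therefore extend to the completion.  The completion embeds in L^2 because the
   mean over T^d of [f, f]_n^ is |f|_2^2: an element that vanishes in L^2 has a
   continuous nonnegative bracket with zero mean.

   The norm of C^*(Z^d) is the sup norm on T^d.  It dominates the sup norm by
   its maximality.  Conversely, if b = a^* a and N = 2^k, then |b|^N = |b^N|,
   and b^N has O(N^d) coefficients, each at most sup |b^|^N; let N tend to
   infinity.

   For u in X_n, the formula for [[u^, u^]]_n is obtained from the case of C_c by
   passing to a subsequence which converges geometrically, hence almost
   everywhere on fibres, and the formula for [[u^, v^]]_n by polarization.  The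
   structure of the Fourier-side module is then transported from X_n. *)

From HB Require Import structures.
Require Import Defs.
From mathcomp Require Import all_boot all_order all_algebra.
From mathcomp Require Import all_classical all_reals all_analysis.
From mathcomp Require summability.
From mathcomp Require Import measurable_realfun complex ring_quotient ring lra zify.
Set Implicit Arguments.
Unset Strict Implicit.
Unset Printing Implicit Defensive.
Import Order.TTheory GRing.Theory Num.Theory.
Import numFieldNormedType.Exports.
Import Normc.
Local Open Scope classical_set_scope.
Local Open Scope ring_scope.

(** * Lebesgue measure on R^d *)

Section cV_measure.
Context (R : realType).

(** The transform on L^2 is specified through all approximating sequences, and so are the operations
    of X_n; each has to be shown to exist by a continuity estimate before it can be used. For the
    transform this estimate is Plancherel's inequality: Bessel's inequality on the cube, an affine
    map for bounded supports, Fatou's lemma beyond. The equality of norms that makes the transform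
    unitary on X_n comes from the fibre formula instead, and its injectivity there from definiteness
    of the inner product. Integrals of complex functions are estimated through real and imaginary
    parts; this costs a factor 2 that recurs in bounds but affects no limit, while exact norm
    identities are obtained pointwise on the torus or by taking N-th roots. The change of variables
    has two stages: by Tonelli an invertible matrix multiplies integrals by some constant, and this
    constant is computed for integral matrices. Fibre sums are unconditional sums; they are reached
    through sums of squares, for which the extended reals and monotone convergence are available. *)

Lemma measurable_cV_comp d0 (T : measurableType d0) (d : nat) (f : T -> 'cV[R]_d) i :
  measurable_fun setT f -> measurable_fun setT (fun x => f x i 0 : R).
Proof.
move=> mf; exact: (measurableT_comp (@measurable_cV_coord R d i) mf).
Qed.

Lemma measurable_cVP d0 (T : measurableType d0) (d : nat) (f : T -> 'cV[R]_d) :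
  (forall i, measurable_fun setT (fun x => f x i 0 : R)) -> measurable_fun setT f.
Proof. by move=> mf; apply: measurable_fun_cV => i; exact: mf. Qed.

Lemma measurable_cVD d0 (T : measurableType d0) (d : nat) (f g : T -> 'cV[R]_d) :
  measurable_fun setT f -> measurable_fun setT g ->
  measurable_fun setT (fun x => f x + g x).
Proof.
move=> mf mg; apply: measurable_cVP => i; under eq_fun do rewrite mxE.
by apply: measurable_funD; exact: measurable_cV_comp.
Qed.

Lemma measurable_cVN d0 (T : measurableType d0) (d : nat) (f : T -> 'cV[R]_d) :
  measurable_fun setT f -> measurable_fun setT (fun x => - f x).
Proof.
move=> mf; apply: measurable_cVP => i; under eq_fun do rewrite mxE.
by apply: measurable_funN; exact: measurable_cV_comp.
Qed.

Lemma measurable_cV_mulmx d0 (T : measurableType d0) (d e : nat) (M : 'M[R]_(e, d))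
    (f : T -> 'cV[R]_d) :
  measurable_fun setT f -> measurable_fun setT (fun x => M *m f x).
Proof.
move=> mf; apply: measurable_cVP => i; under eq_fun do rewrite mxE.
apply: measurable_sum => k; apply: measurable_funM => //.
exact: measurable_cV_comp.
Qed.

Definition box (d : nat) (A : 'I_d -> set R) : set 'cV[R]_d :=
  [set x | forall i, A i (x i 0)].

Lemma measurable_box (d : nat) (A : 'I_d -> set R) :
  (forall i, measurable (A i : set (measurableTypeR R))) -> measurable (box A).
Proof.
move=> mA.
rewrite (_ : box A = \bigcap_(i in [set: 'I_d]) ((fun x : 'cV[R]_d => x i 0 : R) @^-1` A i)); last first.
  by apply/seteqP; split=> [x Ax i _|x Ax i]; [exact: Ax|exact: (Ax i)].
apply: fin_bigcap_measurable => // i _; rewrite -[X in measurable X]setTI.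
by apply: measurable_cV_comp => //; exact: mA.
Qed.

Lemma cV_lebesgueS (d : nat) (A : set 'cV[R]_(1 + d)) :
  cV_lebesgue R (1 + d) A =
  (\int[cV_lebesgue R d]_v lebesgue_measure (xsection (@cV_cons R d @^-1` A) v))%E.
Proof. by []. Qed.

Lemma cV_cons_ord0 (d : nat) (v : 'cV[R]_d) t : cV_cons (v, t) ord0 0 = t.
Proof.
transitivity (cV_cons (v, t) (lshift d ord0) 0).
  by congr (cV_cons _ _ _); exact/val_inj.
by rewrite /cV_cons col_mxEu mxE.
Qed.

Lemma cV_cons_lift (d : nat) (v : 'cV[R]_d) t i :
  cV_cons (v, t) (lift ord0 i : 'I_(1 + d)) 0 = v i 0.
Proof.
by rewrite /cV_cons (_ : lift _ _ = rshift 1 i) ?col_mxEd//; exact/val_inj.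
Qed.

Lemma cV_lebesgue_box (d : nat) (A : 'I_d -> set R) :
  (forall i, measurable (A i : set (measurableTypeR R))) ->
  cV_lebesgue R d (box A) = (\prod_(i < d) lebesgue_measure (A i : set (measurableTypeR R)))%E.
Proof.
elim: d A => [|d IH] A mA.
  rewrite big_ord0 /= diracE mem_set//.
  by case.
rewrite [LHS]cV_lebesgueS big_ord_recl.
rewrite (_ : _ @^-1` _ = box (fun i => A (lift ord0 i)) `*` A ord0); last first.
  apply/seteqP; split=> -[v t] /=.
    move=> Avt; split=> [i|]; first by have := Avt (lift ord0 i); rewrite cV_cons_lift.
    by have := Avt ord0; rewrite cV_cons_ord0.
  move=> [Av At] i; case: (unliftP ord0 i) => [k|] ->.
    by rewrite cV_cons_lift; exact: Av.
  by rewrite cV_cons_ord0.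
rewrite -[LHS]/((cV_lebesgue R d \x lebesgue_measure)%E _).
rewrite product_measure1E//; last first.
  by apply: measurable_box => i; exact: mA.
by rewrite IH 1?muleC// => i; exact: mA.
Qed.

Definition cbox (d : nat) (r : R) : set 'cV[R]_d := box (fun=> `[- r, r]%classic).

Lemma measurable_cbox d r : measurable (@cbox d r).
Proof. by apply: measurable_box => i; exact: measurable_itv. Qed.

Lemma cV_lebesgue_cbox d r : (cV_lebesgue R d (cbox r) < +oo)%E.
Proof.
rewrite cV_lebesgue_box; last by move=> i; exact: measurable_itv.
rewrite ltey_eq prode_fin_num// => i _; rewrite lebesgue_measure_itv.
by case: ifP.
Qed.

Lemma cbox_cover d : \bigcup_k @cbox d k%:R = setT.
Proof.
apply/seteqP; split=> // x _.
pose M := (\sum_i `|x i 0|).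
exists (Num.trunc M).+1 => // i.
rewrite /= in_itv /= -ler_norml.
apply: (@le_trans _ _ M); last first.
  by apply: ltW; apply: truncnS_gt.
by rewrite /M (bigD1 i)//= lerDl sumr_ge0.
Qed.

Lemma sigma_finite_cV_lebesgue d : sigma_finite setT (cV_lebesgue R d).
Proof.
exists (fun k => @cbox d k%:R); first by rewrite cbox_cover.
by move=> k; split; [exact: measurable_cbox|exact: cV_lebesgue_cbox].
Qed.

(* [cV_lebesgue] is a fixpoint into the type of measures, so that a
   sigma-finite instance can only be attached to a copy of it. *)
Definition cV_leb (d : nat) : set 'cV[R]_d -> \bar R := cV_lebesgue R d.

HB.instance Definition _ d := Measure.copy (@cV_leb d) (cV_lebesgue R d).

HB.instance Definition _ d := @Measure_isSigmaFinite.Build _ _ _ (@cV_leb d)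
  (sigma_finite_cV_lebesgue d).

(** The translated measure agrees with Lebesgue measure on half-open intervals, which determine
    it. *)
Lemma lebesgue_measureD (a : R) (A : set (measurableTypeR R)) : measurable A ->
  lebesgue_measure ((fun x => x + a) @^-1` A) = lebesgue_measure A.
Proof.
move=> mA.
have mf : measurable_fun setT ((fun x : measurableTypeR R => x + a) : measurableTypeR R -> measurableTypeR R).
  exact: measurable_funD.
pose mm : {measure set (measurableTypeR R) -> \bar R} :=
  measure_function_pushforward__canonical__measure_function_Measure
       (@lebesgue_measure R) mf.
rewrite -[LHS]/(mm A); apply/esym/lebesgue_measure_unique => // X [[u v] _ <-] /=.
rewrite /pushforward /=.
rewrite (_ : _ @^-1` _ = `]u - a, v - a]%classic); last first.
  by apply/seteqP; split=> x /=; rewrite !in_itv /= ltrBlDr lerBrDr.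
rewrite !lebesgue_measure_itv /= !lte_fin ltrD2r; case: ifP => // _.
by rewrite -!EFinD; congr EFin; ring.
Qed.

(** By induction on d through the sections of A: the added coordinate is translated by the
    one-dimensional case, and the induction hypothesis identifies the image of the measure under the
    remaining translation. *)
Lemma cV_lebesgueD d (a : 'cV[R]_d) (A : set 'cV[R]_d) : measurable A ->
  cV_lebesgue R d ((fun x => x + a) @^-1` A) = cV_lebesgue R d A.
Proof.
elim: d a A => [|d IH] a A mA.
  congr (cV_lebesgue R 0 _); apply/seteqP; split=> x /=; by rewrite (flatmx0 a) addr0.
have mAa : measurable ((fun x => x + a) @^-1` A).
  rewrite -[X in measurable X]setTI; apply: measurable_cVD => //.
rewrite [LHS]cV_lebesgueS [RHS]cV_lebesgueS.
pose a0 := a ord0 0; pose a' := \col_i (a (lift ord0 i) 0).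
have consD v t : cV_cons (v, t) + a = cV_cons (v + a', t + a0) :> 'cV_(1 + d).
  apply/matrixP => i k; rewrite ord1 {k} mxE.
  case: (unliftP ord0 i) => [k|] ->; last by rewrite !cV_cons_ord0.
  by rewrite !cV_cons_lift !mxE.
have mcA : measurable (@cV_cons R d @^-1` A).
  by rewrite -[X in measurable X]setTI; exact: measurable_cV_cons.
pose F v := lebesgue_measure (xsection (@cV_cons R d @^-1` A) v).
have mF : measurable_fun setT F by exact: measurable_fun_xsection.
transitivity (\int[cV_lebesgue R d]_v F (v + a')%R)%E.
  apply: eq_integral => v _; rewrite /F.
  rewrite -[RHS](lebesgue_measureD a0); last exact: (measurable_xsection _ mcA).
  congr (lebesgue_measure _); apply/seteqP; split=> t;
    by rewrite /xsection /= !inE /= consD.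
have mD : measurable_fun setT (fun v : 'cV[R]_d => v + a').
  by apply: measurable_cVD.
transitivity (\int[pushforward (cV_lebesgue R d) (fun v => v + a')%R]_v F v)%E.
  by rewrite [RHS]ge0_integral_pushforward.
by apply: eq_measure_integral => B mB _; exact: IH.
Qed.

Lemma ge0_integral_cVD d (a : 'cV[R]_d) (F : 'cV[R]_d -> \bar R) :
  measurable_fun setT F -> (forall x, 0 <= F x)%E ->
  (\int[cV_lebesgue R d]_x F (x + a)%R = \int[cV_lebesgue R d]_x F x)%E.
Proof.
move=> mF F0.
have mD : measurable_fun setT (fun v : 'cV[R]_d => v + a) by apply: measurable_cVD.
transitivity (\int[pushforward (cV_lebesgue R d) (fun v => v + a)%R]_v F v)%E.
  by rewrite [RHS]ge0_integral_pushforward// => y _; exact: F0.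
by apply: eq_measure_integral => B mB _; exact: cV_lebesgueD.
Qed.

Definition cube (d : nat) : set 'cV[R]_d := box (fun=> `[0, 1[%classic).

Lemma measurable_cube d : measurable (@cube d).
Proof. by apply: measurable_box => i; exact: measurable_itv. Qed.

Lemma cV_lebesgue_cube d : cV_lebesgue R d (@cube d) = 1%E.
Proof.
rewrite cV_lebesgue_box; last by move=> i; exact: measurable_itv.
by rewrite big1// => i _; rewrite lebesgue_measure_itv /= lte_fin ltr01 -EFinD subr0.
Qed.

(** The Tonelli argument below integrates the indicator of the cube at M y - x with respect to x, so
    the reflected cube appears, with its half-open faces exchanged. *)
Lemma cV_lebesgue_oppcube d : cV_lebesgue R d ((fun x => - x) @^-1` @cube d) = 1%E.
Proof.
rewrite (_ : _ @^-1` _ = @box d (fun=> `]-1, 0]%classic)).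
  rewrite cV_lebesgue_box; last by move=> i; exact: measurable_itv.
  by rewrite big1// => i _; rewrite lebesgue_measure_itv /= lte_fin ltrN10 -EFinD sub0r opprK.
by apply/seteqP; split=> x /= Ax i; have := Ax i; rewrite /= mxE !in_itv /=; lra.
Qed.

Lemma cV_lebesgue_indic d (A : set 'cV[R]_d) : measurable A ->
  cV_lebesgue R d A = (\int[cV_lebesgue R d]_x (\1_A x)%:E)%E.
Proof. by move=> mA; rewrite integral_indic// setIT. Qed.

(* Tonelli applied to [F (x + M y) * 1_cube (M y)]: substituting [x] on one side
   and [y] on the other makes the two integrals proportional. *)
Lemma ge0_integral_mulmx_prop d (M : 'M[R]_d) (F : 'cV[R]_d -> \bar R) :
  M \in unitmx -> measurable_fun setT F -> (forall x, 0 <= F x)%E ->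
  (\int[cV_lebesgue R d]_x F (M *m x) =
   cV_lebesgue R d ((fun x => M *m x) @^-1` @cube d) * \int[cV_lebesgue R d]_x F x)%E.
Proof.
move=> uM mF F0.
have mM : measurable_fun setT (fun v : 'cV[R]_d => M *m v) by apply: measurable_cV_mulmx.
have mI : measurable_fun setT (fun v => (\1_(@cube d) v)%:E : \bar R).
  by apply/measurable_EFinP; exact: measurable_indic (@measurable_cube d).
pose H (p : 'cV[R]_d * 'cV[R]_d) := (F (p.1 + M *m p.2)%R * (\1_(@cube d) (M *m p.2))%:E)%E.
have I0 x : (0 <= (\1_(@cube d) x)%:E :> \bar R)%E by rewrite lee_fin.
have mH : measurable_fun setT H.
  apply: emeasurable_funM.
    apply: measurableT_comp => //; apply: measurable_cVD => //.
    by apply: measurable_cV_mulmx.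
  apply: (measurableT_comp mI); exact: measurable_cV_mulmx.
have H0 p : (0 <= H p)%E by rewrite mule_ge0.
have := fubini_tonelli (m1 := @cV_leb d) (m2 := @cV_leb d) H mH H0.
rewrite /fubini_F /fubini_G /H /=.
have -> : (\int[@cV_leb d]_y \int[@cV_leb d]_x (F (x + M *m y)%R * (\1_(@cube d) (M *m y))%:E) =
   (\int[cV_lebesgue R d]_x F x) * cV_lebesgue R d ((fun x => M *m x) @^-1` @cube d))%E.
  transitivity (\int[cV_lebesgue R d]_y ((\int[cV_lebesgue R d]_x F x) * (\1_(@cube d) (M *m y))%:E))%E.
    apply: eq_integral => y _.
    rewrite -(ge0_integral_cVD (M *m y))// -ge0_integralZr//.
    apply: measurableT_comp => //; exact: measurable_cVD.
  rewrite ge0_integralZl//; last 2 first.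
  - by apply: (measurableT_comp mI).
  - by apply: integral_ge0.
  congr (_ * _)%E.
  rewrite [RHS]cV_lebesgue_indic//.
  by rewrite -[X in measurable X]setTI; apply: mM => //; exact: measurable_cube.
have -> : (\int[@cV_leb d]_x \int[@cV_leb d]_y (F (x + M *m y)%R * (\1_(@cube d) (M *m y))%:E) =
   \int[cV_lebesgue R d]_x F (M *m x))%E.
  transitivity (\int[@cV_leb d]_x \int[@cV_leb d]_y (F (M *m y) * (\1_(@cube d) (M *m y - x)%R)%:E))%E.
    apply: eq_integral => x _.
    pose G y := (F (M *m y) * (\1_(@cube d) (M *m y - x)%R)%:E)%E.
    rewrite -[RHS](@ge0_integral_cVD d (invmx M *m x) G).
    + by apply: eq_integral => y _; rewrite /G mulmxDr mulKVmx// addrK [x + _]addrC.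
    + apply: emeasurable_funM; first exact: measurableT_comp.
      apply: (measurableT_comp mI); apply: measurable_cVD => //.
    + by move=> y; rewrite mule_ge0.
  pose K (p : 'cV[R]_d * 'cV[R]_d) := (F (M *m p.2) * (\1_(@cube d) (M *m p.2 - p.1)%R)%:E)%E.
  have mK : measurable_fun setT K.
    apply: emeasurable_funM.
      by apply: (measurableT_comp mF); apply: measurable_cV_mulmx.
    apply: (measurableT_comp mI); apply: measurable_cVD => //.
      exact: measurable_cV_mulmx.
    exact: measurable_cVN.
  have K0 p : (0 <= K p)%E by rewrite mule_ge0.
  have := fubini_tonelli (m1 := @cV_leb d) (m2 := @cV_leb d) K mK K0.
  rewrite /fubini_F /fubini_G /K /= => ->.
  apply: eq_integral => y _.
  rewrite ge0_integralZl//; last first.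
    apply: (measurableT_comp mI); apply: measurable_cVD => //.
    exact: measurable_cVN.
  rewrite -[RHS]mule1; congr (_ * _)%E.
  have mO : measurable_fun setT (fun x : 'cV[R]_d => - x).
    exact: measurable_cVN.
  transitivity (\int[cV_lebesgue R d]_x (\1_(@cube d) (- (x + - (M *m y)))%R)%:E)%E.
    by apply: eq_integral => x _; rewrite opprB.
  rewrite (ge0_integral_cVD (- (M *m y)) (F := fun x => (\1_(@cube d) (- x))%:E))//; last first.
    exact: (measurableT_comp mI).
  rewrite -(cV_lebesgue_oppcube d) [RHS]cV_lebesgue_indic//.
  by rewrite -[X in measurable X]setTI; apply: mO => //; exact: measurable_cube.
by rewrite muleC.
Qed.

End cV_measure.

(** * Sums of nonnegative functions over a countable type *)

Section esum_integral.
Context (R : realType) (I : countType).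
Local Open Scope ereal_scope.

(** Sums over a countable type become series over [nat], where monotone convergence for series
    applies; numbers that code no element contribute 0. *)
Lemma esum_pickle (a : I -> \bar R) : (forall i, 0 <= a i) ->
  \esum_(i in [set: I]) a i = \sum_(k <oo) oapp a 0 (pickle_inv k).
Proof.
move=> a0.
rewrite nneseries_esumT; last by move=> k; case: pickle_inv => /=.
transitivity (\esum_(k in range (@pickle I)) oapp a 0 (pickle_inv k)).
  rewrite esum_image; last by apply: in2W; exact: pcan_inj pickleK.
  by apply: eq_esum => i _; rewrite pickleK_inv.
rewrite esum_mkcond; apply: eq_esum => k _; case: ifPn => // /negP kn.
case E : (pickle_inv k) => [i|] //=; exfalso; apply: kn; rewrite inE; exists i => //.
by have := @pickle_invK I k; rewrite E.
Qed.

Lemma measurable_esum d (T : measurableType d) (F : I -> T -> \bar R) :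
  (forall i x, 0 <= F i x) -> (forall i, measurable_fun setT (F i)) ->
  measurable_fun setT (fun x => \esum_(i in [set: I]) F i x).
Proof.
move=> F0 mF; under eq_fun do rewrite esum_pickle//.
apply: (@ge0_emeasurable_sum _ _ _ setT (fun k x => oapp (F^~ x) 0 (pickle_inv k)) xpredT).
  by move=> k x _ _; case: pickle_inv => /=.
by move=> k _; case: pickle_inv => [i|] /=; [exact: mF|exact: measurable_cst].
Qed.

Lemma integral_esum d (T : measurableType d) (mu : {measure set T -> \bar R})
    (F : I -> T -> \bar R) :
  (forall i x, 0 <= F i x) -> (forall i, measurable_fun setT (F i)) ->
  \int[mu]_x (\esum_(i in [set: I]) F i x) = \esum_(i in [set: I]) \int[mu]_x F i x.
Proof.
move=> F0 mF; under eq_integral do rewrite esum_pickle//.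
rewrite esum_pickle => [|i]; last exact: integral_ge0.
rewrite integral_nneseries//.
- apply: eq_eseriesr => k _; case: pickle_inv => [i|] //=.
  by rewrite integral0.
- by move=> k; case: pickle_inv => [i|] /=; [exact: mF|exact: measurable_cst].
- by move=> k x _; case: pickle_inv => /=.
Qed.

End esum_integral.

(** * Unfolding over the lattice and integral changes of variables *)

Section lattice.
Context (R : realType) (d : nat).
Local Notation T := 'cV[R]_d.
Local Notation Z := 'cV[int]_d.
Local Notation mu := (cV_lebesgue R d).

Definition zv (g : Z) : T := map_mx intr g.

Lemma zvD g h : zv (g + h) = zv g + zv h. Proof. exact: map_mxD. Qed.
Lemma zvN g : zv (- g) = - zv g. Proof. exact: map_mxN. Qed.
Lemma zvB g h : zv (g - h) = zv g - zv h. Proof. exact: map_mxB. Qed.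
Lemma zv0 : zv 0 = 0. Proof. exact: map_mx0. Qed.

Lemma zv_inj : injective zv.
Proof.
move=> g h /matrixP gh; apply/matrixP => i j; have := gh i j.
by rewrite !mxE => /intr_inj.
Qed.

Definition floorv (x : T) : Z := \col_i Num.floor (x i 0).

Lemma cube_floorP (x : T) g : @cube R d (x - zv g) <-> g = floorv x.
Proof.
split=> [xg|->].
  apply/matrixP => i j; rewrite ord1 mxE; apply/esym/floor_def.
  have := xg i; rewrite /= !mxE in_itv /= intrD /=; lra.
move=> i; rewrite /= !mxE in_itv /=; have := floor_itv (x i 0); rewrite intrD; lra.
Qed.

Lemma indic_cubeE (x : T) g : \1_(@cube R d) (x - zv g) = (g == floorv x)%:R :> R.
Proof.
rewrite indicE; congr (nat_of_bool _)%:R; apply/idP/eqP.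
  by rewrite inE => /cube_floorP.
by move=> /cube_floorP; rewrite inE.
Qed.

Lemma esum_pred1 (F : Z -> \bar R) g : (0 <= F g)%E ->
  (\esum_(h in [set: Z]) ((h == g)%:R%:E * F h) = F g)%E.
Proof.
move=> F0.
rewrite -(esum_set1 F0) [RHS]esum_mkcond; apply: eq_esum => h _.
case: eqP => [->|hg]; first by rewrite mul1e mem_set.
by rewrite mul0e memNset.
Qed.

Lemma measurable_indic_cube d0 (S : measurableType d0) (f : S -> T) :
  measurable_fun setT f -> measurable_fun setT (fun x => (\1_(@cube R d) (f x))%:E : \bar R).
Proof.
move=> mf; apply/measurable_EFinP.
exact: (measurableT_comp (measurable_indic (@measurable_cube R d))).
Qed.

(** Each x lies in exactly one lattice translate of the cube. Summing over the translates,
    exchanging sum and integral, and moving each translate back to the cube gives the right side. *)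
Lemma ge0_integral_unfold (F : T -> \bar R) :
  measurable_fun setT F -> (forall x, 0 <= F x)%E ->
  (\int[mu]_x F x =
   \int[mu]_x ((\1_(@cube R d) x)%:E * \esum_(g in [set: Z]) F (x + zv g)%R))%E.
Proof.
move=> mF F0.
have I0 x : (0 <= (\1_(@cube R d) x)%:E :> \bar R)%E by rewrite lee_fin.
have mD (a : T) : measurable_fun setT (fun x : T => x + a) by apply: measurable_cVD.
transitivity (\int[mu]_x \esum_(g in [set: Z]) ((\1_(@cube R d) (x - zv g)%R)%:E * F x))%E.
  apply: eq_integral => x _.
  by under eq_esum do rewrite indic_cubeE; rewrite (esum_pred1 (F := fun=> F x)).
have mI g : measurable_fun setT (fun x : T => (\1_(@cube R d) (x - zv g)%R)%:E : \bar R).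
  exact: measurable_indic_cube.
rewrite integral_esum; last 2 first.
- by move=> g x; rewrite mule_ge0.
- by move=> g; exact: emeasurable_funM.
transitivity (\esum_(g in [set: Z]) \int[mu]_x ((\1_(@cube R d) x)%:E * F (x + zv g)%R))%E.
  apply: eq_esum => g _.
  rewrite -(@ge0_integral_cVD R d (zv g) (fun x => (\1_(@cube R d) (x - zv g)%R)%:E * F x)%E).
  - by apply: eq_integral => x _; rewrite addrK.
  - exact: emeasurable_funM.
  - by move=> x; rewrite mule_ge0.
have mFD g : measurable_fun setT (fun x : T => F (x + zv g)) by exact: measurableT_comp.
rewrite -integral_esum; last 2 first.
- by move=> g x; rewrite mule_ge0.
- by move=> g; apply: emeasurable_funM => //; exact: measurable_indic_cube.
apply: eq_integral => x _; rewrite indicE; case: (x \in _).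
  by rewrite mul1e; apply: eq_esum => g _; rewrite mul1e.
by rewrite mul0e; apply: esum1 => g _; rewrite mul0e.
Qed.

(* The factor by which x |-> M x scales integrals, that is 1 / |det M|; only
   integral M need to be computed, through the Smith normal form. *)
Definition mxscale (M : 'M[R]_d) : \bar R := mu ((fun x => M *m x) @^-1` @cube R d).

Lemma measurable_mulmx (M : 'M[R]_d) : measurable_fun setT (fun x : T => M *m x).
Proof. exact: measurable_cV_mulmx. Qed.

Lemma mxscaleE M : mxscale M = (\int[mu]_x (\1_(@cube R d) (M *m x))%:E)%E.
Proof.
rewrite /mxscale cV_lebesgue_indic//.
by rewrite -[X in measurable X]setTI; apply: measurable_mulmx => //; exact: measurable_cube.
Qed.

Lemma mxscaleM (M N : 'M[R]_d) : M \in unitmx -> N \in unitmx ->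
  mxscale (M *m N) = (mxscale M * mxscale N)%E.
Proof.
move=> uM uN; rewrite [LHS]mxscaleE.
under eq_integral do rewrite -mulmxA.
rewrite (@ge0_integral_mulmx_prop R d N (fun x => (\1_(@cube R d) (M *m x))%:E))//.
- by rewrite -mxscaleE muleC.
- by apply: measurable_indic_cube; exact: measurable_mulmx.
Qed.

Lemma mxscale1 : mxscale 1%:M = 1%E.
Proof.
rewrite -(@cV_lebesgue_cube R d); congr (mu _).
by apply/seteqP; split=> x /=; rewrite mul1mx.
Qed.

(* The images of the cube under an integral matrix L, moved by Z^d, cover R^d. *)
Lemma mxscale_int_ge1 (L : 'M[int]_d) : map_mx intr L \in @unitmx R d ->
  (1 <= mxscale (invmx (map_mx intr L)))%E.
Proof.
move=> uL; rewrite mxscaleE ge0_integral_unfold//; last first.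
  by apply: measurable_indic_cube; exact: measurable_mulmx.
rewrite -(@cV_lebesgue_cube R d) cV_lebesgue_indic; last exact: measurable_cube.
have mS : measurable_fun setT (fun x : T => \esum_(g in [set: Z])
    (\1_(@cube R d) (invmx (map_mx intr L) *m (x + zv g)))%:E : \bar R).
  apply: measurable_esum => [g x|g]; first by rewrite lee_fin.
  apply: measurable_indic_cube; apply: measurable_cV_mulmx.
  by apply: measurable_cVD.
apply: ge0_le_integral => //.
- exact: measurable_indic_cube.
- by apply: emeasurable_funM => //; exact: measurable_indic_cube.
move=> x _; rewrite -[leLHS]mule1; apply: lee_wpmul2l; first by rewrite lee_fin.
(* Adding g to x changes L^-1 x into its fractional part, which lies in the cube; the single term at
   g is then 1. *)
pose y : T := invmx (map_mx intr L) *m x.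
pose g : Z := - (L *m floorv y).
apply: (@le_trans _ _ (\esum_(h in [set g]) (\1_(@cube R d) (invmx (map_mx intr L) *m (x + zv h)))%:E)%E).
  rewrite esum_set1 ?lee_fin// mulmxDr -/y /g /zv map_mxN mulmxN map_mxM mulKmx//.
  by rewrite indic_cubeE eqxx.
apply: ereal_sup_le => _ [A [fA AS] <-].
by exists A.
Qed.

(** Both L and its inverse are integral, so both scales are at least 1; their product is 1. *)
Lemma mxscale_unimodular (L : 'M[int]_d) : L \in unitmx ->
  mxscale (map_mx intr L) = 1%E.
Proof.
move=> uL.
have uR (M : 'M[int]_d) : M \in unitmx -> map_mx intr M \in @unitmx R d.
  by rewrite !unitmxE det_map_mx => uM; exact: rmorph_unit.
have uLR := uR _ uL; have uLR' : map_mx intr (invmx L) \in @unitmx R d.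
  by apply: uR; rewrite unitmx_inv.
have inv : map_mx intr (invmx L) = invmx (map_mx intr L) :> 'M[R]_d.
  apply: (can_inj (mulKmx uLR)); rewrite -map_mxM mulmxV// mulmxV//.
  by rewrite map_mx1.
have h1 := mxscale_int_ge1 uLR; have h2 := mxscale_int_ge1 uLR'.
rewrite inv invmxK in h2.
have h3 : (mxscale (invmx (map_mx intr L)) * mxscale (map_mx intr L) = 1)%E.
  by rewrite -mxscaleM ?unitmx_inv// mulVmx// mxscale1.
apply/eqP; rewrite eq_le h2 andbT -h3 -[leLHS]mul1e; exact: lee_wpmul2r.
Qed.

(** The preimage of the cube is a box with sides 1/|k i|; a negative k i reverses the interval and
    moves its open end. *)
Lemma mxscale_diag (k : 'I_d -> int) : (forall i, k i != 0) ->
  mxscale (\matrix_(i, j) ((k i)%:~R *+ (i == j))) = (\prod_i `|(k i)%:~R^-1 : R|)%:E.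
Proof.
move=> k0; rewrite /mxscale.
pose S (i : 'I_d) : set R := if 0 < k i then `[0, (k i)%:~R^-1[%classic else `](k i)%:~R^-1, 0]%classic.
rewrite (_ : _ @^-1` _ = box S).
  rewrite cV_lebesgue_box => [|i]; last by rewrite /S; case: ifP => _; exact: measurable_itv.
  rewrite -prodEFin; apply: eq_bigr => i _; rewrite /S.
  have [ki|ki] := ltP 0 (k i); rewrite lebesgue_measure_itv /= lte_fin.
    by rewrite invr_gt0 ltr0z ki -EFinD subr0 ger0_norm// invr_ge0 ler0z ltW.
  have {}ki : k i < 0 by rewrite lt_neqAle k0.
  by rewrite invr_lt0 ltrz0 ki -EFinD sub0r ler0_norm// invr_le0 lerz0 ltW.
apply/seteqP.
have E (x : T) i : ((\matrix_(i, j) ((k i)%:~R *+ (i == j))) *m x) i 0 = (k i)%:~R * x i 0.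
  rewrite mxE (bigD1 i)//= mxE eqxx mulr1n big1 ?addr0// => j ji.
  by rewrite mxE eq_sym (negbTE ji) mulr0n mul0r.
have F (x : T) i : `[0, 1[%classic ((k i)%:~R * x i 0 : R) <-> S i (x i 0).
  rewrite /S; have [ki|ki] := ltP 0 (k i); rewrite /= !in_itv /=.
    have k'0 : 0 < (k i)%:~R :> R by rewrite ltr0z.
    by rewrite pmulr_rge0// -[_ < _^-1](ltr_pM2l k'0) mulfV// gt_eqF.
  have k'0 : (k i)%:~R < 0 :> R by rewrite ltrz0 lt_neqAle k0.
  rewrite nmulr_rge0// andbC -[_^-1 < _](ltr_nM2l k'0) mulfV// lt_eqF//.
by split=> x xk i; [apply/F; rewrite -E; exact: xk|rewrite /= E; apply/F; exact: xk].
Qed.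

(** In the Smith normal form the two unimodular factors have scale 1 and determinant of absolute
    value 1, so only the diagonal factor contributes to either side. *)
Lemma mxscale_int (D : 'M[int]_d) : \det D != 0 ->
  mxscale (map_mx intr D) = (`|(\det D)%:~R^-1 : R|)%:E.
Proof.
move=> D0.
have [L uL [N uN [s _ Ds]]] := int_Smith_normal_form D.
pose k (i : 'I_d) := s`_i.
pose K : 'M[int]_d := \matrix_(i, j) (s`_i *+ (i == j :> nat)).
have KE : K = \matrix_(i, j) (k i *+ (i == j)) by [].
have detK : \det K = \prod_i k i.
  have -> : K = diag_mx (\row_i k i).
    by apply/matrixP => i j; rewrite !mxE.
  by rewrite det_diag; apply: eq_bigr => i _; rewrite mxE.
have k0 i : k i != 0.
  move: D0; rewrite Ds !det_mulmx -/K detK; apply: contraNneq => ki.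
  by rewrite (bigD1 i)//= ki mul0r mulr0 mul0r.
have uR (M : 'M[int]_d) : M \in unitmx -> map_mx intr M \in @unitmx R d.
  by rewrite !unitmxE det_map_mx => uM; exact: rmorph_unit.
have mK : map_mx intr K = \matrix_(i, j) ((k i)%:~R *+ (i == j)) :> 'M[R]_d.
  by apply/matrixP => i j; rewrite !mxE rmorphMn.
have uK : map_mx intr K \in @unitmx R d.
  rewrite unitmxE det_map_mx detK unitfE intr_eq0; apply/prodf_neq0 => i _; exact: k0.
have n1 (M : 'M[int]_d) : M \in unitmx -> `|(\det M)%:~R^-1 : R| = 1.
  by rewrite unitmxE => /orP[] /eqP ->; rewrite ?rmorphN rmorph1 ?invrN invr1 ?normrN normr1.
have DsR : map_mx intr D = map_mx intr L *m map_mx intr K *m map_mx intr N :> 'M[R]_d.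
  by rewrite Ds !map_mxM.
rewrite DsR !mxscaleM ?unitmx_mul ?uK ?uR//.
rewrite (mxscale_unimodular uL) (mxscale_unimodular uN) mule1 mul1e mK mxscale_diag//.
congr EFin; rewrite Ds !det_mulmx -/K detK !intrM !invfM !normrM !n1//.
rewrite mulr1 mul1r rmorph_prod -prodfV normr_prod; apply: eq_bigr => i _.
by [].
Qed.

End lattice.

(** * Complex-valued functions *)

Local Notation C R := ((R[i])^o).

Section complex_numbers.
Context (R : realType).
Implicit Types z w : C R.

Lemma ReD z w : complex.Re (z + w) = complex.Re z + complex.Re w.
Proof. by case: z w => [a b] [a' b']. Qed.
Lemma ImD z w : complex.Im (z + w) = complex.Im z + complex.Im w.
Proof. by case: z w => [a b] [a' b']. Qed.
Lemma ReN z : complex.Re (- z) = - complex.Re z. Proof. by case: z. Qed.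
Lemma ImN z : complex.Im (- z) = - complex.Im z. Proof. by case: z. Qed.
Lemma ReB z w : complex.Re (z - w) = complex.Re z - complex.Re w.
Proof. by case: z w => [a b] [a' b']. Qed.
Lemma ImB z w : complex.Im (z - w) = complex.Im z - complex.Im w.
Proof. by case: z w => [a b] [a' b']. Qed.
Lemma ReM z w : complex.Re (z * w) =
  complex.Re z * complex.Re w - complex.Im z * complex.Im w.
Proof. by case: z w => [a b] [a' b']. Qed.
Lemma ImM z w : complex.Im (z * w) =
  complex.Re z * complex.Im w + complex.Im z * complex.Re w.
Proof. by case: z w => [a b] [a' b']. Qed.
Lemma ReZ (r : R) z : complex.Re ((r%:C)%C * z) = r * complex.Re z.
Proof. by rewrite ReM /= mul0r subr0. Qed.
Lemma ReC (r : R) : complex.Re (r%:C)%C = r. Proof. by []. Qed.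
Lemma CrM (r s : R) : ((r * s)%:C)%C = (r%:C)%C * (s%:C)%C :> C R.
Proof. exact: rmorphM. Qed.
Lemma CrB (r s : R) : ((r - s)%:C)%C = (r%:C)%C - (s%:C)%C :> C R.
Proof. exact: rmorphB. Qed.
Lemma Re_conj z : complex.Re (conjc z) = complex.Re z. Proof. by case: z. Qed.
Lemma Im_conj z : complex.Im (conjc z) = - complex.Im z. Proof. by case: z. Qed.

Lemma cjM z w : conjc (z * w) = conjc z * conjc w :> C R. Proof. exact: rmorphM. Qed.
Lemma cjD z w : conjc (z + w) = conjc z + conjc w :> C R. Proof. exact: rmorphD. Qed.
Lemma cjB z w : conjc (z - w) = conjc z - conjc w :> C R. Proof. exact: rmorphB. Qed.
Lemma cjN z : conjc (- z) = - conjc z :> C R. Proof. exact: rmorphN. Qed.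
Lemma cjK z : conjc (conjc z) = z :> C R. Proof. exact: conjcK. Qed.
Lemma cN1 z : -1 * z = - z :> C R. Proof. exact: mulN1r. Qed.

Lemma Re_sum I (s : seq I) (P : pred I) (F : I -> C R) :
  complex.Re (\sum_(i <- s | P i) F i) = \sum_(i <- s | P i) complex.Re (F i).
Proof. by apply: (big_morph (@complex.Re R)) => //; exact: ReD. Qed.

Lemma eqc z w : complex.Re z = complex.Re w -> complex.Im z = complex.Im w -> z = w.
Proof. by case: z w => [a b] [a' b'] /= -> ->. Qed.

Lemma normc_ge0 z : 0 <= normc z.
Proof. by case: z => a b; exact: sqrtr_ge0. Qed.

Lemma normcD z w : normc (z + w) <= normc z + normc w.
Proof. exact: le_normcD. Qed.
Lemma normcM' z w : normc (z * w) = normc z * normc w.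
Proof. exact: normcM. Qed.
Lemma normcN' z : normc (- z) = normc z.
Proof. exact: normcN. Qed.
Lemma normcB z w : normc (z - w) <= normc z + normc w.
Proof. by rewrite (le_trans (normcD _ _))// normcN'. Qed.
Lemma normc_distC z w : normc (z - w) = normc (w - z).
Proof. by rewrite -normcN' opprB. Qed.
Lemma normc_conj z : normc (conjc z) = normc z.
Proof. by case: z => a b /=; rewrite sqrrN. Qed.

Lemma normc_eq0 z : normc z = 0 -> z = 0.
Proof. exact: eq0_normc. Qed.

Lemma normc_Re z : `|complex.Re z| <= normc z.
Proof.
rewrite -(@ler_pXn2r _ 2)// ?nnegrE ?normc_ge0//.
by rewrite normc_sqr real_normK ?num_real// lerDl sqr_ge0.
Qed.

Lemma normc_Im z : `|complex.Im z| <= normc z.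
Proof.
rewrite -(@ler_pXn2r _ 2)// ?nnegrE ?normc_ge0//.
by rewrite normc_sqr real_normK ?num_real// lerDr sqr_ge0.
Qed.

Lemma normc_le z : normc z <= `|complex.Re z| + `|complex.Im z|.
Proof.
rewrite -(@ler_pXn2r _ 2)// ?nnegrE ?normc_ge0// ?addr_ge0//.
rewrite normc_sqr sqrrD !real_normK ?num_real// -addrA lerD2l lerDr.
by rewrite mulrn_wge0// mulr_ge0.
Qed.

Lemma conj_mul z : conjc z * z = ((normc z ^+ 2)%:C)%C :> C R.
Proof.
by apply: eqc; rewrite ?ReM ?ImM Re_conj Im_conj normc_sqr /=; ring.
Qed.

Lemma normc_real (r : R) : normc (r%:C)%C = `|r|.
Proof. by rewrite /= expr0n addr0 sqrtr_sqr. Qed.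

Lemma normr_C z : `|z| = ((normc z)%:C)%C :> R[i].
Proof. by []. Qed.

(** The norm of [R[i]] is itself complex-valued, so the epsilon of the general criterion is a
    complex number; a positive one is real, and the criterion reduces to [normc]. *)
Lemma cvgc_lt T (F : set_system T) (FF : Filter F) (f : T -> C R) (l : C R) :
  f x @[x --> F] --> l <-> forall e : R, 0 < e -> \forall x \near F, normc (l - f x) < e.
Proof.
split=> [/cvgrPdist_lt fl e e0|H].
  have := fl (e%:C)%C; rewrite ltcR => /(_ e0); apply: filterS => x.
  by rewrite normr_C ltcR.
apply/cvgrPdist_lt => -[e e'] /[dup]; rewrite ltcE /= => /andP[/eqP -> e0] _.
have := H _ e0; apply: filterS => x; rewrite normr_C.
by rewrite -[(e +i* 0)%C]/(e%:C)%C ltcR.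
Qed.

Lemma continuous_ReIm (T : topologicalType) (f : T -> C R) :
  continuous f <-> continuous (fun x => complex.Re (f x)) /\
                   continuous (fun x => complex.Im (f x)).
Proof.
split=> [cf|[cr ci] x].
  split=> x; apply/cvgrPdist_lt => e e0;
    have /cvgc_lt/(_ _ e0) := cf x; apply: filterS => y;
    apply: le_lt_trans.
    by rewrite -ReB normc_Re.
  by rewrite -ImB normc_Im.
apply/cvgc_lt => e e0.
have e20 : 0 < e / 2 by rewrite divr_gt0.
have /cvgrPdist_lt/(_ _ e20) h1 := cr x.
have /cvgrPdist_lt/(_ _ e20) h2 := ci x.
apply: filterS2 h1 h2 => y h1 h2; rewrite (le_lt_trans (normc_le _))//.
by rewrite ReB ImB [e]splitr ltrD.
Qed.

Definition ce (t : R) : C R := cexp (2 * pi * t).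

Lemma cexpD (s t : R) : cexp (s + t) = cexp s * cexp t.
Proof. by apply: eqc; rewrite ?ReM ?ImM /= ?cosD ?sinD//; ring. Qed.

Lemma normc_cexp (t : R) : normc (cexp t) = 1.
Proof. by rewrite /= cos2Dsin2 sqrtr1. Qed.

Lemma ce0 : ce 0 = 1.
Proof. by rewrite /ce mulr0; apply: eqc; rewrite /= ?cos0 ?sin0. Qed.

Lemma ceD s t : ce (s + t) = ce s * ce t.
Proof. by rewrite /ce mulrDr cexpD. Qed.

Lemma normc_ce t : normc (ce t) = 1.
Proof. exact: normc_cexp. Qed.

Lemma ceN t : ce (- t) = conjc (ce t).
Proof. by rewrite /ce mulrN; apply: eqc; rewrite /= ?cosN ?sinN. Qed.

Lemma ce_neq0 t : ce t != 0.
Proof. by apply/eqP => /(congr1 (@normc R)); rewrite normc_ce normc0; apply/eqP; rewrite oner_eq0. Qed.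

Lemma ceJ t : conjc (ce t) * ce t = 1.
Proof. by rewrite -ceN -ceD addNr ce0. Qed.

Lemma ce1 : ce 1 = 1.
Proof.
by rewrite /ce mulr1 mulr_natl; apply: eqc; rewrite /= ?cos2pi ?sin2pi.
Qed.

Lemma ce_int (k : int) : ce k%:~R = 1.
Proof.
have ceS (n : nat) : ce n%:R = 1.
  elim: n => [|n IH]; first exact: ce0.
  by rewrite -addn1 natrD ceD IH ce1 mulr1.
case: k => n; first exact: ceS.
by rewrite NegzE rmorphN ceN ceS conjc1.
Qed.

Lemma ce_half : ce (2^-1) = -1.
Proof.
have -> : ce (2^-1) = cexp (pi : R) by rewrite /ce mulrAC divff ?mul1r.
by apply: eqc; rewrite /= ?cospi ?sinpi ?oppr0.
Qed.

Lemma continuous_ce : continuous ce.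
Proof.
have c2 : continuous (fun t : R => 2 * pi * t).
  by move=> t; apply: cvgMr; exact: cvg_id.
apply/continuous_ReIm; split=> t.
  by apply: (continuous_comp (g := @cos R)); [exact: c2|exact: continuous_cos].
by apply: (continuous_comp (g := @sin R)); [exact: c2|exact: continuous_sin].
Qed.

End complex_numbers.

(** * Topology and measurable sets of R^d *)

Section cV_topology.
Context (R : realType) (d : nat).
Local Notation T := 'cV[R]_d.

Lemma open_cVP (U : set T) : open U -> forall x, U x ->
  exists2 e : R, 0 < e & forall y : T, (forall i, `|x i 0 - y i 0| < e) -> U y.
Proof.
move=> oU x Ux; have /nbhs_ballP[e /= e0 eU] := open_nbhs_nbhs (conj oU Ux).
exists e => // y xy; apply: eU; split=> // i j; rewrite ord1.
exact: xy.
Qed.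

Lemma continuous_coord (i : 'I_d) : continuous (fun x : T => x i 0).
Proof. exact: coord_continuous. Qed.

Lemma continuous_cVP (S : topologicalType) (f : S -> T) :
  (forall i, continuous (fun x => f x i 0)) -> continuous f.
Proof.
move=> cf x; apply/cvgrPdist_lt => e e0.
have : \forall y \near x, forall i, `|f x i 0 - f y i 0| < e.
  by apply: filter_forall => i; have /cvgrPdist_lt/(_ e e0) := cf i x.
apply: filterS => y xy.
rewrite [ltLHS]mx_normrE; apply/bigmax_ltP; split => // -[i j] _ /=.
by rewrite ord1 !mxE.
Qed.

(** The sigma-algebra is generated by the coordinates, so an open set has to be written as a
    countable union of boxes; those with rational centre and half-side 1/(k + 1) suffice. *)
Lemma open_measurable_cV (U : set T) : open U -> measurable U.
Proof.
move=> oU.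
pose B (p : 'cV[rat]_d * nat) : set T :=
  box (fun i => `]ratr (p.1 i 0) - p.2.+1%:R^-1, ratr (p.1 i 0) + p.2.+1%:R^-1[%classic).
pose B' p := if `[< B p `<=` U >] then B p else set0.
rewrite (_ : U = \bigcup_p B' p).
  apply: countable_bigcupT_measurable; first exact: countableP.
  move=> p; rewrite /B'; case: ifP => // _.
  by apply: measurable_box => i; exact: measurable_itv.
apply/seteqP; split=> [x Ux|x [p _]]; last first.
  by rewrite /B'; case: ifPn => // /asboolP; exact.
have [e e0 eU] := open_cVP oU Ux.
(* With 1/(n + 1) < e/2, a box of this half-side whose centre is that close to x contains x and
   stays within e of it. *)
pose n := Num.trunc (2 / e).
have ne : n.+1%:R^-1 < e / 2.
  by rewrite invf_plt ?posrE ?divr_gt0// invf_div truncnS_gt.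
pose r := n.+1%:R^-1 : R.
have r0 : 0 < r by rewrite invr_gt0.
have q_ex i : {q : rat | `|x i 0 - ratr q| < r}.
  apply: cid; have xr : x i 0 - r < x i 0 + r by lra.
  have [q] := rat_in_itvoo xr; rewrite in_itv /= => qx.
  by exists q; rewrite ltr_norml; lra.
exists (\col_i sval (q_ex i), n) => //; rewrite /B'; case: ifPn.
  by move=> _ i; rewrite /= mxE in_itv /=; have := svalP (q_ex i); rewrite ltr_norml -/r; lra.
case/negP; apply/asboolP => y By; apply: eU => i.
have := By i; rewrite /= mxE in_itv /= -/r => yq.
have := svalP (q_ex i); rewrite !ltr_norml -/r; move: ne; rewrite -/r; lra.
Qed.

Lemma continuous_measurable_cV (f : T -> R) : continuous f -> measurable_fun setT f.
Proof.
move=> /continuousP cf.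
apply: (measurability (@RGenOpens.G R)); first exact: RGenOpens.measurableE.
move=> _ [_ [a [b ->]] <-]; rewrite setTI; apply: open_measurable_cV; apply: cf.
exact: interval_open.
Qed.
End cV_topology.

(** * Measurable and integrable complex-valued functions *)

Section complex_measurable.
Context (R : realType) (d : nat).
Local Notation T := 'cV[R]_d.
Local Notation mu := (cV_lebesgue R d).
Implicit Types f g : T -> C R.

Lemma cmeasurable_continuous f : continuous f -> cmeasurable f.
Proof.
by move=> /continuous_ReIm[cr ci]; split; exact: continuous_measurable_cV.
Qed.

Lemma cmeasurable_comp f (phi : T -> T) : cmeasurable f ->
  measurable_fun setT phi -> cmeasurable (fun x => f (phi x)).
Proof. by move=> [mr mi] mphi; split; [exact: (measurableT_comp mr)|exact: (measurableT_comp mi)]. Qed.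

Lemma cmeasurable_cst (c : C R) : cmeasurable (fun _ : T => c).
Proof. by split; exact: measurable_cst. Qed.

Lemma cmeasurable_real (h : T -> R) : measurable_fun setT h ->
  cmeasurable (fun x => ((h x)%:C)%C : C R).
Proof. by split => //; exact: measurable_cst. Qed.

Lemma cmeasurableD f g : cmeasurable f -> cmeasurable g -> cmeasurable (fun x => f x + g x).
Proof.
move=> [fr fi] [gr gi]; split.
  by under eq_fun do rewrite ReD; exact: measurable_funD.
by under eq_fun do rewrite ImD; exact: measurable_funD.
Qed.

Lemma cmeasurableN f : cmeasurable f -> cmeasurable (fun x => - f x).
Proof.
move=> [fr fi]; split.
  by under eq_fun do rewrite ReN; exact: measurable_funN.
by under eq_fun do rewrite ImN; exact: measurable_funN.
Qed.

Lemma cmeasurableB f g : cmeasurable f -> cmeasurable g -> cmeasurable (fun x => f x - g x).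
Proof. by move=> mf mg; apply: cmeasurableD => //; exact: cmeasurableN. Qed.

Lemma cmeasurableM f g : cmeasurable f -> cmeasurable g -> cmeasurable (fun x => f x * g x).
Proof.
move=> [fr fi] [gr gi]; split.
  by under eq_fun do rewrite ReM; apply: measurable_funB; exact: measurable_funM.
by under eq_fun do rewrite ImM; apply: measurable_funD; exact: measurable_funM.
Qed.

Lemma cmeasurable_conj f : cmeasurable f -> cmeasurable (fun x => conjc (f x) : C R).
Proof.
move=> [fr fi]; split.
  by under eq_fun do rewrite Re_conj.
by under eq_fun do rewrite Im_conj; exact: measurable_funN.
Qed.

Lemma cmeasurable_indic (A : set T) : measurable A -> cmeasurable (fun x => ((\1_A x)%:C)%C : C R).
Proof. by move=> mA; apply: cmeasurable_real; exact: measurable_indic. Qed.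

Lemma measurable_normc f : cmeasurable f -> measurable_fun setT (fun x => normc (f x)).
Proof.
move=> mf; have /measurable_EFinP := measurable_normc_sqr mf => mf2.
rewrite (_ : (fun _ => _) = (fun y => Num.sqrt y) \o (fun x => normc (f x) ^+ 2)).
  apply: (measurableT_comp _ mf2); apply: continuous_measurable_fun.
  exact: sqrt_continuous.
by apply/funext => x /=; rewrite sqrtr_sqr ger0_norm// normc_ge0.
Qed.

Lemma cvgn_cmeasurable (F : nat -> T -> C R) f : (forall n, cmeasurable (F n)) ->
  (forall x, (F n x @[n --> \oo] --> (f x : C R))) -> cmeasurable f.
Proof.
move=> mF Ff; split.
  apply: (measurable_fun_cvg (h := fun n x => complex.Re (F n x))) => [n|x _].
    by case: (mF n).
  apply/cvgrPdist_lt => e e0; have /cvgc_lt/(_ _ e0) := Ff x; apply: filterS => n.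
  by apply: le_lt_trans; rewrite -ReB normc_Re.
apply: (measurable_fun_cvg (h := fun n x => complex.Im (F n x))) => [n|x _].
  by case: (mF n).
apply/cvgrPdist_lt => e e0; have /cvgc_lt/(_ _ e0) := Ff x; apply: filterS => n.
by apply: le_lt_trans; rewrite -ImB normc_Im.
Qed.

(** Convertible to [cLp 1], since the power with exponent 1 computes away; the two are exchanged
    silently below. *)
Definition cL1 f := cmeasurable f /\ (\int[mu]_x (normc (f x))%:E < +oo)%E.

Lemma cL1_le f (h : T -> R) : cmeasurable f -> measurable_fun setT h ->
  (\int[mu]_x (h x)%:E < +oo)%E -> (forall x, normc (f x) <= h x) -> cL1 f.
Proof.
move=> mf mh hoo fh; split=> //; apply: le_lt_trans hoo.
apply: ge0_le_integral => //.
- by move=> x _; rewrite lee_fin normc_ge0.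
- by apply/measurable_EFinP; exact: measurable_normc.
- by apply/measurable_EFinP.
- by move=> x _; rewrite lee_fin.
Qed.

Lemma cL1_Re f : cL1 f -> mu.-integrable setT (EFin \o (fun x => complex.Re (f x))).
Proof.
move=> [mf foo]; apply/integrableP; split; first by apply/measurable_EFinP; case: mf.
apply: le_lt_trans foo; apply: ge0_le_integral => //.
- by apply: measurableT_comp => //; apply/measurable_EFinP; case: mf.
- by apply/measurable_EFinP; exact: measurable_normc.
- by move=> x _ /=; rewrite lee_fin normc_Re.
Qed.

Lemma cL1_Im f : cL1 f -> mu.-integrable setT (EFin \o (fun x => complex.Im (f x))).
Proof.
move=> [mf foo]; apply/integrableP; split; first by apply/measurable_EFinP; case: mf.
apply: le_lt_trans foo; apply: ge0_le_integral => //.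
- by apply: measurableT_comp => //; apply/measurable_EFinP; case: mf.
- by apply/measurable_EFinP; exact: measurable_normc.
- by move=> x _ /=; rewrite lee_fin normc_Im.
Qed.

Lemma cL1_normc f : cL1 f -> mu.-integrable setT (EFin \o (fun x => normc (f x))).
Proof.
move=> [mf foo]; apply/integrableP; split.
  by apply/measurable_EFinP; exact: measurable_normc.
apply: le_lt_trans foo; apply: ge0_le_integral => //.
- by apply: measurableT_comp => //; apply/measurable_EFinP; exact: measurable_normc.
- by apply/measurable_EFinP; exact: measurable_normc.
- by move=> x _ /=; rewrite lee_fin ger0_norm// normc_ge0.
Qed.

Lemma cL1D f g : cL1 f -> cL1 g -> cL1 (fun x => f x + g x).
Proof.
move=> If Ig; apply: (cL1_le (h := fun x => normc (f x) + normc (g x))).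
- by case: If Ig => [? _] [? _]; exact: cmeasurableD.
- by case: If Ig => [? _] [? _]; apply: measurable_funD; exact: measurable_normc.
- under eq_integral do rewrite EFinD.
  rewrite ge0_integralD//.
  + by case: If Ig => [_ ?] [_ ?]; exact: lte_add_pinfty.
  + by move=> x _; rewrite lee_fin normc_ge0.
  + by apply/measurable_EFinP; case: If => ? _; exact: measurable_normc.
  + by move=> x _; rewrite lee_fin normc_ge0.
  + by apply/measurable_EFinP; case: Ig => ? _; exact: measurable_normc.
- by move=> x; exact: normcD.
Qed.

Lemma cL1_bndM f g (K : R) : cL1 f -> cmeasurable g -> (forall x, normc (g x) <= K) ->
  cL1 (fun x => f x * g x).
Proof.
move=> If mg gK.
have K0 : 0 <= K by exact: le_trans (normc_ge0 _) (gK 0).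
apply: (cL1_le (h := fun x => K * normc (f x))).
- by case: If => [? _]; exact: cmeasurableM.
- by case: If => [? _]; apply: measurable_funM => //; exact: measurable_normc.
- under eq_integral do rewrite EFinM.
  rewrite ge0_integralZl//.
  + by case: If => [_ ?]; rewrite lte_mul_pinfty.
  + by apply/measurable_EFinP; case: If => ? _; exact: measurable_normc.
  + by move=> x _; rewrite lee_fin normc_ge0.
- by move=> x; rewrite normcM' mulrC ler_wpM2r ?normc_ge0.
Qed.

Lemma cL1Z (a : C R) f : cL1 f -> cL1 (fun x => a * f x).
Proof.
move=> If; under [X in cL1 X]eq_fun do rewrite mulrC.
exact: (cL1_bndM (K := normc a) If (cmeasurable_cst a)).
Qed.

Lemma cL1N f : cL1 f -> cL1 (fun x => - f x).
Proof.
by move=> If; under [X in cL1 X]eq_fun do rewrite -mulN1r; exact: cL1Z.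
Qed.

Lemma cL1B f g : cL1 f -> cL1 g -> cL1 (fun x => f x - g x).
Proof. by move=> If Ig; apply: cL1D => //; exact: cL1N. Qed.

Lemma cL1_conj f : cL1 f -> cL1 (fun x => conjc (f x) : C R).
Proof.
move=> [mf foo]; split; first exact: cmeasurable_conj.
by under eq_integral do rewrite normc_conj.
Qed.

Lemma cL1_0 : cL1 (fun _ => 0).
Proof.
split; first exact: cmeasurable_cst.
by under eq_integral do rewrite normc0; rewrite integral0 ltry.
Qed.

Lemma cL1_sum I (s : seq I) (F : I -> T -> C R) :
  (forall i, cL1 (F i)) -> cL1 (fun x => \sum_(i <- s) F i x).
Proof.
move=> mF; elim: s => [|i s IH].
  by under [X in cL1 X]eq_fun do rewrite big_nil; exact: cL1_0.
by under [X in cL1 X]eq_fun do rewrite big_cons; exact: cL1D.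
Qed.

Lemma cL1_bnd f (A : set T) (K : R) : cmeasurable f -> measurable A -> (mu A < +oo)%E ->
  (forall x, normc (f x) <= K) -> (forall x, ~ A x -> f x = 0) -> cL1 f.
Proof.
move=> mf mA Aoo fK f0.
apply: (cL1_le (h := fun x => K * \1_A x)) => //.
- exact: measurable_funM.
- under eq_integral do rewrite EFinM.
  have K0 : 0 <= K by exact: le_trans (normc_ge0 _) (fK 0).
  rewrite ge0_integralZl//.
  + by rewrite -cV_lebesgue_indic// lte_mul_pinfty.
  + by apply/measurable_EFinP.
- move=> x; rewrite indicE; case: (boolP (x \in A)) => xA; first by rewrite mulr1.
  by rewrite f0 ?normc0 ?mulr0//; move/negP: xA; rewrite inE.
Qed.

Lemma cintegralD f g : cL1 f -> cL1 g ->
  cintegral (fun x => f x + g x) = cintegral f + cintegral g.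
Proof.
move=> If Ig; apply: eqc; rewrite ?ReD ?ImD /cintegral /=.
  under eq_Rintegral do rewrite ReD.
  by rewrite RintegralD//; exact: cL1_Re.
under eq_Rintegral do rewrite ImD.
by rewrite RintegralD//; exact: cL1_Im.
Qed.

Lemma cintegralZ (a : C R) f : cL1 f -> cintegral (fun x => a * f x) = a * cintegral f.
Proof.
move=> If; apply: eqc; rewrite ?ReM ?ImM /cintegral /=.
  under eq_Rintegral do rewrite ReM.
  rewrite RintegralB// ?RintegralZl//; try exact: cL1_Re; try exact: cL1_Im.
    by apply: (integrableZl measurableT _ (cL1_Re If)).
  by apply: (integrableZl measurableT _ (cL1_Im If)).
under eq_Rintegral do rewrite ImM.
rewrite RintegralD// ?RintegralZl//; try exact: cL1_Re; try exact: cL1_Im.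
  by apply: (integrableZl measurableT _ (cL1_Im If)).
by apply: (integrableZl measurableT _ (cL1_Re If)).
Qed.

Lemma cintegralZr (a : C R) f : cL1 f -> cintegral (fun x => f x * a) = cintegral f * a.
Proof. by move=> If; rewrite [RHS]mulrC -cintegralZ//; congr cintegral; apply/funext => x; rewrite mulrC. Qed.

Lemma cintegralN f : cL1 f -> cintegral (fun x => - f x) = - cintegral f.
Proof.
by move=> If; rewrite -mulN1r -cintegralZ//; congr cintegral; apply/funext => x; rewrite mulN1r.
Qed.

Lemma cintegralB f g : cL1 f -> cL1 g ->
  cintegral (fun x => f x - g x) = cintegral f - cintegral g.
Proof. by move=> If Ig; rewrite cintegralD ?cintegralN//; exact: cL1N. Qed.

Lemma cintegral0 : cintegral (fun _ : T => 0 : C R) = 0.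
Proof. by apply: eqc; rewrite /cintegral /= /Rintegral integral0. Qed.

Lemma cintegral_sum I (s : seq I) (F : I -> T -> C R) :
  (forall i, cL1 (F i)) ->
  cintegral (fun x => \sum_(i <- s) F i x) = \sum_(i <- s) cintegral (F i).
Proof.
move=> mF; elim: s => [|i s IH].
  by under [X in cintegral X]eq_fun do rewrite big_nil; rewrite big_nil cintegral0.
under [X in cintegral X]eq_fun do rewrite big_cons.
by rewrite cintegralD ?big_cons ?IH//; exact: cL1_sum.
Qed.

Lemma cintegral_conj f : cL1 f -> cintegral (fun x => conjc (f x) : C R) = conjc (cintegral f).
Proof.
move=> If; apply: eqc; rewrite ?Re_conj ?Im_conj /cintegral /=.
  by under eq_Rintegral do rewrite Re_conj.
under eq_Rintegral do rewrite Im_conj -mulN1r.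
by rewrite RintegralZl ?mulN1r//; exact: cL1_Im.
Qed.

(** Real and imaginary parts are bounded separately, hence the factor 2. It is the origin of the
    factors 2 in [cubeint_le], [coeff_bound] and [n2_le_Xnorm]. *)
Lemma normc_cintegral f : cL1 f ->
  normc (cintegral f) <= 2 * \int[mu]_x normc (f x).
Proof.
move=> If; rewrite (le_trans (normc_le _))// mulr_natl mulr2n lerD//.
  apply: (le_trans (le_normr_Rintegral measurableT (cL1_Re If))).
  apply: le_Rintegral => //; [|exact: cL1_normc|by move=> x _; exact: normc_Re].
  exact: integrable_norm (cL1_Re If).
apply: (le_trans (le_normr_Rintegral measurableT (cL1_Im If))).
apply: le_Rintegral => //; [|exact: cL1_normc|by move=> x _; exact: normc_Im].
exact: integrable_norm (cL1_Im If).
Qed.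

Lemma integral_cVD (a : T) (F : T -> \bar R) : measurable_fun setT F ->
  (\int[mu]_x F (x + a)%R = \int[mu]_x F x)%E.
Proof.
move=> mF; rewrite integralE [RHS]integralE; congr (_ - _)%E.
  rewrite -[RHS](@ge0_integral_cVD R d a)//; last exact: measurable_funepos.
  by apply: eq_integral => x _; rewrite !funepos.unlock.
rewrite -[RHS](@ge0_integral_cVD R d a) //; last exact: measurable_funeneg.
by apply: eq_integral => x _; rewrite !funeneg.unlock.
Qed.

Lemma cintegral_shift (a : T) f : cmeasurable f ->
  cintegral (fun x => f (x + a)) = cintegral f.
Proof.
move=> [mr mi]; apply: eqc; rewrite /cintegral /= /Rintegral; congr fine.
  by apply: (integral_cVD a (F := fun x => (complex.Re (f x))%:E)); exact/measurable_EFinP.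
by apply: (integral_cVD a (F := fun x => (complex.Im (f x))%:E)); exact/measurable_EFinP.
Qed.

Lemma cL1_shift (a : T) f : cL1 f -> cL1 (fun x => f (x + a)).
Proof.
move=> [mf foo]; split.
  by apply: cmeasurable_comp => //; exact: measurable_cVD.
rewrite (@ge0_integral_cVD R d a (fun x => (normc (f x))%:E))//.
  by apply/measurable_EFinP; exact: measurable_normc.
by move=> x; rewrite lee_fin normc_ge0.
Qed.

Lemma Rintegral_mulmx (M : 'M[R]_d) (F : T -> R) : M \in unitmx ->
  mxscale M \is a fin_num -> mu.-integrable setT (EFin \o F) ->
  \int[mu]_x F (M *m x) = fine (mxscale M) * \int[mu]_x F x.
Proof.
move=> uM fM iF; have mF : measurable_fun setT (EFin \o F) by case/integrableP: iF.
rewrite /Rintegral -fineM//; last exact: integrable_fin_num.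
congr fine; rewrite integralE [in RHS]integralE.
rewrite muleBr//; last first.
  by apply: fin_num_adde_defl; rewrite fin_numN; exact: integrable_neg_fin_num.
congr (_ - _)%E.
  rewrite -[RHS](@ge0_integral_mulmx_prop R d M (EFin \o F)^\+%E)//; last exact: measurable_funepos.
  by apply: eq_integral => x _; rewrite !funepos.unlock.
rewrite -[RHS](@ge0_integral_mulmx_prop R d M (EFin \o F)^\-%E)//; last exact: measurable_funeneg.
by apply: eq_integral => x _; rewrite !funeneg.unlock.
Qed.

Lemma cintegral_mulmx (M : 'M[R]_d) f : M \in unitmx ->
  mxscale M \is a fin_num -> cL1 f ->
  cintegral (fun x => f (M *m x)) = ((fine (mxscale M))%:C)%C * cintegral f.
Proof.
move=> uM fM If; apply: eqc; rewrite ?ReM ?ImM /= ?mul0r ?subr0 ?addr0.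
  by rewrite (Rintegral_mulmx uM fM (cL1_Re If)).
by rewrite (Rintegral_mulmx uM fM (cL1_Im If)).
Qed.

Lemma cintegral_ae f g : cmeasurable f -> cmeasurable g ->
  {ae mu, forall x, f x = g x} -> cintegral f = cintegral g.
Proof.
move=> [fr fi] [gr gi] fg; apply: eqc; rewrite /cintegral /= /Rintegral; congr fine.
  apply: ae_eq_integral => //; [exact/measurable_EFinP|exact/measurable_EFinP|].
  by apply: filterS fg => x -> _.
apply: ae_eq_integral => //; [exact/measurable_EFinP|exact/measurable_EFinP|].
by apply: filterS fg => x -> _.
Qed.

End complex_measurable.

(** * Continuous functions with compact support *)

Section compact_support.
Context (R : realType) (d : nat).
Local Notation T := 'cV[R]_d.
Local Notation Z := 'cV[int]_d.
Implicit Types f g : T -> C R.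

Lemma cV_hausdorff : hausdorff_space T.
Proof. exact: norm_hausdorff. Qed.

Lemma compact_sub_cbox (K : set T) : compact K -> exists2 r : R, 0 <= r & K `<=` @cbox R d r.
Proof.
move=> cK; have [M [_ KM]] := compact_bounded cK.
exists (`|M| + 1); first by rewrite addr_ge0.
move=> x Kx i; rewrite /= in_itv /= -ler_norml.
have := KM (`|M| + 1); rewrite (le_lt_trans (ler_norm M)) ?ltrDl// => /(_ isT x Kx).
apply: le_trans; rewrite [leRHS]mx_normrE.
exact: (le_bigmax _ (fun ij : 'I_d * 'I_1 => `|x ij.1 ij.2|) (i, 0)).
Qed.

Lemma compact_cbox (r : R) : compact (@cbox R d r).
Proof.
have := @rV_compact R d (fun=> `[- r, r]%classic) (fun=> @segment_compact R (- r) r).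
move=> c.
have ct : continuous (fun v : 'rV[R]_d => v^T : T).
  apply: continuous_cVP => i; under eq_fun do rewrite mxE.
  exact: coord_continuous.
have := continuous_compact (continuous_subspaceT ct) c.
congr (compact _); apply/seteqP; split=> [_ [v vr <-] i|x xr].
  by rewrite mxE; exact: vr.
by exists x^T; [move=> i; rewrite mxE; exact: xr|rewrite trmxK].
Qed.

Lemma Ccr_sub f (K : set T) : continuous f -> compact K -> (forall x, f x != 0 -> K x) -> Ccr f.
Proof.
move=> cf cK fK; split=> //.
apply: (subclosed_compact _ cK); first exact: closed_closure.
have /closure_id -> := compact_closed cV_hausdorff cK.
exact: closure_subset.
Qed.

Lemma Ccr_cont f : Ccr f -> continuous f. Proof. by case. Qed.

Lemma Ccr_supp f : Ccr f -> exists2 r : R, 0 <= r & forall x, f x != 0 -> @cbox R d r x.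
Proof.
move=> [_ /compact_sub_cbox[r r0 fr]]; exists r => // x fx.
by apply: fr; exact: subset_closure.
Qed.

Lemma CcrP f (r : R) : continuous f -> (forall x, f x != 0 -> @cbox R d r x) -> Ccr f.
Proof. by move=> cf fr; apply: Ccr_sub cf (@compact_cbox r) fr. Qed.

Lemma cbox_le (r s : R) : r <= s -> @cbox R d r `<=` @cbox R d s.
Proof. by move=> rs x xr i; have := xr i; rewrite /= !in_itv /=; lra. Qed.

Lemma continuous_normc (S : topologicalType) (h : S -> C R) : continuous h ->
  continuous (fun x => normc (h x)).
Proof.
move=> ch x; apply/cvgrPdist_lt => e e0; have /cvgc_lt/(_ _ e0) := ch x.
apply: filterS => y; apply: le_lt_trans.
have h1 := normcD (h x - h y) (h y); have h2 := normcD (h y - h x) (h x).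
rewrite !subrK in h1 h2; rewrite normc_distC in h2.
rewrite ler_norml; lra.
Qed.

Lemma Ccr_bnd f : Ccr f -> exists2 K : R, 0 <= K & forall x, normc (f x) <= K.
Proof.
move=> [cf cK].
have cn := continuous_normc cf.
have := compact_bounded (V := R^o) (continuous_compact (continuous_subspaceT cn) cK).
move=> [M [_ HM]]; exists (`|M| + 1); first by rewrite addr_ge0.
move=> x; have [->|fx] := eqVneq (f x) 0; first by rewrite normc0 addr_ge0.
rewrite -[leLHS]ger0_norm ?normc_ge0//; apply: HM.
  by rewrite (le_lt_trans (ler_norm M)) ?ltrDl.
by exists x => //; exact: subset_closure.
Qed.

Lemma continuous_cM (S : topologicalType) (h k : S -> C R) : continuous h -> continuous k ->
  continuous (fun x => h x * k x).
Proof. by move=> ch ck x; apply: continuousM; [exact: ch|exact: ck]. Qed.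

Lemma continuous_cD (S : topologicalType) (h k : S -> C R) : continuous h -> continuous k ->
  continuous (fun x => h x + k x).
Proof. by move=> ch ck x; apply: continuousD; [exact: ch|exact: ck]. Qed.

Lemma continuous_cst_C (S : topologicalType) (c : C R) : continuous (fun _ : S => c).
Proof. by move=> x; exact: cst_continuous. Qed.

Lemma continuous_csum (S : topologicalType) I (s : seq I) (F : I -> S -> C R) :
  (forall i, continuous (F i)) -> continuous (fun x => \sum_(i <- s) F i x).
Proof.
move=> cF; elim: s => [|i s IH].
  by under eq_fun do rewrite big_nil; exact: continuous_cst_C.
have -> : (fun x => \sum_(j <- i :: s) F j x) = (fun x => F i x + \sum_(j <- s) F j x).
  by apply/funext => x; rewrite big_cons.
exact: (@continuous_cD S (F i) (fun x => \sum_(j <- s) F j x) (cF i) IH).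
Qed.

Lemma CcrD f g : Ccr f -> Ccr g -> Ccr (fun x => f x + g x).
Proof.
move=> Cf Cg; have [r r0 fr] := Ccr_supp Cf; have [s s0 gs] := Ccr_supp Cg.
apply: (CcrP (r := r + s)).
  by apply: continuous_cD; exact: Ccr_cont.
move=> x fgx; have [fx|fx] := eqVneq (f x) 0.
  apply: (cbox_le (r := s)); first by rewrite lerDr.
  by apply: gs; move: fgx; rewrite fx add0r.
by apply: (cbox_le (r := r)); [rewrite lerDl|exact: fr].
Qed.

Lemma CcrM f g : Ccr f -> continuous g -> Ccr (fun x => f x * g x).
Proof.
move=> Cf cg; have [r r0 fr] := Ccr_supp Cf.
apply: (CcrP (r := r)); first exact: (@continuous_cM T f g (Ccr_cont Cf) cg).
by move=> x fgx; apply: fr; move: fgx; apply: contraNneq => ->; rewrite mul0r.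
Qed.

Lemma CcrZ (a : C R) f : Ccr f -> Ccr (fun x => a * f x).
Proof.
move=> Cf; under [X in Ccr X]eq_fun do rewrite mulrC.
by apply: CcrM => //; exact: continuous_cst_C.
Qed.

Lemma Ccr0 : Ccr (fun _ : T => 0 : C R).
Proof. by apply: (CcrP (r := 0)) => [|x]; [exact: continuous_cst_C|rewrite eqxx]. Qed.

Lemma CcrB f g : Ccr f -> Ccr g -> Ccr (fun x => f x - g x).
Proof.
move=> Cf Cg; apply: CcrD => //; under [X in Ccr X]eq_fun do rewrite -mulN1r.
exact: CcrZ.
Qed.

Lemma Ccr_conj f : Ccr f -> Ccr (fun x => conjc (f x) : C R).
Proof.
move=> Cf; have [r r0 fr] := Ccr_supp Cf.
apply: (CcrP (r := r)); first by apply: continuous_conjc; exact: Ccr_cont.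
by move=> x fx; apply: fr; move: fx; apply: contraNneq => ->; rewrite conjc0.
Qed.

Lemma Ccr_sum I (s : seq I) (F : I -> T -> C R) : (forall i, Ccr (F i)) ->
  Ccr (fun x => \sum_(i <- s) F i x).
Proof.
move=> mF; elim: s => [|i s IH].
  by under [X in Ccr X]eq_fun do rewrite big_nil; exact: Ccr0.
by under [X in Ccr X]eq_fun do rewrite big_cons; exact: CcrD.
Qed.

Lemma continuous_RD (S : topologicalType) (h k : S -> R) : continuous h -> continuous k ->
  continuous (fun x => h x + k x).
Proof. by move=> ch ck x; exact: (continuousD (ch x) (ck x)). Qed.

Lemma continuous_RM (S : topologicalType) (h k : S -> R) : continuous h -> continuous k ->
  continuous (fun x => h x * k x).
Proof. by move=> ch ck x; exact: (continuousM (ch x) (ck x)). Qed.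

Lemma continuous_shift (a : T) : continuous (fun x : T => x + a).
Proof. apply: continuous_cVP => i; have -> : (fun x : T => (x + a) i 0) = (fun x => x i 0 + a i 0).
  by apply/funext => x; rewrite mxE.
exact: (@continuous_RD _ (fun x : T => x i 0) (fun=> a i 0) (@continuous_coord R d i) (fun x => @cst_continuous _ _ _ _)). Qed.

Lemma Ccr_shift (a : T) f : Ccr f -> Ccr (fun x => f (x + a)).
Proof.
move=> [cf cK]; apply: (@Ccr_sub _ ((fun x => x - a) @` closure [set x | f x != 0])).
- by move=> x; apply: (@continuous_comp _ _ _ (fun x : T => x + a) f); [exact: continuous_shift|exact: cf].
- by apply: continuous_compact cK; apply: continuous_subspaceT; exact: continuous_shift.
- by move=> x fx; exists (x + a); [exact: subset_closure|rewrite addrK].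
Qed.

Lemma continuous_mulmx (M : 'M[R]_d) : continuous (fun x : T => M *m x).
Proof.
apply: continuous_cVP => i.
have -> : (fun x : T => (M *m x) i 0) = (fun x => \sum_j M i j * x j 0).
  by apply/funext => x; rewrite mxE.
have: forall s : seq 'I_d, continuous (fun x : T => \sum_(j <- s) M i j * x j 0 : R).
  elim=> [|j s IH].
    by under eq_fun do rewrite big_nil; move=> x; exact: cst_continuous.
  under eq_fun do rewrite big_cons.
  exact: (@continuous_RD _ (fun x : T => M i j * x j 0) _ (continuous_RM (fun x => @cst_continuous _ _ _ _) (@continuous_coord R d j)) IH).
exact.
Qed.

Lemma Ccr_mulmx (M : 'M[R]_d) f : M \in unitmx -> Ccr f -> Ccr (fun x => f (M *m x)).
Proof.
move=> uM [cf cK]; apply: (@Ccr_sub _ ((fun x => invmx M *m x) @` closure [set x | f x != 0])).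
- by move=> x; apply: (@continuous_comp _ _ _ (fun x : T => M *m x) f); [exact: continuous_mulmx|exact: cf].
- by apply: continuous_compact cK; apply: continuous_subspaceT; exact: continuous_mulmx.
- by move=> x fx; exists (M *m x); [exact: subset_closure|rewrite mulKmx].
Qed.

Lemma Ccr_cL1 f : Ccr f -> cL1 f.
Proof.
move=> Cf; have [r r0 fr] := Ccr_supp Cf; have [K K0 fK] := Ccr_bnd Cf.
apply: (cL1_bnd (A := @cbox R d r) (K := K)) => //.
- by apply: cmeasurable_continuous; exact: Ccr_cont.
- exact: measurable_cbox.
- exact: cV_lebesgue_cbox.
- by move=> x xr; apply/eqP/negPn/negP => /fr.
Qed.

Lemma Ccr_L2 f : Ccr f -> cLp 2 f.
Proof.
move=> Cf; split; first by apply: cmeasurable_continuous; exact: Ccr_cont.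
have [_] := Ccr_cL1 (CcrM Cf (Ccr_cont Cf)).
by under eq_integral do rewrite normcM'.
Qed.

Lemma finite_zbox (K : nat) : finite_set [set g : Z | forall i, (`|g i 0%R| <= K)%N].
Proof.
apply: (@sub_finite_set _ _ ((fun f : {ffun 'I_d -> 'I_(K.*2.+1)} => \col_i ((f i : nat)%:Z - K%:Z)) @` setT)).
  move=> g /= gK; have lt i : (`|(g i 0 + K%:Z)%R| < K.*2.+1)%N.
    have := gK i; move: (g i 0) => z; rewrite -addnn; lia.
  exists [ffun i => Ordinal (lt i)] => //; apply/matrixP => i k; rewrite ord1 mxE ffunE /=.
  have := gK i; lia.
exact: finite_image.
Qed.

Lemma finite_cbox_lattice (r : R) : finite_set [set g : Z | @cbox R d r (zv R g)].
Proof.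
apply: sub_finite_set (finite_zbox (Num.trunc r).+1) => g gr i.
have := gr i; rewrite /= mxE in_itv /= -ler_norml => gir.
have : `|(g i 0)%:~R : R| < (Num.trunc r).+1%:R.
  by rewrite (le_lt_trans gir)// truncnS_gt.
rewrite -intr_norm pmulrn ltr_int; lia.
Qed.

Lemma cboxD (r s : R) (x y : T) : @cbox R d r x -> @cbox R d s y -> @cbox R d (r + s) (x + y).
Proof.
by move=> xr ys i; have := xr i; have := ys i; rewrite /= !mxE !in_itv /=; lra.
Qed.

Lemma cboxN (r : R) (x : T) : @cbox R d r x -> @cbox R d r (- x).
Proof. by move=> xr i; have := xr i; rewrite /= !mxE !in_itv /=; lra. Qed.

(** Such a c is the difference of a point of the support of g and one of the support of f, hence
    bounded. This is why brackets are finitely supported. *)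
Lemma compact_support_lattice f g : Ccr f -> Ccr g ->
  finite_set [set c : Z | exists x, f (x - zv R c) != 0 /\ g x != 0].
Proof.
move=> Cf Cg; have [r r0 fr] := Ccr_supp Cf; have [s s0 gs] := Ccr_supp Cg.
apply: sub_finite_set (finite_cbox_lattice (s + r)) => c [x [fx gx]] /=.
have -> : zv R c = x + - (x - zv R c) by rewrite opprB addrC subrK.
by apply: cboxD; [exact: gs|apply: cboxN; exact: fr].
Qed.

End compact_support.

Local Notation zseq S := (finmap.enum_fset (fset_set S)).

(** * Finitely supported functions on Z^d and trigonometric polynomials *)

Section lattice_sums.
Context (R : realType) (d : nat).
Local Notation T := 'cV[R]_d.
Local Notation Z := 'cV[int]_d.
Implicit Types (a b F G : Z -> C R) (f : T -> C R).

(** The finitely supported sum takes the default value 0 when the support of F is infinite; the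
    hypotheses [Ccz] below exclude this. *)
Definition zsum F : C R := \sum_(c \in [set: Z]) F c.

Lemma zsumE F (S : set Z) : finite_set S -> (forall c, ~ S c -> F c = 0) ->
  zsum F = \sum_(c <- zseq S) F c.
Proof.
move=> fS FS; apply: fsbigTE => c; rewrite in_fset_set// => /negP; rewrite inE; exact: FS.
Qed.

Lemma Ccz_sub F (S : set Z) : finite_set S -> (forall c, ~ S c -> F c = 0) -> Ccz F.
Proof.
move=> fS FS; apply: sub_finite_set fS => c /= Fc; apply: contrapT => /FS Fc0.
by move: Fc; rewrite Fc0 eqxx.
Qed.

Lemma Ccz_out F c : ~ [set g | F g != 0] c -> F c = 0.
Proof. by move=> /= /negP/negPn/eqP. Qed.

Lemma CczMl F (G : Z -> C R) : Ccz F -> Ccz (fun c => F c * G c).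
Proof. by move=> cF; apply: (Ccz_sub cF) => c /Ccz_out ->; rewrite mul0r. Qed.

Lemma zsum_Ccz_mul F (G : Z -> C R) : Ccz F ->
  zsum (fun c => F c * G c) = \sum_(c <- zseq [set g | F g != 0]) F c * G c.
Proof. by move=> cF; apply: zsumE => // c /Ccz_out ->; rewrite mul0r. Qed.

Lemma CczD F G : Ccz F -> Ccz G -> Ccz (fun c => F c + G c).
Proof.
move=> cF cG; have cFG : finite_set ([set g | F g != 0] `|` [set g | G g != 0]).
  by rewrite finite_setU.
by apply: (Ccz_sub cFG) => c /not_orP[/Ccz_out -> /Ccz_out ->]; rewrite addr0.
Qed.

Lemma CczZ (k : C R) F : Ccz F -> Ccz (fun c => k * F c).
Proof. by move=> cF; apply: (Ccz_sub cF) => c /Ccz_out ->; rewrite mulr0. Qed.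

Lemma Ccz0 : Ccz (fun _ : Z => 0 : C R).
Proof. by apply: (@Ccz_sub _ set0). Qed.

Lemma CczB F G : Ccz F -> Ccz G -> Ccz (fun c => F c - G c).
Proof.
move=> cF cG; apply: CczD => //; under [X in Ccz X]eq_fun do rewrite -mulN1r; exact: CczZ.
Qed.

Lemma Ccz_sum I (s : seq I) (F : I -> Z -> C R) : (forall i, Ccz (F i)) ->
  Ccz (fun c => \sum_(i <- s) F i c).
Proof.
move=> cF; elim: s => [|i s IH].
  by under [X in Ccz X]eq_fun do rewrite big_nil; exact: Ccz0.
by under [X in Ccz X]eq_fun do rewrite big_cons; exact: CczD.
Qed.

Lemma Ccz_shift (h : Z) F : Ccz F -> Ccz (fun c => F (c - h)).
Proof.
move=> cF; apply: (@Ccz_sub _ ((fun c => c + h) @` [set g | F g != 0])).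
  exact: finite_image.
move=> c Fc; apply/eqP/negPn/negP => Fch; apply: Fc; exists (c - h) => //.
by rewrite subrK.
Qed.

Lemma Ccz_star a : Ccz a -> Ccz (starZ a).
Proof.
move=> ca; apply: (@Ccz_sub _ ((fun c => - c) @` [set g | a g != 0])).
  exact: finite_image.
move=> c ac; rewrite /starZ; suff -> : a (- c) = 0 by rewrite conjc0.
apply/eqP/negPn/negP => Fch; apply: ac; exists (- c) => //; exact: opprK.
Qed.

Lemma Ccz_delta : Ccz (@deltaZ R d).
Proof.
apply: (@Ccz_sub _ [set 0]) => // c /= c0; rewrite /deltaZ.
by case: eqP.
Qed.

Lemma zsumD F G : Ccz F -> Ccz G -> zsum (fun c => F c + G c) = zsum F + zsum G.
Proof.
move=> cF cG; have cFG : finite_set ([set g | F g != 0] `|` [set g | G g != 0]).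
  by rewrite finite_setU.
rewrite !(zsumE cFG); first by rewrite big_split.
- by move=> c /not_orP[_ /Ccz_out ->].
- by move=> c /not_orP[/Ccz_out -> _].
- by move=> c /not_orP[/Ccz_out -> /Ccz_out ->]; rewrite addr0.
Qed.

Lemma zsumZ (k : C R) F : Ccz F -> zsum (fun c => k * F c) = k * zsum F.
Proof.
move=> cF; rewrite !(zsumE cF); first by rewrite mulr_sumr.
  exact: Ccz_out.
by move=> c /Ccz_out ->; rewrite mulr0.
Qed.

Lemma zsum0 : zsum (fun _ => 0) = 0.
Proof. exact: fsbig1. Qed.

Lemma zsum_sum I (s : seq I) (F : I -> Z -> C R) : (forall i, Ccz (F i)) ->
  zsum (fun c => \sum_(i <- s) F i c) = \sum_(i <- s) zsum (F i).
Proof.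
move=> cF; elim: s => [|i s IH].
  by under [X in zsum X]eq_fun do rewrite big_nil; rewrite big_nil zsum0.
under [X in zsum X]eq_fun do rewrite big_cons.
by rewrite zsumD ?big_cons ?IH//; exact: Ccz_sum.
Qed.

Lemma zsum_shift (h : Z) F : zsum (fun c => F (c - h)) = zsum F.
Proof.
apply/esym; apply: (reindex_fsbigT (fun c : Z => c - h)).
by exists (fun c => c + h) => c; rewrite ?addrK ?subrK.
Qed.

Lemma zsum_opp F : zsum (fun c => F (- c)) = zsum F.
Proof.
apply/esym; apply: (reindex_fsbigT (fun c : Z => - c)).
by exists (fun c : Z => - c) => c; rewrite opprK.
Qed.

Lemma zsum_refl (h : Z) F : zsum (fun c => F (h - c)) = zsum F.
Proof. by rewrite -(zsum_opp F) -[RHS](zsum_shift h); congr zsum; apply/funext => c; rewrite opprB. Qed.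

Lemma zsum_conj F : Ccz F -> conjc (zsum F) = zsum (fun c => conjc (F c)).
Proof.
move=> cF; rewrite !(zsumE cF); first by rewrite rmorph_sum.
  by move=> c /Ccz_out ->; rewrite conjc0.
exact: Ccz_out.
Qed.

Lemma zsum_delta (g : Z) F : zsum (fun c => (c == g)%:R * F c) = F g.
Proof.
rewrite (zsumE (S := [set g])) ?fset_set1 ?finmap.big_seq_fset1 ?eqxx ?mul1r//.
by move=> c /= /eqP/negbTE ->; rewrite mul0r.
Qed.

Lemma convZE a b : Ccz a ->
  convZ a b = fun g => \sum_(h <- zseq [set g | a g != 0]) a h * b (g - h).
Proof. by move=> ca; apply/funext => g; exact: (zsum_Ccz_mul (fun h => b (g - h)) ca). Qed.

Lemma convZC a b : convZ a b = convZ b a.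
Proof.
apply/funext => g; rewrite /convZ -[LHS](zsum_refl g); congr zsum; apply/funext => c.
by rewrite mulrC; congr (b _ * _); rewrite opprB addrCA subrr addr0.
Qed.

Lemma Ccz_conv a b : Ccz a -> Ccz b -> Ccz (convZ a b).
Proof.
by move=> ca cb; rewrite convZE//; apply: Ccz_sum => h; apply: CczZ; exact: Ccz_shift.
Qed.

Definition zdot (g : Z) (x : T) : R := dotc (zv R g) x.

Lemma dotcDl (x y z : T) : dotc (x + y) z = dotc x z + dotc y z.
Proof. by rewrite -big_split; apply: eq_bigr => i _; rewrite mxE mulrDl. Qed.
Lemma dotcNl (x z : T) : dotc (- x) z = - dotc x z.
Proof. by rewrite -sumrN; apply: eq_bigr => i _; rewrite mxE mulNr. Qed.
Lemma dotcC (x y : T) : dotc x y = dotc y x.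
Proof. by apply: eq_bigr => i _; rewrite mulrC. Qed.
Lemma dotcDr (x y z : T) : dotc x (y + z) = dotc x y + dotc x z.
Proof. by rewrite dotcC dotcDl !(dotcC _ x). Qed.
Lemma dotcNr (x z : T) : dotc x (- z) = - dotc x z.
Proof. by rewrite dotcC dotcNl dotcC. Qed.

Lemma dotcE (x y : T) : dotc x y = (x^T *m y) 0 0.
Proof. by rewrite mxE; apply: eq_bigr => i _; rewrite mxE. Qed.

Lemma dotc_mulmx (M : 'M[R]_d) (x y : T) : dotc (M *m x) y = dotc x (M^T *m y).
Proof. by rewrite !dotcE trmx_mul mulmxA. Qed.

Definition ez (g : Z) (x : T) : C R := ce (zdot g x).

Lemma ezD g x y : ez g (x + y) = ez g x * ez g y.
Proof. by rewrite /ez /zdot dotcDr ceD. Qed.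
Lemma ezDl g h x : ez (g + h) x = ez g x * ez h x.
Proof. by rewrite /ez /zdot zvD dotcDl ceD. Qed.
Lemma ezN g x : ez g (- x) = conjc (ez g x).
Proof. by rewrite /ez /zdot dotcNr ceN. Qed.
Lemma ezNl g x : ez (- g) x = conjc (ez g x).
Proof. by rewrite /ez /zdot zvN dotcNl ceN. Qed.
Lemma ezBl g h x : ez (g - h) x = ez g x * conjc (ez h x).
Proof. by rewrite ezDl ezNl. Qed.
Lemma ez0 x : ez 0 x = 1.
Proof.
rewrite /ez /zdot zv0 (_ : dotc _ _ = 0) ?ce0//.
by rewrite /dotc big1// => i _; rewrite mxE mul0r.
Qed.
Lemma ez_zv g h : ez g (zv R h) = 1.
Proof.
rewrite /ez (_ : zdot g (zv R h) = (\sum_i g i 0 * h i 0)%:~R) ?ce_int//.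
by rewrite rmorph_sum; apply: eq_bigr => i _; rewrite !mxE rmorphM.
Qed.
Lemma ez_per g x h : ez g (x + zv R h) = ez g x.
Proof. by rewrite ezD ez_zv mulr1. Qed.
Lemma normc_ez g x : normc (ez g x) = 1.
Proof. exact: normc_ce. Qed.

Lemma continuous_dotc (x : T) : continuous (dotc x).
Proof.
have H : forall s : seq 'I_d, continuous (fun y : T => \sum_(j <- s) x j 0 * y j 0 : R).
  elim=> [|j s IH].
    by under eq_fun do rewrite big_nil; move=> y; exact: cst_continuous.
  under eq_fun do rewrite big_cons.
  exact: (@continuous_RD _ _ (fun y : T => x j 0 * y j 0) _ (continuous_RM (fun y => @cst_continuous _ _ _ _) (@continuous_coord R d j)) IH).
exact: H.
Qed.

Lemma continuous_cedot (x : T) : continuous (fun y : T => ce (dotc x y) : C R).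
Proof. by move=> y; apply: (continuous_comp (g := @ce R)); [exact: continuous_dotc|exact: continuous_ce]. Qed.

Lemma continuous_ez g : continuous (ez g : T -> C R).
Proof. exact: continuous_cedot. Qed.

(** [fourierZ] lifted to a periodic function on R^d, where translation and integration are
    available; [fourierZ_proj] makes the link. *)
Definition trig a (x : T) : C R := zsum (fun g => a g * ez g x).

Lemma trigD a b x : Ccz a -> Ccz b -> trig (fun c => a c + b c) x = trig a x + trig b x.
Proof.
move=> ca cb; rewrite -zsumD; [|exact: CczMl|exact: CczMl].
by congr zsum; apply/funext => c; rewrite mulrDl.
Qed.

Lemma trigZ k a x : Ccz a -> trig (fun c => k * a c) x = k * trig a x.
Proof.
move=> ca; rewrite -zsumZ; last exact: CczMl.
by congr zsum; apply/funext => c; rewrite mulrA.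
Qed.

Lemma trig_sum I (s : seq I) (F : I -> Z -> C R) x : (forall i, Ccz (F i)) ->
  trig (fun c => \sum_(i <- s) F i c) x = \sum_(i <- s) trig (F i) x.
Proof.
move=> cF; rewrite -zsum_sum; last by move=> i; exact: CczMl.
by congr zsum; apply/funext => c; rewrite mulr_suml.
Qed.

Lemma trig_delta g x : trig (fun c => (c == g)%:R) x = ez g x.
Proof. exact: zsum_delta. Qed.

Lemma trig_deltaZ x : trig (@deltaZ R d) x = 1.
Proof. by rewrite -(ez0 x) -(trig_delta 0). Qed.

Lemma trig_shift h a x : trig (fun c => a (c - h)) x = ez h x * trig a x.
Proof.
have [ca|nca] := pselect (Ccz a).
  rewrite -zsumZ; last exact: CczMl.
  rewrite -[RHS](zsum_shift h); congr zsum; apply/funext => c.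
  by rewrite mulrCA -ezDl [h + _]addrC subrK.
(* When a has infinite support both sides are the default 0, since characters do not vanish. *)
rewrite /trig /zsum !fsbig_dflt ?mulr0//.
  apply: contra_not nca => fa; apply: sub_finite_set fa => c /= ac; split=> //=.
  by apply/eqP; rewrite mulf_neq0// /ez ce_neq0.
apply: contra_not nca => fa.
have := finite_image (fun c => c - h) fa; apply: sub_finite_set => c /= ac.
exists (c + h); last by rewrite addrK.
by split=> //=; rewrite addrK; apply/eqP; rewrite mulf_neq0// /ez ce_neq0.
Qed.

Lemma trig_conv a b x : Ccz a -> Ccz b -> trig (convZ a b) x = trig a x * trig b x.
Proof.
move=> ca cb; rewrite convZE// trig_sum; last first.
  by move=> h; apply: CczZ; exact: Ccz_shift.
rewrite {2}/trig zsum_Ccz_mul// mulr_suml; apply: eq_bigr => h _.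
by rewrite trigZ ?trig_shift ?mulrA//; exact: Ccz_shift.
Qed.

Lemma trig_star a x : Ccz a -> trig (starZ a) x = conjc (trig a x).
Proof.
move=> ca; rewrite zsum_conj; last exact: CczMl.
rewrite -[RHS]zsum_opp; congr zsum; apply/funext => c.
by rewrite cjM ezNl cjK.
Qed.

Lemma trig_per a x h : trig a (x + zv R h) = trig a x.
Proof. by congr zsum; apply/funext => c; rewrite ez_per. Qed.

Lemma continuous_trig a : Ccz a -> continuous (trig a).
Proof.
move=> ca; have -> : trig a = fun x => \sum_(c <- zseq [set g | a g != 0]) a c * ez c x.
  by apply/funext => x; exact: zsum_Ccz_mul.
apply: continuous_csum => c; apply: continuous_cM; first exact: continuous_cst_C.
exact: continuous_ez.
Qed.

End lattice_sums.

(** * Integration over the unit cube and orthogonality of characters *)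

Section cube_integrals.
Context (R : realType) (d : nat).
Local Notation T := 'cV[R]_d.
Local Notation Z := 'cV[int]_d.
Implicit Types (a b : Z -> C R) (f : T -> C R).

Definition Icube (x : T) : C R := ((\1_(@cube R d) x)%:C)%C.

Lemma IcubeE x : Icube x = if x \in @cube R d then 1 else 0.
Proof. by rewrite /Icube indicE; case: (x \in _). Qed.

Lemma cmeasurable_Icube : cmeasurable Icube.
Proof. by apply: cmeasurable_indic; exact: measurable_cube. Qed.

Lemma normc_Icube x : normc (Icube x) <= 1.
Proof. by rewrite IcubeE; case: ifP; rewrite ?normc1 ?normc0. Qed.

Lemma Icube_floorv x g : Icube (x - zv R g) = (g == floorv x)%:R.
Proof. by rewrite /Icube indic_cubeE; case: eqP. Qed.

Lemma sum_Icube x (S : set Z) : finite_set S -> S (floorv x) ->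
  \sum_(g <- zseq S) Icube (x - zv R g) = 1.
Proof.
move=> fS Sx; under eq_bigr do rewrite Icube_floorv.
rewrite (bigD1_seq (floorv x)) ?finmap.fset_uniq ?in_fset_set ?inE//= eqxx.
by rewrite big1 ?addr0// => g /negbTE ->.
Qed.

Lemma sum_IcubeD x (S : set Z) : finite_set S -> S (- floorv x) ->
  \sum_(g <- zseq S) Icube (x + zv R g) = 1.
Proof.
move=> fS Sx; have E g : Icube (x + zv R g) = (g == - floorv x)%:R.
  by rewrite -[g in LHS]opprK zvN Icube_floorv eqr_oppLR.
under eq_bigr do rewrite E.
rewrite (bigD1_seq (- floorv x)) ?finmap.fset_uniq ?in_fset_set ?inE//= eqxx.
by rewrite big1 ?addr0// => g /negbTE ->.
Qed.

Lemma floorv_cubeD (x : T) g : cube x -> floorv (x + zv R g) = g.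
Proof. by move=> xc; apply/esym/cube_floorP; rewrite addrK. Qed.

(** Complex analogue of [ge0_integral_unfold]: S contains the cells that meet the support of f, so
    that only finite sums occur. *)
Lemma cintegral_unfold f (K : R) (S : set Z) : cmeasurable f ->
  (forall x, normc (f x) <= K) -> finite_set S ->
  (forall x, f x != 0 -> S (floorv x)) ->
  cintegral f = cintegral (fun x => Icube x * \sum_(g <- zseq S) f (x + zv R g)).
Proof.
move=> mf fK fS fSx.
have IL g : cL1 (fun x => Icube x * f (x + zv R g)).
  apply: (cL1_bnd (A := @cube R d) (K := K)).
  - apply: cmeasurableM; first exact: cmeasurable_Icube.
    by apply: cmeasurable_comp => //; exact: measurable_cVD.
  - exact: measurable_cube.
  - by rewrite cV_lebesgue_cube ltry.
  - move=> x; rewrite normcM' -[K]mul1r ler_pM ?normc_ge0//; exact: normc_Icube.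
  - by move=> x; rewrite IcubeE; case: ifPn => [/set_mem//|_ _]; rewrite mul0r.
transitivity (cintegral (fun x => \sum_(g <- zseq S) Icube (x - zv R g) * f x)).
  congr cintegral; apply/funext => x; rewrite -mulr_suml.
  by have [->|fx] := eqVneq (f x) 0; rewrite ?mulr0// sum_Icube ?mul1r//; exact: fSx.
rewrite cintegral_sum; last first.
  move=> g; have := cL1_shift (- zv R g) (IL g).
  by under [X in cL1 X]eq_fun do rewrite subrK.
transitivity (\sum_(g <- zseq S) cintegral (fun x => Icube x * f (x + zv R g))).
  apply: eq_bigr => g _; rewrite -[RHS](cintegral_shift (- zv R g)); last by case: (IL g).
  by congr cintegral; apply/funext => x; rewrite subrK.
rewrite -cintegral_sum//; congr cintegral; apply/funext => x.
by rewrite mulr_sumr.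
Qed.

Lemma finite_floorv_cbox (r : R) : finite_set [set floorv x | x in @cbox R d r].
Proof.
apply: sub_finite_set (@finite_cbox_lattice R d (r + 1)) => g [x xr <-] i.
have := xr i; rewrite /= !mxE !in_itv /=.
have := floor_itv (x i 0); rewrite intrD; lra.
Qed.

Definition cubeL1 f := cL1 (fun x => Icube x * f x).

Lemma cubeL1_bnd f (K : R) : cmeasurable f -> (forall x, normc (f x) <= K) -> cubeL1 f.
Proof.
move=> mf fK; apply: (cL1_bnd (A := @cube R d) (K := K)).
- by apply: cmeasurableM => //; exact: cmeasurable_Icube.
- exact: measurable_cube.
- by rewrite cV_lebesgue_cube ltry.
- move=> x; rewrite normcM' -[K]mul1r ler_pM ?normc_ge0//; exact: normc_Icube.
- by move=> x; rewrite IcubeE; case: ifPn => [/set_mem//|_ _]; rewrite mul0r.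
Qed.

Definition cubeint f := cintegral (fun x => Icube x * f x).

Lemma cubeintD f g : cubeL1 f -> cubeL1 g ->
  cubeint (fun x => f x + g x) = cubeint f + cubeint g.
Proof.
by move=> If Ig; rewrite -cintegralD//; congr cintegral; apply/funext => x; rewrite mulrDr.
Qed.

Lemma cubeL1D f g : cubeL1 f -> cubeL1 g -> cubeL1 (fun x => f x + g x).
Proof.
by move=> If Ig; rewrite /cubeL1; under [X in cL1 X]eq_fun do rewrite mulrDr; exact: cL1D.
Qed.

Lemma cubeL1Z (k : C R) f : cubeL1 f -> cubeL1 (fun x => k * f x).
Proof.
by move=> If; rewrite /cubeL1; under [X in cL1 X]eq_fun do rewrite mulrCA; exact: cL1Z.
Qed.

Lemma cubeintZ (k : C R) f : cubeL1 f -> cubeint (fun x => k * f x) = k * cubeint f.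
Proof.
by move=> If; rewrite -cintegralZ//; congr cintegral; apply/funext => x; rewrite mulrCA.
Qed.

Lemma cubeL1_sum I (s : seq I) (F : I -> T -> C R) :
  (forall i, cubeL1 (F i)) -> cubeL1 (fun x => \sum_(i <- s) F i x).
Proof.
move=> mF; rewrite /cubeL1; under [X in cL1 X]eq_fun do rewrite mulr_sumr.
exact: cL1_sum.
Qed.

Lemma cubeint_sum I (s : seq I) (F : I -> T -> C R) :
  (forall i, cubeL1 (F i)) ->
  cubeint (fun x => \sum_(i <- s) F i x) = \sum_(i <- s) cubeint (F i).
Proof.
move=> mF; rewrite -cintegral_sum//; congr cintegral; apply/funext => x.
by rewrite mulr_sumr.
Qed.

Lemma cubeint1 : cubeint (fun=> 1) = 1.
Proof.
rewrite /cubeint; under [X in cintegral X]eq_fun do rewrite mulr1.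
apply: eqc; rewrite /cintegral /= /Rintegral; last by rewrite integral0.
by rewrite -cV_lebesgue_indic ?cV_lebesgue_cube//; exact: measurable_cube.
Qed.

Lemma cubeL1_ez k : cubeL1 (ez k : T -> C R).
Proof.
apply: (cubeL1_bnd (K := 1)); last by move=> x; rewrite normc_ez.
exact: cmeasurable_continuous (@continuous_ez R d k).
Qed.

(** For k nonzero there is a translation t with character value -1. By periodicity the integral over
    the translated cube is the integral over the cube, so it equals its own opposite. *)
Lemma cubeint_ez k : cubeint (ez k : T -> C R) = (k == 0)%:R.
Proof.
have [->|/eqP k0] := eqVneq k 0.
  by rewrite -cubeint1; congr cubeint; apply/funext => x; rewrite ez0.
have [i ki] : exists i, k i 0 != 0.
  apply: contrapT => /forallNP k0'; apply: k0; apply/matrixP => i j.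
  by rewrite ord1 mxE; apply/eqP/negPn/negP; exact: k0'.
(* Only the i-th coordinate is nonzero, and k_i t_i = 1/2. *)
pose t : T := \col_j (if j == i then (2 * (k i 0)%:~R)^-1 else 0).
have kt : ez k t = -1.
  rewrite /ez -ce_half; congr ce; rewrite /zdot /dotc (bigD1 i)//= !mxE eqxx.
  rewrite big1 ?addr0; first by field; rewrite intr_eq0.
  by move=> j ji; rewrite !mxE (negbTE ji) mulr0.
have tb : cbox 1 (- t).
  move=> l; rewrite /= !mxE in_itv /=; case: eqP => [_|]; last by lra.
  rewrite -ler_norml normrN normfV normrM -intr_norm ger0_norm//.
  rewrite invf_le1; last by rewrite mulr_gt0// ltr0z normr_gt0.
  have : (1 <= `|k i 0|) by move: ki; lia.
  rewrite -(ler1z R); lra.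
have mI : cmeasurable (fun x : T => Icube (x + t)).
  by apply: cmeasurable_comp; [exact: cmeasurable_Icube|exact: measurable_cVD].
have mE := cmeasurable_continuous (@continuous_ez R d k).
have E : cubeint (ez k) = - cubeint (ez k).
  rewrite -[RHS]cN1 -[in RHS]kt.
  transitivity (cintegral (fun x => Icube (x + t) * ez k (x + t))).
    by rewrite (cintegral_shift t (f := fun x => Icube x * ez k x))//; case: (cubeL1_ez k).
  have IL : cL1 (fun x => Icube (x + t) * ez k x).
    have := cL1_shift t (cL1Z (conjc (ez k t)) (cubeL1_ez k)).
    congr cL1; apply/funext => x; rewrite ezD mulrCA.
    by rewrite [conjc _ * _]mulrC -mulrA [ez k t * _]mulrC /ez ceJ mulr1.
  transitivity (ez k t * cintegral (fun x => Icube (x + t) * ez k x)).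
    rewrite -cintegralZ//; congr cintegral; apply/funext => x.
    by rewrite ezD mulrA mulrC.
  congr (_ * _).
  (* The shifted cube lies in the box of radius 2, so finitely many cells cover it; its pieces,
     moved by the lattice, fill the unit cube exactly once. *)
  pose S : set Z := [set floorv x | x in @cbox R d 2].
  have xS x : cube (x + t) -> S (floorv x).
    move=> xt; exists x => //; rewrite -(addrK t x) -[2]/(1 + 1).
    apply: cboxD => // j; have := xt j; rewrite /= !mxE !in_itv /=; lra.
  rewrite (@cintegral_unfold (fun x => Icube (x + t) * ez k x) 1 S).
  - congr cintegral; apply/funext => x; rewrite IcubeE; case: ifPn => [xc|]; last by rewrite !mul0r.
    rewrite !mul1r; under eq_bigr do rewrite ez_per.
    rewrite -mulr_suml -[RHS]mul1r; congr (_ * _).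
    transitivity (\sum_(g <- zseq S) Icube (x + t + zv R g)).
      by apply: eq_bigr => g _; rewrite addrAC.
    apply: sum_IcubeD; first exact: finite_floorv_cbox.
    have /set_mem xc' := xc; rewrite -(floorv_cubeD (- floorv (x + t)) xc').
    by apply: xS; rewrite zvN addrAC; apply/cube_floorP.
  - exact: cmeasurableM.
  - by move=> x; rewrite normcM' normc_ez mulr1 normc_Icube.
  - exact: finite_floorv_cbox.
  - move=> x; rewrite IcubeE; case: ifPn => [/set_mem xc _|_]; last by rewrite mul0r eqxx.
    exact: xS.
have : cubeint (ez k) + cubeint (ez k) = 0 by rewrite {1}E addNr.
by case: (cubeint (ez k)) => u v /= [h1 h2]; apply: eqc => /=; lra.
Qed.
End cube_integrals.

(** * The points where a character of R equals 1 *)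

Section character_zeros.
Context (R : realType).

(** For s in [0, 1), cos (2 pi s) = 1 forces sin (pi s) = 0 by the double angle formula, whereas sin
    (pi s) is positive for 0 < s < 1. *)
Lemma ce_eq1 (t : R) : ce t = 1 -> t = (Num.floor t)%:~R.
Proof.
move=> t1; pose s := t - (Num.floor t)%:~R.
have s1 : ce s = 1 by rewrite ceD -rmorphN t1 ce_int mulr1.
have /andP[s0 s_lt1] : 0 <= s < 1 by rewrite /s; have := floor_itv t; rewrite intrD; lra.
suff : s = 0 by move/eqP; rewrite subr_eq0 => /eqP.
apply/eqP; rewrite eq_le s0 andbT leNgt; apply/negP => s_gt0.
have : 0 < sin (pi * s).
  apply: sin_gt0_pi; rewrite mulr_gt0 ?pi_gt0//= -[ltRHS]mulr1 ltr_pM2l ?pi_gt0//.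
move: s1 => /(congr1 (@complex.Re R)) /=.
have -> : 2 * pi * s = (pi * s) *+ 2 by rewrite mulr2n; ring.
rewrite cos_mulr2n => c1; rewrite lt_neqAle eq_sym => /andP[/negP + _]; apply.
by rewrite -sqrf_eq0; apply/eqP; have := cos2Dsin2 (pi * s); lra.
Qed.

End character_zeros.

(** * Fejer kernels, Parseval and Poisson summation *)

Section fejer.
Context (R : realType) (d : nat).
Local Notation T := 'cV[R]_d.
Local Notation Z := 'cV[int]_d.
Implicit Types (a b : Z -> C R) (G : T -> C R).

Definition periodic G := forall x g, G (x + zv R g) = G x.

Definition ei (i : 'I_d) : Z := \col_j (j == i)%:Z.

(* Wt vanishes exactly on Z^d and its mean against the N-th Fejer kernel is
   O(1/N); since a continuous periodic G satisfies
   |G x - G y| <= e + K Wt (x - y), convolutions with Fejer kernels converge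
   uniformly (Korovkin's argument). *)
Definition Wt (t : T) : R := \sum_i normc (1 - ez (ei i) t) ^+ 2.

Lemma zdot_ei i (t : T) : zdot (ei i) t = t i 0.
Proof.
rewrite /zdot /dotc (bigD1 i)//= !mxE eqxx mul1r big1 ?addr0// => j ji.
by rewrite !mxE (negbTE ji) mul0r.
Qed.

Lemma Wt_ge0 t : 0 <= Wt t.
Proof. by apply: sumr_ge0 => i _; rewrite sqr_ge0. Qed.

Lemma Wt_eq0 t : Wt t = 0 -> t = zv R (floorv t).
Proof.
move=> /eqP; rewrite psumr_eq0; last by move=> i _; rewrite sqr_ge0.
move=> /allP W0; apply/matrixP => i j; rewrite ord1 !mxE.
have := W0 i (mem_index_enum i); rewrite sqrf_eq0 => /eqP/normc_eq0/eqP.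
by rewrite subr_eq0 eq_sym => /eqP; rewrite /ez zdot_ei; exact: ce_eq1.
Qed.

Lemma continuous_Wt : continuous Wt.
Proof.
have H : forall s : seq 'I_d, continuous (fun t : T => \sum_(i <- s) normc (1 - ez (ei i) t) ^+ 2 : R).
  elim=> [|j s IH].
    by under eq_fun do rewrite big_nil; move=> y; exact: cst_continuous.
  under eq_fun do rewrite big_cons.
  apply: (@continuous_RD _ _ (fun t : T => normc (1 - ez (ei j) t) ^+ 2)) => //.
  have cn : continuous (fun t : T => normc (1 - ez (ei j) t)).
    apply: continuous_normc; have -> : (fun t : T => 1 - ez (ei j) t) = (fun t => 1 + -1 * ez (ei j) t).
      by apply/funext => t; rewrite cN1.
    apply: (@continuous_cD R T (fun=> 1) (fun t => -1 * ez (ei j) t)); first exact: continuous_cst_C.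
    by apply: (@continuous_cM R T (fun=> -1) (ez (ei j))); [exact: continuous_cst_C|exact: continuous_ez].
  exact: (continuous_RM cn cn).
exact: H.
Qed.

Lemma cube_frac (x : T) : cube (x - zv R (floorv x)).
Proof. exact/cube_floorP. Qed.

Lemma cube_cbox (x : T) : cube x -> cbox 1 x.
Proof. by move=> xc i; have := xc i; rewrite /= !in_itv /=; lra. Qed.

Lemma periodic_bnd G : continuous G -> periodic G -> exists2 K : R, 0 <= K & forall x, normc (G x) <= K.
Proof.
move=> cG pG; have cn := continuous_normc cG.
have := compact_bounded (V := R^o) (continuous_compact (continuous_subspaceT cn) (@compact_cbox R d 1)).
move=> [M [_ HM]]; exists (`|M| + 1); first by rewrite addr_ge0.
move=> x; rewrite -(pG x (- floorv x)) zvN.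
rewrite -[leLHS]ger0_norm ?normc_ge0//; apply: HM.
  by rewrite (le_lt_trans (ler_norm M)) ?ltrDl.
by exists (x - zv R (floorv x)) => //; apply: cube_cbox; exact: cube_frac.
Qed.

(** On the compact set of pairs in the box with |G x - G y| >= e, [Wt] (x - y) has a positive
    minimum, since it vanishes only on the lattice, where G x = G y. K is twice a bound of |G|
    divided by this minimum, or 0 when there is no such pair. Periodicity brings any pair into the
    box. *)
Lemma periodic_modulus G (e : R) : continuous G -> periodic G -> 0 < e ->
  exists2 K : R, 0 <= K & forall x y, normc (G x - G y) <= e + K * Wt (x - y).
Proof.
move=> cG pG e0; have [B B0 GB] := periodic_bnd cG pG.
pose H (p : T * T) : R := normc (G p.1 - G p.2).
have cH : continuous H.
  apply: continuous_normc.
  have -> : (fun p : T * T => G p.1 - G p.2) = (fun p => G p.1 + -1 * G p.2).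
    by apply/funext => p; rewrite cN1.
  have c1 : continuous (fun p : T * T => G p.1).
    by move=> p; apply: (continuous_comp (g := G)); [exact: cvg_fst|exact: cG].
  have c2 : continuous (fun p : T * T => G p.2).
    by move=> p; apply: (continuous_comp (g := G)); [exact: cvg_snd|exact: cG].
  apply: (continuous_cD c1).
  by apply: (@continuous_cM R _ (fun=> -1)); [exact: continuous_cst_C|exact: c2].
have cW : continuous (fun p : T * T => Wt (p.1 - p.2)).
  have cB : continuous (fun p : T * T => p.1 - p.2).
    by move=> p; exact: (cvgB cvg_fst cvg_snd).
  by move=> p; apply: (@continuous_comp _ _ _ (fun p : T * T => p.1 - p.2) Wt); [exact: cB|exact: continuous_Wt].
pose A : set (T * T) := (@cbox R d 1 `*` @cbox R d 1) `&` [set p | e <= H p].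
have cA : compact A.
  apply: (subclosed_compact _ (compact_setX (@compact_cbox R d 1) (@compact_cbox R d 1))).
    apply: closedI; last first.
      by apply: (@closed_comp _ _ H [set r | e <= r]) => [p _|]; [exact: cH|exact: closed_ge].
    apply: compact_closed; last exact: (compact_setX (@compact_cbox R d 1) (@compact_cbox R d 1)).
    exact: norm_hausdorff.
  by move=> p [].
have red (x y : T) K : (forall p, A p -> 2 * B <= K * Wt (p.1 - p.2)) ->
  0 <= K -> normc (G x - G y) <= e + K * Wt (x - y).
  move=> HA K0.
  pose x' := x - zv R (floorv x); pose y' := y - zv R (floorv y).
  have -> : G x = G x' by rewrite /x' -zvN pG.
  have -> : G y = G y' by rewrite /y' -zvN pG.
  have -> : Wt (x - y) = Wt (x' - y').
    apply: eq_bigr => i _; congr (normc (1 - _) ^+ 2).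
    by rewrite -[LHS](ez_per _ _ (floorv y - floorv x)) zvB; congr ez; rewrite /x' /y'; rewrite opprB addrACA [RHS]addrACA [- zv R _ + _]addrC.
  have [eH|He] := leP e (H (x', y')).
    apply: (le_trans (normcB _ _)).
    have /= := HA (x', y') (conj (conj (cube_cbox (cube_frac x)) (cube_cbox (cube_frac y))) eH).
    by have := GB x'; have := GB y'; lra.
  by rewrite (le_trans (ltW He))// lerDl mulr_ge0// Wt_ge0.
have [A0|/set0P/negP/negPn/eqP A0] := pselect (A !=set0); last first.
  exists 0 => // x y; apply: red => // p; by rewrite A0.
have [p pA pmin] := compact_EVT_min A0 cA (continuous_subspaceT cW).
have Wp : 0 < Wt (p.1 - p.2).
  rewrite lt_neqAle Wt_ge0 andbT eq_sym; apply/eqP => /Wt_eq0 W0.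
  move: pA => /set_mem[_]; rewrite /= /H (_ : G p.1 = G p.2) ?subrr ?normc0; last first.
    by rewrite -[in LHS](subrK p.2 p.1) [X in G (X + _)]W0 [_ + p.2]addrC pG.
  by rewrite leNgt e0.
exists (2 * B / Wt (p.1 - p.2)); first by rewrite divr_ge0 ?mulr_ge0 ?Wt_ge0.
move=> x y; apply: red; last by rewrite divr_ge0 ?mulr_ge0 ?Wt_ge0.
move=> q qA; rewrite -mulrA ler_peMr ?mulr_ge0// mulrC ler_pdivlMr// mul1r.
by apply: pmin; exact/mem_set.
Qed.

Context (N : nat).
Local Notation I := {ffun 'I_d -> 'I_N.+1}.

Definition kv (p : I) : Z := \col_i (p i : nat)%:Z.

Lemma kv_inj : injective kv.
Proof.
move=> p q /matrixP pq; apply/ffunP => i; apply/val_inj.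
by have := pq i 0; rewrite !mxE => -[].
Qed.

(** The d-dimensional Fejer kernel with frequencies in {0, ..., N}^d, written as a double sum so
    that its Fourier coefficients count pairs of frequencies; [fejerE] is the form that shows
    positivity. *)
Definition fejer (t : T) : C R :=
  ((#|I|%:R^-1)%:C)%C * \sum_(p : I) \sum_(q : I) ez (kv p - kv q) t.

Definition dirichlet (t : T) : C R := \sum_(p : I) ez (kv p) t.

Lemma cardI_gt0 : 0 < #|I|%:R :> R.
Proof. by rewrite ltr0n; apply/card_gt0P; exists [ffun=> ord0]. Qed.

Lemma fejerE t : fejer t = ((#|I|%:R^-1 * normc (dirichlet t) ^+ 2)%:C)%C.
Proof.
rewrite /fejer rmorphM /=; congr (_ * _).
rewrite -conj_mul mulrC /dirichlet mulr_suml; apply: eq_bigr => p _.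
rewrite -[conjc _]/(conjc (\sum_(q : I) ez (kv q) t)) rmorph_sum mulr_sumr.
by apply: eq_bigr => q _; rewrite ezBl.
Qed.

Lemma normc_fejer t : normc (fejer t) = complex.Re (fejer t).
Proof. by rewrite fejerE normc_real ger0_norm// mulr_ge0 ?sqr_ge0// invr_ge0 ltW// cardI_gt0. Qed.

Lemma cubeL1_ezB h x : cubeL1 (fun y : T => ez h (x - y) : C R).
Proof.
have := cubeL1Z (ez h x) (@cubeL1_ez R d (- h)).
by congr cubeL1; apply/funext => y; rewrite ezD ezN ezNl.
Qed.

Lemma cubeint_ezB h x : cubeint (fun y : T => ez h (x - y) : C R) = (h == 0)%:R.
Proof.
transitivity (cubeint (fun y : T => ez h x * ez (- h) y)).
  by congr cubeint; apply/funext => y; rewrite ezD ezN ezNl.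
rewrite cubeintZ; last exact: cubeL1_ez.
rewrite cubeint_ez oppr_eq0; case: eqP => [->|_]; rewrite ?mulr0//.
by rewrite ez0 mulr1.
Qed.

(** Orthogonality turns the integral into a count of the pairs with a given difference; the counts
    for h = 0 and for h the plus or minus i-th unit vector are evaluated next. *)
Lemma cubeint_fejer h x :
  cubeint (fun y => fejer (x - y) * ez h (x - y)) =
  ((#|I|%:R^-1 * \sum_(p : I) \sum_(q : I) (kv p - kv q + h == 0)%:R)%:C)%C /\
  cubeL1 (fun y => fejer (x - y) * ez h (x - y)).
Proof.
have -> : (fun y => fejer (x - y) * ez h (x - y)) =
  (fun y => ((#|I|%:R^-1)%:C)%C * \sum_(p : I) \sum_(q : I) ez (kv p - kv q + h) (x - y)).
  apply/funext => y; rewrite /fejer -mulrA; congr (_ * _); rewrite mulr_suml.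
  by apply: eq_bigr => p _; rewrite mulr_suml; apply: eq_bigr => q _; rewrite -ezDl.
have L p : cubeL1 (fun y : T => \sum_(q : I) ez (kv p - kv q + h) (x - y) : C R).
  by apply: cubeL1_sum => q; exact: cubeL1_ezB.
split; last by apply: cubeL1Z; apply: cubeL1_sum.
rewrite cubeintZ; last exact: cubeL1_sum.
rewrite cubeint_sum// rmorphM /=; congr (_ * _); rewrite rmorph_sum; apply: eq_bigr => p _.
rewrite cubeint_sum; last by move=> q; exact: cubeL1_ezB.
rewrite rmorph_sum; apply: eq_bigr => q _; rewrite cubeint_ezB.
by case: eqP.
Qed.

Lemma fejer_count0 : \sum_(p : I) \sum_(q : I) (kv p - kv q + 0 == 0)%:R = #|I|%:R :> R.
Proof.
transitivity (\sum_(p : I) 1 : R); last by rewrite sumr_const.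
apply: eq_bigr => p _; rewrite (bigD1 p)//= subrr addr0 eqxx big1 ?addr0// => q qp.
rewrite addr0 subr_eq0; case: eqP => // /kv_inj pq; by rewrite pq eqxx in qp.
Qed.

(** Replacing the maximal i-th entry of p by an arbitrary r is injective in (p, r). *)
Lemma card_top (i : 'I_d) : (#|[pred p : I | p i == ord_max]| * N.+1 <= #|I|)%N.
Proof.
rewrite -[X in (_ * X)%N]card_ord -card_sig -card_prod.
pose F (pr : {p : I | p i == ord_max} * 'I_N.+1) : I :=
  [ffun j => if j == i then pr.2 else sval pr.1 j].
apply: (leq_card F) => -[[p pi] r] [[q qi] s] /ffunP pq.
congr pair; last by have := pq i; rewrite !ffunE eqxx.
apply/val_inj/ffunP => j /=; have := pq j; rewrite !ffunE; case: eqP => [-> _|//].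
by rewrite (eqP pi) (eqP qi).
Qed.

(** Every p whose i-th entry is not maximal has a partner q, which is p raised by one at i; by
    [card_top] the remaining p are at most one in N + 1. The other sign follows by exchanging p and
    q. *)
Lemma fejer_count1 (i : 'I_d) (s : bool) :
  #|I|%:R - #|I|%:R / N.+1%:R <=
  \sum_(p : I) \sum_(q : I) (kv p - kv q + (if s then ei i else - ei i) == 0)%:R :> R.
Proof.
wlog -> : s / s.
  move=> /(_ true erefl) H; case: s; first exact: H.
  apply: le_trans H _; rewrite [leLHS]exchange_big /=.
  apply: ler_sum => p _; apply: ler_sum => q _; rewrite le_eqVlt; apply/orP; left; apply/eqP.
  congr (_%:R); congr nat_of_bool; rewrite -[RHS]oppr_eq0 !opprD opprK opprK.
  by rewrite [- kv p + _]addrC.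
apply: (@le_trans _ _ (\sum_(p : I) (p i != ord_max)%:R)); last first.
  apply: ler_sum => p _; case: (boolP (p i != ord_max)) => pi /=; last first.
    by apply: sumr_ge0 => q _.
  have lt : ((p i).+1 < N.+1)%N.
    by rewrite ltn_neqAle ltn_ord andbT; apply: contraNneq pi => -[E]; exact/eqP/val_inj.
  pose q : I := [ffun j => if j == i then Ordinal lt else p j].
  rewrite (bigD1 q)//= (_ : _ == 0) ?lerDl ?sumr_ge0//.
  apply/eqP/matrixP => j k; rewrite ord1 !mxE ffunE; case: eqP => [->|] /=; lia.
have -> : \sum_(p : I) (p i != ord_max)%:R = #|I|%:R - #|[pred p : I | p i == ord_max]|%:R :> R.
  have -> : #|[pred p : I | p i == ord_max]|%:R = \sum_(p : I) (p i == ord_max)%:R :> R.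
    rewrite -sum1_card natr_sum big_mkcond; apply: eq_bigr => p _.
    by rewrite inE /=; case: eqP.
  have -> : #|I|%:R = \sum_(p : I) 1 :> R by rewrite sumr_const.
  by rewrite -sumrB; apply: eq_bigr => p _; case: eqP; rewrite ?subrr ?subr0.
rewrite lerD2l lerN2 ler_pdivlMr ?ltr0n// -natrM ler_nat; exact: card_top.
Qed.

Lemma fejer_int x : cubeL1 (fun y => fejer (x - y)) /\ cubeint (fun y => fejer (x - y)) = 1.
Proof.
have [E L] := cubeint_fejer 0 x; have F : (fun y => fejer (x - y) * ez 0 (x - y)) = (fun y => fejer (x - y)).
  by apply/funext => y; rewrite ez0 mulr1.
rewrite F in E L; split=> //; rewrite E fejer_count0 mulVf//.
by rewrite gt_eqF// cardI_gt0.
Qed.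

Lemma WtE t : ((Wt t)%:C)%C = \sum_i (2 - (ez (ei i) t + ez (- ei i) t)) :> C R.
Proof.
rewrite /Wt rmorph_sum; apply: eq_bigr => i _; rewrite -[LHS]conj_mul ezNl cjB conjc1.
have := conj_mul (ez (ei i) t); rewrite normc_ez expr1n => h.
by rewrite mulrBl !mulrBr h; ring.
Qed.

(** [Wt] is the sum over i of 2 minus the two characters at the plus and minus i-th unit vector, and
    the mean of each against the kernel is at least 1 - 1/(N + 1). *)
Lemma fejer_Wt x : cubeL1 (fun y => fejer (x - y) * ((Wt (x - y))%:C)%C) /\
  complex.Re (cubeint (fun y => fejer (x - y) * ((Wt (x - y))%:C)%C)) <= d%:R * (2 / N.+1%:R).
Proof.
pose F i y := 2 * fejer (x - y) + -1 * (fejer (x - y) * ez (ei i) (x - y) + fejer (x - y) * ez (- ei i) (x - y)).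
have -> : (fun y => fejer (x - y) * ((Wt (x - y))%:C)%C) = (fun y => \sum_i F i y).
  by apply/funext => y; rewrite WtE mulr_sumr; apply: eq_bigr => i _; rewrite /F; ring.
have [L0 E0] := fejer_int x.
have L1 i := (cubeint_fejer (ei i) x).2; have L2 i := (cubeint_fejer (- ei i) x).2.
have E1 i := (cubeint_fejer (ei i) x).1; have E2 i := (cubeint_fejer (- ei i) x).1.
have LF i : cubeL1 (F i).
  by apply: cubeL1D; [exact: cubeL1Z|apply: cubeL1Z; exact: cubeL1D].
split; first exact: cubeL1_sum.
rewrite cubeint_sum// Re_sum -[d in d%:R]card_ord -sum1_card natr_sum mulr_suml.
apply: ler_sum => i _; rewrite mul1r.
rewrite cubeintD; [|exact: cubeL1Z|apply: cubeL1Z; exact: cubeL1D].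
rewrite (cubeintZ 2 L0) (cubeintZ (-1) (cubeL1D (L1 i) (L2 i))).
rewrite (cubeintD (L1 i) (L2 i)) E0 E1 E2 mulr1 cN1 ReB ReD /=.
have c1 := fejer_count1 i true; have c2 := fejer_count1 i false; rewrite /= in c1 c2.
have B0 := cardI_gt0; have B0' : #|I|%:R != 0 :> R by rewrite gt_eqF.
have h (u : R) : #|I|%:R - #|I|%:R / N.+1%:R <= u -> 1 - N.+1%:R^-1 <= #|I|%:R^-1 * u.
  move=> /(ler_wpM2l (ltW (_ : 0 < #|I|%:R^-1))); rewrite invr_gt0 => /(_ B0).
  by apply: le_trans; rewrite mulrBr mulrA mulVf// mul1r.
have {}c1 := h _ c1; have {}c2 := h _ c2; rewrite lerBlDr.
apply: (@le_trans _ _ (2 / N.+1%:R + ((1 - N.+1%:R^-1) + (1 - N.+1%:R^-1)))).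
  by rewrite le_eqVlt; apply/orP; left; apply/eqP; ring.
by rewrite lerD2l lerD.
Qed.

Lemma cubeint_le (h k : T -> C R) : cubeL1 h -> cubeL1 k ->
  (forall y, normc (h y) <= complex.Re (k y)) ->
  normc (cubeint h) <= 2 * complex.Re (cubeint k).
Proof.
move=> Lh Lk hk; rewrite (le_trans (normc_cintegral Lh))// ler_wpM2l//.
apply: le_Rintegral => //; [exact: cL1_normc|exact: cL1_Re|].
move=> y _; rewrite normcM' ReM IcubeE; case: ifP => _ /=.
  by rewrite expr1n expr0n /= addr0 sqrtr1 !mul1r mul0r subr0.
by rewrite expr0n /= addr0 sqrtr0 !mul0r subrr.
Qed.

(** The kernel is a finite sum of characters of x - y, so integrating over y leaves a trigonometric
    polynomial in x whose coefficients are those of G, weighted by the kernel. *)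
Lemma fejer_conv G : cmeasurable G -> (exists K : R, forall x, normc (G x) <= K) ->
  exists2 a, Ccz a & forall x, trig a x = cubeint (fun y => G y * fejer (x - y)) /\
    cubeL1 (fun y => G y * fejer (x - y)).
Proof.
move=> mG [K GK].
pose c g := cubeint (fun y => G y * ez (- g) y).
have Lc g : cubeL1 (fun y => G y * ez (- g) y).
  apply: (cubeL1_bnd (K := K)); last by move=> y; rewrite normcM' normc_ez mulr1.
  by apply: cmeasurableM => //; exact: cmeasurable_continuous (@continuous_ez R d _).
pose b := ((#|I|%:R^-1)%:C)%C : C R.
pose a := fun g => \sum_(p : I) \sum_(q : I) (b * c (kv p - kv q)) * (g == kv p - kv q)%:R.
have cd (g : Z) : Ccz (fun h => (h == g)%:R : C R).
  by apply: (@Ccz_sub _ _ _ [set g]) => // h /= /eqP/negbTE ->.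
exists a.
  by apply: Ccz_sum => p; apply: Ccz_sum => q; apply: CczZ.
move=> x.
have E : (fun y => G y * fejer (x - y)) =
  fun y => \sum_(p : I) \sum_(q : I) (b * ez (kv p - kv q) x) * (G y * ez (- (kv p - kv q)) y).
  apply/funext => y; rewrite /fejer -/b mulrCA mulr_sumr mulr_sumr; apply: eq_bigr => p _.
  rewrite mulr_sumr mulr_sumr; apply: eq_bigr => q _; rewrite ezD ezN ezNl.
  by rewrite mulrACA [G y * _]mulrC !mulrA -!mulrA; congr (_ * _); ring.
have LE p : cubeL1 (fun y => \sum_(q : I) (b * ez (kv p - kv q) x) * (G y * ez (- (kv p - kv q)) y)).
  by apply: cubeL1_sum => q; apply: cubeL1Z.
rewrite E; split; last exact: cubeL1_sum.
rewrite cubeint_sum// trig_sum; last by move=> p; apply: Ccz_sum => q; apply: CczZ.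
apply: eq_bigr => p _; rewrite cubeint_sum; last by move=> q; apply: cubeL1Z.
rewrite trig_sum; last by move=> q; apply: CczZ.
apply: eq_bigr => q _; rewrite cubeintZ// trigZ// trig_delta -/(c _).
by rewrite mulrAC.
Qed.

End fejer.

(** * Uniform density of trigonometric polynomials *)

Section fejer_density.
Context (R : realType) (d : nat).
Local Notation T := 'cV[R]_d.

(** As the kernel has integral 1, the error is the mean of (G x - G y) against the kernel at x - y.
    By [periodic_modulus] it is controlled by a small constant plus K times the mean of [Wt], which
    tends to 0 with 1/N. *)
Theorem trig_dense (G : T -> C R) (e : R) : continuous G -> periodic G -> 0 < e ->
  exists2 a, Ccz a & forall x, normc (G x - trig a x) <= e.
Proof.
move=> cG pG e0.
(* The error is at most 2 (e/4 + e/4): two terms, and the factor 2 of [cubeint_le]. *)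
have e4 : 0 < e / 4 by rewrite divr_gt0.
have [K K0 HK] := periodic_modulus cG pG e4.
pose N := Num.trunc (8 * K * d%:R / e).
have NK : K * (d%:R * (2 / N.+1%:R)) <= e / 4.
  have : 8 * K * d%:R / e < N.+1%:R by exact: truncnS_gt.
  rewrite ltr_pdivrMr// => h; rewrite !mulrA ler_pdivrMr ?ltr0n//.
  by rewrite -(ler_pM2r (_ : 0 < 4))// -!mulrA; move: h; set n1 := N.+1%:R; nra.
have [B B0 GB] := periodic_bnd cG pG; have mG := cmeasurable_continuous cG.
have [a ca Ha] := fejer_conv N mG (ex_intro _ B GB).
exists a => // x; have [-> Lx] := Ha x.
have [L1 E1] := fejer_int N x; have [L2 E2] := fejer_Wt N x.
have -> : G x - cubeint (fun y => G y * fejer N (x - y)) =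
    cubeint (fun y => G x * fejer N (x - y) + -1 * (G y * fejer N (x - y))).
  by rewrite (cubeintD (cubeL1Z _ L1) (cubeL1Z _ Lx)) (cubeintZ _ L1) (cubeintZ _ Lx) E1 mulr1 cN1.
pose k y : C R := ((e / 4)%:C)%C * fejer N (x - y) + (K%:C)%C * (fejer N (x - y) * ((Wt (x - y))%:C)%C).
have Lk : cubeL1 k by apply: cubeL1D; exact: cubeL1Z.
apply: (@le_trans _ _ (2 * complex.Re (cubeint k))).
  apply: cubeint_le => //.
    by apply: cubeL1D; apply: cubeL1Z.
  move=> y; rewrite cN1 -mulrBl normcM' normc_fejer /k fejerE.
  rewrite !ReD !ReM /= !mul0r ?mulr0 !subr0.
  rewrite [X in K * X]mulrC [K * (_ * _)]mulrA -mulrDl ler_wpM2r ?HK//.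
  by rewrite mulr_ge0 ?sqr_ge0// invr_ge0 ltW// cardI_gt0.
rewrite (cubeintD (cubeL1Z _ L1) (cubeL1Z _ L2)) (cubeintZ _ L1) (cubeintZ _ L2) E1 mulr1 ReD ReZ ReC.
have E4 : e = 2 * (e / 4 + e / 4) by field.
rewrite [leRHS]E4.
rewrite ler_pM2l// lerD//.
exact: le_trans (ler_wpM2l K0 E2) NK.
Qed.

End fejer_density.

(** * Bessel's inequality and Parseval's identity *)

Section parseval.
Context (R : realType) (d : nat).
Local Notation T := 'cV[R]_d.
Local Notation Z := 'cV[int]_d.
Local Notation mu := (cV_lebesgue R d).
Implicit Types (G H : T -> C R).

Definition bmeas G := cmeasurable G /\ exists K : R, forall x, normc (G x) <= K.

Lemma bmeas_ez k : bmeas (ez k : T -> C R).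
Proof.
split; first exact: cmeasurable_continuous (@continuous_ez R d k).
by exists 1 => x; rewrite normc_ez.
Qed.

Lemma bmeas_cont_per G : continuous G -> periodic G -> bmeas G.
Proof.
move=> cG pG; split; first exact: cmeasurable_continuous.
by have [K _ GK] := periodic_bnd cG pG; exists K.
Qed.

Lemma bmeas_conjM G H : bmeas G -> bmeas H -> cubeL1 (fun x => conjc (G x) * H x).
Proof.
move=> [mG [K GK]] [mH [L HL]]; apply: (cubeL1_bnd (K := K * L)).
  by apply: cmeasurableM => //; exact: cmeasurable_conj.
move=> x; rewrite normcM' normc_conj ler_pM ?normc_ge0//.
Qed.

Lemma bmeasD G H : bmeas G -> bmeas H -> bmeas (fun x => G x + H x).
Proof.
move=> [mG [K GK]] [mH [L HL]]; split; first exact: cmeasurableD.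
by exists (K + L) => x; rewrite (le_trans (normcD _ _))// lerD.
Qed.

Lemma bmeasZ (k : C R) G : bmeas G -> bmeas (fun x => k * G x).
Proof.
move=> [mG [K GK]]; split; first by apply: cmeasurableM => //; exact: cmeasurable_cst.
by exists (normc k * K) => x; rewrite normcM' ler_wpM2l ?normc_ge0.
Qed.

Lemma bmeas0 : bmeas (fun _ => 0).
Proof. by split; [exact: cmeasurable_cst|exists 0 => x; rewrite normc0]. Qed.

Lemma bmeas_sum I (s : seq I) (F : I -> T -> C R) : (forall i, bmeas (F i)) ->
  bmeas (fun x => \sum_(i <- s) F i x).
Proof.
move=> mF; elim: s => [|i s IH].
  by under [X in bmeas X]eq_fun do rewrite big_nil; exact: bmeas0.
by under [X in bmeas X]eq_fun do rewrite big_cons; exact: bmeasD.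
Qed.

(** The inner product of L^2 of the cube; [cubeq] and [fc] below are the squared norm and the
    Fourier coefficients that go with it. *)
Definition ipc G H := cubeint (fun x => conjc (G x) * H x).

Lemma ipcDr G H K : bmeas G -> bmeas H -> bmeas K ->
  ipc G (fun x => H x + K x) = ipc G H + ipc G K.
Proof.
move=> mG mH mK; rewrite -cubeintD; try exact: bmeas_conjM.
by congr cubeint; apply/funext => x; rewrite mulrDr.
Qed.

Lemma ipcZr (k : C R) G H : bmeas G -> bmeas H -> ipc G (fun x => k * H x) = k * ipc G H.
Proof.
move=> mG mH; rewrite -cubeintZ; last exact: bmeas_conjM.
by congr cubeint; apply/funext => x; rewrite mulrCA.
Qed.

Lemma ipcC G H : bmeas G -> bmeas H -> ipc H G = conjc (ipc G H).
Proof.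
move=> mG mH; rewrite -cintegral_conj; last exact: bmeas_conjM.
congr cintegral; apply/funext => x; rewrite !cjM cjK [conjc (H x) * _]mulrC; congr (_ * _).
by rewrite IcubeE; case: ifP; rewrite ?conjc1 ?conjc0.
Qed.

Lemma ipc_sumr I (s : seq I) (F : I -> T -> C R) G : bmeas G -> (forall i, bmeas (F i)) ->
  ipc G (fun x => \sum_(i <- s) F i x) = \sum_(i <- s) ipc G (F i).
Proof.
move=> mG mF; rewrite -cubeint_sum; last by move=> i; exact: bmeas_conjM.
by congr cubeint; apply/funext => x; rewrite mulr_sumr.
Qed.

Lemma ipc_ez k l : ipc (ez k) (ez l) = (k == l)%:R.
Proof.
transitivity (cubeint (ez (l - k) : T -> C R)).
  by congr cubeint; apply/funext => x; rewrite ezBl mulrC.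
by rewrite cubeint_ez subr_eq0 eq_sym.
Qed.

Definition cubeq G : R := \int[mu]_x (\1_(@cube R d) x * normc (G x) ^+ 2).

Lemma ipc_diag G : bmeas G -> ipc G G = ((cubeq G)%:C)%C.
Proof.
move=> mG; have L := bmeas_conjM mG mG.
have E x : Icube x * (conjc (G x) * G x) = ((\1_(@cube R d) x * normc (G x) ^+ 2)%:C)%C :> C R.
  by rewrite conj_mul [RHS]CrM.
apply: eqc; rewrite /ipc /cubeint /cintegral /cubeq /=.
  by apply: eq_Rintegral => x _; rewrite E.
by under eq_Rintegral do rewrite E /=; rewrite /Rintegral integral0.
Qed.

Lemma cubeq_ge0 G : 0 <= cubeq G.
Proof. by apply: Rintegral_ge0 => x _; rewrite mulr_ge0 ?sqr_ge0. Qed.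

Lemma cubeq_le G (K : R) : bmeas G -> 0 <= K -> (forall x, normc (G x) <= K) -> cubeq G <= K ^+ 2.
Proof.
move=> mG K0 GK; have L := bmeas_conjM mG mG.
have -> : K ^+ 2 = complex.Re (cubeint (fun _ : T => ((K ^+ 2)%:C)%C : C R)).
  have -> : cubeint (fun _ : T => ((K ^+ 2)%:C)%C : C R) = ((K ^+ 2)%:C)%C * cubeint (fun _ : T => 1) :> C R.
    rewrite -cubeintZ; first by congr cubeint; apply/funext => x; rewrite mulr1.
    by apply: (cubeL1_bnd (K := 1)); [exact: cmeasurable_cst|move=> x; rewrite normc1].
  by rewrite cubeint1 mulr1.
have -> : cubeq G = complex.Re (ipc G G) by rewrite ipc_diag.
apply: le_Rintegral => //; [exact: cL1_Re L| |].
  apply: cL1_Re; apply: (cubeL1_bnd (K := `|K ^+ 2|)); first exact: cmeasurable_cst.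
  by move=> x; rewrite normc_real.
move=> x _; rewrite conj_mul !ReM IcubeE; case: ifP => _ /=; rewrite ?mul0r ?mul1r ?subr0//.
by rewrite ler_pXn2r ?nnegrE ?normc_ge0.
Qed.

Definition fc G k := ipc (ez k) G.

(** Pythagoras in a form that serves twice: with a the Fourier coefficients the last sum vanishes
    and Bessel's inequality follows; with a from a uniform approximation the left side is small and
    Parseval's identity follows. *)
Lemma ipc_sub_trig G (s : seq Z) (a : Z -> C R) : bmeas G -> uniq s ->
  cubeq (fun x => G x + -1 * \sum_(k <- s) a k * ez k x) =
  cubeq G - \sum_(k <- s) normc (fc G k) ^+ 2 + \sum_(k <- s) normc (a k - fc G k) ^+ 2.
Proof.
move=> mG us.
pose P x := \sum_(k <- s) a k * ez k x.
have mE k : bmeas (fun x => a k * ez k x) by apply: bmeasZ; exact: bmeas_ez.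
have mP : bmeas P by exact: bmeas_sum.
have m1P : bmeas (fun x => -1 * P x) by exact: bmeasZ.
have mD : bmeas (fun x => G x + -1 * P x) by exact: bmeasD.
have GP : ipc G P = \sum_(k <- s) a k * conjc (fc G k).
  rewrite ipc_sumr//; apply: eq_bigr => k _; rewrite ipcZr//; last exact: bmeas_ez.
  by rewrite (ipcC (bmeas_ez k) mG).
have EP k : k \in s -> ipc (ez k) P = a k.
  move=> ks; rewrite ipc_sumr//; last exact: bmeas_ez.
  rewrite (bigD1_seq k)//= ipcZr ?ipc_ez ?eqxx ?mulr1; try exact: bmeas_ez.
  rewrite big1 ?addr0// => l lk; rewrite ipcZr ?ipc_ez; try exact: bmeas_ez.
  by rewrite eq_sym (negbTE lk) mulr0.
have PP : ipc P P = \sum_(k <- s) a k * conjc (a k).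
  rewrite [LHS]ipc_sumr// big_seq [RHS]big_seq; apply: eq_bigr => k ks.
  rewrite ipcZr//; last exact: bmeas_ez.
  by rewrite (ipcC (bmeas_ez k) mP) EP.
have : ipc (fun x => G x + -1 * P x) (fun x => G x + -1 * P x) =
    ipc G G + -1 * ipc G P + -1 * (conjc (ipc G P) + -1 * ipc P P).
  rewrite ipcDr// ipcZr//.
  rewrite (ipcC mG mD) (ipcC mP mD) !ipcDr// !ipcZr//.
  rewrite (ipcC mG mP) !ipc_diag//.
  by apply: eqc; rewrite !(ReD,ImD,ReM,ImM,Re_conj,Im_conj) /= ?(ReD,ImD,ReM,ImM,Re_conj,Im_conj) /=; ring.
rewrite !ipc_diag// => /(congr1 (@complex.Re R)).
rewrite -(ipc_diag mP) PP GP.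
rewrite !ReD !cN1 !ReN !ReD !ReN !ReC !Re_conj !Re_sum => ->.
rewrite -!addrA; congr (_ + _).
rewrite -sumrB -!sumrN -!big_split; apply: eq_bigr => k _.
move: (fc G k) (a k) => v u; rewrite /= !normc_sqr ReB ImB !ReM !Re_conj !Im_conj; ring.
Qed.

Lemma bessel G (s : seq Z) : bmeas G -> uniq s ->
  \sum_(k <- s) normc (fc G k) ^+ 2 <= cubeq G.
Proof.
move=> mG us; have := ipc_sub_trig (fc G) mG us.
rewrite [X in _ + X]big1 ?addr0; last by move=> k _; rewrite subrr normc0 expr0n.
by move=> E; rewrite -subr_ge0 -E cubeq_ge0.
Qed.

Theorem parseval G : continuous G -> periodic G ->
  (\esum_(k in [set: Z]) (normc (fc G k) ^+ 2)%:E = (cubeq G)%:E)%E.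
Proof.
move=> cG pG; have mG := bmeas_cont_per cG pG.
apply/eqP; rewrite eq_le; apply/andP; split.
  apply: ub_ereal_sup => _ [A [fA _] <-].
  by rewrite fsbig_finite//= sumEFin lee_fin bessel// finmap.fset_uniq.
apply/lee_addgt0Pr => e e0.
(* A uniform error sqrt e bounds the mean square error by e. *)
pose r := Num.sqrt e; have r0 : 0 < r by rewrite sqrtr_gt0.
have [a ca Ga] := trig_dense cG pG r0.
pose S := [set g | a g != 0]; pose s := zseq S.
have us : uniq s by exact: finmap.fset_uniq.
apply: (@le_trans _ _ ((\sum_(k <- s) normc (fc G k) ^+ 2)%:E + e%:E)%E); last first.
  rewrite leeD2r//; apply: ereal_sup_ubound; exists S => //.
  by rewrite fsbig_finite//= sumEFin.
rewrite -EFinD lee_fin.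
have E := ipc_sub_trig a mG us.
have : cubeq (fun x => G x + -1 * \sum_(k <- s) a k * ez k x) <= r ^+ 2.
  apply: cubeq_le; [|exact: ltW|].
    apply: bmeasD => //; apply: bmeasZ; apply: bmeas_sum => k; apply: bmeasZ; exact: bmeas_ez.
  move=> x; have := Ga x; rewrite /trig zsum_Ccz_mul//.
  by rewrite cN1.
rewrite E sqr_sqrtr ?(ltW e0)// => h.
have : 0 <= \sum_(k <- s) normc (a k - fc G k) ^+ 2 by apply: sumr_ge0 => k _; rewrite sqr_ge0.
lra.
Qed.

End parseval.

(** * Periodisation and Poisson summation *)

Section poisson.
Context (R : realType) (d : nat).
Local Notation T := 'cV[R]_d.
Local Notation Z := 'cV[int]_d.
Implicit Types (f phi psi : T -> C R).

Definition per phi (y : T) : C R := zsum (fun g => phi (y + zv R g)).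

(** On the box of radius r the periodisation of phi is the sum over this fixed finite set of
    translates; its continuity and its integrals are read off from there. *)
Definition hits phi (r : R) : set Z := [set g | exists2 y, @cbox R d r y & phi (y + zv R g) != 0].

Lemma finite_hits phi r : Ccr phi -> finite_set (hits phi r).
Proof.
move=> Cp; have [s s0 ps] := Ccr_supp Cp.
apply: sub_finite_set (@finite_cbox_lattice R d (s + r)) => g [y yr py] /=.
have -> : zv R g = (y + zv R g) + - y by rewrite addrC addKr.
by apply: cboxD; [exact: ps|exact: cboxN].
Qed.

Lemma perE phi r y : Ccr phi -> cbox r y ->
  per phi y = \sum_(g <- zseq (hits phi r)) phi (y + zv R g).
Proof.
move=> Cp yr; apply: zsumE; first exact: finite_hits.
by move=> g; apply: contra_notP => /eqP py; exists y.
Qed.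

Lemma per_periodic phi : periodic (per phi).
Proof.
move=> y h; rewrite /per -[RHS](zsum_shift (- h)); congr zsum; apply/funext => g.
by rewrite opprK zvD [zv R g + _]addrC addrA.
Qed.

Lemma per_continuous phi : Ccr phi -> continuous (per phi).
Proof.
move=> Cp y; have [r yr] : exists r : R, \forall z \near y, cbox r z.
  exists (\sum_i `|y i 0| + 1).
  have : \forall z \near (y : T), forall i, `|(y : T) i 0 - (z : T) i 0| < 1.
    by apply/nbhs_ballP; exists 1 => //= z [_ yz] i; exact: yz.
  apply: filterS => z yz' i; have yz := yz' i; rewrite /= in_itv /= -ler_norml.
  have : `|y i 0| <= \sum_i `|y i 0| by rewrite [leRHS](bigD1 i)//= lerDl sumr_ge0.
  have := ler_normB (y i 0) (y i 0 - z i 0); rewrite opprB addrC subrK; move: yz; lra.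
have yr' : cbox r y by exact: nbhs_singleton yr.
have : continuous_at y (fun z => \sum_(g <- zseq (hits phi r)) phi (z + zv R g)).
  apply: continuous_csum => g z.
  apply: (@continuous_comp _ _ _ (fun z : T => z + zv R g) phi); first exact: continuous_shift.
  exact: (Ccr_cont Cp).
rewrite /continuous_at -(perE Cp yr'); apply: cvg_trans; apply: near_eq_cvg.
  exact: (@nbhs_filter T y).
by apply: filterS yr => z zr; rewrite (perE Cp zr).
Qed.

Lemma Ccr_bmeas phi : Ccr phi -> bmeas phi.
Proof.
move=> Cp; split; first exact: cmeasurable_continuous (Ccr_cont Cp).
by have [K _ pK] := Ccr_bnd Cp; exists K.
Qed.

(** Since H is periodic, the lattice translates of the cube that meet the support of phi reassemble
    the integral over R^d. *)
Lemma cubeint_per phi (H : T -> C R) : Ccr phi -> bmeas H -> periodic H ->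
  cubeint (fun y => H y * per phi y) = cintegral (fun y => H y * phi y).
Proof.
move=> Cp [mH [K HK]] pH; have [mp [L pL]] := Ccr_bmeas Cp.
rewrite (@cintegral_unfold R d (fun y => H y * phi y) (K * L) (hits phi 1)).
- congr cintegral; apply/funext => y; rewrite IcubeE; case: ifPn => [/set_mem yc|]; last by rewrite !mul0r.
  rewrite !mul1r (perE Cp (cube_cbox yc)) mulr_sumr; apply: eq_bigr => g _.
  by rewrite pH.
- exact: cmeasurableM.
- by move=> x; rewrite normcM' ler_pM ?normc_ge0.
- exact: finite_hits.
move=> x Hpx; exists (x - zv R (floorv x)); first by apply: cube_cbox; exact: cube_frac.
by rewrite subrK; move: Hpx; apply: contraNneq => ->; rewrite mulr0.
Qed.

(** The bracket at level 0, that is for the identity matrix; the other levels reduce to it by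
    composition with the matrix, see [brM_br]. *)
Definition br f (g : T -> C R) (c : Z) : C R := cintegral (fun x => conjc (f (x - zv R c)) * g x).

Definition modul f (x : T) (y : T) : C R := f y * ce (dotc x y).

Lemma Ccr_modul f x : Ccr f -> Ccr (modul f x).
Proof. by move=> Cf; apply: CcrM => //; exact: continuous_cedot. Qed.

Lemma fourier1E f xi : fourier1 f xi = cintegral (modul f xi).
Proof. by congr cintegral; apply/funext => y; rewrite /modul dotcC. Qed.

(** The transform is taken with the character itself while a Fourier coefficient pairs with its
    conjugate; hence the opposite signs of k. *)
Lemma fc_per f x k : Ccr f -> fc (per (modul f x)) (- k) = fourier1 f (x + zv R k).
Proof.
move=> Cf; rewrite /fc /ipc.
have -> : (fun y => conjc (ez (- k) y) * per (modul f x) y) = (fun y => ez k y * per (modul f x) y).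
  by apply/funext => y; rewrite -ezNl opprK.
rewrite cubeint_per; [|exact: Ccr_modul|exact: bmeas_ez|by move=> y g; exact: ez_per].
rewrite fourier1E; congr cintegral; apply/funext => y.
by rewrite /modul dotcDl ceD mulrCA; congr (_ * _); rewrite mulrC.
Qed.

(** One periodisation is absorbed by turning the integral over the cube into one over R^d; the other
    is expanded, and its term at - c contributes the coefficient of the bracket at c times the
    character of c. *)
Lemma brE f (g : T -> C R) x : Ccr f -> Ccr g -> ipc (per (modul f x)) (per (modul g x)) = trig (br f g) x.
Proof.
move=> Cf Cg; have Cfx := Ccr_modul x Cf; have Cgx := Ccr_modul x Cg.
have cp := per_continuous Cfx; have pp := @per_periodic (modul f x).
rewrite /ipc cubeint_per//; last 2 first.
- have [mp [K pK]] := bmeas_cont_per cp pp; split; first exact: cmeasurable_conj.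
  by exists K => y; rewrite normc_conj.
- by move=> y h; rewrite pp.
have [r r0 gr] := Ccr_supp Cg.
pose S := hits (modul f x) r; have fS : finite_set S by exact: finite_hits.
have L c : cL1 (fun y => conjc (modul f x (y + zv R c)) * modul g x y).
  exact: (Ccr_cL1 (CcrM (Ccr_conj (Ccr_shift _ Cfx)) (Ccr_cont Cgx))).
transitivity (cintegral (fun y => \sum_(c <- zseq S) conjc (modul f x (y + zv R c)) * modul g x y)).
  congr cintegral; apply/funext => y; have [gy|gy] := eqVneq (g y) 0.
    by rewrite /modul gy mul0r mulr0 big1// => c _; rewrite mulr0.
  rewrite (perE Cfx (gr _ gy)) rmorph_sum mulr_suml; exact: eq_bigr.
rewrite cintegral_sum//.
transitivity (zsum (fun c => cintegral (fun y => conjc (modul f x (y + zv R c)) * modul g x y))).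
  apply/esym/zsumE => // c Sc; rewrite -[RHS](@cintegral0 R d); congr cintegral; apply/funext => y.
  have [gy|gy] := eqVneq (g y) 0; first by rewrite /modul gy mul0r mulr0.
  suff -> : modul f x (y + zv R c) = 0 by rewrite conjc0 mul0r.
  by apply: contra_notP Sc => /eqP fy; exists y => //; exact: gr.
rewrite -zsum_opp; congr zsum; apply/funext => c; rewrite /br -cintegralZr; last first.
  exact: (Ccr_cL1 (CcrM (Ccr_conj (Ccr_shift _ Cf)) (Ccr_cont Cg))).
congr cintegral; apply/funext => y; rewrite /modul zvN cjM dotcDr dotcNr ceD ceN cjM cjK.
rewrite -!mulrA; congr (_ * _); rewrite [ce (dotc x (zv R c))](_ : _ = ez c x); last first.
  by rewrite /ez /zdot dotcC.
by rewrite [_ * (ez c x * _)]mulrCA [_ * (g y * _)]mulrCA ceJ mulr1 mulrC.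
Qed.

(** Parseval for the periodisation of f times a character: its squared norm is the symbol of the
    bracket by [brE], and its coefficients are the values of the transform on x + Z^d. Positivity of
    the bracket comes from here. *)
Theorem poisson f x : Ccr f -> exists2 Q : R, 0 <= Q &
  trig (br f f) x = (Q%:C)%C /\
  (\esum_(k in [set: Z]) (normc (fourier1 f (x + zv R k)) ^+ 2)%:E = Q%:E)%E.
Proof.
move=> Cf; have Cfx := Ccr_modul x Cf.
have cp := per_continuous Cfx; have pp := @per_periodic (modul f x).
exists (cubeq (per (modul f x))); first exact: cubeq_ge0.
split; first by rewrite -brE// ipc_diag//; exact: bmeas_cont_per.
rewrite -(parseval cp pp).
rewrite [RHS](reindex_esum [set: Z] [set: Z] (fun k : Z => - k)); last first.
  by split=> [//|c e _ _ /oppr_inj//|c _]; exists (- c); rewrite ?opprK.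
by apply: eq_esum => k _; rewrite fc_per.
Qed.

End poisson.


(** * C(T^d) and the Gelfand transform of C^*(Z^d) *)

Section seminorms.
Context (R : realType) (V : zmodType) (nrm : V -> R).

(** Covers the norms of L^2, of C(T^d) and of a C*-algebra, so that limits in the sense of [cvg_for]
    are treated once. [Xnorm], whose properties hold on C_c(R^d), is treated apart. *)
Record is_seminorm : Prop := {
  snD : forall x y, nrm (x + y) <= nrm x + nrm y;
  snN : forall x, nrm (- x) = nrm x;
  sn0 : nrm 0 = 0 }.

Hypothesis sn : is_seminorm.

Lemma sn_ge0 x : 0 <= nrm x.
Proof. by have := snD sn x (- x); rewrite subrr (sn0 sn) (snN sn); lra. Qed.

Lemma sn_distC x y : nrm (x - y) = nrm (y - x).
Proof. by rewrite -(snN sn) opprB. Qed.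

Lemma sn_tri z x y : nrm (x - y) <= nrm (x - z) + nrm (z - y).
Proof. by rewrite -[x - y](subrKA z)%R (snD sn). Qed.

Lemma sn_distB x y : `|nrm x - nrm y| <= nrm (x - y).
Proof.
have h1 := snD sn (x - y) y; have h2 := snD sn (y - x) x.
by rewrite !subrK in h1 h2; rewrite (sn_distC y x) in h2; rewrite ler_norml; lra.
Qed.

Lemma cvg_forP u l : cvg_for nrm u l <->
  forall e, 0 < e -> exists N, forall k, (N <= k)%N -> nrm (u k - l) < e.
Proof.
split=> [/cvgrPdist_lt H e e0|H].
  have [N _ HN] := H e e0; exists N => k Nk; have := HN k Nk.
  by rewrite /= sub0r normrN ger0_norm// sn_ge0.
apply/cvgrPdist_lt => e e0; have [N HN] := H e e0; exists N => // k Nk /=.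
by rewrite sub0r normrN ger0_norm ?sn_ge0//; exact: HN.
Qed.

Lemma cvg_forD u v l m : cvg_for nrm u l -> cvg_for nrm v m ->
  cvg_for nrm (fun k => u k + v k) (l + m).
Proof.
move=> /cvg_forP ul /cvg_forP vm; apply/cvg_forP => e e0.
have e2 : 0 < e / 2 by rewrite divr_gt0.
have [N HN] := ul _ e2; have [M HM] := vm _ e2.
exists (maxn N M) => k; rewrite geq_max => /andP[Nk Mk].
rewrite opprD addrACA (le_lt_trans (snD sn _ _))// [e]splitr.
by rewrite ltrD ?HN ?HM.
Qed.

Lemma cvg_for_cst l : cvg_for nrm (fun=> l) l.
Proof. by apply/cvg_forP => e e0; exists 0%N => k _; rewrite subrr (sn0 sn). Qed.

Lemma cvg_forN u l : cvg_for nrm u l -> cvg_for nrm (fun k => - u k) (- l).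
Proof.
move=> /cvg_forP ul; apply/cvg_forP => e /ul[N HN]; exists N => k /HN.
by rewrite -opprD (snN sn).
Qed.

Lemma cvg_for_cauchy u l : cvg_for nrm u l -> cauchy_for nrm u.
Proof.
move=> /cvg_forP ul e e0; have e2 : 0 < e / 2 by rewrite divr_gt0.
have [N HN] := ul _ e2; exists N => k m Nk Nm.
by rewrite (le_lt_trans (sn_tri l _ _))// [e]splitr ltrD ?HN// sn_distC HN.
Qed.

Lemma cvg_for_unique u l m : (forall x, nrm x = 0 -> x = 0) ->
  cvg_for nrm u l -> cvg_for nrm u m -> l = m.
Proof.
move=> nz /cvg_forP ul /cvg_forP um; apply/eqP; rewrite -subr_eq0; apply/eqP/nz/eqP.
rewrite eq_le sn_ge0 andbT; apply/ler_addgt0Pr => e e0; rewrite add0r.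
have e2 : 0 < e / 2 by rewrite divr_gt0.
have [N HN] := ul _ e2; have [M HM] := um _ e2.
apply: ltW; rewrite (le_lt_trans (sn_tri (u (maxn N M)) _ _))// [e]splitr ltrD//.
  by rewrite sn_distC HN// leq_maxl.
by rewrite HM// leq_maxr.
Qed.

Lemma cvg_for_norm u l : cvg_for nrm u l -> (nrm (u k) @[k --> \oo] --> nrm l).
Proof.
move=> /cvg_forP ul; apply/cvgrPdist_lt => e /ul[N HN]; exists N => // k /HN /=.
by apply: le_lt_trans; rewrite distrC sn_distB.
Qed.

Lemma cvg_for_le (W : zmodType) (nrmW : W -> R) (u : nat -> V) l (v : nat -> W) m (c : R) :
  (forall w, 0 <= nrm w) -> is_seminorm ->
  cvg_for nrm u l -> (forall k, nrmW (v k - m) <= c * nrm (u k - l)) ->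
  (forall k, 0 <= nrmW (v k - m)) -> cvg_for nrmW v m.
Proof.
move=> _ _ ul vu v0; apply: (@squeeze_cvgr _ _ _ _ (fun=> 0) (fun k => c * nrm (u k - l))).
- by apply: nearW => k; rewrite v0 vu.
- exact: cvg_cst.
- by rewrite -[X in _ --> X](mulr0 c); apply: cvgMr; exact: ul.
Qed.

End seminorms.

(** * Continuous functions on the torus *)

Section torus_theory.
Context (R : realType) (d : nat).
Local Notation T := 'cV[R]_d.
Local Notation Z := 'cV[int]_d.
Local Open Scope quotient_scope.

Lemma lattice_predP (v : T) : reflect (exists g, v = zv R g) (v \in @lattice_pred R d).
Proof.
apply: (iffP forallP) => [vZ|[g ->] i]; last by rewrite mxE intr_int.
exists (\col_i Num.floor (v i 0)); apply/matrixP => i j; rewrite ord1 !mxE.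
by have /floorK := vZ i.
Qed.

Lemma torus_projP (x y : T) : torus_proj x = torus_proj y <-> exists g, x = y + zv R g.
Proof.
rewrite /torus_proj; split=> [xy|[g ->]].
  have : (x - y) \in @lattice_pred R d by rewrite Quotient.idealrBE; apply/eqP.
  by move=> /lattice_predP[g xyg]; exists g; rewrite -xyg addrC subrK.
have : (y + zv R g - y) \in @lattice_pred R d.
  by rewrite addrAC subrr add0r; apply/lattice_predP; exists g.
by rewrite Quotient.idealrBE => /eqP.
Qed.

Lemma torus_reprK (z : torus R d) : torus_proj (torus_repr z) = z.
Proof. exact: reprK. Qed.

Lemma torus_projD (x : T) g : torus_proj (x + zv R g) = torus_proj x.
Proof. by apply/torus_projP; exists g. Qed.

Lemma torus_ind (P : torus R d -> Prop) : (forall x : T, P (torus_proj x)) -> forall z, P z.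
Proof. by move=> H z; rewrite -(torus_reprK z). Qed.

(** [fourierZ] evaluates at a chosen representative of a point of the torus; periodicity of [trig]
    removes the choice. *)
Lemma fourierZ_proj (a : Z -> C R) (x : T) : fourierZ a (torus_proj x) = trig a x.
Proof.
have [g E] : exists g, torus_repr (torus_proj x) = x + zv R g.
  by apply/torus_projP; rewrite torus_reprK.
transitivity (trig a (torus_repr (torus_proj x))); first by [].
by rewrite E trig_per.
Qed.

Lemma continuous_torus (h : torus R d -> C R) :
  continuous h <-> continuous (fun x => h (torus_proj x)).
Proof. exact: quotient_continuous. Qed.

Lemma periodic_torus (h : torus R d -> C R) : periodic (fun x => h (torus_proj x)).
Proof. by move=> x g; rewrite torus_projD. Qed.

Lemma CT_cont (h : CT R d) : continuous (h : torus R d -> C R).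
Proof. by have /asboolP := valP h. Qed.

(** Descends a periodic function to the torus; [insubd] falls back on 0 when the result is not
    continuous, and [mkCTE] gives the intended value. *)
Definition mkCT (G : T -> C R) : CT R d := insubd (0 : CT R d) (fun z => G (torus_repr z)).

Lemma mkCTE (G : T -> C R) x : continuous G -> periodic G -> mkCT G (torus_proj x) = G x.
Proof.
move=> cG pG; have E y : G (torus_repr (torus_proj y)) = G y.
  have [g ->] : exists g, torus_repr (torus_proj y) = y + zv R g.
    by apply/torus_projP; rewrite torus_reprK.
  by rewrite pG.
rewrite /mkCT val_insubd (_ : _ \in _) ?E//; apply/asboolP/continuous_torus.
by under eq_fun do rewrite E.
Qed.

Lemma CT_eq (h k : CT R d) : (forall x, h (torus_proj x) = k (torus_proj x)) -> h = k.
Proof. by move=> hk; apply/val_inj/funext; exact: torus_ind. Qed.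

Lemma CTD (h k : CT R d) z : (h + k) z = h z + k z. Proof. by []. Qed.
Lemma CTB (h k : CT R d) z : (h - k) z = h z - k z. Proof. by []. Qed.
Lemma CTM (h k : CT R d) z : (h * k) z = h z * k z. Proof. by []. Qed.
Lemma CTZ (c : R[i]) (h : CT R d) z : (c *: h) z = c * h z. Proof. by []. Qed.
Lemma CTstarE (h : CT R d) z : CT_star h z = conjc (h z). Proof. by []. Qed.

Lemma CT_bnd (h : CT R d) : exists2 K : R, 0 <= K & forall z, normc (h z) <= K.
Proof.
have [K K0 HK] := periodic_bnd ((continuous_torus h).1 (@CT_cont h)) (@periodic_torus h).
by exists K => //; exact: torus_ind.
Qed.

Lemma CT_norm_has (h : CT R d) : has_sup [set normc (h z) | z in setT].
Proof.
split; first by exists (normc (h (torus_proj 0))); exists (torus_proj 0).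
by have [K _ HK] := CT_bnd h; exists K => _ [z _ <-].
Qed.

Lemma CT_norm_ub (h : CT R d) z : normc (h z) <= CT_norm h.
Proof. by apply: sup_upper_bound; [exact: CT_norm_has|exists z]. Qed.

Lemma CT_norm_le (h : CT R d) (K : R) : (forall z, normc (h z) <= K) -> CT_norm h <= K.
Proof.
move=> hK; apply: ge_sup; first by exists (normc (h (torus_proj 0))); exists (torus_proj 0).
by move=> _ [z _ <-].
Qed.

Lemma CT_norm_ge0 (h : CT R d) : 0 <= CT_norm h.
Proof. exact: le_trans (normc_ge0 _) (CT_norm_ub h (torus_proj 0)). Qed.

Lemma CT_normD (h k : CT R d) : CT_norm (h + k) <= CT_norm h + CT_norm k.
Proof.
by apply: CT_norm_le => z; rewrite CTD (le_trans (normcD _ _))// lerD ?CT_norm_ub.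
Qed.

Lemma CT_normZ (c : R[i]) (h : CT R d) : CT_norm (c *: h) = normc c * CT_norm h.
Proof.
have le (c' : R[i]) (k : CT R d) : CT_norm (c' *: k) <= normc c' * CT_norm k.
  apply: CT_norm_le => z; rewrite CTZ normcM'; apply: ler_wpM2l (CT_norm_ub k z).
  exact: normc_ge0.
apply/eqP; rewrite eq_le le/=; have [->|c0] := eqVneq c 0.
  by rewrite normc0 mul0r CT_norm_ge0.
have nc : 0 < normc c.
  by rewrite lt_neqAle normc_ge0 andbT eq_sym; apply: contraNneq c0 => /normc_eq0 ->.
have := le c^-1 (c *: h); rewrite scalerA mulVf// scale1r normcV.
by rewrite mulrC ler_pdivlMr// mulrC.
Qed.

Lemma CT_norm_sn : is_seminorm (@CT_norm R d).
Proof.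
split; first exact: CT_normD.
  by move=> h; rewrite -scaleN1r CT_normZ normcN normc1 mul1r.
by rewrite -(scale0r 0) CT_normZ normc0 mul0r.
Qed.

Lemma CT_norm_eq0 (h : CT R d) : CT_norm h = 0 -> h = 0.
Proof.
move=> h0; apply: CT_eq => x; apply: normc_eq0; apply/eqP.
by rewrite eq_le normc_ge0 andbT -h0 CT_norm_ub.
Qed.

Lemma CT_normM (h k : CT R d) : CT_norm (h * k) <= CT_norm h * CT_norm k.
Proof.
by apply: CT_norm_le => z; rewrite CTM normcM' ler_pM ?normc_ge0// CT_norm_ub.
Qed.

Lemma CT_norm_star (h : CT R d) : CT_norm (CT_star h) = CT_norm h.
Proof.
apply/eqP; rewrite eq_le; apply/andP; split; apply: CT_norm_le => z.
  by rewrite CTstarE normc_conj CT_norm_ub.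
by rewrite -normc_conj -CTstarE CT_norm_ub.
Qed.

Lemma CT_norm_identity (h : CT R d) : CT_norm (CT_star h * h) = CT_norm h ^+ 2.
Proof.
apply/eqP; rewrite eq_le; apply/andP; split.
  by rewrite (le_trans (CT_normM _ _))// CT_norm_star expr2.
rewrite -[leRHS]sqr_sqrtr ?CT_norm_ge0// ler_pXn2r ?nnegrE ?sqrtr_ge0 ?CT_norm_ge0//.
apply: CT_norm_le => z; rewrite -[leLHS]ger0_norm ?normc_ge0// -sqrtr_sqr.
rewrite ler_wsqrtr//; have := CT_norm_ub (CT_star h * h) z.
by rewrite CTM CTstarE normcM' normc_conj expr2.
Qed.

Lemma cauchy_C_cvg (s : nat -> C R) : cauchy_for (fun z : C R => normc z) s ->
  exists l : C R, forall e : R, 0 < e -> exists N, forall k, (N <= k)%N -> normc (s k - l) < e.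
Proof.
move=> cs.
have cR (r : nat -> R) : (forall k l, `|r k - r l| <= normc (s k - s l)) ->
    exists l, forall e : R, 0 < e -> exists N, forall k, (N <= k)%N -> `|r k - l| < e.
  move=> rs; have : cvg (r k @[k --> \oo]).
    apply/cauchy_cvgP/cauchy_ballP => e e0; have [N HN] := cs e e0.
    exists ([set r k | k in [set k | (N <= k)%N]], [set r k | k in [set k | (N <= k)%N]]).
      by split; exists N => // k Nk; exists k.
    move=> [_ _] [/= [k Nk <-] [l Nl <-]]; apply: le_lt_trans (rs _ _) _; exact: HN.
  move=> /cvg_ex[l rl]; exists l => e e0; have /cvgrPdist_lt/(_ e e0)[N _ HN] := rl.
  by exists N => k Nk; rewrite distrC; exact: HN.
have [a Ha] : exists l : R, forall e : R, 0 < e -> exists N, forall k, (N <= k)%N -> `|complex.Re (s k) - l| < e.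
  by apply: cR => k l; rewrite -ReB normc_Re.
have [b Hb] : exists l : R, forall e : R, 0 < e -> exists N, forall k, (N <= k)%N -> `|complex.Im (s k) - l| < e.
  by apply: cR => k l; rewrite -ImB normc_Im.
exists (a +i* b)%C => e e0; have e2 : 0 < e / 2 by rewrite divr_gt0.
have [N HN] := Ha _ e2; have [M HM] := Hb _ e2.
exists (maxn N M) => k; rewrite geq_max => /andP[Nk Mk].
by rewrite (le_lt_trans (normc_le _))// ReB ImB /= [e]splitr ltrD ?HN ?HM.
Qed.

Lemma CT_complete (u : nat -> CT R d) : cauchy_for (@CT_norm R d) u ->
  exists l, cvg_for (@CT_norm R d) u l.
Proof.
move=> cu.
have cz z : cauchy_for (fun z : C R => normc z) (fun k => u k z).
  move=> e /cu[N HN]; exists N => k l Nk Nl.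
  by apply: le_lt_trans (HN k l Nk Nl); rewrite -CTB CT_norm_ub.
pose l z := sval (cid (cauchy_C_cvg (cz z))).
have lP z : forall e : R, 0 < e -> exists N, forall k, (N <= k)%N -> normc (u k z - l z) < e.
  exact: svalP (cid (cauchy_C_cvg (cz z))).
have ul (e : R) : 0 < e -> exists N, forall k z, (N <= k)%N -> normc (u k z - l z) <= e.
  move=> e0; have e2 : 0 < e / 2 by rewrite divr_gt0.
  have [N HN] := cu _ e2; exists N => k z Nk.
  have [M HM] := lP z _ e2; pose m := maxn N M.
  rewrite -(subrKA (u m z)) (le_trans (normcD _ _))// [e]splitr lerD//.
    by rewrite -CTB (le_trans (CT_norm_ub _ _))// ltW// HN// leq_maxl.
  by rewrite ltW// HM// leq_maxr.
have cl : continuous l.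
  move=> z; apply/(@cvgc_lt R (torus R d) _ (nbhs_filter z)) => e e0; have e3 : 0 < e / 3 by rewrite divr_gt0.
  have [N HN] := ul _ e3.
  have /(@cvgc_lt R (torus R d) _ (nbhs_filter z))/(_ _ e3) := @CT_cont (u N) z; apply: (@filterS _ _ (nbhs_filter z)) => w zw.
  have h1 := HN N z (leqnn N); have h2 := HN N w (leqnn N).
  have -> : l z - l w = (l z - u N z) + ((u N z - u N w) + (u N w - l w)) by ring.
  rewrite (le_lt_trans (normcD _ _))// normc_distC.
  have := normcD (u N z - u N w) (u N w - l w); move: h1 h2 zw; lra.
have lCT : l \in @CT_pred R d by apply/asboolP.
exists (MkCT lCT); apply/(cvg_forP CT_norm_sn) => e e0.
have e2 : 0 < e / 2 by rewrite divr_gt0.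
have [N HN] := ul _ e2; exists N => k Nk; apply: (@le_lt_trans _ _ (e / 2)); last by lra.
by apply: CT_norm_le => z; exact: HN.
Qed.

Lemma CT_cstar : is_cstar_algebra (@CT_star R d) (@CT_norm R d).
Proof.
split.
- exact: CT_norm_eq0.
- exact: CT_normD.
- exact: CT_normZ.
- exact: CT_normM.
- by move=> a b; apply: CT_eq => x; rewrite CTD !CTstarE CTD cjD.
- by move=> k a; apply: CT_eq => x; rewrite CTZ !CTstarE CTZ cjM.
- by move=> a b; apply: CT_eq => x; rewrite CTM !CTstarE CTM cjM mulrC.
- by move=> a; apply: CT_eq => x; rewrite !CTstarE cjK.
- exact: CT_norm_identity.
- exact: CT_complete.
Qed.

(** Positivity means a factorisation; the factor is the pointwise square root, which is again
    continuous and periodic. *)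
Lemma CT_pos_sqrt (h : CT R d) : (forall z, exists2 r : R, 0 <= r & h z = (r%:C)%C) ->
  exists b : CT R d, h = CT_star b * b.
Proof.
move=> h0.
have ch := (continuous_torus h).1 (@CT_cont h).
pose G (x : T) : C R := ((Num.sqrt (complex.Re (h (torus_proj x))))%:C)%C.
have cG : continuous G.
  apply/continuous_ReIm; split=> x; last exact: cst_continuous.
  apply: (@continuous_comp _ _ _ (fun x => complex.Re (h (torus_proj x))) Num.sqrt).
    by have /continuous_ReIm[cr _] := ch; exact: cr.
  exact: sqrt_continuous.
have pG : periodic G by move=> x g; rewrite /G torus_projD.
exists (mkCT G); apply: CT_eq => x; rewrite CTM CTstarE mkCTE//.
have [r r0 hr] := h0 (torus_proj x).
rewrite conj_mul /G normc_real hr /= ger0_norm ?sqrtr_ge0//.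
by rewrite sqr_sqrtr.
Qed.

Definition ctrig (a : Z -> C R) : CT R d := mkCT (trig a).

Lemma trig_periodic (a : Z -> C R) : periodic (trig a).
Proof. by move=> x g; exact: trig_per. Qed.

Lemma ctrigE a x : Ccz a -> ctrig a (torus_proj x) = trig a x.
Proof. by move=> ca; apply: mkCTE; [exact: continuous_trig|exact: trig_periodic]. Qed.

Lemma ctrigD a b : Ccz a -> Ccz b -> ctrig (fun c => a c + b c) = ctrig a + ctrig b.
Proof.
move=> ca cb; apply: CT_eq => x; apply: etrans (ctrigE x (CczD ca cb)) _.
apply: etrans (trigD x ca cb) _; rewrite -(ctrigE x ca) -(ctrigE x cb).
exact: (esym (CTD (ctrig a) (ctrig b) (torus_proj x))).
Qed.

Lemma ctrigZ k a : Ccz a -> ctrig (fun c => k * a c) = k *: ctrig a.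
Proof.
move=> ca; apply: CT_eq => x; apply: etrans (ctrigE x (CczZ k ca)) _.
apply: etrans (trigZ k x ca) _; rewrite -(ctrigE x ca).
exact: (esym (CTZ k (ctrig a) (torus_proj x))).
Qed.

Lemma ctrigM a b : Ccz a -> Ccz b -> ctrig (convZ a b) = ctrig a * ctrig b.
Proof.
move=> ca cb; apply: CT_eq => x; apply: etrans (ctrigE x (Ccz_conv ca cb)) _.
apply: etrans (trig_conv x ca cb) _; rewrite -(ctrigE x ca) -(ctrigE x cb).
exact: (esym (CTM (ctrig a) (ctrig b) (torus_proj x))).
Qed.

Lemma ctrig_star a : Ccz a -> ctrig (starZ a) = CT_star (ctrig a).
Proof.
move=> ca; apply: CT_eq => x; apply: etrans (ctrigE x (Ccz_star ca)) _.
apply: etrans (trig_star x ca) _; rewrite -(ctrigE x ca).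
exact: (esym (CTstarE (ctrig a) (torus_proj x))).
Qed.

Lemma ctrig1 : ctrig (@deltaZ R d) = 1.
Proof. by apply: CT_eq => x; rewrite (ctrigE x (Ccz_delta R d)) trig_deltaZ. Qed.

Lemma ctrig_star_morphism : star_morphism (@CT_star R d) ctrig.
Proof.
split; [exact: ctrig1|exact: ctrigD|exact: ctrigZ|exact: ctrigM|exact: ctrig_star].
Qed.

Lemma ctrig_dense (h : CT R d) (e : R) : 0 < e ->
  exists2 a, Ccz a & CT_norm (ctrig a - h) <= e.
Proof.
move=> e0; have [a ca Ha] := trig_dense ((continuous_torus h).1 (@CT_cont h)) (@periodic_torus h) e0.
exists a => //; apply: CT_norm_le; apply: torus_ind => x.
by rewrite CTB ctrigE// normc_distC.
Qed.

Lemma Ccz_bmeas (a : Z -> C R) : Ccz a -> bmeas (trig a : T -> C R).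
Proof. by move=> ca; apply: bmeas_cont_per; [exact: continuous_trig|exact: trig_periodic]. Qed.

Lemma fc_trig (a : Z -> C R) g : Ccz a -> fc (trig a : T -> C R) g = a g.
Proof.
move=> ca; have E : trig a = fun x : T => \sum_(k <- zseq [set k | a k != 0]) a k * ez k x.
  by apply/funext => x; exact: zsum_Ccz_mul.
rewrite /fc E ipc_sumr; [|exact: bmeas_ez|by move=> k; apply: bmeasZ; exact: bmeas_ez].
transitivity (\sum_(k <- zseq [set k | a k != 0]) a k * (k == g)%:R).
  by apply: eq_bigr => k _; rewrite ipcZr ?ipc_ez 1?eq_sym//; exact: bmeas_ez.
rewrite -(zsum_Ccz_mul (fun k => (k == g)%:R) ca).
by rewrite -[RHS](zsum_delta g); congr zsum; apply/funext => k; rewrite mulrC.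
Qed.

(** A coefficient is the mean of the function against a character. The factor 2 comes from
    [cubeint_le] and is removed by taking roots in [norm_j_le_ctrig]. *)
Lemma coeff_bound (a : Z -> C R) g (K : R) : Ccz a -> (forall x, normc (trig a x) <= K) ->
  normc (a g) <= 2 * K.
Proof.
move=> ca aK; rewrite -(fc_trig g ca).
have KE : complex.Re (cubeint (fun _ : T => (K%:C)%C : C R)) = K.
  have -> : (fun _ : T => (K%:C)%C : C R) = (fun _ => (K%:C)%C * 1) by apply/funext => x; rewrite mulr1.
  rewrite cubeintZ ?cubeint1 ?mulr1//.
  by apply: (cubeL1_bnd (K := 1)); [exact: cmeasurable_cst|move=> x; rewrite normc1].
rewrite -[in leRHS]KE; apply: cubeint_le.
- by apply: bmeas_conjM; [exact: bmeas_ez|exact: Ccz_bmeas].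
- by apply: (cubeL1_bnd (K := normc ((K%:C)%C : C R))); [exact: cmeasurable_cst|].
by move=> y; rewrite normcM' normc_conj normc_ez mul1r; exact: aK.
Qed.

Lemma ctrig_inj (a b : Z -> C R) : Ccz a -> Ccz b -> ctrig a = ctrig b -> a = b.
Proof.
move=> ca cb ab; apply/funext => g; rewrite -(fc_trig g ca) -(fc_trig g cb); congr (fc _ g).
by apply/funext => x; rewrite -(ctrigE x ca) ab (ctrigE x cb).
Qed.

End torus_theory.

(** Replaces the limit of N-th roots. If t = (1 + x) s with x > 0, Bernoulli's inequality for the
    exponent 2^i, raised to the power q = 2^d > d, gives a lower bound of order (2^i)^q, which beats
    a polynomial of degree d in 2^i. *)
Lemma expr_poly_le (R : realType) (d : nat) (s t K c : R) : 0 <= s -> 0 <= t ->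
  0 <= K -> 0 <= c ->
  (forall k, t ^+ (2 ^ k) <= c * (K * (2 ^ k)%:R + 1) ^+ d * s ^+ (2 ^ k)) -> t <= s.
Proof.
move=> s0 t0 K0 c0 H; rewrite leNgt; apply/negP => st.
have t0' : 0 < t by exact: le_lt_trans st.
have [s1|sn] := eqVneq s 0.
  have := H 0%N; rewrite s1 expn0 !expr1 mulr0; lra.
have sp : 0 < s by rewrite lt_neqAle eq_sym sn.
pose x := t / s - 1; have x0 : 0 < x by rewrite /x subr_gt0 ltr_pdivlMr// mul1r.
have Hx k : (1 + x) ^+ (2 ^ k) <= c * (K * (2 ^ k)%:R + 1) ^+ d.
  have -> : 1 + x = t / s by rewrite /x addrC subrK.
  by rewrite expr_div_n ler_pdivrMr ?exprn_gt0.
have bern m : 1 + x *+ m <= (1 + x) ^+ m.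
  elim: m => [|m IH]; first by rewrite mulr0n addr0 expr0.
  rewrite exprS mulrS; apply: le_trans (ler_wpM2l _ IH); last by lra.
  have : 0 <= x * (x *+ m) by rewrite mulr_ge0 ?mulrn_wge0 ?ltW.
  lra.
have dj : (d < 2 ^ d)%N by exact: ltn_expl.
pose q := (2 ^ d)%N; pose B := c * (K * q%:R + 1) ^+ d.
have Bi i : (2 ^ i)%:R * x ^+ q <= B.
  pose M : R := (2 ^ i)%:R; have M1 : 1 <= M by rewrite /M ler1n expn_gt0.
  have M0 : 0 < M by lra.
  have h1 : (M * x) ^+ q <= c * (K * q%:R + 1) ^+ d * M ^+ d.
    apply: le_trans (_ : (1 + x) ^+ (2 ^ (i + d)) <= _).
      rewrite expnD exprM -/q lerXn2r ?nnegrE//.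
      - by rewrite mulr_ge0 ?ltW.
      - by rewrite exprn_ge0//; lra.
      - by apply: le_trans (bern _); rewrite -[x *+ _]mulr_natr mulrC -/M; lra.
    apply: le_trans (Hx _) _; rewrite -mulrA ler_wpM2l// -exprMn lerXn2r ?nnegrE//.
    - by rewrite addr_ge0// mulr_ge0.
    - by rewrite mulr_ge0 ?addr_ge0 ?mulr_ge0// ltW.
    - rewrite expnD natrM -/q -/M.
      have -> : (K * q%:R + 1) * M = K * (M * q%:R) + M by ring.
      by rewrite lerD2l.
  have e1 : (M * x) ^+ q = (M * x ^+ q * M ^+ (q - d.+1)) * M ^+ d.
    have Mq : M ^+ q = M ^+ (q - d.+1) * (M * M ^+ d) by rewrite -exprS -exprD subnK.
    by rewrite exprMn Mq; ring.
  rewrite e1 ler_pM2r ?exprn_gt0// in h1; apply: le_trans h1.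
  by rewrite ler_peMr ?mulr_ge0 ?exprn_ge0 ?exprn_ege1// ltW.
have xq : 0 < x ^+ q by rewrite exprn_gt0.
have := Bi (Num.trunc (B / x ^+ q)).+1; apply/negP; rewrite -ltNge -ltr_pdivrMr//.
apply: lt_trans (truncnS_gt _) _; rewrite ltr_nat; exact: ltn_expl.
Qed.

(** * Norm and limits in a C*-algebra *)

Section cstar_theory.
Context (R : realType) (A : algType R[i]) (star : A -> A) (nrm : A -> R).
Hypothesis cs : is_cstar_algebra star nrm.

Lemma cstar_sn : is_seminorm nrm.
Proof.
split; first exact: (cstar_normD cs).
  by move=> a; rewrite -scaleN1r (cstar_normZ cs) normcN normc1 mul1r.
by rewrite -(scale0r (0 : A)) (cstar_normZ cs) normc0 mul0r.
Qed.

Lemma cstar_norm_ge0 a : 0 <= nrm a. Proof. exact: sn_ge0 cstar_sn a. Qed.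

Lemma cstar_norm_star a : nrm (star a) = nrm a.
Proof.
have le b : nrm b <= nrm (star b).
  have [->|b0] := eqVneq (nrm b) 0; first exact: cstar_norm_ge0.
  have bp : 0 < nrm b by rewrite lt_neqAle eq_sym b0 cstar_norm_ge0.
  by rewrite -(ler_pM2r bp) -expr2 -(cstar_identity cs) (cstar_normM cs).
by apply/eqP; rewrite eq_le le andbT; have := le (star a); rewrite (cstar_starK cs).
Qed.

Lemma cstar_star1 : star 1 = 1.
Proof.
have := cstar_starM cs (star 1) 1; rewrite mulr1 (cstar_starK cs).
by rewrite mulr1 => <-.
Qed.

Lemma cstar_norm1 : nrm 1 <= 1.
Proof.
have := cstar_identity cs 1; rewrite cstar_star1 mulr1.
have := cstar_norm_ge0 1; set t := nrm 1 => t0 tt.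
have [->//|tn] := eqVneq t 0.
by rewrite -(ler_pM2r (_ : 0 < t)) ?mul1r -?expr2 -?tt// lt_neqAle eq_sym tn.
Qed.

Lemma cstar_starB a b : star (a - b) = star a - star b.
Proof.
rewrite (cstar_starD cs) -scaleN1r (cstar_starZ cs) -[- star b]scaleN1r.
by congr (_ + _ *: _); rewrite rmorphN rmorph1.
Qed.

(** For a self-adjoint element the C*-identity doubles the exponent, which is why only exponents 2^k
    occur. *)
Lemma cstar_norm_pow2 a k : star a = a -> nrm (a ^+ (2 ^ k)) = nrm a ^+ (2 ^ k).
Proof.
move=> sa; have sp m : star (a ^+ m) = a ^+ m.
  elim: m => [|m IH]; first by rewrite expr0 cstar_star1.
  by rewrite exprS (cstar_starM cs) IH sa -exprSr -exprS.
elim: k => [|k IH]; first by rewrite expn0 !expr1.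
rewrite expnS mulnC !exprM [in LHS]expr2 -[X in nrm (X * _)]sp.
by rewrite (cstar_identity cs) IH.
Qed.

Lemma cvg_forZ (k : R[i]) u l : cvg_for nrm u l -> cvg_for nrm (fun n => k *: u n) (k *: l).
Proof.
move=> ul; apply: (cvg_for_le (c := normc k) cstar_norm_ge0 cstar_sn ul) => n.
  by rewrite -scalerBr (cstar_normZ cs).
exact: cstar_norm_ge0.
Qed.

Lemma cvg_for_bnd (V : zmodType) (nV : V -> R) (u : nat -> V) : is_seminorm nV -> cauchy_for nV u ->
  exists2 K : R, 0 <= K & forall k, nV (u k) <= K.
Proof.
move=> sn /(_ 1 ltr01)[N HN].
exists (nV (u N) + 1 + \sum_(i < N) nV (u i)).
  by rewrite !addr_ge0 ?sn_ge0// sumr_ge0// => i _; rewrite sn_ge0.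
move=> k; have [Nk|kN] := leqP N k.
  have := snD sn (u k - u N) (u N); rewrite subrK.
  have := HN k N Nk (leqnn N).
  have : 0 <= \sum_(i < N) nV (u i) by rewrite sumr_ge0// => i _; rewrite sn_ge0.
  lra.
rewrite (bigD1 (Ordinal kN))//=; have := sn_ge0 sn (u N).
have : 0 <= \sum_(i < N | i != Ordinal kN) nV (u i) by rewrite sumr_ge0// => i _; rewrite sn_ge0.
lra.
Qed.

Lemma cvg_forM u v l m : cvg_for nrm u l -> cvg_for nrm v m ->
  cvg_for nrm (fun n => u n * v n) (l * m).
Proof.
move=> ul vm; have [K K0 uK] := cvg_for_bnd cstar_sn (cvg_for_cauchy cstar_sn ul).
apply/(cvg_forP cstar_sn) => e e0.
have e1 : 0 < e / 2 / (K + 1) by rewrite !divr_gt0//; lra.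
have m1 : 0 < nrm m + 1 by have := cstar_norm_ge0 m; lra.
have e2 : 0 < e / 2 / (nrm m + 1) by rewrite !divr_gt0.
have [N HN] := (cvg_forP cstar_sn _ _).1 vm _ e1.
have [M HM] := (cvg_forP cstar_sn _ _).1 ul _ e2.
exists (maxn N M) => k; rewrite geq_max => /andP[Nk Mk].
have -> : u k * v k - l * m = u k * (v k - m) + (u k - l) * m.
  by rewrite mulrBr mulrBl addrA subrK.
rewrite (le_lt_trans (cstar_normD cs _ _))// [e]splitr ltrD//.
  rewrite (le_lt_trans (cstar_normM cs _ _))//.
  apply: (@le_lt_trans _ _ ((K + 1) * nrm (v k - m))).
    by rewrite ler_wpM2r ?cstar_norm_ge0//; have := uK k; lra.
  by rewrite mulrC -ltr_pdivlMr ?HN//; lra.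
rewrite (le_lt_trans (cstar_normM cs _ _))//.
apply: (@le_lt_trans _ _ (nrm (u k - l) * (nrm m + 1))).
  by rewrite ler_wpM2l ?cstar_norm_ge0//; lra.
by rewrite -ltr_pdivlMr ?HM.
Qed.

Lemma cvg_for_star u l : cvg_for nrm u l -> cvg_for nrm (fun n => star (u n)) (star l).
Proof.
move=> ul; apply: (cvg_for_le (c := 1) cstar_norm_ge0 cstar_sn ul) => n.
  by rewrite -cstar_starB cstar_norm_star mul1r.
exact: cstar_norm_ge0.
Qed.

End cstar_theory.

Lemma cvg_for_harmonic (R : realType) (V : zmodType) (nrm : V -> R) (u : nat -> V) l :
  is_seminorm nrm -> (forall k, nrm (u k - l) <= k.+1%:R^-1) -> cvg_for nrm u l.
Proof.
move=> sn H; apply/(cvg_forP sn) => e e0.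
exists (Num.trunc e^-1) => k ek; apply: le_lt_trans (H k) _.
rewrite -[e]invrK ltf_pV2 ?posrE ?ltr0n ?invr_gt0//.
by apply: lt_le_trans (truncnS_gt _) _; rewrite ler_nat ltnS.
Qed.

(** * The norm of C^*(Z^d) and its identification with C(T^d) *)

Section group_algebra.
Context (R : realType) (d : nat).
Local Notation Z := 'cV[int]_d.
Context (A : algType R[i]) (star : A -> A) (nrm : A -> R) (j : (Z -> C R) -> A).
Hypothesis gc : group_cstar_algebra star nrm j.
Let cs := gcstar_cstar gc.
Let sm := gcstar_morphism gc.
Let sn := cstar_sn cs.

Definition eZ (g : Z) : Z -> C R := fun c => (c == g)%:R.

Lemma eZ_sub (g h : Z) : eZ g h = deltaZ R (h - g).
Proof. by rewrite /eZ /deltaZ subr_eq0. Qed.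

Lemma Ccz_eZ g : Ccz (eZ g).
Proof.
have := Ccz_shift g (Ccz_delta R d); congr Ccz; apply/funext => c.
exact: esym (eZ_sub g c).
Qed.

Lemma jD a b : Ccz a -> Ccz b -> j (fun c => a c + b c) = j a + j b.
Proof. exact: (smorphD sm). Qed.
Lemma jZ (k : C R) a : Ccz a -> j (fun c => k * a c) = k *: j a.
Proof. exact: (smorphZ sm). Qed.
Lemma jM a b : Ccz a -> Ccz b -> j (convZ a b) = j a * j b.
Proof. exact: (smorphM sm). Qed.
Lemma jstar a : Ccz a -> j (starZ a) = star (j a).
Proof. exact: (smorph_star sm). Qed.
Lemma j1 : j (@deltaZ R d) = 1. Proof. exact: (smorph1 sm). Qed.
Lemma j0 : j (fun _ => 0) = 0.
Proof.
have := jZ 0 (Ccz_delta R d); rewrite scale0r => <-; congr j; apply/funext => c.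
by rewrite mul0r.
Qed.
Lemma jB a b : Ccz a -> Ccz b -> j (fun c => a c - b c) = j a - j b.
Proof.
move=> ca cb; rewrite -scaleN1r -[-1 *: j b](jZ (-1) cb) -(jD ca (CczZ _ cb)).
by congr j; apply/funext => c; rewrite mulN1r.
Qed.

(** A translation is unitary in the group algebra, so the C*-identity reduces its norm to that of
    1. *)
Lemma norm_jeZ g : nrm (j (eZ g)) <= 1.
Proof.
have E : convZ (starZ (eZ g)) (eZ g) = @deltaZ R d.
  rewrite convZC; apply/funext => c; transitivity (starZ (eZ g) (c - g)).
    exact: (zsum_delta g (fun h => starZ (eZ g) (c - h))).
  rewrite /starZ /eZ /deltaZ opprB -subr_eq0 -addrA [- c - g]addrC addrA subrr add0r.
  by rewrite oppr_eq0; case: eqP => _; rewrite ?rmorph1 ?rmorph0.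
have := cstar_identity cs (j (eZ g)).
rewrite -jstar; last exact: Ccz_eZ.
rewrite -jM; [|exact: Ccz_star (Ccz_eZ g)|exact: Ccz_eZ].
rewrite E j1 => h; rewrite -(@ler_pXn2r _ 2) ?nnegrE ?ler01 ?(cstar_norm_ge0 cs)//.
by rewrite -h expr1n (cstar_norm1 cs).
Qed.

Lemma norm_j_seq (s : seq Z) (b : Z -> C R) :
  nrm (j (fun c => \sum_(g <- s) b g * eZ g c)) <= \sum_(g <- s) normc (b g).
Proof.
elim: s => [|g s IH].
  rewrite big_nil; under [X in j X]funext do rewrite big_nil.
  by rewrite j0 (sn0 sn).
rewrite big_cons; under [X in j X]funext do rewrite big_cons.
have cg : Ccz (fun c => b g * eZ g c) by apply: CczZ; exact: Ccz_eZ.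
have css : Ccz (fun c => \sum_(g <- s) b g * eZ g c).
  by apply: Ccz_sum => h; apply: CczZ; exact: Ccz_eZ.
rewrite (jD cg css) (le_trans (cstar_normD cs _ _))// lerD//.
rewrite (jZ (b g) (Ccz_eZ g)) (cstar_normZ cs) ler_piMr ?norm_jeZ//.
exact: normc_ge0.
Qed.

Lemma seq_eZE (s : seq Z) (a : Z -> C R) : uniq s -> (forall c, c \notin s -> a c = 0) ->
  a = fun c => \sum_(g <- s) a g * eZ g c.
Proof.
move=> us as0; apply/funext => c; have [cs'|cs'] := boolP (c \in s).
  rewrite (bigD1_seq c)//= /eZ eqxx mulr1 big1 ?addr0// => g gc'.
  by rewrite eq_sym (negbTE gc') mulr0.
rewrite (as0 _ cs') big_seq big1// => g gs; rewrite /eZ.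
by case: eqP => [E|_]; [rewrite E gs in cs'|rewrite mulr0].
Qed.

Lemma norm_j_le (s : seq Z) (a : Z -> C R) : uniq s -> (forall c, c \notin s -> a c = 0) ->
  nrm (j a) <= \sum_(g <- s) normc (a g).
Proof. by move=> us as0; rewrite [in X in X <= _](seq_eZE us as0) norm_j_seq. Qed.

(** A list rather than a set, because its length is what bounds the norm of a power: the integral
    cube of radius K has (2 K + 1)^d points. *)
Definition zball (K : nat) : seq Z :=
  undup [seq (\col_i ((f i : nat)%:Z - K%:Z) : Z) | f : {ffun 'I_d -> 'I_(K.*2.+1)}].

Lemma size_zball K : (size (zball K) <= K.*2.+1 ^ d)%N.
Proof.
by rewrite (leq_trans (size_undup _))// size_map -cardE card_ffun !card_ord.
Qed.

Lemma mem_zball K (g : Z) : (forall i, (`|g i 0%R| <= K)%N) -> g \in zball K.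
Proof.
move=> gK; rewrite mem_undup; have lt i : (`|(g i 0 + K%:Z)%R| < K.*2.+1)%N.
  by have := gK i; lia.
apply/mapP; exists [ffun i => Ordinal (lt i)]; first by rewrite mem_enum.
apply/matrixP => i k; rewrite ord1 !mxE ffunE /=.
by have := gK i; lia.
Qed.

Definition cpow (b : Z -> C R) (n : nat) := iter n (convZ b) (@deltaZ R d).

Lemma Ccz_cpow b n : Ccz b -> Ccz (cpow b n).
Proof. by move=> cb; elim: n => [|n IH]; [exact: Ccz_delta|exact: Ccz_conv]. Qed.

Lemma j_cpow b n : Ccz b -> j (cpow b n) = j b ^+ n.
Proof.
move=> cb; elim: n => [|n IH]; first exact: j1.
by rewrite exprS -IH -(jM cb (Ccz_cpow n cb)).
Qed.

Lemma trig_cpow b n x : Ccz b -> trig (cpow b n) x = trig b x ^+ n.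
Proof.
move=> cb; elim: n => [|n IH]; first exact: trig_deltaZ.
by rewrite exprS -IH -(trig_conv x cb (Ccz_cpow n cb)).
Qed.

Lemma cpow_supp b (r : nat) n : Ccz b ->
  (forall c : Z, b c != 0 -> forall i, (`|c i 0%R| <= r)%N) ->
  forall c, cpow b n c != 0 -> forall i, (`|c i 0%R| <= n * r)%N.
Proof.
move=> cb br; elim: n => [|n IH] c.
  rewrite /cpow /= /deltaZ; have [-> _ i|] := eqVneq c 0; first by rewrite mxE.
  by rewrite eqxx.
rewrite /cpow /= -/(cpow b n) (convZE _ cb) => cn i.
have [h [bh nh]] : exists h : Z, b h != 0 /\ cpow b n (c - h) != 0.
  apply: contrapT => H; move/negP: cn; apply; apply/eqP; apply: big1_seq => h _.
  have [->|bh] := eqVneq (b h) 0; first by rewrite mul0r.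
  have [->|nh] := eqVneq (cpow b n (c - h)) 0; first by rewrite mulr0.
  by exfalso; apply: H; exists h.
have := br _ bh i; have := IH _ nh i; rewrite !mxE mulSn.
by move: (c i 0) (h i 0) (n * r)%N => u v w; lia.
Qed.

Lemma Ccz_supp (b : Z -> C R) : Ccz b -> exists r : nat, forall c : Z, b c != 0 -> forall i, (`|c i 0%R| <= r)%N.
Proof.
move=> cb; pose S := zseq [set g | b g != 0].
exists (\sum_(c <- S) \sum_i `|c i 0%R|)%N => c bc i.
have cS : c \in S by rewrite in_fset_set// inE.
by rewrite (big_rem c)//= (bigD1 i)//= -!addnA leq_addr.
Qed.

Lemma norm_j_le_ctrig a : Ccz a -> nrm (j a) <= CT_norm (ctrig a).
Proof.
move=> ca; pose b := convZ (starZ a) a.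
have cb : Ccz b by exact: Ccz_conv (Ccz_star ca) ca.
have jb : j b = star (j a) * j a by rewrite -(jstar ca) -(jM (Ccz_star ca) ca).
have sb : star (j b) = j b by rewrite jb (cstar_starM cs) (cstar_starK cs).
pose s := CT_norm (ctrig a) ^+ 2.
have trb x : normc (trig b x) <= s.
  rewrite (trig_conv x (Ccz_star ca) ca) normcM' (trig_star x ca) normc_conj -expr2.
  rewrite /s -(ctrigE x ca) ler_pXn2r ?nnegrE ?CT_norm_ge0 ?normc_ge0//.
  exact: CT_norm_ub.
have [r Hr] := Ccz_supp cb.
have main : nrm (j b) <= s.
  (* The factor 2 is that of [coeff_bound]. The support of the N-th power lies in the cube of radius
     N r, which has at most (2 r N + 1)^d points. *)
  apply: (@expr_poly_le R d s (nrm (j b)) (2 * r)%:R 2).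
  - by rewrite sqr_ge0.
  - exact: (cstar_norm_ge0 cs).
  - by [].
  - by [].
  move=> k; rewrite -(cstar_norm_pow2 cs k sb) -(j_cpow _ cb).
  set N := (2 ^ k)%N.
  apply: le_trans (norm_j_le (undup_uniq _ : uniq (zball (N * r))) _) _.
    move=> c cN; apply/eqP/negPn/negP => /(cpow_supp cb Hr) h.
    by rewrite (mem_zball h) in cN.
  have cbn := Ccz_cpow N cb.
  apply: (@le_trans _ _ (\sum_(g <- zball (N * r)) 2 * s ^+ N)).
    apply: ler_sum => g _; apply: (coeff_bound g cbn) => x.
    rewrite (trig_cpow N x cb); elim: (N) => [|m IH].
      by rewrite !expr0 normc1.
    by rewrite !exprS normcM' ler_pM ?normc_ge0.
  rewrite big_const_seq count_predT iter_addr addr0 -[_ *+ size _]mulr_natr.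
  rewrite -[_ * _%:R]mulrA [s ^+ N * _]mulrC mulrA.
  apply: ler_wpM2r; first by rewrite exprn_ge0 ?sqr_ge0.
  apply: ler_wpM2l => //.
  rewrite -natrM natr1 -natrX ler_nat; apply: leq_trans (size_zball _) _.
  by rewrite (_ : (N * r).*2 = (2 * r * N)%N)// -mul2n mulnA mulnAC.
rewrite -(@ler_pXn2r _ 2) ?nnegrE ?CT_norm_ge0 ?(cstar_norm_ge0 cs)//.
by rewrite -(cstar_identity cs) -jb.
Qed.

Lemma norm_jE a : Ccz a -> nrm (j a) = CT_norm (ctrig a).
Proof.
move=> ca; apply/eqP; rewrite eq_le (norm_j_le_ctrig ca) /=.
exact: (gcstar_max gc (@CT_cstar R d) (@ctrig_star_morphism R d) ca).
Qed.

(** The closure of the graph of j a |-> [ctrig] a. As this map is isometric with dense domain and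
    dense range, the closure is the graph of an isometric isomorphism. *)
Definition gelf_rel (x : A) (h : CT R d) : Prop := exists a : nat -> Z -> C R,
  [/\ forall k, Ccz (a k), cvg_for nrm (fun k => j (a k)) x &
      cvg_for (@CT_norm R d) (fun k => ctrig (a k)) h].

Let CTsn := @CT_norm_sn R d.
Let CTcs := @CT_cstar R d.

Lemma norm_jBE a b : Ccz a -> Ccz b ->
  nrm (j a - j b) = CT_norm (ctrig a - ctrig b).
Proof.
move=> ca cb; rewrite -(jB ca cb) (norm_jE (CczB ca cb)); congr CT_norm.
rewrite -[- ctrig b]scaleN1r -(ctrigZ _ cb) -(ctrigD ca (CczZ _ cb)).
by congr ctrig; apply/funext => c; rewrite mulN1r.
Qed.

Lemma gelf_rel_total x : exists h, gelf_rel x h.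
Proof.
have /choice[a Ha] : forall k : nat, exists a, Ccz a /\ nrm (j a - x) <= k.+1%:R^-1.
  move=> k; have k0 : 0 < k.+1%:R^-1 :> R by rewrite invr_gt0.
  have [a ca Ha] := gcstar_dense gc x k0.
  by exists a; split=> //; exact: ltW.
have ax : cvg_for nrm (fun k => j (a k)) x.
  by apply: (cvg_for_harmonic sn) => k; have [] := Ha k.
have ca : cauchy_for (@CT_norm R d) (fun k => ctrig (a k)).
  move=> e /(cvg_for_cauchy sn ax)[N HN]; exists N => k l Nk Nl.
  by have [? _] := Ha k; have [? _] := Ha l; rewrite -norm_jBE//; exact: HN.
have [h Hh] := CT_complete ca.
by exists h, a; split=> // k; have [] := Ha k.
Qed.

Lemma gelf_rel_onto h : exists x, gelf_rel x h.
Proof.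
have /choice[a Ha] : forall k : nat, exists a, Ccz a /\ CT_norm (ctrig a - h) <= k.+1%:R^-1.
  move=> k; have k0 : 0 < k.+1%:R^-1 :> R by rewrite invr_gt0.
  have [a ca Ha] := ctrig_dense h k0.
  by exists a.
have ax : cvg_for (@CT_norm R d) (fun k => ctrig (a k)) h.
  by apply: (cvg_for_harmonic CTsn) => k; have [] := Ha k.
have ca : cauchy_for nrm (fun k => j (a k)).
  move=> e /(cvg_for_cauchy CTsn ax)[N HN]; exists N => k l Nk Nl.
  by have [? _] := Ha k; have [? _] := Ha l; rewrite norm_jBE//; exact: HN.
have [x Hx] := cstar_complete cs ca.
by exists x, a; split=> // k; have [] := Ha k.
Qed.

Lemma gelf_relB x y h k : gelf_rel x h -> gelf_rel y k -> nrm (x - y) = CT_norm (h - k).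
Proof.
move=> [a [ca ax ah]] [b [cb bx bh]].
have h1 := cvg_for_norm sn (cvg_forD sn ax (cvg_forN sn bx)).
have h2 := cvg_for_norm CTsn (cvg_forD CTsn ah (cvg_forN CTsn bh)).
have E : (fun n => nrm (j (a n) - j (b n))) = (fun n => CT_norm (ctrig (a n) - ctrig (b n))).
  by apply/funext => n; exact: norm_jBE.
rewrite E in h1; exact: (cvg_unique _ h1 h2).
Qed.

Definition gelf (x : A) : CT R d := xget 0 (gelf_rel x).

Lemma gelf_rel_gelf x : gelf_rel x (gelf x).
Proof. by rewrite /gelf; case: xgetP => // H; have [h /H] := gelf_rel_total x. Qed.

Lemma gelfP x h : gelf_rel x h -> gelf x = h.
Proof.
move=> xh; apply/eqP; rewrite -subr_eq0; apply/eqP/CT_norm_eq0.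
by rewrite -(gelf_relB (gelf_rel_gelf x) xh) subrr (sn0 sn).
Qed.

Lemma gelf_norm x : CT_norm (gelf x) = nrm x.
Proof.
have r0 : gelf_rel 0 0.
  exists (fun _ _ => 0); split=> [k||]; first exact: Ccz0.
    by rewrite j0; exact: cvg_for_cst.
  have -> : ctrig (fun _ : Z => 0 : C R) = 0 :> CT R d.
    apply: CT_norm_eq0; rewrite -(norm_jE (Ccz0 R d)) j0; exact: (sn0 sn).
  exact: cvg_for_cst.
by have := gelf_relB (gelf_rel_gelf x) r0; rewrite !subr0.
Qed.

Lemma gelf_normB x y : CT_norm (gelf x - gelf y) = nrm (x - y).
Proof. exact: esym (gelf_relB (gelf_rel_gelf x) (gelf_rel_gelf y)). Qed.

Lemma gelf_inj x y : gelf x = gelf y -> x = y.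
Proof.
move=> xy; apply/eqP; rewrite -subr_eq0; apply/eqP/(cstar_norm_eq0 cs).
by rewrite -gelf_normB xy subrr (sn0 CTsn).
Qed.

Lemma gelf_surj h : exists x, gelf x = h.
Proof. by have [x /gelfP xh] := gelf_rel_onto h; exists x. Qed.

Lemma gelf_j a : Ccz a -> gelf (j a) = ctrig a.
Proof.
move=> ca; apply: gelfP; exists (fun=> a).
by split=> //; [exact: (cvg_for_cst sn)|exact: (cvg_for_cst CTsn)].
Qed.

Lemma gelfD x y : gelf (x + y) = gelf x + gelf y.
Proof.
have [a [ca ax ah]] := gelf_rel_gelf x; have [b [cb bx bh]] := gelf_rel_gelf y.
apply: gelfP; exists (fun k c => a k c + b k c); split=> [k||]; first exact: CczD.
  by under [X in cvg_for _ X]eq_fun do rewrite jD//; exact: (cvg_forD sn).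
by under [X in cvg_for _ X]eq_fun do rewrite ctrigD//; exact: (cvg_forD CTsn).
Qed.

Lemma gelfZ (k : R[i]) x : gelf (k *: x) = k *: gelf x.
Proof.
have [a [ca ax ah]] := gelf_rel_gelf x.
apply: gelfP; exists (fun n c => k * a n c); split=> [n||]; first exact: CczZ.
  by under [X in cvg_for _ X]eq_fun do rewrite jZ//; exact: (cvg_forZ cs).
by under [X in cvg_for _ X]eq_fun do rewrite ctrigZ//; exact: (cvg_forZ CTcs).
Qed.

Lemma gelfM x y : gelf (x * y) = gelf x * gelf y.
Proof.
have [a [ca ax ah]] := gelf_rel_gelf x; have [b [cb bx bh]] := gelf_rel_gelf y.
apply: gelfP; exists (fun k => convZ (a k) (b k)); split=> [k||]; first exact: Ccz_conv.
  by under [X in cvg_for _ X]eq_fun do rewrite jM//; exact: (cvg_forM cs).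
by under [X in cvg_for _ X]eq_fun do rewrite ctrigM//; exact: (cvg_forM CTcs).
Qed.

Lemma gelf_star x : gelf (star x) = CT_star (gelf x).
Proof.
have [a [ca ax ah]] := gelf_rel_gelf x.
apply: gelfP; exists (fun n => starZ (a n)); split=> [n||]; first exact: Ccz_star.
  by under [X in cvg_for _ X]eq_fun do rewrite jstar//; exact: (cvg_for_star cs).
by under [X in cvg_for _ X]eq_fun do rewrite ctrig_star//; exact: (cvg_for_star CTcs).
Qed.

Lemma gelf1 : gelf 1 = 1.
Proof. by rewrite -j1 gelf_j; [exact: ctrig1|exact: Ccz_delta]. Qed.

Lemma gelf_iso : cstar_isomorphism star nrm (@CT_star R d) (@CT_norm R d) gelf.
Proof.
split.
- have /choice[g gK] := gelf_surj; exists g => // x; apply: gelf_inj; exact: gK.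
- by move=> k x y; rewrite gelfD gelfZ.
- by split; [exact: gelf1|exact: gelfM].
- exact: gelf_star.
- exact: gelf_norm.
Qed.

Lemma gelf_pos x : (forall z, exists2 r : R, 0 <= r & gelf x z = (r%:C)%C) -> cstar_pos star x.
Proof.
move=> /CT_pos_sqrt[b]; have [y <-] := gelf_surj b.
by rewrite -gelf_star -gelfM => /gelf_inj ->; exists y.
Qed.

Lemma j_inj a b : Ccz a -> Ccz b -> j a = j b -> a = b.
Proof. by move=> ca cb ab; apply: (ctrig_inj ca cb); rewrite -(gelf_j ca) ab (gelf_j cb). Qed.

End group_algebra.

#[local] Existing Instance summability.totally_filter.

(** * Unconditional sums of complex families *)

Section usum_theory.
Context (R : realType) (I : choiceType).
Implicit Types (F G : I -> C R) (l m : C R) (r : I -> R).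

(* Convergence of the net of finite partial sums, which is the one that defines
   [usum]. *)
Definition hsum F l := forall e : R, 0 < e -> exists s : seq I,
  forall t : seq I, uniq t -> {subset s <= t} -> normc (l - \sum_(i <- t) F i) < e.

(** [usum] is a limit operator that has a value in every case; only a proof of [hsum] identifies
    that value. *)
Lemma usumP (S : set I) F l : hsum (fun i => if i \in S then F i else 0) l -> usum S F = l.
Proof.
move=> H; rewrite /usum /summability.sum; apply: cvg_lim; first exact: norm_hausdorff.
apply/cvgc_lt => e /H[s Hs]; exists (fset_set [set` s]) => // B /= sB.
rewrite /summability.partial_sum.
rewrite -(finmap.big_seq_fsetE _ B xpredT (fun i => if i \in S then F i else 0)) /=.
apply: Hs; first exact: finmap.fset_uniq.
by move=> i si; apply: (finmap.fsubsetP sB); rewrite in_fset_set// inE.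
Qed.

Lemma usumTP F l : hsum F l -> usum setT F = l.
Proof.
move=> H; apply: usumP; have -> : (fun i => if i \in setT then F i else 0) = F; last by [].
by apply/funext => i; rewrite in_setT.
Qed.

Lemma hsumD F G l m : hsum F l -> hsum G m -> hsum (fun i => F i + G i) (l + m).
Proof.
move=> Fl Gm e e0; have e2 : 0 < e / 2 by rewrite divr_gt0.
have [s Hs] := Fl _ e2; have [t Ht] := Gm _ e2; exists (s ++ t) => w uw stw.
rewrite big_split /= opprD addrACA (le_lt_trans (normcD _ _))// [e]splitr ltrD//.
  by apply: Hs => // i si; apply: stw; rewrite mem_cat si.
by apply: Ht => // i si; apply: stw; rewrite mem_cat si orbT.
Qed.

Lemma hsumZ (k : C R) F l : hsum F l -> hsum (fun i => k * F i) (k * l).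
Proof.
move=> Fl e e0; have k1 : 0 < normc k + 1 by have := normc_ge0 k; lra.
have [s Hs] := Fl _ (divr_gt0 e0 k1); exists s => t ut st.
rewrite -mulr_sumr -mulrBr normcM'.
apply: (@le_lt_trans _ _ ((normc k + 1) * normc (l - \sum_(i <- t) F i))).
  by rewrite ler_wpM2r ?normc_ge0//; lra.
by rewrite mulrC -ltr_pdivlMr ?Hs.
Qed.

Lemma esum_seq_le (a : I -> \bar R) (s : seq I) : (forall i, 0 <= a i)%E -> uniq s ->
  (\sum_(i <- s) a i <= \esum_(i in [set: I]) a i)%E.
Proof.
move=> a0 us; apply: ereal_sup_ubound; exists [set` s] => //.
by rewrite [RHS]fsbig_seq.
Qed.

Lemma hsum_ge0 r (Q : R) : (forall i, 0 <= r i) ->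
  (\esum_(i in [set: I]) (r i)%:E = Q%:E)%E ->
  hsum (fun i => ((r i)%:C)%C) ((Q%:C)%C).
Proof.
move=> r0 rQ e e0.
have : ((Q - e)%:E < \esum_(i in [set: I]) (r i)%:E)%E by rewrite rQ lte_fin; lra.
move=> /ereal_sup_gt[_ [X [fX _] <-]]; rewrite fsbig_finite// sumEFin lte_fin => QX.
exists (zseq X) => t ut Xt.
have -> : \sum_(i <- t) ((r i)%:C)%C = ((\sum_(i <- t) r i)%:C)%C :> C R.
  by rewrite rmorph_sum.
rewrite -CrB normc_real.
have h1 : \sum_(i <- t) r i <= Q.
  rewrite -lee_fin -rQ -sumEFin; apply: esum_seq_le => // i; rewrite lee_fin; exact: r0.
have h2 : \sum_(i <- zseq X) r i <= \sum_(i <- t) r i.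
  suff pe : perm_eq t (zseq X ++ [seq i <- t | i \notin zseq X]).
    by rewrite (perm_big _ pe) big_cat /= lerDl; apply: sumr_ge0 => i _.
  apply: uniq_perm => //.
    rewrite cat_uniq finmap.fset_uniq filter_uniq// andbT /=; apply/hasPn => i.
    by rewrite mem_filter => /andP[].
  move=> i; rewrite mem_cat mem_filter; case: (boolP (i \in zseq X)) => //= iX.
  by rewrite (Xt _ iX).
by rewrite ltr_norml; lra.
Qed.

(** Nonnegative families are summed by their supremum. With A = (|F| + Re F)/2 and B = (|F| + Im
    F)/2, which lie between 0 and |F|, one has F = 2 A + 2 i B - (1 + i) |F|. *)
Lemma hsum_abs F : (\esum_(i in [set: I]) (normc (F i))%:E < +oo)%E -> exists l, hsum F l.
Proof.
move=> Foo.
have P (r : I -> R) : (forall i, 0 <= r i) -> (forall i, r i <= normc (F i)) ->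
    exists Q, hsum (fun i => ((r i)%:C)%C) Q.
  move=> r0 rF; have h : (\esum_(i in [set: I]) (r i)%:E < +oo)%E.
    by apply: le_lt_trans Foo; apply: le_esum => i _; rewrite lee_fin.
  have h0 : (0 <= \esum_(i in [set: I]) (r i)%:E)%E by apply: esum_ge0 => i _; rewrite lee_fin.
  exists ((fine (\esum_(i in [set: I]) (r i)%:E))%:C)%C; apply: hsum_ge0 => //.
  by rewrite fineK// ge0_fin_numE.
have n0 i := normc_ge0 (F i).
have D (x : R) (y : R) : `|x| <= y -> 0 <= (y + x) / 2 <= y by rewrite ler_norml; lra.
have [A HA] : exists Q, hsum (fun i => (((normc (F i) + complex.Re (F i)) / 2)%:C)%C) Q.
  by apply: P => i; have /andP[] := D _ _ (normc_Re (F i)).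
have [B HB] : exists Q, hsum (fun i => (((normc (F i) + complex.Im (F i)) / 2)%:C)%C) Q.
  by apply: P => i; have /andP[] := D _ _ (normc_Im (F i)).
have [N HN] : exists Q, hsum (fun i => ((normc (F i))%:C)%C) Q by exact: P.
have := hsumD (hsumD (hsumZ 2%:R HA) (hsumZ (2%:R * ('i)%C) HB)) (hsumZ (- (1 + ('i)%C)) HN).
set l := (X in hsum _ X); set G := (X in hsum X _) => H; exists l.
have -> : F = G; last by [].
apply/funext => i; rewrite /G; case: (F i) => x y.
by apply: eqc; rewrite !(ReD, ImD, ReM, ImM, ReN, ImN) /=; lra.
Qed.

Lemma hsum_seq (s : seq I) F : uniq s -> (forall i, i \notin s -> F i = 0) ->
  hsum F (\sum_(i <- s) F i).
Proof.
move=> us Fs e e0; exists s => t ut st.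
rewrite (_ : \sum_(i <- t) F i = \sum_(i <- s) F i) ?subrr ?normc0//.
suff pe : perm_eq t (s ++ [seq i <- t | i \notin s]).
  rewrite (perm_big _ pe) big_cat /= [X in _ + X]big1_seq ?addr0// => i.
  by rewrite mem_filter => /andP[_ /andP[/Fs]].
apply: uniq_perm => //.
  rewrite cat_uniq us filter_uniq// andbT /=; apply/hasPn => i.
  by rewrite mem_filter => /andP[].
move=> i; rewrite mem_cat mem_filter; case: (boolP (i \in s)) => //= iX.
by rewrite (st _ iX).
Qed.

End usum_theory.

Lemma esumZl (R : realType) (I : countType) (k : R) (a : I -> \bar R) :
  0 <= k -> (forall i, 0 <= a i)%E ->
  (\esum_(i in [set: I]) (k%:E * a i) = k%:E * \esum_(i in [set: I]) a i)%E.
Proof.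
move=> k0 a0; rewrite !esum_pickle// => [|i]; last exact: mule_ge0.
rewrite -nneseriesZl; last by move=> i _; case: pickle_inv => /=.
by apply: eq_eseriesr => i _; case: pickle_inv => //=; rewrite mule0.
Qed.

(** * Brackets, actions and Poisson summation for an invertible matrix *)

Section levels.
Context (R : realType) (d : nat).
Local Notation T := 'cV[R]_d.
Local Notation Z := 'cV[int]_d.

(** The scales of M and of its inverse multiply to 1, which in the extended reals excludes both 0
    and +oo. *)
Lemma mxscale_fin (M : 'M[R]_d) : M \in unitmx ->
  mxscale M = (fine (mxscale M))%:E /\ 0 < fine (mxscale M).
Proof.
move=> uM; have h : (mxscale M * mxscale (invmx M) = 1)%E.
  by rewrite -mxscaleM ?unitmx_inv// mulmxV// mxscale1.
have a0 : (0 <= mxscale M)%E by exact: measure_ge0.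
have b0 : (0 <= mxscale (invmx M))%E by exact: measure_ge0.
move: (mxscale M) (mxscale (invmx M)) a0 b0 h => [a| |] [b| |] //= a0 b0 h.
- split=> //; case: h => h; rewrite lee_fin in a0 b0.
  rewrite lt_neqAle a0 andbT; apply: contra_eq_neq h => <-; rewrite mul0r eq_sym.
  exact: oner_neq0.
- move: h; rewrite lee_fin in a0; have [->|a1] := eqVneq a 0.
    by rewrite mul0e => -[/eqP]; rewrite eq_sym oner_eq0.
  by rewrite gt0_muley// lte_fin lt_neqAle eq_sym a1.
- move: h; rewrite lee_fin in b0; have [->|b1] := eqVneq b 0.
    by rewrite mule0 => -[/eqP]; rewrite eq_sym oner_eq0.
  by rewrite gt0_mulye// lte_fin lt_neqAle eq_sym b1.
Qed.

Context (M : 'M[R]_d) (uM : M \in unitmx).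
Let kp := fine (mxscale M).
Lemma kp_gt0 : 0 < kp. Proof. by have [] := mxscale_fin uM. Qed.
Lemma kp_fin : mxscale M \is a fin_num. Proof. by have [-> _] := mxscale_fin uM. Qed.

Implicit Types f g : T -> C R.

Definition brM f g : Z -> C R :=
  fun c => cintegral (fun x => conjc (f (x - M *m zv R c)) * g x).

Definition circM f (a : Z -> C R) : T -> C R :=
  fun x => usum setT (fun c => a c * f (x - M *m zv R c)).

(* f |-> f o M turns translations by M Z^d into translations by Z^d. *)
Definition pull f : T -> C R := fun x => f (M *m x).

Lemma Ccr_pull f : Ccr f -> Ccr (pull f). Proof. exact: Ccr_mulmx. Qed.

Lemma cL1_brM f g v : Ccr f -> Ccr g -> cL1 (fun x => conjc (f (x - v)) * g x).
Proof.
move=> Cf Cg; apply: Ccr_cL1; apply: CcrM; last exact: Ccr_cont.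
by apply: Ccr_conj; exact: (Ccr_shift (- v) Cf).
Qed.

Lemma brM_br f g c : Ccr f -> Ccr g -> br (pull f) (pull g) c = ((kp%:C)%C : C R) * brM f g c.
Proof.
move=> Cf Cg; rewrite /brM -(cintegral_mulmx uM kp_fin (cL1_brM (M *m zv R c) Cf Cg)).
by congr cintegral; apply/funext => x; rewrite /pull mulmxBr.
Qed.

Lemma brME f g : Ccr f -> Ccr g ->
  brM f g = fun c => (((kp^-1)%:C)%C : C R) * br (pull f) (pull g) c.
Proof.
move=> Cf Cg; apply/funext => c; rewrite brM_br// mulrA -CrM mulVf ?mul1r//.
by rewrite gt_eqF// kp_gt0.
Qed.

Lemma Ccz_br f g : Ccr f -> Ccr g -> Ccz (br f g).
Proof.
move=> Cf Cg; apply: Ccz_sub (compact_support_lattice Cf Cg) _ => c nc.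
rewrite /br (_ : (fun x => _) = fun=> 0) ?cintegral0//; apply/funext => x.
have [->|fx] := eqVneq (f (x - zv R c)) 0; first by rewrite conjc0 mul0r.
have [->|gx] := eqVneq (g x) 0; first by rewrite mulr0.
by exfalso; apply: nc; exists x.
Qed.

Lemma Ccz_brM f g : Ccr f -> Ccr g -> Ccz (brM f g).
Proof. by move=> Cf Cg; rewrite brME//; apply: CczZ; apply: Ccz_br; exact: Ccr_pull. Qed.

Lemma brMDr f g h : Ccr f -> Ccr g -> Ccr h ->
  brM f (fun x => g x + h x) = fun c => brM f g c + brM f h c.
Proof.
move=> Cf Cg Ch; apply/funext => c; rewrite /brM -cintegralD; try exact: cL1_brM.
by congr cintegral; apply/funext => x; rewrite mulrDr.
Qed.

Lemma brMZr k f g : Ccr f -> Ccr g -> brM f (fun x => k * g x) = fun c => k * brM f g c.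
Proof.
move=> Cf Cg; apply/funext => c; rewrite /brM -cintegralZ; last exact: cL1_brM.
by congr cintegral; apply/funext => x; rewrite mulrCA.
Qed.

Lemma brM_star f g : Ccr f -> Ccr g -> starZ (brM f g) = brM g f.
Proof.
move=> Cf Cg; apply/funext => c; rewrite /starZ /brM -cintegral_conj; last exact: cL1_brM.
rewrite -(@cintegral_shift R d (- (M *m zv R c))).
  congr cintegral; apply/funext => x; rewrite zvN mulmxN opprK addrNK cjM cjK mulrC.
  by [].
have [+ _] : cL1 (fun x => conjc (conjc (f (x - M *m zv R (- c))) * g x) : C R).
  by apply: cL1_conj; exact: cL1_brM.
by [].
Qed.

Lemma brM0 f : Ccr f -> brM f f 0 = ((\int[cV_lebesgue R d]_x normc (f x) ^+ 2)%:C)%C.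
Proof.
move=> Cf; rewrite /brM; apply: eqc; rewrite /cintegral /=.
  by congr Rintegral; apply/funext => x; rewrite zv0 mulmx0 subr0 conj_mul.
rewrite (_ : (fun x => _) = fun=> 0) ?/Rintegral ?integral0//.
by apply/funext => x; rewrite zv0 mulmx0 subr0 conj_mul.
Qed.

Lemma circM_sum f a x (s : seq Z) : uniq s -> (forall c, c \notin s -> a c = 0) ->
  circM f a x = \sum_(c <- s) a c * f (x - M *m zv R c).
Proof.
move=> us as0; apply: usumTP; apply: hsum_seq => // c /as0 ->; exact: mul0r.
Qed.

Lemma circM_Ccz f a : Ccz a ->
  circM f a = fun x => \sum_(c <- zseq [set c | a c != 0]) a c * f (x - M *m zv R c).
Proof.
move=> ca; apply/funext => x; apply: circM_sum; first exact: finmap.fset_uniq.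
by move=> c; rewrite in_fset_set// notin_setE => /negP/negPn/eqP.
Qed.

Lemma Ccr_circM f a : Ccr f -> Ccz a -> Ccr (circM f a).
Proof.
move=> Cf ca; rewrite circM_Ccz//; apply: Ccr_sum => c; apply: CcrZ.
exact: (Ccr_shift (- (M *m zv R c)) Cf).
Qed.

Lemma circM_zsum f a x : Ccz a -> circM f a x = zsum (fun c => a c * f (x - M *m zv R c)).
Proof. by move=> ca; rewrite circM_Ccz// -(zsum_Ccz_mul (fun c => f (x - M *m zv R c)) ca). Qed.

Lemma brM_circM f g a : Ccr f -> Ccr g -> Ccz a -> brM f (circM g a) = convZ (brM f g) a.
Proof.
move=> Cf Cg ca; rewrite convZC convZE// circM_Ccz//; apply/funext => c; rewrite /brM.
transitivity (cintegral (fun x => \sum_(e <- zseq [set e | a e != 0])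
   a e * (conjc (f (x - M *m zv R c)) * g (x - M *m zv R e)))).
  congr cintegral; apply/funext => x; rewrite mulr_sumr; apply: eq_bigr => e _.
  by rewrite mulrCA.
have L e : cL1 (fun x => conjc (f (x - M *m zv R c)) * g (x - M *m zv R e)).
  exact: (cL1_brM (M *m zv R c) Cf (Ccr_shift (- (M *m zv R e)) Cg)).
rewrite cintegral_sum => [|e]; last exact: cL1Z.
apply: eq_bigr => e _; rewrite cintegralZ//; congr (_ * _).
rewrite -(@cintegral_shift R d (M *m zv R e)); last by case: (L e).
congr cintegral; apply/funext => x; rewrite addrK zvB mulmxBr; congr (conjc (f _) * _).
by rewrite opprB addrA addrAC.
Qed.

Lemma circM_conv f a b : Ccz a -> Ccz b -> circM f (convZ a b) = circM (circM f a) b.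
Proof.
move=> ca cb; apply/funext => x; rewrite (circM_zsum f x (Ccz_conv ca cb)).
rewrite (circM_Ccz (circM f a) cb) convZC (convZE _ cb).
transitivity (zsum (fun c => \sum_(h <- zseq [set g | b g != 0]) b h * (a (c - h) * f (x - M *m zv R c)))).
  by congr zsum; apply/funext => c; rewrite mulr_suml; apply: eq_bigr => h _; rewrite mulrA.
rewrite zsum_sum => [|h]; last first.
  apply: CczZ; exact: (CczMl (fun c => f (x - M *m zv R c)) (Ccz_shift h ca)).
apply: eq_bigr => h _; rewrite (zsumZ (b h) (CczMl (fun c => f (x - M *m zv R c)) (Ccz_shift h ca))).
rewrite (circM_zsum f _ ca); congr (_ * _).
rewrite -(zsum_shift h (fun c => a c * f (x - M *m zv R h - M *m zv R c))).
congr zsum; apply/funext => c; congr (_ * f _).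
by rewrite zvB mulmxBr opprB addrA subrK.
Qed.

Lemma circM_delta f : circM f (@deltaZ R d) = f.
Proof.
apply/funext => x; rewrite (circM_zsum f x (Ccz_delta R d)).
rewrite (zsum_delta 0 (fun c => f (x - M *m zv R c))).
by rewrite zv0 mulmx0 subr0.
Qed.

Lemma circMDl f g a : Ccz a -> circM (fun x => f x + g x) a = fun x => circM f a x + circM g a x.
Proof.
move=> ca; rewrite !circM_Ccz//; apply/funext => x; rewrite -big_split.
by apply: eq_bigr => c _; rewrite mulrDr.
Qed.

Lemma circMZl k f a : Ccz a -> circM (fun x => k * f x) a = fun x => k * circM f a x.
Proof.
move=> ca; rewrite !circM_Ccz//; apply/funext => x; rewrite mulr_sumr.
by apply: eq_bigr => c _; rewrite mulrCA.
Qed.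

Lemma circMDr f a b : Ccz a -> Ccz b ->
  circM f (fun c => a c + b c) = fun x => circM f a x + circM f b x.
Proof.
move=> ca cb; apply/funext => x; rewrite (circM_zsum f x (CczD ca cb)) !circM_zsum//.
rewrite -zsumD; [|exact: CczMl|exact: CczMl].
by congr zsum; apply/funext => c; rewrite mulrDl.
Qed.

Lemma circMZr k f a : Ccz a -> circM f (fun c => k * a c) = fun x => k * circM f a x.
Proof.
move=> ca; apply/funext => x; rewrite (circM_zsum f x (CczZ k ca)) circM_zsum//.
rewrite -zsumZ; last exact: CczMl.
by congr zsum; apply/funext => c; rewrite mulrA.
Qed.

Lemma fourier1_pull f xi : Ccr f -> fourier1 (pull f) (M^T *m xi) = ((kp%:C)%C : C R) * fourier1 f xi.
Proof.
move=> Cf; rewrite !fourier1E -(cintegral_mulmx uM kp_fin (Ccr_cL1 (Ccr_modul xi Cf))).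
congr cintegral; apply/funext => x; rewrite /modul /pull; congr (_ * ce _).
by rewrite dotc_mulmx trmxK.
Qed.

Lemma fourier1_circM f a xi : Ccr f -> Ccz a ->
  fourier1 (circM f a) xi = fourier1 f xi * trig a (M^T *m xi).
Proof.
move=> Cf ca; have Cs c : Ccr (fun x => f (x - M *m zv R c)).
  exact: (Ccr_shift (- (M *m zv R c)) Cf).
rewrite !fourier1E /modul (circM_Ccz f ca).
transitivity (cintegral (fun y => \sum_(c <- zseq [set c | a c != 0])
   a c * modul (fun x => f (x - M *m zv R c)) xi y)).
  congr cintegral; apply/funext => y; rewrite mulr_suml; apply: eq_bigr => c _.
  by rewrite mulrA.
rewrite cintegral_sum => [|c]; last by apply: cL1Z; apply: Ccr_cL1; exact: Ccr_modul.
rewrite /trig (zsum_Ccz_mul (fun c => ez c (M^T *m xi)) ca) mulr_sumr.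
apply: eq_bigr => c _; have Lm := Ccr_cL1 (Ccr_modul xi (Cs c)).
rewrite cintegralZ// mulrCA; congr (_ * _).
rewrite -(@cintegral_shift R d (M *m zv R c)); last by case: Lm.
rewrite -cintegralZr; last exact: Ccr_cL1 (Ccr_modul xi Cf).
congr cintegral; apply/funext => x; rewrite /modul addrK -mulrA; congr (_ * _).
by rewrite dotcDr ceD; congr (_ * ce _); rewrite dotcC dotc_mulmx.
Qed.

(** Composition with M multiplies the squared transform by [kp]^2 and the bracket by [kp]; one
    factor [kp]^-1 remains, which becomes the normalisation of the bracket on the Fourier side. The
    points invmx M^T (x + g) form the fibre over x. *)
Lemma poissonM f x : Ccr f -> exists Q : R, [/\ 0 <= Q, trig (brM f f) x = (Q%:C)%C &
  (\esum_(g in [set: Z]) (normc (fourier1 f (invmx M^T *m (x + zv R g))) ^+ 2)%:E = (kp^-1 * Q)%:E)%E].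
Proof.
move=> Cf; have [Q Q0 [tQ eQ]] := poisson x (Ccr_pull Cf).
exists (kp^-1 * Q); have k0 := kp_gt0; split.
- by rewrite mulr_ge0// invr_ge0 ltW.
- by rewrite brME// trigZ ?tQ ?CrM//; apply: Ccz_br; exact: Ccr_pull.
have E (g : Z) : (normc (fourier1 (pull f) (x + zv R g)) ^+ 2)%:E =
    ((kp ^+ 2)%:E * (normc (fourier1 f (invmx M^T *m (x + zv R g))) ^+ 2)%:E)%E.
  rewrite -EFinM -[x + zv R g](mulKVmx (_ : M^T \in unitmx)) ?unitmx_tr//.
  rewrite fourier1_pull// mulKVmx ?unitmx_tr// normcM' normc_real exprMn gtr0_norm//.
move: eQ; under eq_esum do rewrite E.
rewrite esumZl; [|by rewrite sqr_ge0|by move=> ?; rewrite lee_fin sqr_ge0].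
move=> h; have : ((kp ^- 2)%:E * ((kp ^+ 2)%:E * \esum_(g in [set: Z])
   (normc (fourier1 f (invmx M^T *m (x + zv R g))) ^+ 2)%:E) = (kp^-1 * (kp^-1 * Q))%:E)%E.
  by rewrite h -EFinM; congr EFin; rewrite mulrA -invfM -expr2.
rewrite muleA -EFinM mulVf ?mul1e//.
by rewrite expf_neq0// gt_eqF.
Qed.

End levels.

(** Cauchy-Schwarz from nonnegativity of the quadratic alone, so that it serves at each point of the
    torus and in L^2. The test value is t = - conj b / c, or a large negative multiple of conj b
    when c = 0. *)
Lemma cs_quad (R : realType) (a c : R) (b : C R) : 0 <= a -> 0 <= c ->
  (forall t : C R, 0 <= a + 2 * complex.Re (t * b) + normc t ^+ 2 * c) ->
  normc b ^+ 2 <= a * c.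
Proof.
move=> a0 c0 H; pose q := normc b ^+ 2; have q0 : 0 <= q by exact: sqr_ge0.
have Hs (s : R) : 0 <= a - 2 * s * q + s ^+ 2 * q * c.
  have e : ((- s)%:C)%C * conjc b * b = ((- s * q)%:C)%C :> C R.
    by rewrite -mulrA conj_mul -CrM.
  have := H (((- s)%:C)%C * conjc b); rewrite e normcM' normc_real normc_conj.
  by rewrite exprMn real_normK ?num_real// sqrrN -/q /= mulNr mulrN mulrA.
have [c1|c1] := eqVneq c 0.
  rewrite c1 mulr0 -/q leNgt; apply/negP => qp.
  have := Hs ((a + 1) / q); rewrite c1 mulr0 addr0 -mulrA divfK ?gt_eqF//; lra.
have cp : 0 < c by rewrite lt_neqAle eq_sym c1.
have := Hs c^-1; rewrite -/q.
have -> : a - 2 * c^-1 * q + c^-1 ^+ 2 * q * c = a - q / c by field.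
by rewrite subr_ge0 ler_pdivrMr.
Qed.

Lemma cs_triangle (R : realType) (a c : R) (b : C R) : 0 <= a -> 0 <= c ->
  normc b ^+ 2 <= a * c -> a + 2 * complex.Re b + c <= (Num.sqrt a + Num.sqrt c) ^+ 2.
Proof.
move=> a0 c0 bac; rewrite sqrrD !sqr_sqrtr// -sqrtrM//.
have h : normc b <= Num.sqrt (a * c).
  by rewrite -[leLHS]ger0_norm ?normc_ge0// -sqrtr_sqr ler_wsqrtr.
have := normc_Re b; rewrite ler_norml => /andP[_ h2].
by rewrite -mulr_natl; lra.
Qed.

(** * L^2 and Plancherel *)

Section L2_theory.
Context (R : realType) (d : nat).
Local Notation T := 'cV[R]_d.
Local Notation mu := (cV_lebesgue R d).
Implicit Types f g h : T -> C R.

Definition nn f : R := \int[mu]_x (normc (f x) ^+ 2).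
Definition n2 f : R := Num.sqrt (nn f).

Lemma cL2_meas f : cLp 2 f -> cmeasurable f. Proof. by case. Qed.

Lemma nnE f : cLp 2 f -> (\int[mu]_x (normc (f x) ^+ 2)%:E)%E = (nn f)%:E.
Proof.
move=> [mf foo]; rewrite /nn /Rintegral fineK// ge0_fin_numE//.
by apply: integral_ge0 => x _; rewrite lee_fin sqr_ge0.
Qed.

Lemma nn_ge0 f : 0 <= nn f.
Proof. by apply: Rintegral_ge0 => x _; rewrite sqr_ge0. Qed.

Lemma n2_ge0 f : 0 <= n2 f. Proof. exact: sqrtr_ge0. Qed.

Lemma n2_sqr f : n2 f ^+ 2 = nn f. Proof. by rewrite sqr_sqrtr// nn_ge0. Qed.

Lemma n2_le f (K : R) : 0 <= K -> nn f <= K ^+ 2 -> n2 f <= K.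
Proof. by move=> K0 h; rewrite -(ger0_norm K0) -sqrtr_sqr ler_wsqrtr. Qed.

Lemma cL2_predE f : (f \in @L2_pred R d) <-> cLp 2 f.
Proof. by split=> [/asboolP|/asboolP]. Qed.

Lemma cL2DZ (k : C R) f g : cLp 2 f -> cLp 2 g -> cLp 2 (fun x => k * f x + g x).
Proof.
move=> /cL2_predE Lf /cL2_predE Lg; apply/cL2_predE.
exact: (@L2_submod_closed R d).2 k f g Lf Lg.
Qed.

Lemma cL2_0 : cLp 2 (fun _ : T => 0 : C R).
Proof. by apply/cL2_predE; exact: (@L2_submod_closed R d).1. Qed.

Lemma cL2D f g : cLp 2 f -> cLp 2 g -> cLp 2 (fun x => f x + g x).
Proof.
move=> Lf Lg; have := cL2DZ 1 Lf Lg; congr cLp; apply/funext => x; congr (_ + _).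
exact: mul1r.
Qed.

Lemma cL2Z k f : cLp 2 f -> cLp 2 (fun x => k * f x).
Proof.
move=> Lf; have := cL2DZ k Lf cL2_0; congr cLp; apply/funext => x.
exact: addr0.
Qed.

Lemma cL2B f g : cLp 2 f -> cLp 2 g -> cLp 2 (fun x => f x - g x).
Proof.
move=> Lf Lg; have := cL2DZ (-1) Lg Lf; congr cLp; apply/funext => x.
by rewrite cN1 addrC.
Qed.

Lemma cL2_sum I (s : seq I) (F : I -> T -> C R) : (forall i, cLp 2 (F i)) ->
  cLp 2 (fun x => \sum_(i <- s) F i x).
Proof.
move=> mF; elim: s => [|i s IH].
  by under [X in cLp 2 X]eq_fun do rewrite big_nil; exact: cL2_0.
by under [X in cLp 2 X]eq_fun do rewrite big_cons; exact: cL2D.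
Qed.

Lemma nn_ae f g : cmeasurable f -> cmeasurable g -> {ae mu, forall x, f x = g x} -> nn f = nn g.
Proof.
move=> mf mg fg; rewrite /nn /Rintegral; congr fine.
apply: ae_eq_integral => //; [exact: measurable_normc_sqr|exact: measurable_normc_sqr|].
by apply: filterS fg => x -> _.
Qed.

Lemma n2_ae f g : cmeasurable f -> cmeasurable g -> {ae mu, forall x, f x = g x} -> n2 f = n2 g.
Proof. by move=> mf mg fg; rewrite /n2 (nn_ae mf mg fg). Qed.

Lemma nn_eq0 f : cLp 2 f -> nn f = 0 -> {ae mu, forall x, f x = 0}.
Proof.
move=> Lf f0; have mf := measurable_normc_sqr (cL2_meas Lf).
have : (\int[mu]_x `|(normc (f x) ^+ 2)%:E| = 0)%E.
  under eq_integral do rewrite gee0_abs ?lee_fin ?sqr_ge0//.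
  by rewrite nnE// f0.
move=> /(ae_eq_integral_abs mu measurableT mf); apply: filterS => x /(_ I) /= [].
by move=> /eqP; rewrite sqrf_eq0 => /eqP/normc_eq0.
Qed.

Lemma cL1_mul f g : cLp 2 f -> cLp 2 g -> cL1 (fun x => conjc (f x) * g x).
Proof.
move=> Lf Lg; have [mf mg] := (cL2_meas Lf, cL2_meas Lg).
apply: (cL1_le (h := fun x => normc (f x) ^+ 2 + normc (g x) ^+ 2)).
- by apply: cmeasurableM => //; exact: cmeasurable_conj.
- by apply: measurable_funD; apply/measurable_EFinP; exact: measurable_normc_sqr.
- under eq_integral do rewrite EFinD.
  rewrite ge0_integralD//; last 4 first.
  + by move=> x _; rewrite lee_fin sqr_ge0.
  + exact: measurable_normc_sqr.
  + by move=> x _; rewrite lee_fin sqr_ge0.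
  + exact: measurable_normc_sqr.
  by rewrite !nnE// -EFinD ltry.
move=> x; rewrite normcM' normc_conj.
have := sqr_ge0 (normc (f x) - normc (g x)).
have := sqr_ge0 (normc (f x) + normc (g x)).
by rewrite !expr2; lra.
Qed.

Definition l2ip f g : C R := cintegral (fun x => conjc (f x) * g x).

Lemma l2ip_Re_expand f g (t : C R) : cLp 2 f -> cLp 2 g ->
  nn (fun x => f x + t * g x) = nn f + 2 * complex.Re (t * l2ip f g) + normc t ^+ 2 * nn g.
Proof.
move=> Lf Lg.
have E x : normc (f x + t * g x) ^+ 2 = complex.Re (conjc (f x) * f x) +
   2 * complex.Re (t * (conjc (f x) * g x)) + normc t ^+ 2 * complex.Re (conjc (g x) * g x).
  rewrite !conj_mul /= !normc_sqr; case: (f x) (g x) t => [a b] [p q] [u v].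
  by rewrite !(ReM, ImM, ReD, ImD, Re_conj, Im_conj) /=; ring.
have Lff := cL1_Re (cL1_mul Lf Lf); have Lgg := cL1_Re (cL1_mul Lg Lg).
have Lfg := cL1_mul Lf Lg; have Ltfg := cL1Z t Lfg.
rewrite /nn; under eq_Rintegral do rewrite E.
have i1 : mu.-integrable setT (EFin \o (fun x => 2 * complex.Re (t * (conjc (f x) * g x)))).
  by apply: (integrableZl measurableT _ (cL1_Re Ltfg)).
have i2 : mu.-integrable setT (EFin \o (fun x => normc t ^+ 2 * complex.Re (conjc (g x) * g x))).
  by apply: (integrableZl measurableT _ Lgg).
rewrite RintegralD//; last exact: (integrableD measurableT Lff i1).
rewrite RintegralD// RintegralZl//; last exact: cL1_Re.
rewrite RintegralZl//; congr (_ + 2 * _ + _ * _).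
- by congr Rintegral; apply/funext => x; rewrite conj_mul.
- by rewrite -cintegralZ.
- by congr Rintegral; apply/funext => x; rewrite conj_mul.
Qed.

Lemma l2_cs f g : cLp 2 f -> cLp 2 g -> normc (l2ip f g) ^+ 2 <= nn f * nn g.
Proof.
move=> Lf Lg; apply: cs_quad; [exact: nn_ge0|exact: nn_ge0|move=> t].
by rewrite -l2ip_Re_expand// nn_ge0.
Qed.

Lemma n2D f g : cLp 2 f -> cLp 2 g -> n2 (fun x => f x + g x) <= n2 f + n2 g.
Proof.
move=> Lf Lg; apply: n2_le; first by rewrite addr_ge0 ?n2_ge0.
have := l2ip_Re_expand 1 Lf Lg; rewrite mul1r normc1 expr1n mul1r => h.
have -> : (fun x => f x + g x) = (fun x => f x + 1 * g x).
  by apply/funext => x; rewrite mul1r.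
by rewrite h; apply: cs_triangle; rewrite ?nn_ge0// l2_cs.
Qed.

Lemma n2Z k f : cLp 2 f -> n2 (fun x => k * f x) = normc k * n2 f.
Proof.
move=> Lf; have -> : nn (fun x => k * f x) = normc k ^+ 2 * nn f -> n2 (fun x => k * f x) = normc k * n2 f.
  by move=> h; rewrite /n2 h sqrtrM ?sqr_ge0// sqrtr_sqr ger0_norm// normc_ge0.
by [].
have := l2ip_Re_expand k cL2_0 Lf.
have -> : nn (fun=> 0) = 0 by rewrite /nn normc0 expr0n /Rintegral integral0.
rewrite /l2ip; under [X in cintegral X]eq_fun do rewrite conjc0 mul0r.
rewrite cintegral0 mulr0 /= mulr0 !add0r => <-; congr nn.
by apply/funext => x; rewrite add0r.
Qed.

Lemma n2_sum I (s : seq I) (F : I -> T -> C R) : (forall i, cLp 2 (F i)) ->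
  n2 (fun x => \sum_(i <- s) F i x) <= \sum_(i <- s) n2 (F i).
Proof.
move=> mF; elim: s => [|i s IH].
  under [X in n2 X]eq_fun do rewrite big_nil.
  by rewrite big_nil /n2 /nn normc0 expr0n /Rintegral integral0 //= sqrtr0.
under [X in n2 X]eq_fun do rewrite big_cons.
rewrite big_cons; apply: le_trans (n2D (mF i) (cL2_sum s mF)) _.
by rewrite lerD2l.
Qed.

Lemma nn_shift f a : cmeasurable f -> nn (fun x => f (x + a)) = nn f.
Proof.
move=> mf; rewrite /nn /Rintegral; congr fine.
apply: (ge0_integral_cVD a (F := fun x => (normc (f x) ^+ 2)%:E)).
  exact: measurable_normc_sqr.
by move=> x; rewrite lee_fin sqr_ge0.
Qed.

Lemma cL2_shift f a : cLp 2 f -> cLp 2 (fun x => f (x + a)).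
Proof.
move=> [mf foo]; split.
  by apply: cmeasurable_comp => //; exact: measurable_cVD.
rewrite (@ge0_integral_cVD R d a (fun x => (normc (f x) ^+ 2)%:E))//.
  exact: measurable_normc_sqr.
by move=> x; rewrite lee_fin sqr_ge0.
Qed.

Lemma cL2_mulmx (M : 'M[R]_d) f : M \in unitmx -> cLp 2 f -> cLp 2 (fun x => f (M *m x)).
Proof.
move=> uM [mf foo]; split.
  by apply: cmeasurable_comp => //; exact: measurable_mulmx.
rewrite (@ge0_integral_mulmx_prop R d M (fun x => (normc (f x) ^+ 2)%:E))//; last 2 first.
- exact: measurable_normc_sqr.
- by move=> x; rewrite lee_fin sqr_ge0.
have [E _] := mxscale_fin uM; rewrite -/(mxscale M) E lte_mul_pinfty//.
by rewrite lee_fin fine_ge0// measure_ge0.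
Qed.

Lemma nn_mulmx (M : 'M[R]_d) f : M \in unitmx -> cLp 2 f ->
  nn (fun x => f (M *m x)) = fine (mxscale M) * nn f.
Proof.
move=> uM Lf; apply: EFin_inj; rewrite EFinM -(nnE Lf) -(nnE (cL2_mulmx uM Lf)).
rewrite (@ge0_integral_mulmx_prop R d M (fun x => (normc (f x) ^+ 2)%:E))//; last 2 first.
- by apply: measurable_normc_sqr; exact: cL2_meas.
- by move=> x; rewrite lee_fin sqr_ge0.
by have [E _] := mxscale_fin uM; rewrite -/(mxscale M) [in LHS]E.
Qed.

(* With D i the fibre sums of squares, this makes a sequence that converges fast
   in L^2 converge on almost every fibre. *)
Lemma ae_geom (D : nat -> T -> \bar R) :
  (forall i, measurable_fun setT (D i)) -> (forall i x, (0 <= D i x)%E) ->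
  (forall i, (\int[mu]_x D i x <= (16^-1 ^+ i)%:E)%E) ->
  exists2 E : set T, measurable E /\ mu (~` E) = 0%E &
    forall x, E x -> exists2 K : R, 0 <= K & forall i, (D i x <= (K * 4^-1 ^+ i)%:E)%E.
Proof.
move=> mD D0 HD.
(* Of the decay 16^-i, one factor 4^-i makes the integrals of the weighted functions summable; the
   weight 4^i is returned as the pointwise rate. *)
pose F i x : \bar R := ((4 ^+ i)%:E * D i x)%E.
have F0 i x : (0 <= F i x)%E by apply: mule_ge0 => //; rewrite lee_fin exprn_ge0.
have mF i : measurable_fun setT (F i).
  by apply: emeasurable_funM; [exact: measurable_cst|exact: mD].
pose S x := (\sum_(i <oo) F i x)%E.
have mS : measurable_fun setT S.
  by apply: ge0_emeasurable_sum => // i x _ _; exact: F0.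
have S0 x : (0 <= S x)%E by exact: nneseries_ge0.
have Soo : (\int[mu]_x S x < +oo)%E.
  rewrite integral_nneseries//.
  apply: (@le_lt_trans _ _ (\sum_(i <oo) (4^-1 ^+ i)%:E)%E).
    apply: lee_nneseries => i _ //; first by move=> _; exact: integral_ge0.
    rewrite /F ge0_integralZl//.
    apply: le_trans (lee_wpmul2l _ (HD i)) _; first by rewrite lee_fin exprn_ge0.
    rewrite -EFinM lee_fin -exprMn.
    by rewrite (_ : 4 * 16^-1 = 4^-1 :> R)//; field.
  apply: le_lt_trans (ltry (2 : R)).
  apply: lime_le; first by apply: is_cvg_nneseries => i _ _; rewrite lee_fin exprn_ge0.
  apply: nearW => n; rewrite sumEFin lee_fin.
  apply: (@le_trans _ _ (2 - 2 * 4^-1 ^+ n)); last first.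
    have : 0 <= (4^-1 : R) ^+ n by rewrite exprn_ge0.
    lra.
  elim: n => [|n IH]; first by rewrite big_nil expr0 mulr1 subrr.
  rewrite big_nat_recr//= exprS; have : 0 <= (4^-1 : R) ^+ n by rewrite exprn_ge0.
  by move: IH; lra.
pose E := [set x | (S x < +oo)%E].
have mE : measurable E by rewrite -[X in measurable X]setTI; exact: emeasurable_fun_infty_o.
exists E; first split=> //.
  have iS : mu.-integrable setT S.
    apply/integrableP; split=> //; under eq_integral do rewrite gee0_abs//.
    exact: Soo.
  have := integrable_ae measurableT iS.
  move=> [N [mN N0 EN]]; apply/eqP; rewrite eq_le measure_ge0 andbT -N0.
  apply: le_measure; rewrite ?inE//; first exact: measurableC.
  move=> x /= xE; apply: EN => /= /(_ I); rewrite ge0_fin_numE//; exact: xE.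
move=> x Ex; exists (fine (S x)); first by rewrite fine_ge0.
move=> i; have h : (F i x <= S x)%E.
  apply: le_trans (@nneseries_lim_ge R (fun i => F i x) xpredT 0 i.+1 _) => //.
  by rewrite big_nat_recr//= leeDr// sume_ge0.
have Sx : S x = (fine (S x))%:E by rewrite fineK// ge0_fin_numE.
rewrite -(@lee_pmul2l _ (4 ^+ i)%:E)//.
by rewrite -EFinM mulrCA -exprMn divff// expr1n mulr1 -Sx.
Qed.

Lemma ae_of_set (E : set T) (P : T -> Prop) : measurable E -> mu (~` E) = 0%E ->
  (forall x, E x -> P x) -> {ae mu, forall x, P x}.
Proof.
move=> mE E0 EP; exists (~` E); split; [exact: measurableC|exact: E0|].
by move=> x /= nP Ex; exact/nP/EP.
Qed.

Lemma fatou_sqr (s : nat -> T -> C R) W (c : \bar R) : (forall i, cmeasurable (s i)) ->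
  cmeasurable W -> {ae mu, forall x, s i x @[i --> \oo] --> (W x : C R)} ->
  (forall i, (\int[mu]_x (normc (s i x) ^+ 2)%:E <= c)%E) ->
  (\int[mu]_x (normc (W x) ^+ 2)%:E <= c)%E.
Proof.
move=> ms mW sW sc.
pose G i x := (normc (s i x) ^+ 2)%:E.
have mG i : measurable_fun setT (G i) by exact: measurable_normc_sqr.
have G0 i x : setT x -> (0 <= G i x)%E by rewrite lee_fin sqr_ge0.
have -> : (\int[mu]_x (normc (W x) ^+ 2)%:E = \int[mu]_x limn_einf (G ^~ x))%E.
  apply: ae_eq_integral => //.
  - exact: measurable_normc_sqr.
  - have -> : (fun x => limn_einf (G ^~ x)) = (fun x => - limn_esup (fun i => - G i x))%E.
      by apply/funext => x; rewrite -[LHS]oppeK -limn_esupN.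
    apply: measurableT_comp; first exact: oppe_measurable.
    by apply: measurable_fun_limn_esup => i; apply: measurableT_comp (mG i); exact: oppe_measurable.
  apply: filterS sW => x sx _; apply/esym; apply: (cvg_limn_einf_sup _).1.
  apply/cvg_EFin; first exact: nearW.
  suff ns : normc (s i x) @[i --> \oo] --> normc (W x) by exact: (cvgM ns ns).
  apply/cvgrPdist_lt => e e0; have /cvgc_lt/(_ _ e0) := sx; apply: filterS => i.
  apply: le_lt_trans; rewrite ler_norml.
  have := normcD (W x - s i x) (s i x); have := normcD (s i x - W x) (W x).
  by rewrite !subrK [normc (s i x - W x)]normc_distC; lra.
apply: le_trans (fatou mu measurableT mG G0) _.
rewrite limn_einf_lim; apply: lime_le; first exact: is_cvg_einfs.
apply: nearW => n; apply: le_trans (sc n).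
by apply: ereal_inf_lbound; exists n => /=.
Qed.

Lemma cauchy_sub (V : zmodType) (nrm : V -> R) (u : nat -> V) : cauchy_for nrm u ->
  exists s : nat -> nat, (forall i, (i <= s i)%N) /\
    forall i k l, (s i <= k)%N -> (s i <= l)%N -> nrm (u k - u l) < 4^-1 ^+ i.
Proof.
move=> cu; have /choice[N HN] : forall i : nat, exists N : nat, forall k l, (N <= k)%N -> (N <= l)%N ->
    nrm (u k - u l) < 4^-1 ^+ i.
  by move=> i; apply: cu; rewrite exprn_gt0.
exists (fun i => i + N i)%N; split; first by move=> i; rewrite leq_addr.
by move=> i k l ik il; apply: HN; rewrite (leq_trans _ ik, leq_trans _ il)// leq_addl.
Qed.

(** The squared increments have integral at most 16^-i, so by [ae_geom] the increments are O(2^-i)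
    at almost every point. W is the pointwise limit there and 0 elsewhere, and Fatou's lemma turns
    the telescoped bound into the rate. *)
Lemma riesz_fischer (s : nat -> T -> C R) : (forall i, cLp 2 (s i)) ->
  (forall i, n2 (fun x => s i.+1 x - s i x) <= 4^-1 ^+ i) ->
  exists W, [/\ cLp 2 W, {ae mu, forall x, s i x @[i --> \oo] --> (W x : C R)} &
    forall i, n2 (fun x => s i x - W x) <= 2 * 4^-1 ^+ i].
Proof.
move=> Ls ds.
have q0 i : 0 <= (4^-1 : R) ^+ i by rewrite exprn_ge0.
have far i k : n2 (fun x => s (k + i)%N x - s i x) <= 2 * 4^-1 ^+ i.
  (* The subtracted term 2 * 4^-k is the slack with which the induction on k closes. *)
  have : n2 (fun x => s (k + i)%N x - s i x) <= (2 - 2 * 4^-1 ^+ k) * 4^-1 ^+ i.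
    elim: k => [|k IH].
      have -> : (fun x => s (0 + i)%N x - s i x) = (fun=> 0).
        by apply/funext => x; rewrite subrr.
      rewrite /n2 /nn normc0 expr0n /Rintegral integral0 //= sqrtr0 expr0.
      by rewrite mulr1 subrr mul0r.
    have -> : (fun x => s (k.+1 + i)%N x - s i x) =
        (fun x => (s (k + i).+1 x - s (k + i)%N x) + (s (k + i)%N x - s i x)).
      by apply/funext => x; rewrite addrA subrK.
    apply: le_trans (n2D (cL2B (Ls _) (Ls _)) (cL2B (Ls _) (Ls _))) _.
    have := ds (k + i)%N; have := IH; rewrite exprD exprS.
    have := mulr_ge0 (q0 k) (q0 i); lra.
  have := mulr_ge0 (q0 k) (q0 i); lra.
pose D i x := normc (s i.+1 x - s i x) ^+ 2.
have [E [mE E0] HE] : exists2 E : set T, measurable E /\ mu (~` E) = 0%E &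
    forall x, E x -> exists2 K : R, 0 <= K & forall i, ((D i x)%:E <= (K * 4^-1 ^+ i)%:E)%E.
  apply: (ae_geom (D := fun i x => (D i x)%:E)) => [i|i x|i].
  - by apply: measurable_normc_sqr; apply: cL2_meas; exact: cL2B.
  - by rewrite lee_fin sqr_ge0.
  rewrite nnE; last exact: cL2B.
  rewrite lee_fin -n2_sqr (_ : 16^-1 = 4^-1 ^+ 2 :> R); last by field.
  by rewrite exprAC lerXn2r ?nnegrE ?n2_ge0.
have conv x : E x -> exists l : C R, forall e : R, 0 < e -> exists N, forall k, (N <= k)%N -> normc (s k x - l) < e.
  move=> Ex; apply: cauchy_C_cvg => e e0; have [K K0 HK] := HE x Ex.
  (* K + 1 stands in for the square root of K. *)
  have step i : normc (s i.+1 x - s i x) <= (K + 1) * 2^-1 ^+ i.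
    rewrite -(@ler_pXn2r _ 2) ?nnegrE ?normc_ge0 ?mulr_ge0 ?exprn_ge0//; last lra.
    have := HK i; rewrite lee_fin => HKi; apply: le_trans HKi _; rewrite exprMn exprAC (_ : 2^-1 ^+ 2 = 4^-1 :> R); last by field.
    rewrite ler_wpM2r// expr2; nra.
  have fr i k : normc (s (k + i)%N x - s i x) <= (2 - 2 * 2^-1 ^+ k) * ((K + 1) * 2^-1 ^+ i).
    elim: k => [|k IH]; first by rewrite add0n subrr normc0 expr0 mulr1 subrr mul0r.
    have -> : s (k.+1 + i)%N x - s i x = (s (k + i).+1 x - s (k + i)%N x) + (s (k + i)%N x - s i x).
      by rewrite addrA subrK.
    apply: le_trans (normcD _ _) _; have := step (k + i)%N; have := IH; rewrite exprD exprS.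
    lra.
  have fr' i k : (i <= k)%N -> normc (s k x - s i x) <= 2 * ((K + 1) * 2^-1 ^+ i).
    move=> ik; rewrite -(subnK ik); apply: le_trans (fr i (k - i)%N) _.
    rewrite ler_wpM2r ?mulr_ge0 ?exprn_ge0//; first lra.
    have : 0 <= (2^-1 : R) ^+ (k - i) by rewrite exprn_ge0.
    lra.
  have : (fun i => 4 * (K + 1) * 2^-1 ^+ i) @ \oo --> (4 * (K + 1) * 0 : R).
    by apply: cvgMr; apply: cvg_expr; rewrite ger0_norm; lra.
  rewrite mulr0 => /cvgrPdist_lt/(_ e e0)[N _ HN]; exists N => k l Nk Nl.
  have -> : s k x - s l x = (s k x - s N x) - (s l x - s N x) by rewrite opprB addrA subrK.
  apply: le_lt_trans (normcB _ _) _.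
  have := fr' _ _ Nk; have := fr' _ _ Nl; have := HN N (leqnn N).
  by rewrite /= sub0r normrN ltr_norml => /andP[_]; lra.
pose W x : C R := xget 0 [set l | E x /\ forall e : R, 0 < e -> exists N, forall k, (N <= k)%N -> normc (s k x - l) < e].
have sW x : E x -> s i x @[i --> \oo] --> (W x : C R).
  move=> Ex; have [l Hl] := conv x Ex; rewrite /W; case: xgetP => [w -> [_ Hw]|/(_ l)].
    by apply/cvgc_lt => e /Hw[N HN]; exists N => // k Nk /=; rewrite normc_distC; exact: HN.
  by case.
have W0 x : ~ E x -> W x = 0 by move=> nE; rewrite /W; case: xgetP => // w _ [].
have sE x : (fun i => (\1_E x)%:C%C * s i x) @ \oo --> (W x : C R).
  have [Ex|nE] := pselect (E x).
    have -> : (fun i => (\1_E x)%:C%C * s i x) = (fun i => s i x) :> (nat -> C R).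
      by apply/funext => i; rewrite indicE mem_set// mul1r.
    exact: sW.
  have -> : (fun i => (\1_E x)%:C%C * s i x) = (fun=> 0) :> (nat -> C R).
    by apply/funext => i; rewrite indicE memNset// mul0r.
  by apply/cvgc_lt => e e0; apply: nearW => i; rewrite (W0 _ nE) subrr normc0.
have mW : cmeasurable W.
  apply: cvgn_cmeasurable sE => i; apply: cmeasurableM; last exact: cL2_meas.
  exact: cmeasurable_indic.
have aeW' : {ae mu, forall x, s i x @[i --> \oo] --> (W x : C R)}.
  exact: ae_of_set mE E0 sW.
have key i : (\int[mu]_x (normc (s i x - W x) ^+ 2)%:E <= ((2 * 4^-1 ^+ i) ^+ 2)%:E)%E.
  have -> : (\int[mu]_x (normc (s i x - W x) ^+ 2)%:E = \int[mu]_x (normc (W x - s i x) ^+ 2)%:E)%E.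
    by apply: eq_integral => x _; rewrite normc_distC.
  apply: (@fatou_sqr (fun k x => s (k + i)%N x - s i x) (fun x => W x - s i x)).
  - by move=> k; apply: cL2_meas; exact: cL2B.
  - by apply: cmeasurableB => //; exact: cL2_meas.
  - apply: filterS aeW' => x sx; apply: cvgB; last exact: cvg_cst.
    by rewrite (cvg_shiftn i (fun i => s i x)).
  move=> k; rewrite nnE; last exact: cL2B.
  by rewrite lee_fin -n2_sqr lerXn2r ?nnegrE ?n2_ge0 ?mulr_ge0.
have LsW i : cLp 2 (fun x => s i x - W x).
  split; first by apply: cmeasurableB => //; exact: cL2_meas.
  by apply: le_lt_trans (key i) _; rewrite ltry.
exists W; split=> //.
  have := cL2B (Ls 0%N) (LsW 0%N); congr cLp; apply/funext => x.
  by rewrite opprB addrC subrK.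
by move=> i; apply: n2_le; rewrite ?mulr_ge0// -lee_fin -nnE.
Qed.

End L2_theory.

(** * Classes of square-integrable functions and completeness of L^2 *)

Section L2_quotient.
Context (R : realType) (d : nat).
Local Notation T := 'cV[R]_d.
Local Notation mu := (cV_lebesgue R d).
Local Open Scope quotient_scope.
Implicit Types (f g : T -> C R) (u v : L2 R d).

Lemma pi_L2_eqP (f g : L2fun R d) :
  \pi_(L2 R d) f = \pi_(L2 R d) g <-> {ae mu, forall x, f x = g x}.
Proof.
have E : (f - g \in @ae0_pred R d) <-> {ae mu, forall x, f x = g x}.
  split=> [/asboolP|fg]; last first.
    by apply/asboolP; apply: filterS fg => x fx; rewrite [LHS](_ : _ = f x - g x)// fx subrr.
  apply: filterS => x /eqP; rewrite [X in X == _](_ : _ = f x - g x)// subr_eq0.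
  by move=> /eqP.
by rewrite -E Quotient.idealrBE; split=> [->|/eqP].
Qed.

Lemma L2rep_cL2 u : cLp 2 (L2rep u).
Proof. by have /asboolP := valP (repr u). Qed.

Lemma L2rep_meas u : cmeasurable (L2rep u). Proof. exact: cL2_meas (L2rep_cL2 u). Qed.

Lemma toL2E f (Lf : cLp 2 f) : exists2 F : L2fun R d, toL2 f = \pi_(L2 R d) F & (F : T -> C R) = f.
Proof.
exists (insubd (0 : L2fun R d) f) => //; rewrite val_insubd.
by rewrite (_ : f \in _)//; exact/asboolP.
Qed.

Lemma toL2_rep u : toL2 (L2rep u) = u.
Proof. by rewrite /toL2 /L2rep valKd reprK. Qed.

Lemma L2rep_toL2 f : cLp 2 f -> {ae mu, forall x, L2rep (toL2 f) x = f x}.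
Proof.
move=> Lf; have [F -> <-] := toL2E Lf; apply/(pi_L2_eqP (repr (\pi_(L2 R d) F)) F).
exact: reprK.
Qed.

Lemma toL2_ae f g : cLp 2 f -> cLp 2 g -> {ae mu, forall x, f x = g x} -> toL2 f = toL2 g.
Proof.
move=> Lf Lg; have [F -> <-] := toL2E Lf; have [G -> <-] := toL2E Lg.
by move=> /pi_L2_eqP.
Qed.

Lemma toL2D f g : cLp 2 f -> cLp 2 g -> toL2 (fun x => f x + g x) = toL2 f + toL2 g.
Proof.
move=> Lf Lg; have [F -> FE] := toL2E Lf; have [G -> GE] := toL2E Lg.
have [H -> HE] := toL2E (cL2D Lf Lg).
transitivity (\pi_(L2 R d) (F + G)); last exact: Quotient.pi_add.
by apply/pi_L2_eqP; apply: aeW => x; rewrite HE -FE -GE.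
Qed.

Lemma toL2Z (k : R[i]) f : cLp 2 f -> toL2 (fun x => k * f x) = k *: toL2 f.
Proof.
move=> Lf; have [F -> FE] := toL2E Lf; have [H -> HE] := toL2E (cL2Z k Lf).
transitivity (\pi_(L2 R d) (k *: F)); last exact: pi_L2scale.
by apply/pi_L2_eqP; apply: aeW => x; rewrite HE -FE.
Qed.

Lemma toL2B f g : cLp 2 f -> cLp 2 g -> toL2 (fun x => f x - g x) = toL2 f - toL2 g.
Proof.
move=> Lf Lg; rewrite -scaleN1r -(toL2Z _ Lg) -(toL2D Lf (cL2Z _ Lg)).
by congr toL2; apply/funext => x; rewrite cN1.
Qed.

Lemma L2repD u v : {ae mu, forall x, L2rep (u + v) x = L2rep u x + L2rep v x}.
Proof.
have := L2rep_toL2 (cL2D (L2rep_cL2 u) (L2rep_cL2 v)).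
by rewrite (toL2D (L2rep_cL2 u) (L2rep_cL2 v)) !toL2_rep.
Qed.

Lemma L2repZ (k : R[i]) u : {ae mu, forall x, L2rep (k *: u) x = k * L2rep u x}.
Proof.
have := L2rep_toL2 (cL2Z k (L2rep_cL2 u)).
by rewrite (toL2Z k (L2rep_cL2 u)) !toL2_rep.
Qed.

Lemma L2norm_n2 u : L2norm u = n2 (L2rep u). Proof. by []. Qed.

Lemma L2norm_toL2 f : cLp 2 f -> L2norm (toL2 f) = n2 f.
Proof.
by move=> Lf; apply: n2_ae; [exact: L2rep_meas|exact: cL2_meas|exact: L2rep_toL2].
Qed.

Lemma L2norm_toL2B f g : cLp 2 f -> cLp 2 g -> L2norm (toL2 f - toL2 g) = n2 (fun x => f x - g x).
Proof. by move=> Lf Lg; rewrite -(toL2B Lf Lg) (L2norm_toL2 (cL2B Lf Lg)). Qed.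

Lemma L2normZ (k : R[i]) u : L2norm (k *: u) = normc k * L2norm u.
Proof.
rewrite -{1}(toL2_rep u) -(toL2Z _ (L2rep_cL2 u)).
rewrite (L2norm_toL2 (cL2Z k (L2rep_cL2 u))); exact: (n2Z k (L2rep_cL2 u)).
Qed.

Lemma L2norm_eq0 u : L2norm u = 0 -> u = 0.
Proof.
move=> u0; have nu : nn (L2rep u) = 0 by rewrite -n2_sqr -L2norm_n2 u0 expr0n.
have h := nn_eq0 (L2rep_cL2 u) nu.
rewrite -(toL2_rep u) -(scale0r u) -{2}(toL2_rep u) -(toL2Z 0 (L2rep_cL2 u)).
apply: toL2_ae; [exact: L2rep_cL2|exact: cL2Z (L2rep_cL2 u)|].
by apply: filterS h => x ->; rewrite mulr0.
Qed.

Lemma L2norm_sn : is_seminorm (@L2norm R d).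
Proof.
split.
- move=> u v; rewrite -{1}(toL2_rep u) -{1}(toL2_rep v) -(toL2D (L2rep_cL2 u) (L2rep_cL2 v)).
  rewrite (L2norm_toL2 (cL2D (L2rep_cL2 u) (L2rep_cL2 v))).
  exact: (n2D (L2rep_cL2 u) (L2rep_cL2 v)).
- by move=> u; rewrite -scaleN1r L2normZ normcN normc1 mul1r.
- by rewrite -(scale0r (0 : L2 R d)) L2normZ normc0 mul0r.
Qed.

Lemma L2norm_ge0 u : 0 <= L2norm u. Proof. exact: (sn_ge0 L2norm_sn). Qed.

Lemma L2_sub_cvg (u : nat -> L2 R d) : cauchy_for (@L2norm R d) u ->
  exists (s : nat -> nat) (l : L2 R d), [/\ forall i, (i <= s i)%N, cvg_for (@L2norm R d) u l,
    forall i, L2norm (u (s i) - l) <= 2 * 4^-1 ^+ i &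
    {ae mu, forall x, L2rep (u (s i)) x @[i --> \oo] --> (L2rep l x : C R)}].
Proof.
move=> cu; have [s [si Hs]] := cauchy_sub cu.
(* The indices s i need not increase with i; their partial sums do, and they still dominate s i. *)
pose t := fix t i := if i is i'.+1 then (s i'.+1 + t i')%N else s 0%N.
have st i : (s i <= t i)%N by case: i => [|i] //=; rewrite leq_addr.
have tS i : (t i <= t i.+1)%N by rewrite /= leq_addl.
have L i := L2rep_cL2 (u (t i)).
have ds i : n2 (fun x => L2rep (u (t i.+1)) x - L2rep (u (t i)) x) <= 4^-1 ^+ i.
  rewrite -(L2norm_toL2B (L _) (L _)) !toL2_rep; apply: ltW; apply: Hs => //.
  exact: leq_trans (st i) (tS i).
have [W [LW aeW' HW]] := riesz_fischer L ds.
have tl i : L2norm (u (t i) - toL2 W) <= 2 * 4^-1 ^+ i.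
  by rewrite -{1}(toL2_rep (u (t i))) (L2norm_toL2B (L i) LW); exact: HW.
exists t, (toL2 W); split.
- by move=> i; exact: leq_trans (si i) (st i).
- apply/(cvg_forP L2norm_sn) => e e0.
  have : (fun i => 3 * 4^-1 ^+ i) @ \oo --> (3 * 0 : R).
    by apply: cvgMr; apply: cvg_expr; rewrite ger0_norm; lra.
  rewrite mulr0 => /cvgrPdist_lt/(_ e e0)[N _ /(_ N (leqnn N))] /=.
  rewrite sub0r normrN ltr_norml => /andP[_ HN].
  exists (s N) => k Nk; apply: le_lt_trans HN.
  apply: le_trans (sn_tri (L2norm_sn) (u (t N)) _ _) _.
  have := Hs N k (t N) Nk (st N); have := tl N; lra.
- exact: tl.
have h := L2rep_toL2 LW.
by apply: filterS2 aeW' h => x h1 h2; rewrite h2; exact: h1.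
Qed.

Lemma L2_complete (u : nat -> L2 R d) : cauchy_for (@L2norm R d) u ->
  exists l, cvg_for (@L2norm R d) u l.
Proof. by move=> /L2_sub_cvg[s [l [_ ul _ _]]]; exists l. Qed.

End L2_quotient.

(** * The Fourier transform of integrable functions *)

Section fourier.
Context (R : realType) (d : nat).
Local Notation T := 'cV[R]_d.
Local Notation mu := (cV_lebesgue R d).
Local Notation Z := 'cV[int]_d.
Implicit Types (f w : T -> C R).

Lemma cL1_modul w xi : cL1 w -> cL1 (modul w xi).
Proof.
move=> Lw; apply: (cL1_bndM (K := 1) Lw); last by move=> x; rewrite normc_ce.
by apply: cmeasurable_continuous; exact: continuous_cedot.
Qed.

Lemma fourier1D f w xi : cL1 f -> cL1 w ->
  fourier1 (fun x => f x + w x) xi = fourier1 f xi + fourier1 w xi.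
Proof.
move=> Lf Lw; rewrite !fourier1E -cintegralD; try exact: cL1_modul.
by congr cintegral; apply/funext => x; rewrite /modul mulrDl.
Qed.

Lemma fourier1Z (k : C R) f xi : cL1 f -> fourier1 (fun x => k * f x) xi = k * fourier1 f xi.
Proof.
move=> Lf; rewrite !fourier1E -cintegralZ; last exact: cL1_modul.
by congr cintegral; apply/funext => x; rewrite /modul mulrA.
Qed.

Lemma fourier1B f w xi : cL1 f -> cL1 w ->
  fourier1 (fun x => f x - w x) xi = fourier1 f xi - fourier1 w xi.
Proof.
move=> Lf Lw; rewrite !fourier1E -cintegralB; try exact: cL1_modul.
by congr cintegral; apply/funext => x; rewrite /modul mulrBl.
Qed.

Lemma fourier1_ae f w : cmeasurable f -> cmeasurable w -> {ae mu, forall x, f x = w x} ->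
  fourier1 f = fourier1 w.
Proof.
move=> mf mw fw; apply/funext => xi; rewrite !fourier1E.
have mc : cmeasurable (fun y : T => ce (dotc xi y) : C R).
  by apply: cmeasurable_continuous; exact: continuous_cedot.
apply: cintegral_ae; [exact: cmeasurableM|exact: cmeasurableM|].
by apply: filterS fw => x fx; rewrite /modul fx.
Qed.

Lemma normc_fourier1 w xi : cL1 w -> normc (fourier1 w xi) <= 2 * \int[mu]_x normc (w x).
Proof.
move=> Lw; rewrite fourier1E; apply: le_trans (normc_cintegral (cL1_modul xi Lw)) _.
rewrite (_ : (fun x => normc (modul w xi x)) = (fun x => normc (w x)))//.
by apply/funext => x; rewrite /modul normcM' normc_ce mulr1.
Qed.

Lemma dotc_near0 (N e : R) : 0 <= N -> 0 < e ->
  \forall h \near (0 : T), forall x, @cbox R d N x -> `|dotc h x| < e.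
Proof.
move=> N0 e0; pose K := d%:R * (N + 1) : R.
have K0 : 0 <= K by rewrite mulr_ge0//; lra.
have eK : 0 < e / (K + 1) by rewrite divr_gt0//; lra.
near=> h => x xN; have hK : forall i, `|h i 0| < e / (K + 1).
  near: h; apply: filter_forall => i.
  have /cvgrPdist_lt/(_ _ eK) := @continuous_coord R d i 0.
  by apply: filterS => h; rewrite mxE sub0r normrN.
apply: (@le_lt_trans _ _ (\sum_(i < d) e / (K + 1) * (N + 1))).
  apply: le_trans (ler_norm_sum _ _ _) _; apply: ler_sum => i _.
  rewrite normrM ler_pM//; first exact: ltW.
  have := xN i; rewrite /= in_itv /= -ler_norml; lra.
rewrite sumr_const card_ord -mulr_natr -mulrA [_ * d%:R]mulrC -/K.
by rewrite mulrAC ltr_pdivrMr; lra.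
Unshelve. all: by end_near. Qed.

(** On the bounded support of w the phase (h - xi).x is uniformly small when h is close to xi.
    Continuity is the source of measurability of the transform, first here and then through
    truncations. *)
Lemma fourier1_continuous w (N : R) : cL1 w -> 0 <= N -> (forall x, w x != 0 -> @cbox R d N x) ->
  continuous (fourier1 w).
Proof.
move=> Lw N0 wN xi; apply/(@cvgc_lt R T _ (nbhs_filter xi)) => e e0.
pose I := \int[mu]_x normc (w x); have I0 : 0 <= I by apply: Rintegral_ge0 => x _; rewrite normc_ge0.
have e1 : 0 < e / (2 * I + 1) by rewrite divr_gt0//; lra.
have [r r0 Hr] : exists2 r : R, 0 < r & forall t, `|t| < r -> normc (1 - ce t : C R) < e / (2 * I + 1).
  have /cvgc_lt/(_ _ e1) := @continuous_ce R 0; rewrite ce0 => /nbhs_ballP[r /= r0 Hr].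
  by exists r => // t tr; apply: Hr; rewrite /ball /= sub0r normrN.
have H0 := dotc_near0 N0 r0.
have cs : (fun h : T => h - xi) h @[h --> xi] --> (0 : T).
  have := @continuous_shift R d (- xi) xi; rewrite /continuous_at /=.
  by have -> : (xi - xi : T) = 0 by exact: subrr.
have := cs _ H0; apply: (@filterS T (nbhs xi) (nbhs_filter xi)) => h Hh.
change (normc (fourier1 w xi - fourier1 w h) < e).
have Lc : cL1 (fun x => modul w xi x * (1 - ce (dotc (h - xi) x))).
  apply: (cL1_bndM (K := 2) (cL1_modul xi Lw)).
    apply: cmeasurableB; first exact: cmeasurable_cst.
    by apply: cmeasurable_continuous; exact: continuous_cedot.
  by move=> x; apply: le_trans (normcB _ _) _; rewrite normc_ce normc1; lra.
have -> : fourier1 w xi - fourier1 w h = cintegral (fun x => modul w xi x * (1 - ce (dotc (h - xi) x))).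
  rewrite !fourier1E -cintegralB; try exact: cL1_modul.
  congr cintegral; apply/funext => x; rewrite /modul mulrBr mulr1 -mulrA -ceD.
  by rewrite -dotcDl [xi + _]addrC subrK.
apply: le_lt_trans (normc_cintegral Lc) _.
apply: (@le_lt_trans _ _ (2 * (e / (2 * I + 1) * I))).
  rewrite ler_wpM2l// /I -RintegralZl//; last exact: cL1_normc.
  apply: le_Rintegral => //; first exact: cL1_normc.
    by apply: (integrableZl measurableT _ (cL1_normc Lw)).
  move=> x _; rewrite normcM' /modul normcM' normc_ce mulr1 mulrC.
  have [->|wx] := eqVneq (w x) 0; first by rewrite normc0 !mulr0.
  by rewrite ler_wpM2r ?normc_ge0//; apply: ltW; apply: Hr; exact: Hh (wN _ wx).
have -> : 2 * (e / (2 * I + 1) * I) = (2 * I * e) / (2 * I + 1) by ring.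
by rewrite ltr_pdivrMr; nra.
Qed.

Lemma fourier1_pullL (M : 'M[R]_d) f xi : M \in unitmx -> cL1 f ->
  fourier1 (pull M f) (M^T *m xi) = (((fine (mxscale M))%:C)%C : C R) * fourier1 f xi.
Proof.
move=> uM Lf; rewrite !fourier1E -(cintegral_mulmx uM (kp_fin uM) (cL1_modul xi Lf)).
congr cintegral; apply/funext => x; rewrite /modul /pull; congr (_ * ce _).
by rewrite dotc_mulmx trmxK.
Qed.

Lemma fourier1_shift a f xi : cL1 f ->
  fourier1 (fun x => f (x - a)) xi = ce (dotc xi a) * fourier1 f xi.
Proof.
move=> Lf; rewrite !fourier1E -cintegralZ; last exact: cL1_modul.
have L : cL1 (modul (fun x => f (x - a)) xi).
  by apply: cL1_modul; exact: (cL1_shift (- a) Lf).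
rewrite -(@cintegral_shift R d a); last by case: L.
congr cintegral; apply/funext => x; rewrite /modul addrK mulrCA; congr (_ * _).
by rewrite dotcDr ceD mulrC.
Qed.

(* The values of the transform on x + Z^d are Fourier coefficients of w times a
   character, a function on the cube: apply Bessel and integrate over x. *)
Lemma plancherel_le_cube w (K : R) : cmeasurable w -> (forall x, normc (w x) <= K) ->
  (forall x, ~ @cube R d x -> w x = 0) -> cmeasurable (fourier1 w) ->
  (\int[mu]_x (normc (fourier1 w x) ^+ 2)%:E <= (nn w)%:E)%E.
Proof.
move=> mw wK w0 mF.
have bm x : bmeas (modul w x).
  split; last by exists K => y; rewrite /modul normcM' normc_ce mulr1.
  apply: cmeasurableM => //; apply: cmeasurable_continuous; exact: continuous_cedot.
have E x k : fc (modul w x) (- k) = fourier1 w (x + zv R k).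
  rewrite fourier1E /fc /ipc /cubeint; congr cintegral; apply/funext => y.
  rewrite IcubeE; case: ifPn => [_|]; last first.
    by move=> /negP h; rewrite mul0r /modul w0 ?mul0r// => cy; apply: h; exact/mem_set.
  rewrite mul1r ezNl cjK /modul mulrCA -ceD dotcDl addrC; congr (_ * ce _).
have H x : (\esum_(k in [set: Z]) (normc (fourier1 w (x + zv R k)) ^+ 2)%:E <= (nn w)%:E)%E.
  apply: ge_ereal_sup => _ [X [fX _] <-]; rewrite fsbig_finite// sumEFin lee_fin.
  have us : uniq [seq - k | k <- finmap.enum_fset (fset_set X)].
    by rewrite map_inj_uniq ?finmap.fset_uniq//; exact: oppr_inj.
  have := bessel (bm x) us; rewrite big_map; under eq_bigr do rewrite E.
  move=> h; apply: le_trans h _.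
  rewrite le_eqVlt; apply/orP; left; apply/eqP; congr Rintegral; apply/funext => y.
  rewrite /modul normcM' normc_ce mulr1 indicE.
  have [cy|ncy] := boolP (y \in @cube R d); first by rewrite mul1r.
  by rewrite mul0r w0 ?normc0 ?expr0n// => cy; move: ncy; rewrite mem_set.
rewrite ge0_integral_unfold//; last 2 first.
- exact: measurable_normc_sqr.
- by move=> x; rewrite lee_fin sqr_ge0.
apply: (@le_trans _ _ (\int[mu]_x ((\1_(@cube R d) x)%:E * (nn w)%:E))%E).
  apply: ge0_le_integral => //.
  - move=> x _; apply: mule_ge0; first by rewrite lee_fin.
    by apply: esum_ge0 => k _; rewrite lee_fin sqr_ge0.
  - apply: emeasurable_funM; first by apply/measurable_EFinP; apply: measurable_indic; exact: measurable_cube.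
    apply: measurable_esum => [k x|k]; first by rewrite lee_fin sqr_ge0.
    apply: measurable_normc_sqr; apply: cmeasurable_comp => //; exact: measurable_cVD.
  - by apply: emeasurable_funM => //; apply/measurable_EFinP; apply: measurable_indic; exact: measurable_cube.
  by move=> x _; apply: lee_wpmul2l => //; rewrite lee_fin.
rewrite ge0_integralZr//; last 2 first.
- by apply/measurable_EFinP; apply: measurable_indic; exact: measurable_cube.
- by rewrite lee_fin nn_ge0.
rewrite -cV_lebesgue_indic; last exact: measurable_cube.
by rewrite cV_lebesgue_cube mul1e.
Qed.

Lemma Rbnd_meas (w : T -> C R) (N K : R) : cmeasurable w -> (forall x, normc (w x) <= K) ->
  (forall x, ~ @cbox R d N x -> w x = 0) -> cLp 1 w /\ cLp 2 w.
Proof.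
move=> mw wK w0; have L1 : cL1 w.
  apply: (cL1_bnd (A := @cbox R d N) (K := K)) => //; first exact: measurable_cbox.
  exact: cV_lebesgue_cbox.
split=> //; split=> //.
have [_] := cL1_bndM L1 mw wK; apply: le_lt_trans.
rewrite (_ : (fun x => (normc (w x) ^+ 2)%:E) = (fun x => (normc (w x * w x))%:E))//.
by apply/funext => x; rewrite normcM'.
Qed.

Lemma fourier1_box_meas w (N K : R) : 0 <= N -> cmeasurable w -> (forall x, normc (w x) <= K) ->
  (forall x, ~ @cbox R d N x -> w x = 0) -> cmeasurable (fourier1 w).
Proof.
move=> N0 mw wK w0; apply: cmeasurable_continuous.
apply: (fourier1_continuous (N := N)) => //; first by case: (Rbnd_meas mw wK w0).
by move=> x wx; apply: contrapT => /w0 wx0; rewrite wx0 eqxx in wx.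
Qed.

(** The affine map y |-> (y + N)/(2 N + 1) sends the box into the half-open cube, where
    [plancherel_le_cube] applies; 2 N + 1 keeps the face y = N inside and is nonzero for N = 0. The
    translation is a phase on the transform, and the powers of the scale k cancel. *)
Lemma plancherel_le_box w (N K : R) : 0 <= N -> cmeasurable w -> (forall x, normc (w x) <= K) ->
  (forall x, ~ @cbox R d N x -> w x = 0) ->
  (\int[mu]_x (normc (fourier1 w x) ^+ 2)%:E <= (nn w)%:E)%E.
Proof.
move=> N0 mw wK w0; have [L1 L2] := Rbnd_meas mw wK w0.
have mF := fourier1_box_meas N0 mw wK w0.
pose S : 'M[R]_d := (2 * N + 1)%:M; pose a : T := \col__ N.
have s0 : 0 < 2 * N + 1 by lra.
have uS : S \in unitmx by rewrite unitmxE det_scalar unitfE expf_neq0// gt_eqF.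
have TS : S^T = S by exact: tr_scalar_mx.
have [kE k0] := mxscale_fin uS; set k := fine (mxscale S) in kE k0.
pose wa x := w (x - a); have La : cL1 wa by exact: (cL1_shift (- a) L1).
pose v := pull S wa.
have Ev xi : normc (fourier1 v (S *m xi)) ^+ 2 = k ^+ 2 * normc (fourier1 w xi) ^+ 2.
  rewrite -[in LHS]TS (fourier1_pullL xi uS La) normcM' normc_real gtr0_norm// exprMn.
  by rewrite (fourier1_shift a xi L1) normcM' normc_ce mul1r.
have Lv : cLp 2 v by apply: (cL2_mulmx uS); exact: (cL2_shift (- a) L2).
have mFv : cmeasurable (fourier1 v).
  have -> : fourier1 v = fun xi => ((k%:C)%C : C R) * (ce (dotc (invmx S *m xi) a) * fourier1 w (invmx S *m xi)).
    apply/funext => xi; rewrite -(fourier1_shift a _ L1) -(fourier1_pullL (invmx S *m xi) uS La).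
    by rewrite TS mulKVmx.
  apply: cmeasurableM; first exact: cmeasurable_cst.
  apply: cmeasurableM.
    apply: (@cmeasurable_comp _ _ (fun y => ce (dotc y a))); last exact: measurable_mulmx.
    under [X in cmeasurable X]eq_fun do rewrite dotcC.
    by apply: cmeasurable_continuous; exact: continuous_cedot.
  by apply: (cmeasurable_comp mF); exact: measurable_mulmx.
have H : (\int[mu]_x (normc (fourier1 v x) ^+ 2)%:E <= (k * nn w)%:E)%E.
  have -> : k * nn w = nn v.
    by rewrite (nn_mulmx uS (cL2_shift (- a) L2)) (nn_shift (- a) mw).
  apply: (plancherel_le_cube (K := K)) => //; first exact: cL2_meas.
    by move=> x; exact: wK.
  move=> x xc; apply: w0 => xN; apply: xc => i; have := xN i.
  rewrite /= /S mul_scalar_mx !mxE !in_itv /= => /andP[h1 h2]; apply/andP; split.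
    rewrite -(@ler_pM2l _ (2 * N + 1))// mulr0; lra.
  rewrite -(@ltr_pM2l _ (2 * N + 1))// mulr1; lra.
have := @ge0_integral_mulmx_prop R d S (fun x => (normc (fourier1 v x) ^+ 2)%:E) uS.
move=> /(_ (measurable_normc_sqr mFv)) /(_ (fun x => _))E.
have E2 : (\int[mu]_x (normc (fourier1 v (S *m x)) ^+ 2)%:E = k%:E * \int[mu]_x (normc (fourier1 v x) ^+ 2)%:E)%E.
  by rewrite -kE; apply: E => x; rewrite lee_fin sqr_ge0.
move: E2; under eq_integral do rewrite Ev EFinM.
rewrite ge0_integralZl//; last 3 first.
- exact: measurable_normc_sqr.
- by move=> x _; rewrite lee_fin sqr_ge0.
- by rewrite lee_fin sqr_ge0.
move=> E2; have : ((k ^+ 2)%:E * \int[mu]_x (normc (fourier1 w x) ^+ 2)%:E <= (k ^+ 2)%:E * (nn w)%:E)%E.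
  rewrite E2 -EFinM expr2 -mulrA EFinM; apply: lee_wpmul2l => //.
  by rewrite lee_fin ltW.
by rewrite lee_pmul2l// lte_fin exprn_gt0.
Qed.

(** Cuts off both the position and the size, so that the result falls under [plancherel_le_box];
    measurability of the transform and Plancherel's inequality pass to the limit from there. *)
Definition trunc w (n : nat) : T -> C R :=
  fun x => (((\1_(@cbox R d n%:R `&` [set x | normc (w x) <= n%:R]) x)%:C)%C : C R) * w x.

Lemma truncE w n x : trunc w n x = if `[< @cbox R d n%:R x /\ normc (w x) <= n%:R >] then w x else 0.
Proof.
rewrite /trunc indicE; case: asboolP => h.
  by rewrite mem_set// mul1r.
by rewrite memNset// mul0r.
Qed.

Lemma trunc_meas w n : cmeasurable w -> cmeasurable (trunc w n).
Proof.
move=> mw; apply: cmeasurableM => //; apply: cmeasurable_indic.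
apply: measurableI; first exact: measurable_cbox.
rewrite -[X in measurable X]setTI.
have -> : [set x | normc (w x) <= n%:R] = (fun x => normc (w x)) @^-1` `]-oo, n%:R]%classic.
  by apply/seteqP; split=> x /=; rewrite in_itv.
by apply: (measurable_normc mw) => //; exact: measurable_itv.
Qed.

Lemma trunc_cvg w x : \forall n \near \oo, trunc w n x = w x.
Proof.
pose K := normc (w x) + \sum_i `|x i 0|; exists (Num.trunc K).+1 => // n /= Kn.
rewrite truncE; case: asboolP => // -[].
have h : K < n%:R by apply: lt_le_trans (truncnS_gt _) _; rewrite ler_nat.
have s0 : 0 <= \sum_i `|x i 0| by apply: sumr_ge0.
split; last by have := normc_ge0 (w x); rewrite /K in h; lra.
move=> i; rewrite /= in_itv /= -ler_norml; apply: ltW; apply: le_lt_trans h.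
rewrite /K (bigD1 i)//=; have := normc_ge0 (w x).
have : 0 <= \sum_(j < d | j != i) `|x j 0| by apply: sumr_ge0.
lra.
Qed.

Lemma trunc_le w n x : normc (trunc w n x) <= normc (w x).
Proof. by rewrite truncE; case: asboolP => // _; rewrite normc0 normc_ge0. Qed.

Lemma trunc_bnd w n x : normc (trunc w n x) <= n%:R.
Proof. by rewrite truncE; case: asboolP => [[]//|_]; rewrite normc0. Qed.

Lemma trunc_supp w n x : ~ @cbox R d n%:R x -> trunc w n x = 0.
Proof. by move=> nx; rewrite truncE; case: asboolP => // -[]. Qed.

Lemma trunc_L1_cvg w : cL1 w ->
  (\int[mu]_x normc (w x - trunc w n x)) @[n --> \oo] --> (0 : R).
Proof.
move=> [mw woo]; have mt n := trunc_meas n mw.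
have h := @dominated_convergence _ _ _ mu setT measurableT
  (fun n x => (normc (w x - trunc w n x))%:E) (fun=> 0%E) (fun x => (2 * normc (w x))%:E).
have [//||||_ _] := h _ (measurable_cst _).
- by move=> n; apply/measurable_EFinP; apply: measurable_normc; exact: cmeasurableB.
- apply: aeW => x _; apply: cvg_near_cst; have := trunc_cvg w x.
  by apply: filterS => n ->; rewrite subrr normc0.
- by apply: (integrableZl measurableT (2 : R) (cL1_normc (conj mw woo))).
- apply: aeW => x n _; rewrite gee0_abs ?lee_fin ?normc_ge0//.
  by apply: le_trans (normcB _ _) _; have := trunc_le w n x; lra.
by rewrite integral0 => /fine_cvg.
Qed.

End fourier.

Lemma cvg_for_ext (R : realType) (V : zmodType) (nrm : V -> R) (u w : nat -> V) l :
  (forall k, u k = w k) -> cvg_for nrm u l -> cvg_for nrm w l.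
Proof. by move=> /funext ->. Qed.

Lemma lt_thirds (R : realType) (a b p q x e : R) : a <= b -> b <= p + q ->
  p < e / 3 -> q < e / 3 -> x < e / 3 -> a + x < e.
Proof. lra. Qed.

(** * The Fourier transform on L^2 *)

Section fourier_L2.
Context (R : realType) (d : nat).
Local Notation T := 'cV[R]_d.
Local Notation mu := (cV_lebesgue R d).
Implicit Types (f w : T -> C R).

Lemma trunc_cL1 w n : cmeasurable w -> cLp 1 (trunc w n) /\ cLp 2 (trunc w n).
Proof.
move=> mw; apply: (Rbnd_meas (N := n%:R) (K := n%:R)); first exact: trunc_meas.
  exact: trunc_bnd.
exact: trunc_supp.
Qed.

Lemma fourier1_trunc_cvg w xi : cL1 w -> fourier1 (trunc w n) xi @[n --> \oo] --> (fourier1 w xi : C R).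
Proof.
move=> Lw; have [mw _] := Lw; apply/cvgc_lt => e e0.
have e2 : 0 < e / 2 by rewrite divr_gt0.
have /cvgrPdist_lt/(_ _ e2) := trunc_L1_cvg Lw; apply: filterS => n.
have [Lt _] := trunc_cL1 n mw.
rewrite sub0r normrN -(fourier1B xi Lw Lt) => h.
apply: le_lt_trans (normc_fourier1 xi (cL1B Lw Lt)) _.
have := ler_norm (\int[mu]_x normc (w x - trunc w n x)); lra.
Qed.

Lemma fourier1_meas w : cL1 w -> cmeasurable (fourier1 w).
Proof.
move=> Lw; apply: (cvgn_cmeasurable (F := fun n => fourier1 (trunc w n))) => [n|xi]; last exact: fourier1_trunc_cvg.
have [mw _] := Lw.
apply: (fourier1_box_meas (N := n%:R) (K := n%:R)) => //; first exact: trunc_meas.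
  exact: trunc_bnd.
exact: trunc_supp.
Qed.

Lemma nn_le f w : cLp 2 f -> cLp 2 w -> (forall x, normc (f x) <= normc (w x)) -> nn f <= nn w.
Proof.
move=> Lf Lw fw; rewrite -lee_fin -!nnE//; apply: ge0_le_integral => //.
- by move=> x _; rewrite lee_fin sqr_ge0.
- by apply: measurable_normc_sqr; exact: cL2_meas.
- by apply: measurable_normc_sqr; exact: cL2_meas.
- by move=> x _; rewrite lee_fin lerXn2r ?nnegrE ?normc_ge0.
Qed.

(** The transforms of the truncations converge pointwise and their norms are bounded by that of w,
    so Fatou's lemma applies. *)
Lemma plancherel_le w : cL1 w -> cLp 2 w ->
  (\int[mu]_x (normc (fourier1 w x) ^+ 2)%:E <= (nn w)%:E)%E.
Proof.
move=> L1 L2; have mw := cL2_meas L2.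
apply: (@fatou_sqr _ _ (fun n => fourier1 (trunc w n))).
- by move=> n; apply: fourier1_meas; case: (trunc_cL1 n mw).
- exact: fourier1_meas.
- by apply: aeW => xi; exact: fourier1_trunc_cvg.
move=> n; apply: (@le_trans _ _ (nn (trunc w n))%:E).
  apply: (plancherel_le_box (N := n%:R) (K := n%:R)) => //; first exact: trunc_meas.
    exact: trunc_bnd.
  exact: trunc_supp.
rewrite lee_fin; apply: nn_le => //; first by case: (trunc_cL1 n mw).
exact: trunc_le.
Qed.

Lemma fourier1_cL2 w : cL1 w -> cLp 2 w -> cLp 2 (fourier1 w).
Proof.
move=> L1 L2; split; first exact: fourier1_meas.
by apply: le_lt_trans (plancherel_le L1 L2) _; rewrite ltry.
Qed.

Lemma n2_fourier1_le w : cL1 w -> cLp 2 w -> n2 (fourier1 w) <= n2 w.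
Proof.
move=> L1 L2; apply: ler_wsqrtr; rewrite -lee_fin -nnE; last exact: fourier1_cL2.
exact: plancherel_le.
Qed.

Lemma fourier1_toL2 f : cL1 f -> cLp 2 f -> fourier1 (L2rep (toL2 f)) = fourier1 f.
Proof.
by move=> L1 L2; apply: fourier1_ae; [exact: L2rep_meas|exact: cL2_meas|exact: L2rep_toL2].
Qed.

Lemma cL1_toL2 f : cL1 f -> cLp 2 f -> cL1 (L2rep (toL2 f)).
Proof.
move=> [mf foo] L2; split; first exact: L2rep_meas.
have -> : (\int[mu]_x (normc (L2rep (toL2 f) x))%:E = \int[mu]_x (normc (f x))%:E)%E; last exact: foo.
apply: ae_eq_integral => //.
- by apply/measurable_EFinP; apply: measurable_normc; exact: L2rep_meas.
- by apply/measurable_EFinP; apply: measurable_normc.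
by apply: filterS (L2rep_toL2 L2) => x -> _.
Qed.

Lemma fourier_dist f w : cL1 f -> cLp 2 f -> cL1 w -> cLp 2 w ->
  L2norm (toL2 (fourier1 f) - toL2 (fourier1 w)) <= L2norm (toL2 f - toL2 w).
Proof.
move=> Lf Lf2 Lw Lw2; rewrite (L2norm_toL2B (fourier1_cL2 Lf Lf2) (fourier1_cL2 Lw Lw2)).
rewrite (L2norm_toL2B Lf2 Lw2).
have -> : (fun x => fourier1 f x - fourier1 w x) = fourier1 (fun x => f x - w x).
  by apply/funext => x; rewrite fourier1B.
by apply: n2_fourier1_le; [exact: cL1B|exact: cL2B].
Qed.

Lemma Ccr_fourier_L2 f : Ccr f -> cLp 2 (fourier1 f).
Proof. by move=> Cf; apply: fourier1_cL2; [exact: Ccr_cL1|exact: Ccr_L2]. Qed.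

Definition Llim (f : nat -> T -> C R) (u : L2 R d) :=
  (forall k, Ccr (f k)) /\ cvg_for (@L2norm R d) (fun k => toL2 (f k)) u.

Implicit Types (u v : L2 R d).

(** By Plancherel's inequality the transforms along f form a Cauchy sequence, and every admissible
    sequence with the same limit has transforms with the same limit. So the set in [fourierL2] is
    inhabited and its element is this limit. *)
Lemma fourierL2P (f : nat -> T -> C R) u : Llim f u ->
  cvg_for (@L2norm R d) (fun k => toL2 (fourier1 (f k))) (fourierL2 u).
Proof.
move=> [Cf fu]; have sn := @L2norm_sn R d.
have cF : cauchy_for (@L2norm R d) (fun k => toL2 (fourier1 (f k))).
  move=> e /(cvg_for_cauchy sn fu)[N HN]; exists N => k l Nk Nl.
  apply: le_lt_trans (HN k l Nk Nl).
  by apply: fourier_dist; (apply: Ccr_cL1 || apply: Ccr_L2); exact: Cf.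
have [v Hv] := L2_complete cF.
suff H : forall w : nat -> L2 R d, (forall k, cLp 1 (L2rep (w k))) ->
    cvg_for (@L2norm R d) w u ->
    cvg_for (@L2norm R d) (fun k => toL2 (fourier1 (L2rep (w k)))) v.
  rewrite /fourierL2; case: xgetP => [v' _ /(_ (fun k => toL2 (f k)))|/(_ v)]; last by move/(_ H).
  have L1 k : cLp 1 (L2rep (toL2 (f k))) by exact: cL1_toL2 (Ccr_cL1 (Cf k)) (Ccr_L2 (Cf k)).
  move=> /(_ L1 fu); apply: cvg_for_ext => k; congr toL2.
  exact: fourier1_toL2 (Ccr_cL1 (Cf k)) (Ccr_L2 (Cf k)).
move=> w w1 wu; apply/(cvg_forP sn) => e e0.
have e3 : 0 < e / 3 by rewrite divr_gt0.
have [N HN] := (cvg_forP sn _ _).1 wu _ e3.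
have [M HM] := (cvg_forP sn _ _).1 fu _ e3.
have [K HK] := (cvg_forP sn _ _).1 Hv _ e3.
exists (maxn N (maxn M K)) => k; rewrite !geq_max => /and3P[Nk Mk Kk].
apply: le_lt_trans (sn_tri sn (toL2 (fourier1 (f k))) _ _) _.
have h1 : L2norm (toL2 (fourier1 (L2rep (w k))) - toL2 (fourier1 (f k))) <= L2norm (w k - toL2 (f k)).
  rewrite -{2}(toL2_rep (w k)); apply: fourier_dist.
  - exact: w1.
  - exact: L2rep_cL2.
  - exact: Ccr_cL1 (Cf k).
  - exact: Ccr_L2 (Cf k).
have h2 := sn_tri sn u (w k) (toL2 (f k)).
have h4 : L2norm (u - toL2 (f k)) < e / 3 by rewrite (sn_distC sn); exact: HM.
exact: (lt_thirds h1 h2 (HN k Nk) h4 (HK k Kk)).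
Qed.

Lemma LlimD (f g : nat -> T -> C R) u v : Llim f u -> Llim g v -> Llim (fun k x => f k x + g k x) (u + v).
Proof.
move=> [Cf fu] [Cg gv]; split=> [k|]; first exact: CcrD (Cf k) (Cg k).
under [X in cvg_for _ X]eq_fun do rewrite (toL2D (Ccr_L2 (Cf _)) (Ccr_L2 (Cg _))).
exact: (cvg_forD (@L2norm_sn R d) fu gv).
Qed.

Lemma cvg_for_L2Z (k : R[i]) (u : nat -> L2 R d) l : cvg_for (@L2norm R d) u l ->
  cvg_for (@L2norm R d) (fun n => k *: u n) (k *: l).
Proof.
move=> ul; have sn := @L2norm_sn R d.
apply: (cvg_for_le (c := normc k) (sn_ge0 sn) sn ul) => n; last exact: L2norm_ge0.
by rewrite -scalerBr L2normZ.
Qed.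

Lemma LlimZ (k : C R) (f : nat -> T -> C R) u : Llim f u -> Llim (fun n x => k * f n x) ((k : R[i]) *: u).
Proof.
move=> [Cf fu]; split=> [n|]; first exact: CcrZ (Cf n).
under [X in cvg_for _ X]eq_fun do rewrite (toL2Z _ (Ccr_L2 (Cf _))).
exact: cvg_for_L2Z.
Qed.

Lemma fourierL2D (f g : nat -> T -> C R) u v : Llim f u -> Llim g v -> fourierL2 (u + v) = fourierL2 u + fourierL2 v.
Proof.
move=> fu gv; apply: (cvg_for_unique (@L2norm_sn R d) (@L2norm_eq0 R d) (fourierL2P (LlimD fu gv))).
have := cvg_forD (@L2norm_sn R d) (fourierL2P fu) (fourierL2P gv).
apply: cvg_for_ext => k; case: fu gv => [Cf _] [Cg _].
rewrite -(toL2D (Ccr_fourier_L2 (Cf k)) (Ccr_fourier_L2 (Cg k))); congr toL2.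
by apply/funext => x; rewrite (fourier1D x (Ccr_cL1 (Cf k)) (Ccr_cL1 (Cg k))).
Qed.

Lemma fourierL2Z (k : C R) (f : nat -> T -> C R) u : Llim f u -> fourierL2 ((k : R[i]) *: u) = (k : R[i]) *: fourierL2 u.
Proof.
move=> fu; apply: (cvg_for_unique (@L2norm_sn R d) (@L2norm_eq0 R d) (fourierL2P (LlimZ k fu))).
have := cvg_for_L2Z k (fourierL2P fu).
apply: cvg_for_ext => n; case: fu => [Cf _].
rewrite -(toL2Z _ (Ccr_fourier_L2 (Cf n))); congr toL2.
by apply/funext => x; rewrite (fourier1Z k x (Ccr_cL1 (Cf n))).
Qed.

End fourier_L2.

(** * Null sets, fibres and continuous functions *)

Section null_sets.
Context (R : realType) (d : nat).
Local Notation T := 'cV[R]_d.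
Local Notation mu := (cV_lebesgue R d).

Lemma cV_lebesgue_ball_gt0 (x : T) (e : R) : 0 < e ->
  (0 < mu (box (fun i => `](x i 0 - e)%R, (x i 0 + e)%R[%classic)))%E.
Proof.
move=> e0; pose S i : set R := `](x i 0 - e), (x i 0 + e)[%classic.
rewrite cV_lebesgue_box => [|i]; last exact: measurable_itv.
have -> : (\prod_(i < d) lebesgue_measure (S i : set (measurableTypeR R)) = (\prod_(i < d) (e + e))%:E)%E.
  rewrite -prodEFin; apply: eq_bigr => i _; rewrite /S lebesgue_measure_itv /= lte_fin.
  rewrite ifT; last by lra.
  by rewrite -EFinB; congr EFin; lra.
by rewrite lte_fin; apply: prodr_gt0 => i _; lra.
Qed.

(** A nonzero value persists on an open box, and open boxes have positive measure. *)
Lemma continuous_ae0 (G : T -> C R) : continuous G -> {ae mu, forall x, G x = 0} ->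
  forall x, G x = 0.
Proof.
move=> cG [N [mN N0 GN]] x; apply/eqP/negPn/negP => Gx.
have nG : 0 < normc (G x).
  by rewrite lt_neqAle normc_ge0 andbT eq_sym; apply: contraNneq Gx => /normc_eq0 ->.
have /(@cvgc_lt R T _ (nbhs_filter x))/(_ _ nG) := cG x.
move=> /nbhs_ballP[e /= e0 He].
have := cV_lebesgue_ball_gt0 x e0; apply/negP; rewrite -leNgt -N0.
apply: le_measure; rewrite ?inE//.
  by apply: (@measurable_box R d (fun i => `](x i 0 - e), (x i 0 + e)[%classic)) => i; exact: measurable_itv.
move=> y /= yx; apply: GN => /= Gy.
have : ball x e y.
  split=> // i j; rewrite ord1; have := yx i; rewrite /= in_itv /= /ball /= ltr_norml; lra.
by move=> /He /=; rewrite Gy subr0 ltxx.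
Qed.

Lemma CT_ae_eq (h k : CT R d) : {ae mu, forall x, h (torus_proj x) = k (torus_proj x)} -> h = k.
Proof.
move=> hk; apply: CT_eq => x; apply/eqP; rewrite -subr_eq0; apply/eqP.
have ch := (continuous_torus h).1 (@CT_cont R d h).
have ck := (continuous_torus k).1 (@CT_cont R d k).
apply: (@continuous_ae0 (fun x => h (torus_proj x) - k (torus_proj x))).
  have -> : (fun x => h (torus_proj x) - k (torus_proj x)) = (fun x => h (torus_proj x) + -1 * k (torus_proj x)).
    by apply/funext => y; rewrite cN1.
  exact: (@continuous_cD R T (fun x => h (torus_proj x)) (fun x => -1 * k (torus_proj x)) ch
    (@continuous_cM R T (fun=> -1) (fun x => k (torus_proj x)) (@continuous_cst_C R T (-1)) ck)).
by apply: filterS hk => y ->; rewrite subrr.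
Qed.

(** A null set has null preimages under the countably many invertible affine maps x |-> N (x + g).
    This transfers statements at almost every point to whole fibres. *)
Lemma ae_lattice (N : 'M[R]_d) (P : T -> Prop) : N \in unitmx -> {ae mu, forall y, P y} ->
  {ae mu, forall x, forall g, P (N *m (x + zv R g))}.
Proof.
move=> uN [B [mB B0 PB]].
pose F g x : \bar R := (\1_B (N *m (x + zv R g)))%:E.
have F0 g x : (0 <= F g x)%E by rewrite lee_fin.
have m1 : measurable_fun setT (fun y : T => (\1_B y)%:E : \bar R).
  by apply/measurable_EFinP; exact: measurable_indic.
have mF g : measurable_fun setT (F g).
  have mD : measurable_fun setT (fun x : T => x + zv R g) by exact: measurable_cVD.
  exact: (measurableT_comp m1 (measurableT_comp (measurable_mulmx N) mD)).
have iF g : (\int[mu]_x F g x = 0)%E.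
  rewrite (ge0_integral_cVD (zv R g) (F := fun x => (\1_B (N *m x))%:E)).
  - rewrite (ge0_integral_mulmx_prop (F := fun x => (\1_B x)%:E))//.
    by rewrite -cV_lebesgue_indic// B0 mule0.
  - exact: (measurableT_comp m1 (measurable_mulmx N)).
  - by move=> x; rewrite lee_fin.
have mS : measurable_fun setT (fun x => \esum_(g in [set: 'cV[int]_d]) F g x) by exact: measurable_esum.
have : (\int[mu]_x `|\esum_(g in [set: 'cV[int]_d]) F g x| = 0)%E.
  under eq_integral do rewrite gee0_abs ?esum_ge0//.
  by rewrite integral_esum// esum1.
move=> /(ae_eq_integral_abs mu measurableT mS); apply: filterS => x /(_ I) Sx g.
apply: contrapT => /PB Bx; have : (F g x <= 0)%E.
  have h := @esum_seq_le R _ (fun h => F h x) [:: g] (fun h => F0 h x) isT.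
  by rewrite big_seq1 in h; rewrite Sx in h.
by rewrite /F indicE mem_set// lee_fin ler10.
Qed.

Lemma ae_cube_periodic (P : T -> Prop) : (forall x g, P (x + zv R g) <-> P x) ->
  {ae mu, forall x, @cube R d x -> P x} -> {ae mu, forall x, P x}.
Proof.
move=> perP H; have := ae_lattice (unitmx1 _ _) H; apply: filterS => x /(_ (- floorv x)).
by rewrite mul1mx perP; apply; rewrite zvN; apply/cube_floorP.
Qed.

(** A nonnegative function with integral 0 vanishes almost everywhere on the cube, then almost
    everywhere by periodicity and everywhere by continuity. *)
Lemma CT_mean0 (h : CT R d) : (forall x, exists2 r : R, 0 <= r & h (torus_proj x) = (r%:C)%C) ->
  cubeint (fun x => h (torus_proj x)) = 0 -> h = 0.
Proof.
move=> hr h0; apply: CT_ae_eq.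
have ch := (continuous_torus h).1 (@CT_cont R d h).
have mh := cmeasurable_continuous ch; have [mRe mIm] := mh.
apply: ae_cube_periodic; first by move=> x g; rewrite torus_projD.
have [K K0 hK] := CT_bnd h.
have Lh : cubeL1 (fun x => h (torus_proj x)).
  by apply: (cubeL1_bnd (K := K)) => // x; exact: hK.
pose F x : \bar R := (complex.Re (Icube x * h (torus_proj x)))%:E.
have F0 x : (0 <= F x)%E.
  rewrite lee_fin IcubeE; case: ifP => _; last by rewrite mul0r.
  by rewrite mul1r; have [r r0 ->] := hr x.
have iF : mu.-integrable setT F by exact: cL1_Re Lh.
have mF : measurable_fun setT F by case/integrableP: iF.
have : (\int[mu]_x `|F x| = 0)%E.
  under eq_integral do rewrite gee0_abs//.
  have := congr1 (@complex.Re R) h0; rewrite /cubeint /cintegral /= /Rintegral.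
  by move=> E0; rewrite -(fineK (integrable_fin_num measurableT iF)); congr EFin.
move=> /(ae_eq_integral_abs mu measurableT mF); apply: filterS => x /(_ I) /= [].
move=> hx cx; move: hx; rewrite IcubeE mem_set// mul1r.
by have [r r0 E] := hr x; rewrite E /= => ->.
Qed.

Lemma nonneg_limit (w : C R) : (forall e : R, 0 < e -> exists2 r : R, 0 <= r & normc (((r%:C)%C : C R) - w) < e) ->
  exists2 r : R, 0 <= r & w = (r%:C)%C.
Proof.
move=> H; exists (complex.Re w).
  rewrite leNgt; apply/negP => w0.
  have p : 0 < - complex.Re w by rewrite oppr_gt0.
  have [r r0 hr] := H _ p.
  have := le_lt_trans (normc_Re _) hr; rewrite ReB /= ltr_norml; lra.
apply: eqc => //=; apply/eqP; rewrite -normr_eq0 eq_le normr_ge0 andbT.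
apply/ler_addgt0Pr => e e0; rewrite add0r; have [r r0 hr] := H _ e0.
have := le_lt_trans (normc_Im _) hr; rewrite ImB /= sub0r normrN; exact: ltW.
Qed.

End null_sets.

(** * The completion X_n *)

Section level_norm.
Context (R : realType) (d : nat) (D : 'M[int]_d) (n : int).
Local Notation T := 'cV[R]_d.
Local Notation Z := 'cV[int]_d.
Local Notation M := (mxpow (map_mx intr D : 'M[R]_d) (- n)).
Hypothesis uM : M \in unitmx.
Context (A : algType R[i]) (star : A -> A) (nrm : A -> R) (j : (Z -> C R) -> A).
Hypothesis gc : group_cstar_algebra star nrm j.
Let cs := gcstar_cstar gc.
Let sn := cstar_sn cs.
Implicit Types (f g h : T -> C R) (x : T).
Local Notation br := (bracket D n).
Local Notation nX := (@Xnorm R d D n).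
Local Notation "f ** a" := (@circ R d D n f a) (at level 40).

Lemma bracketE f g : br f g = brM M f g. Proof. by []. Qed.
Lemma circE f a : f ** a = circM M f a. Proof. by []. Qed.

Lemma Ccz_bracket f g : Ccr f -> Ccr g -> Ccz (br f g).
Proof. exact: (Ccz_brM uM). Qed.

Lemma bracketDr f g h : Ccr f -> Ccr g -> Ccr h ->
  br f (fun x => g x + h x) = fun c => br f g c + br f h c.
Proof. exact: brMDr. Qed.

Lemma bracketZr k f g : Ccr f -> Ccr g -> br f (fun x => k * g x) = fun c => k * br f g c.
Proof. exact: brMZr. Qed.

Lemma bracket_star f g : Ccr f -> Ccr g -> starZ (br f g) = br g f.
Proof. exact: brM_star. Qed.

Lemma bracket_circ f g a : Ccr f -> Ccr g -> Ccz a -> br f (g ** a) = convZ (br f g) a.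
Proof. exact: brM_circM. Qed.

Lemma Ccr_circ f a : Ccr f -> Ccz a -> Ccr (f ** a).
Proof. exact: Ccr_circM. Qed.

(** For fixed x, a positive semidefinite sesquilinear form on C_c(R^d), with quadratic form [tq].
    The estimates on [Xnorm] are made for each x and then taken to the supremum. *)
Definition tb f g x : C R := trig (br f g) x.
Definition tq f x : R := complex.Re (tb f f x).

Lemma tb_conj f g x : Ccr f -> Ccr g -> tb g f x = conjc (tb f g x).
Proof. by move=> Cf Cg; rewrite /tb -(bracket_star Cf Cg) trig_star//; exact: Ccz_bracket. Qed.

Lemma tb_diag f x : Ccr f -> tb f f x = ((tq f x)%:C)%C /\ 0 <= tq f x.
Proof.
move=> Cf; have [Q [Q0 tQ _]] := poissonM uM x Cf.
by rewrite /tq /tb bracketE tQ.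
Qed.

Lemma tbDr f g h x : Ccr f -> Ccr g -> Ccr h -> tb f (fun x => g x + h x) x = tb f g x + tb f h x.
Proof.
move=> Cf Cg Ch; rewrite /tb (bracketDr Cf Cg Ch); apply: trigD; exact: Ccz_bracket.
Qed.

Lemma tbZr k f g x : Ccr f -> Ccr g -> tb f (fun x => k * g x) x = k * tb f g x.
Proof. by move=> Cf Cg; rewrite /tb (bracketZr k Cf Cg); apply: trigZ; exact: Ccz_bracket. Qed.

Lemma tq_expand f g (t : C R) x : Ccr f -> Ccr g ->
  tq (fun x => f x + t * g x) x = tq f x + 2 * complex.Re (t * tb f g x) + normc t ^+ 2 * tq g x.
Proof.
move=> Cf Cg; have Ct := CcrZ t Cg; have Cs := CcrD Cf Ct.
rewrite /tq (tbDr x Cs Cf Ct) (tbZr t x Cs Cg) (tb_conj x Cf Cs) (tb_conj x Cg Cs).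
rewrite (tbDr x Cf Cf Ct) (tbDr x Cg Cf Ct) !tbZr//.
rewrite (tb_conj x Cf Cg) (tb_diag x Cf).1 (tb_diag x Cg).1.
rewrite normc_sqr; case: t (tb f g x) {Ct Cs} => [a b] [p q].
by rewrite !(ReM, ImM, ReD, ImD, Re_conj, Im_conj) /= ; ring.
Qed.

Lemma tb_cs f g x : Ccr f -> Ccr g -> normc (tb f g x) ^+ 2 <= tq f x * tq g x.
Proof.
move=> Cf Cg; apply: cs_quad; [exact: (tb_diag x Cf).2|exact: (tb_diag x Cg).2|move=> t].
rewrite -(tq_expand t x Cf Cg); apply: (tb_diag x _).2.
by apply: CcrD => //; exact: CcrZ.
Qed.

Lemma fourierZ_tb f g x : fourierZ (br f g) (torus_proj x) = tb f g x.
Proof. exact: fourierZ_proj. Qed.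

Lemma tq_bnd f : Ccr f -> exists K, forall x, tq f x <= K.
Proof.
move=> Cf; have cb := Ccz_bracket Cf Cf.
exists (CT_norm (ctrig (br f f))) => x; apply: le_trans (CT_norm_ub _ (torus_proj x)).
rewrite (ctrigE x cb) -/(tb f f x) (tb_diag x Cf).1 normc_real; exact: ler_norm.
Qed.

Lemma Xnorm_has f : Ccr f ->
  has_sup [set Num.sqrt (complex.Re (fourierZ (br f f) z)) | z in setT].
Proof.
move=> Cf; split; first by exists (Num.sqrt (complex.Re (fourierZ (br f f) (torus_proj 0)))); exists (torus_proj 0).
have [K HK] := tq_bnd Cf; exists (Num.sqrt K) => _ [z _ <-].
by move: z; apply: torus_ind => x; rewrite fourierZ_tb; apply: ler_wsqrtr; exact: HK.
Qed.

Lemma Xnorm_ub f x : Ccr f -> Num.sqrt (tq f x) <= nX f.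
Proof.
move=> Cf; rewrite /tq -fourierZ_tb; apply: sup_upper_bound; first exact: Xnorm_has.
by exists (torus_proj x).
Qed.

Lemma Xnorm_ge0 f : Ccr f -> 0 <= nX f.
Proof. by move=> Cf; apply: le_trans (Xnorm_ub 0 Cf); exact: sqrtr_ge0. Qed.

Lemma tq_le f x : Ccr f -> tq f x <= nX f ^+ 2.
Proof.
move=> Cf; rewrite -[leLHS]sqr_sqrtr; last exact: (tb_diag x Cf).2.
by apply: lerXn2r; rewrite ?nnegrE ?sqrtr_ge0 ?Xnorm_ge0//; exact: Xnorm_ub.
Qed.

Lemma Xnorm_le f (K : R) : Ccr f -> 0 <= K -> (forall x, tq f x <= K ^+ 2) -> nX f <= K.
Proof.
move=> Cf K0 fK; apply: ge_sup.
  by exists (Num.sqrt (complex.Re (fourierZ (br f f) (torus_proj 0)))); exists (torus_proj 0).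
move=> _ [z _ <-]; move: z; apply: torus_ind => x; rewrite fourierZ_tb -/(tq f x).
by rewrite -(ger0_norm K0) -sqrtr_sqr; apply: ler_wsqrtr.
Qed.

Lemma norm_bracket f g : Ccr f -> Ccr g -> nrm (j (br f g)) <= nX f * nX g.
Proof.
move=> Cf Cg; have cb := Ccz_bracket Cf Cg; rewrite (norm_jE gc cb).
apply: CT_norm_le; apply: torus_ind => x; rewrite (ctrigE x cb) -/(tb f g x).
rewrite -(@ler_pXn2r _ 2) ?nnegrE ?normc_ge0 ?mulr_ge0 ?Xnorm_ge0//.
apply: le_trans (tb_cs x Cf Cg) _; rewrite exprMn ler_pM ?tq_le//.
  exact: (tb_diag x Cf).2.
exact: (tb_diag x Cg).2.
Qed.

Lemma Xnorm_sqr f : Ccr f -> nX f ^+ 2 = nrm (j (br f f)).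
Proof.
move=> Cf; apply/eqP; rewrite eq_le {2}expr2 norm_bracket// andbT.
rewrite -[leRHS]sqr_sqrtr; last exact: (cstar_norm_ge0 cs).
apply: lerXn2r; rewrite ?nnegrE ?sqrtr_ge0 ?Xnorm_ge0//.
apply: Xnorm_le => // x.
have cb := Ccz_bracket Cf Cf.
rewrite sqr_sqrtr; last exact: (cstar_norm_ge0 cs).
rewrite (norm_jE gc cb); apply: le_trans (CT_norm_ub _ (torus_proj x)).
rewrite (ctrigE x cb) -/(tb f f x) (tb_diag x Cf).1 normc_real; exact: ler_norm.
Qed.

Lemma XnormE f : Ccr f -> nX f = Num.sqrt (nrm (j (br f f))).
Proof. by move=> Cf; rewrite -Xnorm_sqr// sqrtr_sqr ger0_norm// Xnorm_ge0. Qed.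

Lemma XnormD f g : Ccr f -> Ccr g -> nX (fun x => f x + g x) <= nX f + nX g.
Proof.
move=> Cf Cg; apply: Xnorm_le; [exact: CcrD|by rewrite addr_ge0 ?Xnorm_ge0|move=> x].
have := tq_expand 1 x Cf Cg; rewrite mul1r normc1 expr1n mul1r.
have -> : (fun x => f x + 1 * g x) = (fun x => f x + g x) by apply/funext => y; rewrite mul1r.
move=> ->; apply: le_trans (cs_triangle _ _ (tb_cs x Cf Cg)) _.
- exact: (tb_diag x Cf).2.
- exact: (tb_diag x Cg).2.
apply: lerXn2r; rewrite ?nnegrE ?addr_ge0 ?sqrtr_ge0 ?Xnorm_ge0//.
by apply: lerD; exact: Xnorm_ub.
Qed.

Lemma XnormZ k f : Ccr f -> nX (fun x => k * f x) <= normc k * nX f.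
Proof.
move=> Cf; apply: Xnorm_le; [exact: CcrZ|by rewrite mulr_ge0 ?normc_ge0 ?Xnorm_ge0|move=> x].
have Ck := CcrZ k Cf.
have -> : tq (fun x => k * f x) x = normc k ^+ 2 * tq f x.
  rewrite /tq (tbZr k x Ck Cf) (tb_conj x Cf Ck) (tbZr k x Cf Cf) (tb_diag x Cf).1.
  by rewrite cjM mulrA [k * _]mulrC conj_mul; rewrite !(ReM, Re_conj, Im_conj) /=; ring.
by rewrite exprMn ler_wpM2l ?sqr_ge0// tq_le.
Qed.

Lemma Xnorm_distC f g : Ccr f -> Ccr g -> nX (fun x => f x - g x) = nX (fun x => g x - f x).
Proof.
have le f' g' : Ccr f' -> Ccr g' -> nX (fun x => f' x - g' x) <= nX (fun x => g' x - f' x).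
  move=> Cf Cg; have -> : (fun x => f' x - g' x) = (fun x => -1 * (g' x - f' x)).
    by apply/funext => x; rewrite cN1 opprB.
  apply: le_trans (XnormZ _ (CcrB Cg Cf)) _; by rewrite normcN' normc1 mul1r.
by move=> Cf Cg; apply/eqP; rewrite eq_le; apply/andP; split; exact: le.
Qed.

Lemma Xnorm_tri h f g : Ccr f -> Ccr g -> Ccr h ->
  nX (fun x => f x - g x) <= nX (fun x => f x - h x) + nX (fun x => h x - g x).
Proof.
move=> Cf Cg Ch; have -> : (fun x => f x - g x) = (fun x => (f x - h x) + (h x - g x)).
  by apply/funext => x; rewrite subrKA.
by apply: XnormD; exact: CcrB.
Qed.

Lemma Xnorm0 : nX (fun=> 0) = 0.
Proof.
apply/eqP; rewrite eq_le Xnorm_ge0 ?andbT; last exact: Ccr0.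
have := XnormZ 0 (@Ccr0 R d); by rewrite normc0 !mul0r.
Qed.

Lemma normc_trig_le a x : Ccz a -> normc (trig a x) <= nrm (j a).
Proof. by move=> ca; rewrite (norm_jE gc ca) -(ctrigE x ca); exact: CT_norm_ub. Qed.

(** At each x the quadratic form of f ** a is that of f multiplied by |[trig] a x|^2. *)
Lemma Xnorm_circ f a : Ccr f -> Ccz a -> nX (f ** a) <= nX f * nrm (j a).
Proof.
move=> Cf ca; have Cfa := Ccr_circ Cf ca.
apply: Xnorm_le => // [|x]; first by rewrite mulr_ge0 ?Xnorm_ge0 ?(cstar_norm_ge0 cs).
have E g : Ccr g -> tb g (f ** a) x = tb g f x * trig a x.
  move=> Cg; rewrite /tb (bracket_circ Cg Cf ca); apply: trig_conv => //.
  exact: Ccz_bracket.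
have -> : tq (f ** a) x = tq f x * normc (trig a x) ^+ 2.
  rewrite /tq (E _ Cfa) (tb_conj x Cf Cfa) (E _ Cf) cjM (tb_diag x Cf).1 conjc_real -mulrA.
  by rewrite conj_mul ReM /=; ring.
rewrite exprMn; apply: ler_pM.
- exact: (tb_diag x Cf).2.
- exact: sqr_ge0.
- exact: tq_le.
apply: lerXn2r; rewrite ?nnegrE ?normc_ge0 ?(cstar_norm_ge0 cs)//.
exact: normc_trig_le.
Qed.

Lemma bracket0_nn f : Ccr f -> br f f 0 = ((nn f)%:C)%C.
Proof. exact: brM0. Qed.

(** The squared L^2 norm is the coefficient of the bracket at 0, which [coeff_bound] controls. The
    constant 2 suffices for continuity of the embedding into L^2. *)
Lemma n2_le_Xnorm f : Ccr f -> n2 f <= 2 * nX f.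
Proof.
move=> Cf; have x0 := Xnorm_ge0 Cf; apply: n2_le; first by rewrite mulr_ge0.
have h : normc (br f f 0) <= 2 * nX f ^+ 2.
  apply: coeff_bound; first exact: Ccz_bracket.
  move=> x; rewrite -/(tb f f x) (tb_diag x Cf).1 normc_real ger0_norm; last exact: (tb_diag x Cf).2.
  exact: tq_le.
rewrite bracket0_nn// normc_real ger0_norm ?nn_ge0// in h.
by rewrite exprMn; have := sqr_ge0 (nX f); lra.
Qed.

Lemma bracketBr f g h : Ccr f -> Ccr g -> Ccr h ->
  j (br f (fun x => g x - h x)) = j (br f g) - j (br f h).
Proof.
move=> Cf Cg Ch; rewrite -(jB gc (Ccz_bracket Cf Cg) (Ccz_bracket Cf Ch)); congr j.
have -> : (fun x => g x - h x) = (fun x => g x + -1 * h x).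
  by apply/funext => x; rewrite cN1.
rewrite (bracketDr Cf Cg (CcrZ _ Ch)) (bracketZr (-1) Cf Ch).
by apply/funext => c; rewrite cN1.
Qed.

Lemma j_bracket_star f g : Ccr f -> Ccr g -> star (j (br f g)) = j (br g f).
Proof. by move=> Cf Cg; rewrite -(jstar gc (Ccz_bracket Cf Cg)) (bracket_star Cf Cg). Qed.

Lemma bracket_dist f f' g g' : Ccr f -> Ccr f' -> Ccr g -> Ccr g' ->
  nrm (j (br f g) - j (br f' g')) <=
  nX f * nX (fun x => g x - g' x) + nX (fun x => f x - f' x) * nX g'.
Proof.
move=> Cf Cf' Cg Cg'; apply: le_trans (sn_tri sn (j (br f g')) _ _) _; apply: lerD.
  rewrite -(bracketBr Cf Cg Cg'); apply: norm_bracket => //; exact: CcrB.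
rewrite -(j_bracket_star Cg' Cf) -(j_bracket_star Cg' Cf') -(cstar_starB cs).
rewrite (cstar_norm_star cs) -(bracketBr Cg' Cf Cf') mulrC.
by apply: norm_bracket => //; exact: CcrB.
Qed.

End level_norm.

#[local] Opaque Xnorm bracket circ.

Lemma fc_bound (R : realType) (d : nat) (G : 'cV[R]_d -> C R) g (K : R) : bmeas G ->
  (forall x, normc (G x) <= K) -> normc (fc G g) <= 2 * K.
Proof.
move=> bG GK.
have KE : complex.Re (cubeint (fun _ : 'cV[R]_d => (K%:C)%C : C R)) = K.
  have -> : (fun _ : 'cV[R]_d => (K%:C)%C : C R) = (fun _ => (K%:C)%C * 1) by apply/funext => x; rewrite mulr1.
  rewrite cubeintZ ?cubeint1 ?mulr1//.
  by apply: (cubeL1_bnd (K := 1)); [exact: cmeasurable_cst|move=> x; rewrite normc1].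
rewrite -[in leRHS]KE; apply: cubeint_le.
- by apply: bmeas_conjM => //; exact: bmeas_ez.
- by apply: (cubeL1_bnd (K := normc ((K%:C)%C : C R))); [exact: cmeasurable_cst|].
by move=> y; rewrite normcM' normc_conj normc_ez mul1r; exact: GK.
Qed.

Lemma le_bnd1 (R : realType) (a b c s : R) : 0 <= s -> b < 1 -> a <= b + c -> a <= c + 1 + s.
Proof. lra. Qed.
Lemma lt_thirds2 (R : realType) (a b p q e : R) : b <= p + q -> a < e / 3 -> p < e / 3 ->
  q < e / 3 -> a + b < e.
Proof. lra. Qed.

Lemma le_bnd2 (R : realType) (a s t : R) : 0 <= s -> 0 <= t -> a <= s + 1 + (a + t).
Proof. lra. Qed.

Section circ_facts.
Context (R : realType) (d : nat) (D : 'M[int]_d) (n : int).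
Implicit Types (f g : 'cV[R]_d -> C R) (a b : 'cV[int]_d -> C R).

Lemma circDl f g a : Ccz a -> circ D n (fun x => f x + g x) a = fun x => circ D n f a x + circ D n g a x.
Proof. exact: circMDl. Qed.
Lemma circZl k f a : Ccz a -> circ D n (fun x => k * f x) a = fun x => k * circ D n f a x.
Proof. exact: circMZl. Qed.
Lemma circDr f a b : Ccz a -> Ccz b ->
  circ D n f (fun c => a c + b c) = fun x => circ D n f a x + circ D n f b x.
Proof. exact: circMDr. Qed.
Lemma circZr k f a : Ccz a -> circ D n f (fun c => k * a c) = fun x => k * circ D n f a x.
Proof. exact: circMZr. Qed.
Lemma circ_conv f a b : Ccz a -> Ccz b -> circ D n f (convZ a b) = circ D n (circ D n f a) b.
Proof. exact: circM_conv. Qed.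
Lemma circ_delta f : circ D n f (@deltaZ R d) = f.
Proof. exact: circM_delta. Qed.
End circ_facts.

(** * Extension of the operations to the completion, and the module axioms *)

Section completion.
Context (R : realType) (d : nat) (D : 'M[int]_d) (n : int).
Local Notation T := 'cV[R]_d.
Local Notation Z := 'cV[int]_d.
Local Notation M := (mxpow (map_mx intr D : 'M[R]_d) (- n)).
Hypothesis uM : M \in unitmx.
Context (A : algType R[i]) (star : A -> A) (nrm : A -> R) (j : (Z -> C R) -> A).
Hypothesis gc : group_cstar_algebra star nrm j.
Let cs := gcstar_cstar gc.
Let sn := cstar_sn cs.
Let L2sn := @L2norm_sn R d.
Implicit Types (f g h : nat -> T -> C R) (u v w : L2 R d) (x y : A).
Local Notation br := (bracket D n).
Local Notation nX := (@Xnorm R d D n).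
Local Notation "f ** a" := (@circ R d D n f a) (at level 40).
Local Notation Xap := (@Xapprox R d D n).
Local Notation ip := (@Xn_ip R d D n A nrm j).
Local Notation act := (@Xn_act R d D n A nrm j).

Definition Xnull f := forall e : R, 0 < e -> exists N, forall k, (N <= k)%N -> nX (f k) < e.

(** Convertible to [cauchy_for] applied to [Xnorm], with the difference of functions written
    pointwise. *)
Definition Xcauchy f := forall e : R, 0 < e -> exists N, forall k l, (N <= k)%N -> (N <= l)%N ->
  nX (fun t => f k t - f l t) < e.

Lemma Xap_Ccr f u : Xap f u -> forall k, Ccr (f k). Proof. by case. Qed.
Lemma Xap_cauchy f u : Xap f u -> Xcauchy f. Proof. by case=> _ H _. Qed.
Lemma Xap_L2 f u : Xap f u -> cvg_for (@L2norm R d) (fun k => toL2 (f k)) u. Proof. by case. Qed.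
Lemma Xap_Llim f u : Xap f u -> Llim f u. Proof. by case. Qed.
Lemma mkXap f u : (forall k, Ccr (f k)) -> Xcauchy f ->
  cvg_for (@L2norm R d) (fun k => toL2 (f k)) u -> Xap f u.
Proof. by []. Qed.

Lemma Xcauchy_bnd f : (forall k, Ccr (f k)) -> Xcauchy f -> exists2 K : R, 0 <= K & forall k, nX (f k) <= K.
Proof.
move=> Cf /(_ 1 ltr01)[N HN].
have x0 k := Xnorm_ge0 uM (Cf k).
exists (nX (f N) + 1 + \sum_(i < N) nX (f i)).
  by rewrite !addr_ge0// sumr_ge0.
move=> k; have [Nk|kN] := leqP N k.
  have h1 := XnormD uM (CcrB (Cf k) (Cf N)) (Cf N).
  have E : (fun t => f k t - f N t + f N t) = f k by apply/funext => t; rewrite subrK.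
  rewrite E in h1; apply: le_bnd1 (HN k N Nk (leqnn N)) h1.
  by rewrite sumr_ge0.
rewrite (bigD1 (Ordinal kN))//=; apply: le_bnd2 (x0 N) _.
by rewrite sumr_ge0.
Qed.

(** The estimate behind continuity of every product below, K1 and K2 being bounds of the two
    factors; the added 1 keeps the denominator positive. *)
Lemma two_terms (K1 K2 a b e : R) : 0 <= K1 -> 0 <= K2 -> 0 <= a -> 0 <= b ->
  a < e / (K1 + K2 + 1) -> b < e / (K1 + K2 + 1) -> K1 * a + b * K2 < e.
Proof.
move=> K10 K20 a0 b0 ha hb; have s0 : 0 < K1 + K2 + 1 by lra.
set q := e / (K1 + K2 + 1) in ha hb.
have -> : e = q * (K1 + K2 + 1) by rewrite /q divfK// gt_eqF.
have q0 : 0 < q by exact: le_lt_trans ha.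
have h1 : K1 * a <= K1 * q by rewrite ler_wpM2l// ltW.
have h2 : b * K2 <= q * K2 by rewrite ler_wpM2r// ltW.
lra.
Qed.

Lemma bracket_cauchy f g : (forall k, Ccr (f k)) -> Xcauchy f -> (forall k, Ccr (g k)) -> Xcauchy g ->
  cauchy_for nrm (fun k => j (br (f k) (g k))).
Proof.
move=> Cf cf Cg cg e e0; have [K K0 fK] := Xcauchy_bnd Cf cf; have [L L0 gL] := Xcauchy_bnd Cg cg.
have e1 : 0 < e / (K + L + 1) by rewrite divr_gt0//; lra.
have [N HN] := cf _ e1; have [P HP] := cg _ e1.
exists (maxn N P) => k l; rewrite !geq_max => /andP[Nk Pk] /andP[Nl Pl].
apply: le_lt_trans (bracket_dist uM gc (Cf k) (Cf l) (Cg k) (Cg l)) _.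
have h1 := Xnorm_ge0 uM (CcrB (Cg k) (Cg l)); have h2 := Xnorm_ge0 uM (CcrB (Cf k) (Cf l)).
apply: le_lt_trans (two_terms K0 L0 h1 h2 (HP k l Pk Pl) (HN k l Nk Nl)).
exact: (lerD (ler_wpM2r h1 (fK k)) (ler_wpM2l h2 (gL _))).
Qed.

Lemma bracket_close f f' g g' x : (forall k, Ccr (f k)) -> Xcauchy f -> (forall k, Ccr (f' k)) ->
  (forall k, Ccr (g k)) -> (forall k, Ccr (g' k)) -> Xcauchy g' ->
  Xnull (fun k t => f k t - f' k t) -> Xnull (fun k t => g k t - g' k t) ->
  cvg_for nrm (fun k => j (br (f k) (g k))) x -> cvg_for nrm (fun k => j (br (f' k) (g' k))) x.
Proof.
move=> Cf cf Cf' Cg Cg' cg' ff' gg' bx; apply/(cvg_forP sn) => e e0.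
have [K K0 fK] := Xcauchy_bnd Cf cf; have [L L0 gL] := Xcauchy_bnd Cg' cg'.
have e2 : 0 < e / 2 by rewrite divr_gt0.
have e1 : 0 < e / 2 / (K + L + 1) by rewrite divr_gt0//; lra.
have [N HN] := ff' _ e1; have [P HP] := gg' _ e1.
have [Q HQ] := (cvg_forP sn _ _).1 bx _ e2.
exists (maxn Q (maxn N P)) => k; rewrite !geq_max => /and3P[Qk Nk Pk].
apply: le_lt_trans (sn_tri sn (j (br (f k) (g k))) _ _) _; rewrite [e]splitr; apply: ltrD.
  rewrite (sn_distC sn); apply: le_lt_trans (bracket_dist uM gc (Cf k) (Cf' k) (Cg k) (Cg' k)) _.
  have h1 := Xnorm_ge0 uM (CcrB (Cg k) (Cg' k)); have h2 := Xnorm_ge0 uM (CcrB (Cf k) (Cf' k)).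
  apply: le_lt_trans (two_terms K0 L0 h1 h2 (HP k Pk) (HN k Nk)).
  exact: (lerD (ler_wpM2r h1 (fK k)) (ler_wpM2l h2 (gL _))).
exact: HQ.
Qed.

Lemma Xnull_L2 f : (forall k, Ccr (f k)) -> Xnull f -> cvg_for (@L2norm R d) (fun k => toL2 (f k)) 0.
Proof.
move=> Cf f0; apply/(cvg_forP L2sn) => e e0; have e2 : 0 < e / 2 by rewrite divr_gt0.
have [N HN] := f0 _ e2; exists N => k /HN h; rewrite subr0 (L2norm_toL2 (Ccr_L2 (Cf k))).
by have := n2_le_Xnorm uM (Cf k); lra.
Qed.

Lemma Xcauchy_lim f : (forall k, Ccr (f k)) -> Xcauchy f -> exists u, Xap f u.
Proof.
move=> Cf cf; have : cauchy_for (@L2norm R d) (fun k => toL2 (f k)).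
  move=> e e0; have e2 : 0 < e / 2 by rewrite divr_gt0.
  have [N HN] := cf _ e2; exists N => k l Nk Nl.
  rewrite (L2norm_toL2B (Ccr_L2 (Cf k)) (Ccr_L2 (Cf l))).
  have := n2_le_Xnorm uM (CcrB (Cf k) (Cf l)); have := HN k l Nk Nl; lra.
by move=> /L2_complete[u fu]; exists u; exact: mkXap.
Qed.

Lemma Xap_unique f u v : Xap f u -> Xap f v -> u = v.
Proof. move=> /Xap_L2 fu /Xap_L2 fv; exact: (cvg_for_unique L2sn (@L2norm_eq0 R d) fu fv). Qed.

Lemma XapD f g u v : Xap f u -> Xap g v -> Xap (fun k t => f k t + g k t) (u + v).
Proof.
move=> fu gv; have [Cf Cg] := (Xap_Ccr fu, Xap_Ccr gv).
have [Cs cL] := LlimD (Xap_Llim fu) (Xap_Llim gv).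
apply: mkXap => // e e0; have e2 : 0 < e / 2 by rewrite divr_gt0.
have [N HN] := Xap_cauchy fu e2; have [P HP] := Xap_cauchy gv e2.
exists (maxn N P) => k l; rewrite !geq_max => /andP[Nk Pk] /andP[Nl Pl].
have -> : (fun t => f k t + g k t - (f l t + g l t)) = (fun t => (f k t - f l t) + (g k t - g l t)).
  by apply/funext => t; rewrite opprD addrACA.
apply: le_lt_trans (XnormD uM (CcrB (Cf k) (Cf l)) (CcrB (Cg k) (Cg l))) _.
by rewrite [e]splitr; apply: ltrD; [exact: HN|exact: HP].
Qed.

Lemma XapZ (c : C R) f u : Xap f u -> Xap (fun k t => c * f k t) ((c : R[i]) *: u).
Proof.
move=> fu; have Cf := Xap_Ccr fu.
have [Cs cL] := LlimZ c (Xap_Llim fu).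
apply: mkXap => // e e0; have c1 : 0 < normc c + 1 by have := normc_ge0 c; lra.
have [N HN] := Xap_cauchy fu (divr_gt0 e0 c1); exists N => k l Nk Nl.
have -> : (fun t => c * f k t - c * f l t) = (fun t => c * (f k t - f l t)).
  by apply/funext => t; rewrite mulrBr.
apply: le_lt_trans (XnormZ uM _ (CcrB (Cf k) (Cf l))) _.
have := HN k l Nk Nl; rewrite ltr_pdivlMr//.
have := Xnorm_ge0 uM (CcrB (Cf k) (Cf l)); lra.
Qed.

Lemma Xap_ext f f' u : (forall k, f k = f' k) -> Xap f u -> Xap f' u.
Proof. by move=> /funext ->. Qed.

Lemma XapB f g u v : Xap f u -> Xap g v -> Xap (fun k t => f k t - g k t) (u - v).
Proof.
move=> fu gv; rewrite -scaleN1r; apply: Xap_ext (XapD fu (XapZ (-1) gv)) => k.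
by apply/funext => t; rewrite cN1.
Qed.

Lemma Xap_cst (f : T -> C R) : Ccr f -> Xap (fun=> f) (toL2 f).
Proof.
move=> Cf; apply: mkXap => //; last exact: cvg_for_cst L2sn _.
move=> e e0; exists 0%N => k l _ _; have -> : (fun t => f t - f t) = (fun=> 0).
  by apply/funext => t; rewrite subrr.
by rewrite (Xnorm0 uM).
Qed.

Lemma Xap0 : Xap (fun _ _ => 0) 0.
Proof.
have := XapB (Xap_cst (@Ccr0 R d)) (Xap_cst (@Ccr0 R d)); rewrite [X in Xap _ X]subrr.
by apply: Xap_ext => k; apply/funext => t; rewrite subrr.
Qed.

(* The limit in C(T^d) of the brackets [f_k, f_k] is nonnegative with mean
   lim |f_k|_2^2 = 0, hence vanishes; so X_n embeds in L^2. *)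
Lemma Xap0_null f : Xap f 0 -> Xnull f.
Proof.
move=> f0; have Cf := Xap_Ccr f0; have cf := Xap_cauchy f0.
have [x bx] := cstar_complete cs (bracket_cauchy Cf cf Cf cf).
have cb k := Ccz_bracket uM (Cf k) (Cf k).
have hx (e : R) : 0 < e -> exists N, forall k, (N <= k)%N -> CT_norm (ctrig (br (f k) (f k)) - gelf nrm j x) < e.
  move=> /((cvg_forP sn _ _).1 bx)[N HN]; exists N => k Nk.
  by rewrite -(gelf_j gc (cb k)) (gelf_normB gc); exact: HN.
set h := gelf nrm j x in hx *.
have ch := (continuous_torus h).1 (@CT_cont R d h).
have bmh : bmeas (fun t => h (torus_proj t)) by exact: bmeas_cont_per ch (@periodic_torus R d h).
have h0 : h = 0.
  apply: CT_mean0.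
    move=> t; apply: nonneg_limit => e e0; have [N HN] := hx e e0.
    exists (tq D n (f N) t); first exact: (tb_diag uM t (Cf N)).2.
    rewrite -(tb_diag uM t (Cf N)).1 /tb -(ctrigE t (cb N)) -CTB.
    by apply: le_lt_trans (CT_norm_ub _ _) (HN N (leqnn N)).
  have -> : cubeint (fun t => h (torus_proj t)) = fc (fun t => h (torus_proj t)) 0.
    by rewrite /fc /ipc; congr cubeint; apply/funext => t; rewrite ez0 conjc1 mul1r.
  apply: normc_eq0; apply/eqP; rewrite eq_le normc_ge0 andbT.
  apply/ler_addgt0Pr => e e0; rewrite add0r.
  (* The mean of h is its coefficient at 0. It differs by at most 2e/3 from that of [f_k, f_k],
     which is |f_k|_2^2 and at most e/3. *)
  have e3 : 0 < e / 3 by rewrite divr_gt0.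
  have [N HN] := hx _ e3.
  have se : 0 < Num.sqrt (e / 3) by rewrite sqrtr_gt0.
  have [P HP] := (cvg_forP L2sn _ _).1 (Xap_L2 f0) _ se.
  pose k := maxn N P.
  have nk : nn (f k) <= e / 3.
    have := HP k (leq_maxr N P); rewrite subr0 (L2norm_toL2 (Ccr_L2 (Cf k))) => hk.
    rewrite -n2_sqr -[leRHS](sqr_sqrtr (ltW e3)); apply: lerXn2r; rewrite ?nnegrE ?n2_ge0 ?sqrtr_ge0//.
    exact: ltW.
  have h1 : normc (fc (fun t => h (torus_proj t)) 0 - br (f k) (f k) 0) <= 2 * (e / 3).
    rewrite -(fc_trig 0 (cb k)).
    have bt := Ccz_bmeas (cb k).
    have bN : bmeas (fun t => -1 * trig (br (f k) (f k)) t) by exact: bmeasZ.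
    have -> : fc (fun t => h (torus_proj t)) 0 - fc (trig (br (f k) (f k)) : T -> C R) 0 =
        fc (fun t => h (torus_proj t) + -1 * trig (br (f k) (f k)) t) 0.
      rewrite /fc (ipcDr (@bmeas_ez R d 0) bmh bN) (ipcZr _ (@bmeas_ez R d 0) bt).
      by rewrite cN1.
    apply: fc_bound; first exact: bmeasD.
    move=> t; rewrite cN1 -(ctrigE t (cb k)) -CTB; apply: le_trans (CT_norm_ub _ _) _.
    rewrite -/h (sn_distC (@CT_norm_sn R d)); apply: ltW; apply: HN; exact: leq_maxl.
  have := normcD (fc (fun t => h (torus_proj t)) 0 - br (f k) (f k) 0) (br (f k) (f k) 0).
  rewrite subrK (bracket0_nn D n (Cf k)) normc_real ger0_norm ?nn_ge0//.
  by rewrite (bracket0_nn D n (Cf k)) in h1; lra.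
move=> e e0; have e2 : 0 < e ^+ 2 by rewrite exprn_gt0.
have [N HN] := hx _ e2; exists N => k Nk; have := HN k Nk.
rewrite h0 subr0 -(norm_jE gc (cb k)) -(Xnorm_sqr uM gc (Cf k)) => hk.
by rewrite -(@ltr_pXn2r _ 2) ?nnegrE ?(Xnorm_ge0 uM)// ltW.
Qed.

Lemma Xap_sub_null f g u : Xap f u -> Xap g u -> Xnull (fun k t => f k t - g k t).
Proof. by move=> fu gu; apply: Xap0_null; have := XapB fu gu; rewrite subrr. Qed.

Lemma Xap_close f f' u : Xap f u -> (forall k, Ccr (f' k)) ->
  Xnull (fun k t => f k t - f' k t) -> Xap f' u.
Proof.
move=> fu Cf' ff'; have Cf := Xap_Ccr fu.
have Cd k := CcrB (Cf k) (Cf' k).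
apply: mkXap => //.
  move=> e e0; have e3 : 0 < e / 3 by rewrite divr_gt0.
  have [N HN] := ff' _ e3; have [P HP] := Xap_cauchy fu e3.
  exists (maxn N P) => k l; rewrite !geq_max => /andP[Nk Pk] /andP[Nl Pl].
  apply: le_lt_trans (Xnorm_tri uM (Cf' k) (Cf' l) (Cf k)) _.
  have h1 := Xnorm_tri uM (Cf k) (Cf' l) (Cf l).
  rewrite (Xnorm_distC uM (Cf' k) (Cf k)).
  exact: (lt_thirds2 h1 (HN k Nk) (HP k l Pk Pl) (HN l Nl)).
have := cvg_forD L2sn (Xap_L2 fu) (cvg_forN L2sn (Xnull_L2 Cd ff')).
rewrite oppr0 addr0; apply: cvg_for_ext => k.
by rewrite (toL2B (Ccr_L2 (Cf k)) (Ccr_L2 (Cf' k))) opprB addrC subrK.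
Qed.

(** By [Xap0_null] two approximations of the same element differ by a sequence that tends to 0 in
    [Xnorm], so the limit of brackets does not depend on them and the set in [Xn_ip] is
    inhabited. *)
Lemma Xn_ipP f g u v : Xap f u -> Xap g v -> cvg_for nrm (fun k => j (br (f k) (g k))) (ip u v).
Proof.
move=> fu gv; have [x bx] := cstar_complete cs (bracket_cauchy (Xap_Ccr fu) (Xap_cauchy fu) (Xap_Ccr gv) (Xap_cauchy gv)).
have H : forall f' g', Xap f' u -> Xap g' v -> cvg_for nrm (fun k => j (br (f' k) (g' k))) x.
  move=> f' g' f'u g'v; apply: bracket_close bx.
  - exact: Xap_Ccr fu.
  - exact: Xap_cauchy fu.
  - exact: Xap_Ccr f'u.
  - exact: Xap_Ccr gv.
  - exact: Xap_Ccr g'v.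
  - exact: Xap_cauchy g'v.
  - exact: Xap_sub_null fu f'u.
  - exact: Xap_sub_null gv g'v.
rewrite /Xn_ip; case: xgetP => [y _ Hy|/(_ x)]; first exact: Hy.
by move/(_ H).
Qed.

Lemma circ_dist (f g : T -> C R) a b : Ccr f -> Ccr g -> Ccz a -> Ccz b ->
  nX (fun t => (f ** a) t - (g ** b) t) <=
  nX f * nrm (j a - j b) + nX (fun t => f t - g t) * nrm (j b).
Proof.
move=> Cf Cg ca cb.
have E1 : (fun c => a c + -1 * b c) = (fun c => a c - b c).
  by apply/funext => c; rewrite cN1.
have E2 : (fun t => f t + -1 * g t) = (fun t => f t - g t).
  by apply/funext => t; rewrite cN1.
have E : (fun t => (f ** a) t - (g ** b) t) =
    (fun t => (f ** (fun c => a c - b c)) t + ((fun t => f t - g t) ** b) t).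
  rewrite -E1 -E2 (circDr D n f ca (CczZ _ cb)) (circZr D n (-1) f cb).
  rewrite (circDl D n f _ cb) (circZl D n (-1) g cb).
  by apply/funext => t; rewrite !cN1 addrA subrK.
have caB := CczB ca cb; have CB := CcrB Cf Cg.
rewrite E -(jB gc ca cb).
apply: le_trans (XnormD uM (Ccr_circ D n Cf caB) (Ccr_circ D n CB cb)) _.
exact: (lerD (Xnorm_circ uM gc Cf caB) (Xnorm_circ uM gc CB cb)).
Qed.

Lemma Xap_circ_ex f u (a : nat -> Z -> C R) x : Xap f u -> (forall k, Ccz (a k)) ->
  cvg_for nrm (fun k => j (a k)) x -> exists w, Xap (fun k => f k ** a k) w.
Proof.
move=> fu ca ax; have Cf := Xap_Ccr fu; apply: Xcauchy_lim.
  by move=> k; exact: Ccr_circ.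
have cax := cvg_for_cauchy sn ax.
have [K K0 fK] := Xcauchy_bnd Cf (Xap_cauchy fu); have [L L0 aL] := cvg_for_bnd sn cax.
move=> e e0; have e1 : 0 < e / (K + L + 1) by rewrite divr_gt0//; lra.
have [N HN] := Xap_cauchy fu e1; have [P HP] := cax _ e1.
exists (maxn N P) => k l; rewrite !geq_max => /andP[Nk Pk] /andP[Nl Pl].
apply: le_lt_trans (circ_dist (Cf k) (Cf l) (ca k) (ca l)) _.
have h1 := cstar_norm_ge0 cs (j (a k) - j (a l)).
have h2 := Xnorm_ge0 uM (CcrB (Cf k) (Cf l)).
apply: le_lt_trans (two_terms K0 L0 h1 h2 (HP k l Pk Pl) (HN k l Nk Nl)).
exact: (lerD (ler_wpM2r h1 (fK k)) (ler_wpM2l h2 (aL l))).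
Qed.

Lemma Xap_circ_close f f' u (a a' : nat -> Z -> C R) x w : Xap f u -> Xap f' u ->
  (forall k, Ccz (a k)) -> (forall k, Ccz (a' k)) ->
  cvg_for nrm (fun k => j (a k)) x -> cvg_for nrm (fun k => j (a' k)) x ->
  Xap (fun k => f k ** a k) w -> Xap (fun k => f' k ** a' k) w.
Proof.
move=> fu f'u ca ca' ax a'x fw; have Cf := Xap_Ccr fu; have Cf' := Xap_Ccr f'u.
apply: (Xap_close fw) => [k|]; first exact: Ccr_circ.
have [K K0 fK] := Xcauchy_bnd Cf (Xap_cauchy fu).
have [L L0 aL] := cvg_for_bnd sn (cvg_for_cauchy sn a'x).
move=> e e0; have e1 : 0 < e / (K + L + 1) by rewrite divr_gt0//; lra.
have [N HN] := Xap_sub_null fu f'u e1.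
have aa' := cvg_forD sn ax (cvg_forN sn a'x); rewrite subrr in aa'.
have [P HP] := (cvg_forP sn _ _).1 aa' _ e1.
exists (maxn N P) => k; rewrite !geq_max => /andP[Nk Pk].
apply: le_lt_trans (circ_dist (Cf k) (Cf' k) (ca k) (ca' k)) _.
have h1 := cstar_norm_ge0 cs (j (a k) - j (a' k)).
have h2 := Xnorm_ge0 uM (CcrB (Cf k) (Cf' k)).
have h3 := HP k Pk; rewrite subr0 in h3.
apply: le_lt_trans (two_terms K0 L0 h1 h2 h3 (HN k Nk)).
exact: (lerD (ler_wpM2r h1 (fK k)) (ler_wpM2l h2 (aL k))).
Qed.

(** The set in [Xn_act] is inhabited: [Xap_circ_ex] gives a limit along one choice of sequences, and
    [Xap_circ_close] carries it to every other. *)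
Lemma Xn_actP f u (a : nat -> Z -> C R) x : Xap f u -> (forall k, Ccz (a k)) ->
  cvg_for nrm (fun k => j (a k)) x -> Xap (fun k => f k ** a k) (act u x).
Proof.
move=> fu ca ax; have [w fw] := Xap_circ_ex fu ca ax.
have H : forall f' (a' : nat -> Z -> C R), Xap f' u -> (forall k, Ccz (a' k)) ->
    cvg_for nrm (fun k => j (a' k)) x -> Xap (fun k => f' k ** a' k) w.
  by move=> f' a' f'u ca' a'x; exact: Xap_circ_close fu f'u ca ca' ax a'x fw.
rewrite /Xn_act; case: xgetP => [v _ Hv|/(_ w)]; first exact: Hv.
by move/(_ H).
Qed.

Lemma j_seq x : exists2 a : nat -> Z -> C R, forall k, Ccz (a k) & cvg_for nrm (fun k => j (a k)) x.
Proof. by have [a [ca ax _]] := gelf_rel_gelf gc x; exists a. Qed.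

Let Auniq (u : nat -> A) l m : cvg_for nrm u l -> cvg_for nrm u m -> l = m.
Proof. exact: (cvg_for_unique sn (cstar_norm_eq0 cs)). Qed.

Notation Xn := (@Xn R d D n).

Lemma Xn_sub u v : Xn u -> Xn v -> Xn (u - v).
Proof. by move=> [f fu] [g gv]; eexists; exact: XapB fu gv. Qed.

Lemma Xn_actX u x : Xn u -> Xn (act u x).
Proof. by move=> [f fu]; have [a ca ax] := j_seq x; eexists; exact: Xn_actP fu ca ax. Qed.

Lemma Xn_act1 u : Xn u -> act u 1 = u.
Proof.
move=> [f fu]; apply: (Xap_unique _ fu).
have h : cvg_for nrm (fun k : nat => j (@deltaZ R d)) 1.
  by rewrite (j1 gc); exact: cvg_for_cst.
apply: Xap_ext (Xn_actP fu (fun=> Ccz_delta R d) h) => k; exact: circ_delta.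
Qed.

Lemma Xn_actM u x y : Xn u -> act u (x * y) = act (act u x) y.
Proof.
move=> [f fu]; have [a ca ax] := j_seq x; have [b cb bx] := j_seq y.
apply: Xap_unique (Xn_actP (Xn_actP fu ca ax) cb bx).
have h : cvg_for nrm (fun k => j (convZ (a k) (b k))) (x * y).
  apply: cvg_for_ext (cvg_forM cs ax bx) => k; exact: esym (jM gc (ca k) (cb k)).
apply: Xap_ext (Xn_actP fu (fun k => Ccz_conv (ca k) (cb k)) h) => k.
exact: circ_conv.
Qed.

Lemma Xn_actDl u v x : Xn u -> Xn v -> act (u + v) x = act u x + act v x.
Proof.
move=> [f fu] [g gv]; have [a ca ax] := j_seq x.
apply: Xap_unique (XapD (Xn_actP fu ca ax) (Xn_actP gv ca ax)).
apply: Xap_ext (Xn_actP (XapD fu gv) ca ax) => k; exact: circDl.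
Qed.

Lemma Xn_actDr u x y : Xn u -> act u (x + y) = act u x + act u y.
Proof.
move=> [f fu]; have [a ca ax] := j_seq x; have [b cb bx] := j_seq y.
apply: Xap_unique (XapD (Xn_actP fu ca ax) (Xn_actP fu cb bx)).
have h : cvg_for nrm (fun k => j (fun c => a k c + b k c)) (x + y).
  apply: cvg_for_ext (cvg_forD sn ax bx) => k; exact: esym (jD gc (ca k) (cb k)).
apply: Xap_ext (Xn_actP fu (fun k => CczD (ca k) (cb k)) h) => k; exact: circDr.
Qed.

Lemma Xn_actZl (k : R[i]) u x : Xn u -> act (k *: u) x = k *: act u x.
Proof.
move=> [f fu]; have [a ca ax] := j_seq x.
apply: Xap_unique (XapZ k (Xn_actP fu ca ax)).
apply: Xap_ext (Xn_actP (XapZ k fu) ca ax) => i; exact: circZl.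
Qed.

Lemma Xn_actZr (k : R[i]) u x : Xn u -> act u (k *: x) = k *: act u x.
Proof.
move=> [f fu]; have [a ca ax] := j_seq x.
apply: Xap_unique (XapZ k (Xn_actP fu ca ax)).
have h : cvg_for nrm (fun i => j (fun c => (k : C R) * a i c)) (k *: x).
  apply: cvg_for_ext (cvg_forZ cs k ax) => i; exact: esym (jZ gc k (ca i)).
apply: Xap_ext (Xn_actP fu (fun i => CczZ k (ca i)) h) => i; exact: circZr.
Qed.

Lemma Xn_ipD u v w : Xn u -> Xn v -> Xn w -> ip u (v + w) = ip u v + ip u w.
Proof.
move=> [f fu] [g gv] [h hw]; apply: Auniq (Xn_ipP fu (XapD gv hw)) _.
apply: cvg_for_ext (cvg_forD sn (Xn_ipP fu gv) (Xn_ipP fu hw)) => k.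
have [Cf [Cg Ch]] := (Xap_Ccr fu k, (Xap_Ccr gv k, Xap_Ccr hw k)).
by rewrite (bracketDr D n Cf Cg Ch) (jD gc)//; exact: Ccz_bracket.
Qed.

Lemma Xn_ipZ (k : R[i]) u v : Xn u -> Xn v -> ip u (k *: v) = k *: ip u v.
Proof.
move=> [f fu] [g gv]; apply: Auniq (Xn_ipP fu (XapZ k gv)) _.
apply: cvg_for_ext (cvg_forZ cs k (Xn_ipP fu gv)) => i.
have [Cf Cg] := (Xap_Ccr fu i, Xap_Ccr gv i).
by rewrite (bracketZr D n k Cf Cg) (jZ gc)//; exact: Ccz_bracket.
Qed.

Lemma Xn_ip_act u v x : Xn u -> Xn v -> ip u (act v x) = ip u v * x.
Proof.
move=> [f fu] [g gv]; have [a ca ax] := j_seq x.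
apply: Auniq (Xn_ipP fu (Xn_actP gv ca ax)) _.
apply: cvg_for_ext (cvg_forM cs (Xn_ipP fu gv) ax) => k.
have [Cf Cg] := (Xap_Ccr fu k, Xap_Ccr gv k).
by rewrite (bracket_circ D n Cf Cg (ca k)) (jM gc)//; exact: Ccz_bracket.
Qed.

Lemma Xn_ip_star u v : Xn u -> Xn v -> star (ip u v) = ip v u.
Proof.
move=> [f fu] [g gv]; apply: Auniq (Xn_ipP gv fu).
apply: cvg_for_ext (cvg_for_star cs (Xn_ipP fu gv)) => k.
exact: (j_bracket_star uM gc (Xap_Ccr fu k) (Xap_Ccr gv k)).
Qed.

Lemma gelf_ip_cvg f g u v : Xap f u -> Xap g v ->
  cvg_for (@CT_norm R d) (fun k => ctrig (br (f k) (g k))) (gelf nrm j (ip u v)).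
Proof.
move=> fu gv; apply/(cvg_forP (@CT_norm_sn R d)) => e e0.
have [N HN] := (cvg_forP sn _ _).1 (Xn_ipP fu gv) _ e0; exists N => k Nk.
have cb := Ccz_bracket uM (Xap_Ccr fu k) (Xap_Ccr gv k).
by rewrite -(gelf_j gc cb) (gelf_normB gc); exact: HN.
Qed.

Lemma gelf_ip_ge0 u z : Xn u -> exists2 r : R, 0 <= r & gelf nrm j (ip u u) z = (r%:C)%C.
Proof.
move=> [f fu]; move: z; apply: torus_ind => t; apply: nonneg_limit => e e0.
have Cf := Xap_Ccr fu.
have [N HN] := (cvg_forP (@CT_norm_sn R d) _ _).1 (gelf_ip_cvg fu fu) _ e0.
exists (tq D n (f N) t); first exact: (tb_diag uM t (Cf N)).2.
rewrite -(tb_diag uM t (Cf N)).1 /tb -(ctrigE t (Ccz_bracket uM (Cf N) (Cf N))) -CTB.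
by apply: le_lt_trans (CT_norm_ub _ _) (HN N (leqnn N)).
Qed.

Lemma Xn_ip_pos u : Xn u -> cstar_pos star (ip u u).
Proof. by move=> Xu; apply: (gelf_pos gc) => z; exact: gelf_ip_ge0. Qed.

Local Notation hn := (@hilbert_norm R A nrm (L2 R d) ip).

Lemma Xap_hn f u : Xap f u -> (nX (f k) @[k --> \oo] --> hn u).
Proof.
move=> fu; have h := cvg_for_norm sn (Xn_ipP fu fu).
have -> : (fun k => nX (f k)) = (fun k => Num.sqrt (nrm (j (br (f k) (f k))))).
  by apply/funext => k; exact: (XnormE uM gc (Xap_Ccr fu k)).
apply: (cvg_comp (fun k => nrm (j (br (f k) (f k)))) (@Num.sqrt R) h).
exact: sqrt_continuous.
Qed.

Lemma hn_le u f (K : R) : Xap f u -> (exists N, forall k, (N <= k)%N -> nX (f k) <= K) -> hn u <= K.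
Proof.
move=> fu [N HN]; have h := Xap_hn fu.
rewrite -(cvg_lim (@Rhausdorff R) h); apply: limr_le; first by apply/cvg_ex; exists (hn u).
by exists N => // k Nk; exact: HN.
Qed.

Lemma hn_toL2 (f : T -> C R) : Ccr f -> hn (toL2 f) = nX f.
Proof.
move=> Cf; have h := Xap_hn (Xap_cst Cf).
exact: (cvg_unique _ h (@cvg_cst _ _ _ _ _)).
Qed.

Lemma hnD u v : Xn u -> Xn v -> hn (u + v) <= hn u + hn v.
Proof.
move=> [f fu] [g gv]; have h1 := Xap_hn (XapD fu gv).
have h2 : (fun k => nX (f k) + nX (g k)) @ \oo --> hn u + hn v.
  exact: (cvgD (Xap_hn fu) (Xap_hn gv)).
apply: (ler_cvg_to h1 h2); apply: nearW => k.
exact: (XnormD uM (Xap_Ccr fu k) (Xap_Ccr gv k)).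
Qed.

Lemma hn_ge0 u : 0 <= hn u. Proof. exact: sqrtr_ge0. Qed.

Lemma L2norm_le_hn u : Xn u -> L2norm u <= 2 * hn u.
Proof.
move=> [f fu]; have h1 := cvg_for_norm L2sn (Xap_L2 fu).
have h2 : (fun k => 2 * nX (f k)) @ \oo --> 2 * hn u.
  by apply: cvgMr; exact: Xap_hn fu.
apply: (ler_cvg_to h1 h2); apply: nearW => k.
rewrite (L2norm_toL2 (Ccr_L2 (Xap_Ccr fu k))).
exact: (n2_le_Xnorm uM (Xap_Ccr fu k)).
Qed.

(** Elements of X_n are classes in L^2, so definiteness is read off from the bound of the L^2 norm
    by the module norm. *)
Lemma Xn_ip_eq0 u : Xn u -> ip u u = 0 -> u = 0.
Proof.
move=> Xu u0; apply: L2norm_eq0; apply/eqP; rewrite eq_le (L2norm_ge0 u) andbT.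
apply: le_trans (L2norm_le_hn Xu) _.
by rewrite /hilbert_norm u0 (sn0 sn) sqrtr0 mulr0.
Qed.

Lemma Xn_ip_module : inner_product_module star Xn ip act setT.
Proof.
split.
- by exists (fun _ _ => 0); exact: Xap0.
- by move=> u v [f fu] [g gv]; eexists; exact: XapD fu gv.
- by move=> k u [f fu]; exists (fun i t => (k : C R) * f i t); exact: (XapZ k fu).
- by move=> u x Xu _; exact: Xn_actX.
- exact: Xn_act1.
- by move=> u x y Xu _ _; exact: Xn_actM.
- by move=> u v x Xu Xv _; exact: Xn_actDl.
- by move=> u x y Xu _ _; exact: Xn_actDr.
- by move=> k u x Xu _; exact: Xn_actZl.
- by move=> k u x Xu _; exact: Xn_actZr.
- by [].
- exact: Xn_ipD.
- exact: Xn_ipZ.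
- by move=> u v x Xu Xv _; exact: Xn_ip_act.
- exact: Xn_ip_star.
- exact: Xn_ip_pos.
- exact: Xn_ip_eq0.
Qed.

Lemma Xap_near f u (e : R) : Xap f u -> 0 < e ->
  exists N, forall k, (N <= k)%N -> hn (u - toL2 (f k)) <= e.
Proof.
move=> fu e0; have [N HN] := Xap_cauchy fu e0; exists N => k Nk.
apply: (hn_le (XapB fu (Xap_cst (Xap_Ccr fu k)))); exists N => l Nl.
by apply: ltW; exact: HN.
Qed.

Lemma hn_distC u v : Xn u -> Xn v -> hn (u - v) = hn (v - u).
Proof.
have le u' v' : Xn u' -> Xn v' -> hn (u' - v') <= hn (v' - u').
  move=> [f fu] [g gv]; have h1 := Xap_hn (XapB fu gv); have h2 := Xap_hn (XapB gv fu).
  apply: (ler_cvg_to h1 h2); apply: nearW => k.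
  by rewrite (Xnorm_distC uM (Xap_Ccr fu k) (Xap_Ccr gv k)).
by move=> Xu Xv; apply/eqP; rewrite eq_le; apply/andP; split; exact: le.
Qed.

Lemma Xn_toL2 (f : T -> C R) : Ccr f -> Xn (toL2 f).
Proof. by move=> Cf; exists (fun=> f); exact: Xap_cst. Qed.

Lemma hn_tri w u v : Xn u -> Xn v -> Xn w -> hn (u - v) <= hn (u - w) + hn (w - v).
Proof.
by move=> Xu Xv Xw; rewrite -[u - v](subrKA w); apply: hnD; exact: Xn_sub.
Qed.

(** Each u k is replaced by a function g k of C_c(R^d) at distance at most 1/(k + 1). The sequence g
    is Cauchy in [Xnorm], so it represents an element of X_n, which is also the limit of u. *)
Lemma Xn_complete (u : nat -> L2 R d) : (forall k, Xn (u k)) -> cauchy_for hn u ->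
  exists2 l, Xn l & cvg_for hn u l.
Proof.
move=> Xu cu.
have /choice[g Hg] : forall k, exists g : T -> C R, Ccr g /\ hn (u k - toL2 g) <= k.+1%:R^-1.
  move=> k; have [f fu] := Xu k; have k0 : 0 < k.+1%:R^-1 :> R by rewrite invr_gt0.
  have [N HN] := Xap_near fu k0; exists (f N); split; first exact: (Xap_Ccr fu N).
  exact: HN.
have Cg k : Ccr (g k) by case: (Hg k).
have gu k : hn (u k - toL2 (g k)) <= k.+1%:R^-1 by case: (Hg k).
have small (e : R) : 0 < e -> exists N, forall k, (N <= k)%N -> hn (u k - toL2 (g k)) < e.
  move=> e0; exists (Num.trunc e^-1) => k ek; apply: le_lt_trans (gu k) _.
  rewrite -[e]invrK ltf_pV2 ?posrE ?ltr0n ?invr_gt0//.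
  by apply: lt_le_trans (truncnS_gt _) _; rewrite ler_nat ltnS.
have cg : Xcauchy g.
  move=> e e0; have e3 : 0 < e / 3 by rewrite divr_gt0.
  have [N HN] := small _ e3; have [P HP] := cu _ e3.
  exists (maxn N P) => k l; rewrite !geq_max => /andP[Nk Pk] /andP[Nl Pl].
  rewrite -(hn_toL2 (CcrB (Cg k) (Cg l))) (toL2B (Ccr_L2 (Cg k)) (Ccr_L2 (Cg l))).
  apply: le_lt_trans (hn_tri (Xn_toL2 (Cg k)) (Xn_toL2 (Cg l)) (Xu k)) _.
  rewrite (hn_distC (Xn_toL2 (Cg k)) (Xu k)).
  have h := hn_tri (Xu k) (Xn_toL2 (Cg l)) (Xu l).
  exact: (lt_thirds2 h (HN k Nk) (HP k l Pk Pl) (HN l Nl)).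
have [l gl] := Xcauchy_lim Cg cg; have Xl : Xn l by exists g.
exists l => //; apply/cvgrPdist_lt => e e0; have e2 : 0 < e / 2 by rewrite divr_gt0.
have [N HN] := small _ e2; have [P HP] := Xap_near gl e2.
exists (maxn N P) => // k; rewrite /= geq_max => /andP[Nk Pk].
rewrite sub0r normrN ger0_norm ?hn_ge0//.
apply: le_lt_trans (hn_tri (Xu k) Xl (Xn_toL2 (Cg k))) _.
rewrite [e]splitr; apply: ltr_leD; first exact: HN.
by rewrite (hn_distC (Xn_toL2 (Cg k)) Xl); exact: HP.
Qed.

Lemma Xn_hilbert : hilbert_module star nrm Xn ip act.
Proof. by split; [exact: Xn_ip_module|exact: Xn_complete]. Qed.

Lemma Xn_cvg_L2 (u : nat -> L2 R d) l : (forall k, Xn (u k)) -> Xn l ->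
  cvg_for hn u l -> cvg_for (@L2norm R d) u l.
Proof.
move=> Xu Xl ul; apply: (@squeeze_cvgr _ _ _ _ (fun=> 0) (fun k => 2 * hn (u k - l))).
- by apply: nearW => k; rewrite L2norm_ge0/=; apply: L2norm_le_hn; exact: Xn_sub.
- exact: cvg_cst.
- by rewrite -[X in _ --> X](mulr0 2); apply: cvgMr; exact: ul.
Qed.

End completion.

(** * A bump function whose lattice translates are disjoint *)

Section bump.
Context (R : realType) (d : nat).
Local Notation T := 'cV[R]_d.

Let G (y : T) : R := 16^-1 - \sum_i y i 0 * y i 0.
(** The positive part of 1/16 - |y|^2. It vanishes outside the ball of radius 1/4, so two distinct
    integral translates are never both nonzero. *)
Definition bump (y : T) : C R := (((G y + `|G y|) / 2)%:C)%C.

Lemma bump_continuous : continuous bump.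
Proof.
have cs : continuous (fun y : T => \sum_i y i 0 * y i 0 : R).
  have H : forall s : seq 'I_d, continuous (fun y : T => \sum_(i <- s) y i 0 * y i 0 : R).
    elim=> [|i s IH].
      by under [X in continuous X]eq_fun do rewrite big_nil; move=> x; exact: cst_continuous.
    under [X in continuous X]eq_fun do rewrite big_cons.
    apply: continuous_RD => //; apply: continuous_RM; exact: continuous_coord.
  exact: H.
have cG : continuous G.
  have -> : G = fun y : T => 16^-1 + -1 * \sum_i y i 0 * y i 0 by apply/funext => y; rewrite mulN1r.
  apply: (@continuous_RD R T (fun=> 16^-1)); first by move=> y; exact: cst_continuous.
  by apply: (@continuous_RM R T (fun=> -1)) => // y; exact: cst_continuous.
have cn : continuous (fun y => `|G y|).
  by move=> y; apply: continuous_comp; [exact: cG|exact: norm_continuous].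
apply/continuous_ReIm; split; last by move=> y; exact: cst_continuous.
apply: (@continuous_RM R T (fun y => G y + `|G y|) (fun=> 2^-1)); first exact: continuous_RD.
by move=> y; exact: cst_continuous.
Qed.

Lemma bump_supp y : bump y != 0 -> forall i, `|y i 0| < 4^-1.
Proof.
move=> by0 i; have G0 : 0 < G y.
  rewrite ltNge; apply: contra by0 => Gy; apply/eqP; rewrite /bump ler0_norm//.
  by rewrite subrr mul0r.
have h : y i 0 * y i 0 < 16^-1.
  apply: le_lt_trans (_ : \sum_i y i 0 * y i 0 < _); last by rewrite -subr_gt0.
  rewrite (bigD1 i)//= lerDl; apply: sumr_ge0 => k _; exact: sqr_ge0.
rewrite ltNge; apply/negP => h2; have : 4^-1 * 4^-1 <= `|y i 0| * `|y i 0| by rewrite ler_pM.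
rewrite -normrM ger0_norm ?sqr_ge0//; have : (4^-1 * 4^-1 : R) = 16^-1 by field.
by move: h; lra.
Qed.

Lemma bump0 : bump 0 != 0.
Proof.
rewrite /bump (_ : G 0 = 16^-1); last first.
  by rewrite /G big1 ?subr0// => i _; rewrite mxE mul0r.
rewrite ger0_norm//; apply/eqP => /(congr1 (@complex.Re R)) /=; lra.
Qed.

Lemma bump_Ccr : Ccr bump.
Proof.
apply: (CcrP (r := 4^-1)); first exact: bump_continuous.
by move=> y /bump_supp h i; rewrite /= in_itv /= -ler_norml ltW.
Qed.

Lemma bump_disjoint y (c : 'cV[int]_d) : c != 0 -> conjc (bump (y - zv R c)) * bump y = 0.
Proof.
move=> c0; have [->|/bump_supp h1] := eqVneq (bump y) 0; first by rewrite mulr0.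
have [->|/bump_supp h2] := eqVneq (bump (y - zv R c)) 0; first by rewrite conjc0 mul0r.
exfalso; move/eqP: c0; apply; apply/matrixP => i k; rewrite ord1 mxE.
have := h1 i; have := h2 i; rewrite !mxE => a b.
have : `|(c i 0)%:~R : R| < 1.
  have -> : (c i 0)%:~R = y i 0 - (y i 0 - (c i 0)%:~R) by rewrite opprB addrC subrK.
  by apply: le_lt_trans (ler_normB _ _) _; lra.
by rewrite -intr_norm -[1]/(1%:~R) ltr_int; case: (c i 0) => [[|m]|m].
Qed.

End bump.

(** * The module C_c(R^d), fullness of X_n and the action of l^1 *)

Section wavelet_modules.
Context (R : realType) (d : nat) (D : 'M[int]_d) (n : int).
Local Notation T := 'cV[R]_d.
Local Notation mu := (cV_lebesgue R d).
Local Notation Z := 'cV[int]_d.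
Local Notation M := (mxpow (map_mx intr D : 'M[R]_d) (- n)).
Hypothesis uM : M \in unitmx.
Context (A : algType R[i]) (star : A -> A) (nrm : A -> R) (j : (Z -> C R) -> A).
Hypothesis gc : group_cstar_algebra star nrm j.
Let cs := gcstar_cstar gc.
Let sn := cstar_sn cs.
Let L2sn := @L2norm_sn R d.
Local Notation br := (bracket D n).
Local Notation "f ** a" := (@circ R d D n f a) (at level 40).
Local Notation Xap := (@Xapprox R d D n).
Local Notation ip := (@Xn_ip R d D n A nrm j).
Local Notation act := (@Xn_act R d D n A nrm j).
Local Notation Xn := (@Xn R d D n).

(** j is injective on C_c(Z^d), so an element of the image determines its coefficients. *)
Lemma Ccz_ofK a : Ccz a -> Ccz_of j (j a) = a.
Proof.
move=> ca; rewrite /Ccz_of; case: xgetP => [b _ [cb]|/(_ a)]; last by case.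
exact: (j_inj gc).
Qed.

Lemma Ccz_of_Ccz x : (j @` (@Ccz R d)) x -> Ccz (Ccz_of j x) /\ j (Ccz_of j x) = x.
Proof. by move=> [a ca <-]; rewrite Ccz_ofK. Qed.

Lemma bracket_eq0 f : Ccr f -> j (br f f) = 0 -> f = fun=> 0.
Proof.
move=> Cf; rewrite -(j0 gc) => /(j_inj gc (Ccz_bracket uM Cf Cf) (Ccz0 R d)) bf.
have := bracket0_nn D n Cf; rewrite bf => /(congr1 (@complex.Re R)) /= /esym nf.
have h := nn_eq0 (Ccr_L2 Cf) nf.
by apply/funext; exact: continuous_ae0 (Ccr_cont Cf) h.
Qed.

Lemma bracket_pos f : Ccr f -> cstar_pos star (j (br f f)).
Proof.
move=> Cf; have cb := Ccz_bracket uM Cf Cf; apply: (gelf_pos gc).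
apply: torus_ind => x; rewrite (gelf_j gc cb) (ctrigE x cb) -/(tb D n f f x).
exists (tq D n f x); first exact: (tb_diag uM x Cf).2.
exact: (tb_diag uM x Cf).1.
Qed.

Lemma Ccr_ip_module : inner_product_module star (@Ccr R d)
  (fun f g => j (br f g)) (fun f a => f ** (Ccz_of j a)) (j @` (@Ccz R d)).
Proof.
split.
- exact: Ccr0.
- by move=> f g; exact: CcrD.
- by move=> k f; exact: CcrZ.
- by move=> f a Cf /Ccz_of_Ccz[ca _]; exact: Ccr_circ.
- move=> f Cf; rewrite -(j1 gc) (Ccz_ofK (Ccz_delta R d)); exact: circ_delta.
- move=> f a b Cf [a' ca <-] [b' cb <-]; rewrite -(jM gc ca cb).
  by rewrite (Ccz_ofK ca) (Ccz_ofK cb) (Ccz_ofK (Ccz_conv ca cb)); exact: circ_conv.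
- move=> f g a Cf Cg /Ccz_of_Ccz[ca _]; exact: circDl.
- move=> f a b Cf [a' ca <-] [b' cb <-]; rewrite -(jD gc ca cb).
  by rewrite (Ccz_ofK ca) (Ccz_ofK cb) (Ccz_ofK (CczD ca cb)); exact: circDr.
- move=> k f a Cf /Ccz_of_Ccz[ca _]; exact: circZl.
- move=> k f a Cf [a' ca <-]; rewrite -(jZ gc k ca).
  by rewrite (Ccz_ofK ca) (Ccz_ofK (CczZ k ca)); exact: circZr.
- by move=> f g Cf Cg; exists (br f g) => //; exact: Ccz_bracket.
- move=> f g h Cf Cg Ch; rewrite -(jD gc (Ccz_bracket uM Cf Cg) (Ccz_bracket uM Cf Ch)).
  by congr j; exact: bracketDr.
- move=> k f g Cf Cg; rewrite -(jZ gc k (Ccz_bracket uM Cf Cg)).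
  by congr j; exact: bracketZr.
- move=> f g a Cf Cg [a' ca <-]; rewrite (Ccz_ofK ca) (bracket_circ D n Cf Cg ca).
  exact: (jM gc (Ccz_bracket uM Cf Cg) ca).
- exact: (j_bracket_star uM gc).
- exact: bracket_pos.
- exact: bracket_eq0.
Qed.

Lemma conv_delta (q : C R) b : convZ (fun c => q * @deltaZ R d c) b = fun c => q * b c.
Proof.
apply/funext => c; rewrite /convZ.
transitivity (zsum (fun h : Z => (h == 0)%:R * (q * b (c - h)))).
  by congr zsum; apply/funext => h; rewrite /deltaZ mulrAC mulrC mulrA.
by rewrite (zsum_delta 0 (fun h => q * b (c - h))) subr0.
Qed.

(* The translates of a bump supported in a small ball are orthogonal, so that
   its bracket is a nonzero multiple of the unit. *)
Lemma exists_frame : exists f (q : C R), [/\ Ccr f, q != 0 & br f f = fun c => q * @deltaZ R d c].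
Proof.
have uMi : invmx M \in unitmx by rewrite unitmx_inv.
have Cf : Ccr (pull (invmx M) (@bump R d)) by apply: Ccr_pull => //; exact: bump_Ccr.
set f := pull _ _ in Cf; exists f, ((nn f)%:C)%C; split=> //.
  apply/eqP => /(congr1 (@complex.Re R)) /= nf.
  have h := continuous_ae0 (Ccr_cont Cf) (nn_eq0 (Ccr_L2 Cf) nf) 0.
  have E : f 0 = bump (invmx M *m 0) by [].
  rewrite mulmx0 in E.
  by have := @bump0 R d; rewrite -E h eqxx.
apply/funext => c; rewrite /deltaZ; have [->|c0] := eqVneq c 0.
  by rewrite mulr1 (bracket0_nn D n Cf).
rewrite mulr0 bracketE /brM (_ : (fun x => _) = fun=> 0) ?cintegral0//.
apply/funext => x; rewrite /f /pull mulmxBr mulKmx//; exact: bump_disjoint.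
Qed.

Lemma Xn_ip_toL2 f g : Ccr f -> Ccr g -> ip (toL2 f) (toL2 g) = j (br f g).
Proof.
move=> Cf Cg; apply: (cvg_for_unique sn (cstar_norm_eq0 cs) (Xn_ipP uM gc (Xap_cst uM Cf) (Xap_cst uM Cg))).
exact: cvg_for_cst.
Qed.

(** If [f, f]_n is q times the unit, then f and f ** (b / q) have bracket exactly b, and b can be
    taken close to a. *)
Lemma Xn_full : full_module nrm Xn ip.
Proof.
move=> a e e0; have [b cb ba] := gcstar_dense gc a e0.
have [f [q [Cf q0 bf]]] := exists_frame.
have cqb : Ccz (fun c => q^-1 * b c) by exact: CczZ.
have Cg := Ccr_circ D n Cf cqb.
exists (toL2 f), (toL2 (f ** (fun c => q^-1 * b c))); split.
- exact: (Xn_toL2 uM Cf).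
- exact: (Xn_toL2 uM Cg).
rewrite (Xn_ip_toL2 Cf Cg) (bracket_circ D n Cf Cf cqb) bf conv_delta.
have -> : (fun c => q * (q^-1 * b c)) = b by apply/funext => c; rewrite mulrA divff// mul1r.
exact: ba.
Qed.

Lemma l1_le (a b : Z -> C R) : (l1norm (fun c => a c + b c)%R <= l1norm a + l1norm b)%E.
Proof.
rewrite -esumD => [|c _|c _]; try by rewrite lee_fin normc_ge0.
by apply: le_esum => c _; rewrite -EFinD lee_fin normcD.
Qed.

Lemma l1_opp (a : Z -> C R) : l1norm (fun c => - a c) = l1norm a.
Proof. by apply: eq_esum => c _; rewrite normcN'. Qed.

Lemma norm_j_l1 a : Ccz a -> ((nrm (j a))%:E <= l1norm a)%E.
Proof.
move=> ca; pose s := zseq [set g | a g != 0].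
have us : uniq s by exact: finmap.fset_uniq.
apply: (@le_trans _ _ (\sum_(c <- s) (normc (a c))%:E)%E).
  rewrite sumEFin lee_fin; apply: (norm_j_le gc us) => c.
  by rewrite /s in_fset_set// notin_setE => /negP/negPn/eqP.
by apply: (esum_seq_le (a := fun c => (normc (a c))%:E)) => // c; rewrite lee_fin normc_ge0.
Qed.

Definition ztrunc (a : Z -> C R) (N : nat) : Z -> C R := fun c => if c \in zball d N then a c else 0.

Lemma Ccz_ztrunc a N : Ccz (ztrunc a N).
Proof.
apply: (@Ccz_sub R d _ [set` zball d N]); first exact: finite_seq.
by move=> c nc; rewrite /ztrunc ifN//; apply/negP.
Qed.

Lemma zball_exhaust (s : seq Z) : exists N, forall K, (N <= K)%N -> {subset s <= zball d K}.
Proof.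
exists (\sum_(c <- s) \sum_i `|c i 0%R|)%N => K NK c cs'; apply: mem_zball => i.
apply: leq_trans NK; rewrite (big_rem c)//= (bigD1 i)//= -!addnA leq_addr//.
Qed.

Lemma ztrunc_cvg a : (l1norm a < +oo)%E -> forall e : R, 0 < e ->
  exists N, forall K, (N <= K)%N -> (l1norm (fun c => (ztrunc a K c - a c)%R) <= e%:E)%E.
Proof.
move=> aoo e e0; have a0 : (0 <= l1norm a)%E by apply: esum_ge0 => c _; rewrite lee_fin normc_ge0.
have [Q HQ] : exists Q : R, l1norm a = Q%:E.
  by exists (fine (l1norm a)); rewrite fineK// ge0_fin_numE.
have : ((Q - e)%:E < l1norm a)%E by rewrite HQ lte_fin; lra.
move=> /ereal_sup_gt[_ [X [fX _] <-]]; rewrite fsbig_finite// sumEFin lte_fin => QX.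
have [N HN] := zball_exhaust (zseq X); exists N => K NK.
have E : (l1norm a = l1norm (ztrunc a K) + l1norm (fun c => (ztrunc a K c - a c)%R))%E.
  rewrite -esumD => [|c _|c _]; try by rewrite lee_fin normc_ge0.
  apply: eq_esum => c _; rewrite -EFinD /ztrunc; case: ifP => _.
    by rewrite subrr normc0 addr0.
  by rewrite sub0r normcN' normc0 add0r.
have h : ((\sum_(c <- zseq X) normc (a c))%:E <= l1norm (ztrunc a K))%E.
  rewrite -sumEFin.
  have -> : (\sum_(c <- zseq X) (normc (a c))%:E = \sum_(c <- zseq X) (normc (ztrunc a K c))%:E)%E.
    by apply: eq_big_seq => c cX; rewrite /ztrunc (HN K NK c cX).
  apply: (esum_seq_le (a := fun c => (normc (ztrunc a K c))%:E)); last exact: finmap.fset_uniq.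
  by move=> c; rewrite lee_fin normc_ge0.
have p0 : (0 <= l1norm (fun c => (ztrunc a K c - a c)%R))%E by apply: esum_ge0 => c _; rewrite lee_fin normc_ge0.
rewrite HQ in E; move: E h p0.
case: (l1norm (ztrunc a K)) => [p| |]; case: (l1norm (fun c => (ztrunc a K c - a c)%R)) => [q| |] //=.
by rewrite -EFinD => -[QE]; rewrite !lee_fin; move: QX; rewrite QE; lra.
Qed.

(** The norm of C^*(Z^d) is at most the l^1 norm on C_c(Z^d), so all sequences that tend to a in l^1
    have the same limit; the truncations [ztrunc] show that it exists. *)
Lemma l1_embedP a (b : nat -> Z -> C R) : (l1norm a < +oo)%E -> (forall k, Ccz (b k)) ->
  (fun k => l1norm (b k - a)) @ \oo --> 0%E ->
  cvg_for nrm (fun k => j (b k)) (l1_embed nrm j a).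
Proof.
move=> aoo cb ba.
have near_small (b' : nat -> Z -> C R) : (fun k => l1norm (b' k - a)) @ \oo --> 0%E ->
    forall e : R, 0 < e -> exists N, forall k, (N <= k)%N -> (l1norm (fun c => (b' k c - a c)%R) <= e%:E)%E.
  move=> ba' e e0; have [fn] := (fine_cvgP _ _).1 ba'.
  move=> /cvgrPdist_lt/(_ e e0) => fc'.
  have [N _ HN] : \forall k \near \oo, (l1norm (fun c => (b' k c - a c)%R) <= e%:E)%E.
    apply: filterS2 fn fc' => k fk; rewrite sub0r normrN => hk.
    rewrite -[X in (X <= _)%E](fineK fk) lee_fin; apply: ltW; apply: le_lt_trans hk.
    exact: ler_norm.
  by exists N => k Nk; exact: HN.
have dist (e : R) p q : Ccz p -> Ccz q -> (l1norm (fun c => (p c - a c)%R) <= (e / 2)%:E)%E ->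
    (l1norm (fun c => (q c - a c)%R) <= (e / 2)%:E)%E -> nrm (j p - j q) <= e.
  move=> cp cq hp hq; rewrite -(jB gc cp cq) -lee_fin.
  apply: le_trans (norm_j_l1 (CczB cp cq)) _.
  have -> : (fun c => p c - q c) = (fun c => (p c - a c) + - (q c - a c)).
    by apply/funext => c; rewrite opprB addrA subrK.
  apply: le_trans (l1_le _ _) _; rewrite l1_opp [e]splitr EFinD; exact: leeD.
have ct : cauchy_for nrm (fun N => j (ztrunc a N)).
  move=> e e0; have e4 : 0 < e / 2 / 2 by rewrite !divr_gt0.
  have [N HN] := ztrunc_cvg aoo e4; exists N => k l Nk Nl.
  apply: (@le_lt_trans _ _ (e / 2)); last by lra.
  by apply: dist; [exact: Ccz_ztrunc|exact: Ccz_ztrunc|exact: HN|exact: HN].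
have [x tx] := cstar_complete cs ct.
suff H : forall b' : nat -> Z -> C R, (forall k, Ccz (b' k)) ->
    (fun k => l1norm (b' k - a)) @ \oo --> 0%E -> cvg_for nrm (fun k => j (b' k)) x.
  rewrite /l1_embed; case: xgetP => [y _ Hy|/(_ x)]; first exact: Hy.
  by move/(_ H).
move=> b' cb' ba'; apply/(cvg_forP sn) => e e0.
have e4 : 0 < e / 2 / 2 by rewrite !divr_gt0.
have e2 : 0 < e / 2 by rewrite divr_gt0.
have [N HN] := ztrunc_cvg aoo e4; have [P HP] := near_small _ ba' _ e4.
have [Q HQ] := (cvg_forP sn _ _).1 tx _ e2.
exists (maxn N (maxn P Q)) => k; rewrite !geq_max => /and3P[Nk Pk Qk].
apply: le_lt_trans (sn_tri sn (j (ztrunc a k)) _ _) _; rewrite [e]splitr; apply: ler_ltD; last exact: HQ.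
by apply: dist => //; [exact: Ccz_ztrunc|exact: HP|exact: HN].
Qed.

Lemma ztrunc_embed a : (l1norm a < +oo)%E -> cvg_for nrm (fun k => j (ztrunc a k)) (l1_embed nrm j a).
Proof.
move=> aoo; apply: (l1_embedP aoo) => [k|]; first exact: Ccz_ztrunc.
have fn : \forall k \near \oo, l1norm (ztrunc a k - a) \is a fin_num.
  have [N HN] := ztrunc_cvg aoo ltr01; exists N => // k Nk /=.
  rewrite ge0_fin_numE; last by apply: esum_ge0 => c _; rewrite lee_fin normc_ge0.
  by apply: le_lt_trans (HN k Nk) _; rewrite ltry.
apply/fine_cvgP; split=> //; apply/cvgrPdist_lt => e e0.
have e2 : 0 < e / 2 by rewrite divr_gt0.
have [N HN] := ztrunc_cvg aoo e2.
have H : \forall k \near \oo, (l1norm (ztrunc a k - a)%R <= (e / 2)%:E)%E by exists N.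
apply: filterS2 fn H => k fk hk; rewrite sub0r normrN /= ger0_norm; last first.
  by apply: fine_ge0; apply: esum_ge0 => c _; rewrite lee_fin normc_ge0.
apply: (@le_lt_trans _ _ (e / 2)); last by lra.
by rewrite -lee_fin fineK.
Qed.

Lemma ae_forall_nat (P : nat -> T -> Prop) : (forall k, {ae mu, forall x, P k x}) ->
  {ae mu, forall x, forall k, P k x}.
Proof.
move=> H; have := negligible_bigcup (fun k => H k); apply: negligibleS.
by move=> x /= /existsNP[k nP]; exists k.
Qed.

(** Since t <= 1 + t^2, the terms are dominated by |a c| + |a c| |v (x - M c)|^2. The first part is
    summable, and the second has a sum with finite integral, hence finite almost everywhere. *)
Lemma l1_convolution_ae (v : T -> C R) a : cLp 2 v -> (l1norm a < +oo)%E ->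
  {ae mu, forall x, exists l, hsum (fun c => a c * v (x - M *m zv R c)) l}.
Proof.
move=> Lv aoo.
pose F c t : \bar R := (normc (a c) * normc (v (t - M *m zv R c)) ^+ 2)%:E.
have F0 c t : (0 <= F c t)%E by rewrite lee_fin mulr_ge0 ?normc_ge0 ?sqr_ge0.
have Lc c : cLp 2 (fun t => v (t - M *m zv R c)) by exact: (cL2_shift (- (M *m zv R c)) Lv).
have mF c : measurable_fun setT (F c).
  apply/measurable_EFinP; apply: measurable_funM; first exact: measurable_cst.
  by apply/measurable_EFinP; apply: measurable_normc_sqr; exact: cL2_meas (Lc c).
have iF : (\int[mu]_t (\esum_(c in [set: Z]) F c t) < +oo)%E.
  rewrite integral_esum//.
  have E c : (\int[mu]_t F c t = (nn v)%:E * (normc (a c))%:E)%E.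
    under eq_integral do rewrite /F EFinM.
    rewrite ge0_integralZl//; last 3 first.
    - by apply: measurable_normc_sqr; exact: cL2_meas (Lc c).
    - by move=> t _; rewrite lee_fin sqr_ge0.
    - by rewrite lee_fin normc_ge0.
    by rewrite (nnE (Lc c)) (nn_shift (- (M *m zv R c)) (cL2_meas Lv)) muleC.
  under eq_esum do rewrite E.
  rewrite esumZl; [|exact: nn_ge0|by move=> c; rewrite lee_fin normc_ge0].
  by rewrite lte_mul_pinfty// lee_fin nn_ge0.
have mS : measurable_fun setT (fun t => \esum_(c in [set: Z]) F c t) by exact: measurable_esum.
have S0 t : (0 <= \esum_(c in [set: Z]) F c t)%E by apply: esum_ge0.
have iS : mu.-integrable setT (fun t => \esum_(c in [set: Z]) F c t).
  by apply/integrableP; split=> //; under eq_integral do rewrite gee0_abs//.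
have := integrable_ae measurableT iS; apply: filterS => t /(_ I) Ft; apply: hsum_abs.
apply: (@le_lt_trans _ _ (l1norm a + \esum_(c in [set: Z]) F c t)%E); last first.
  by apply: lte_add_pinfty => //; rewrite -ge0_fin_numE.
rewrite -esumD => [|c _|c _]; [|by rewrite lee_fin normc_ge0|exact: F0].
apply: le_esum => c _; rewrite /F -EFinD lee_fin normcM'.
rewrite -[X in _ <= X + _]mulr1 -mulrDr ler_wpM2l ?normc_ge0//.
have := sqr_ge0 (normc (v (t - M *m zv R c)) - 1).
by have := normc_ge0 (v (t - M *m zv R c)); rewrite !expr2; nra.
Qed.

(** Let s N be the partial sum over the cube of radius N. Its L^2 distance to f N ** [ztrunc] a N is
    at most |a|_1 times that of f N to u, so s tends in L^2 to the module action, and a subsequence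
    does so almost everywhere. At almost every x it also tends to the unconditional sum. *)
Lemma Xn_l1_act u a : Xn u -> (l1norm a < +oo)%E ->
  {ae mu, forall x, L2rep (act u (l1_embed nrm j a)) x = (L2rep u ** a) x}.
Proof.
move=> [f fu] aoo; set w := act u _.
have Xw : Xap (fun k => f k ** ztrunc a k) w.
  exact: (Xn_actP uM gc fu (Ccz_ztrunc a) (ztrunc_embed aoo)).
have Lu := L2rep_cL2 u.
have Lsh c (v : T -> C R) : cLp 2 v -> cLp 2 (fun t => v (t - M *m zv R c)).
  by move=> Lv; exact: (cL2_shift (- (M *m zv R c)) Lv).
pose s N t : C R := \sum_(c <- zball d N) a c * L2rep u (t - M *m zv R c).
have Ls N : cLp 2 (s N).
  apply: (cL2_sum (zball d N) (F := fun c t => a c * L2rep u (t - M *m zv R c))) => c.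
  by apply: cL2Z; exact: Lsh.
have fE k : f k ** ztrunc a k = fun t => \sum_(c <- zball d k) a c * f k (t - M *m zv R c).
  rewrite circE; apply/funext => t; rewrite (@circM_sum _ _ M _ _ _ (zball d k)).
  - by apply: eq_big_seq => c cz; rewrite /ztrunc cz.
  - exact: undup_uniq.
  - by move=> c cz; rewrite /ztrunc (negbTE cz).
have a0 : (0 <= l1norm a)%E by apply: esum_ge0 => c _; rewrite lee_fin normc_ge0.
have [Q HQ] : exists Q : R, l1norm a = Q%:E.
  by exists (fine (l1norm a)); rewrite fineK// ge0_fin_numE.
have Cf := Xap_Ccr fu.
have dist k : L2norm (toL2 (s k) - toL2 (f k ** ztrunc a k)) <= Q * L2norm (toL2 (f k) - u).
  have Lf := Ccr_L2 (Cf k).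
  rewrite -[X in _ * L2norm (_ - X)]toL2_rep (L2norm_toL2B Lf Lu).
  rewrite (L2norm_toL2B (Ls k) (Ccr_L2 (Xap_Ccr Xw k))) fE.
  have -> : (fun x => s k x - \sum_(c <- zball d k) a c * f k (x - M *m zv R c)) =
      (fun x => \sum_(c <- zball d k) (- a c) * (fun y => f k y - L2rep u y) (x - M *m zv R c)).
    apply/funext => x; rewrite /s -sumrB; apply: eq_bigr => c _.
    by rewrite mulNr mulrBr opprB.
  have LB c : cLp 2 (fun x => (fun y => f k y - L2rep u y) (x - M *m zv R c)).
    exact: (Lsh c (fun y => f k y - L2rep u y) (cL2B Lf Lu)).
  apply: le_trans (n2_sum (zball d k) (F := fun c x => (- a c) * (fun y => f k y - L2rep u y) (x - M *m zv R c)) _) _.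
    by move=> c; apply: cL2Z; exact: LB.
  have E c : n2 (fun x => (- a c) * (fun y => f k y - L2rep u y) (x - M *m zv R c)) =
      normc (a c) * n2 (fun y => f k y - L2rep u y).
    rewrite (n2Z (- a c) (LB c)) normcN'; congr (_ * Num.sqrt _).
    exact: (nn_shift (- (M *m zv R c)) (cL2_meas (cL2B Lf Lu))).
  under eq_bigr do rewrite E.
  rewrite -mulr_suml ler_wpM2r ?n2_ge0// -lee_fin -HQ -sumEFin.
  apply: (esum_seq_le (a := fun c => (normc (a c))%:E)); last exact: undup_uniq.
  by move=> c; rewrite lee_fin normc_ge0.
have sw : cvg_for (@L2norm R d) (fun k => toL2 (s k)) w.
  have h1 : cvg_for (@L2norm R d) (fun k => toL2 (s k) - toL2 (f k ** ztrunc a k)) 0.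
    apply: (cvg_for_le (c := Q) (sn_ge0 L2sn) L2sn (Xap_L2 fu)) => k; rewrite subr0; first exact: dist.
    exact: L2norm_ge0.
  have := cvg_forD L2sn h1 (Xap_L2 Xw); rewrite add0r; apply: cvg_for_ext => k.
  by rewrite subrK.
have [sg [l [sgi sl _ ael]]] := L2_sub_cvg (cvg_for_cauchy L2sn sw).
have lw : l = w by exact: (cvg_for_unique L2sn (@L2norm_eq0 R d) sl sw).
rewrite lw in ael.
have aes : {ae mu, forall x, forall k, L2rep (toL2 (s k)) x = s k x}.
  by apply: ae_forall_nat => k; exact: L2rep_toL2.
apply: filterS2 (filterI ael aes) (l1_convolution_ae Lu aoo) => x [hl hs] [m hm].
have -> : (L2rep u ** a) x = m by rewrite circE; exact: (usumTP hm).
have sm : s (sg i) x @[i --> \oo] --> (m : C R).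
  apply/cvgc_lt => e /hm[r Hr]; have [N HN] := zball_exhaust r; exists N => // k /= Nk.
  by apply: Hr; [exact: undup_uniq|apply: HN; exact: leq_trans Nk (sgi k)].
have E : (fun i => L2rep (toL2 (s (sg i))) x) = (fun i => s (sg i) x).
  by apply/funext => i; rewrite hs.
rewrite E in hl; exact: (cvg_unique (@norm_hausdorff _ _) hl sm).
Qed.

End wavelet_modules.

(** * Powers of the dilation matrix and the index *)

Section matrix_powers.
Context (R : realType) (d : nat).

Lemma mxpow_tr (B : 'M[R]_d) n : (mxpow B n)^T = mxpow B^T n.
Proof.
have H (E : 'M[R]_d) k : (E ^+ k)^T = E^T ^+ k.
  elim: k => [|k IH]; first by rewrite !expr0; exact: trmx1.
  by rewrite exprS exprSr -IH; exact: trmx_mul.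
by case: n => k /=; rewrite H// trmx_inv.
Qed.

(** A singular matrix would have the eigenvalue 0, whose modulus is not greater than 1. *)
Lemma dilation_det (D : 'M[int]_d) : dilation_matrix R D -> \det D != 0.
Proof.
move=> H; apply/negP => /eqP D0.
have /H : eigenvalue (map_mx intr D : 'M[R[i]]_d) 0.
  rewrite /eigenvalue /eigenspace raddf0 subr0 kermx_eq0 row_free_unit.
  by rewrite unitmxE det_map_mx D0 unitr0.
by rewrite normr0 ltr10.
Qed.

Lemma unitmx_exp (B : 'M[R]_d) k : B \in unitmx -> B ^+ k \in unitmx.
Proof.
move=> uB; elim: k => [|k IH]; first by rewrite expr0; exact: unitmx1.
by rewrite exprS; change (B *m B ^+ k \in unitmx); rewrite unitmx_mul uB.
Qed.

Lemma mxpow_unit (B : 'M[R]_d) n : B \in unitmx -> mxpow B n \in unitmx.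
Proof. by case: n => k uB /=; apply: unitmx_exp => //; rewrite unitmx_inv. Qed.

Lemma fine_mxscale_exp (B : 'M[R]_d) k : B \in unitmx -> fine (mxscale (B ^+ k)) = fine (mxscale B) ^+ k.
Proof.
move=> uB; elim: k => [|k IH].
  by rewrite !expr0; change (fine (mxscale (1%:M : 'M[R]_d)) = 1); rewrite mxscale1.
rewrite !exprS -IH; change (fine (mxscale (B *m B ^+ k)) = fine (mxscale B) * fine (mxscale (B ^+ k))).
by rewrite (mxscaleM uB (unitmx_exp k uB)) fineM// kp_fin// unitmx_exp.
Qed.

Lemma fine_mxscale_inv (B : 'M[R]_d) : B \in unitmx -> fine (mxscale (invmx B)) = (fine (mxscale B))^-1.
Proof.
move=> uB; have uI : invmx B \in unitmx by rewrite unitmx_inv.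
have := mxscaleM uB uI; rewrite mulmxV// mxscale1 => /(congr1 fine) /=.
rewrite fineM ?kp_fin// => h; have k0 := kp_gt0 uB.
apply: (@mulfI _ (fine (mxscale B))); first by rewrite gt_eqF.
by rewrite -h divff// gt_eqF.
Qed.

(** The map x |-> D x multiplies integrals by 1/m, so the scale of D^-n is m^n: the factor in front
    of the fibre sum is the Jacobian left over in [poissonM]. *)
Lemma index_powE (D : 'M[int]_d) n : \det D != 0 -> map_mx intr D \in @unitmx R d ->
  index_pow R D n = ((fine (mxscale (mxpow (map_mx intr D : 'M[R]_d) (- n))))%:C)%C.
Proof.
move=> D0 uD; set B := map_mx intr D; set q := fine (mxscale B).
have q0 : 0 < q by exact: kp_gt0.
have qE : q^-1 = (dilation_index D)%:R.
  rewrite /q mxscale_int//= normfV invrK /dilation_index.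
  by rewrite -intr_norm; case: (\det D) => m //; rewrite /= pmulrn.
rewrite /index_pow.
have E : (dilation_index D)%:R = ((q^-1)%:C)%C :> C R by rewrite qE rmorph_nat.
case: n => [[|k]|k].
- rewrite oppr0 /= expr0z; change (1 = ((fine (mxscale (1%:M : 'M[R]_d)))%:C)%C :> C R).
  by rewrite mxscale1.
- rewrite -[mxpow _ _]/(invmx B ^+ k.+1) fine_mxscale_exp ?unitmx_inv// fine_mxscale_inv//.
  by rewrite rmorphXn /= -/q -E.
rewrite -[mxpow _ _]/(B ^+ k.+1) fine_mxscale_exp// -/q.
by rewrite -[q]invrK exprVn rmorphV ?unitfE ?expf_neq0 ?invr_eq0 ?gt_eqF//= rmorphXn /= -E.
Qed.

End matrix_powers.

(** * Limits of sums of squares and reindexing of unconditional sums *)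

Section real_lemmas.
Context (R : realType).

(** The weight t makes the main term as close to its true size as desired, at the price of a large
    constant on the difference, which tends to 0 in the applications. *)
Lemma normc_sqr_weighted (a b : C R) (t : R) : 0 < t ->
  normc a ^+ 2 <= (1 + t) * normc b ^+ 2 + (1 + t^-1) * normc (a - b) ^+ 2.
Proof.
move=> t0; have h := normcD (a - b) b; rewrite subrK in h.
have n1 := normc_ge0 a; have n2' := normc_ge0 b; have n3 := normc_ge0 (a - b).
apply: (@le_trans _ _ ((normc (a - b) + normc b) ^+ 2)); first by rewrite lerXn2r ?nnegrE ?addr_ge0.
move: (normc b) (normc (a - b)) n2' n3 => p q p0 q0.
have -> : (1 + t) * p ^+ 2 + (1 + t^-1) * q ^+ 2 = (q + p) ^+ 2 + t^-1 * (t * p - q) ^+ 2.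
  by field; rewrite gt_eqF.
by rewrite lerDl mulr_ge0 ?sqr_ge0// invr_ge0 ltW.
Qed.

(** For fixed t, letting k tend to infinity gives S <= (1 + t) p and p <= (1 + t) S; then t tends to
    0. Finiteness of S comes from t = 1 and k = 0. *)
Lemma eq_of_weighted (S : \bar R) (p : R) (pk dk : nat -> R) : (0 <= S)%E -> 0 <= p ->
  pk k @[k --> \oo] --> p -> dk k @[k --> \oo] --> (0 : R) ->
  (forall t k, 0 < t -> (S <= ((1 + t) * pk k + (1 + t^-1) * dk k)%:E)%E) ->
  (forall t k, 0 < t -> ((pk k)%:E <= (1 + t)%:E * S + ((1 + t^-1) * dk k)%:E)%E) -> S = p%:E.
Proof.
move=> S0 p0 pkp dk0 H1 H2.
have [s sE] : exists s, S = s%:E.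
  exists (fine S); rewrite fineK// ge0_fin_numE//.
  by apply: le_lt_trans (H1 1 0%N ltr01) _; rewrite ltry.
move: S0 H1 H2; rewrite sE lee_fin => s0 H1 H2; congr EFin.
have lim t : 0 < t -> (fun k => (1 + t) * pk k + (1 + t^-1) * dk k) @ \oo --> (1 + t) * p.
  by move=> t0; rewrite -[(1 + t) * p]addr0 -(mulr0 (1 + t^-1)); apply: cvgD; apply: cvgMr.
have lim2 t : 0 < t -> (fun k => (1 + t) * s + (1 + t^-1) * dk k) @ \oo --> (1 + t) * s.
  by move=> t0; rewrite -[X in _ --> X]addr0 -(mulr0 (1 + t^-1)); apply: cvgD; [exact: cvg_cst|apply: cvgMr].
have a1 t : 0 < t -> s <= (1 + t) * p.
  move=> t0; apply: (ler_cvg_to (cvg_cst s) (lim t t0)); apply: nearW => k.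
  by have := H1 t k t0; rewrite lee_fin.
have a2 t : 0 < t -> p <= (1 + t) * s.
  move=> t0; apply: (ler_cvg_to pkp (lim2 t t0)); apply: nearW => k.
  by have := H2 t k t0; rewrite -EFinM -EFinD lee_fin.
have fin (x y : R) : 0 <= y -> (forall t, 0 < t -> x <= (1 + t) * y) -> x <= y.
  move=> y0 H; apply/ler_addgt0Pr => e e0.
  have t0 : 0 < e / (y + 1) by rewrite divr_gt0//; lra.
  apply: le_trans (H _ t0) _; rewrite mulrDl mul1r lerD2l mulrAC ler_pdivrMr; nra.
by apply/eqP; rewrite eq_le; apply/andP; split; [exact: fin p0 a1|exact: fin s0 a2].
Qed.

(** Passes from Z^d, where sums are computed, to a fibre in R^d, where [usum] is taken. A finite
    list in J is pulled back along the bijection phi to the indices of its elements that lie in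
    S. *)
Lemma hsum_reindex (I J : choiceType) (phi : I -> J) (S : set J) (G : J -> C R) l :
  injective phi -> (forall i, S (phi i)) -> (forall x, S x -> exists i, phi i = x) ->
  hsum (fun i => G (phi i)) l -> hsum (fun x => if x \in S then G x else 0) l.
Proof.
move=> phi_inj phiS Sphi H e e0; have [s Hs] := H e e0.
exists (map phi s) => t ut st.
have [psi Hpsi] : exists psi : J -> option I, forall x, S x -> omap phi (psi x) = Some x.
  have /choice[psi Hpsi] : forall x, exists o : option I, S x -> omap phi o = Some x.
    move=> x; have [Sx|nSx] := pselect (S x); last by exists None.
    by have [i <-] := Sphi x Sx; exists (Some i).
  by exists psi.
pose t' := pmap psi [seq x <- t | x \in S].
have mt i : (i \in t') = (phi i \in t).
  rewrite mem_pmap; apply/mapP/idP => [[x]|it].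
    rewrite mem_filter => /andP[/set_mem Sx xt] E.
    by have := Hpsi x Sx; rewrite -E /= => -[->].
  exists (phi i); first by rewrite mem_filter it andbT; exact/mem_set/phiS.
  have := Hpsi (phi i) (phiS i); case: (psi (phi i)) => //= k [kE].
  by rewrite (phi_inj _ _ kE).
have ut' : uniq t'.
  have : uniq (map phi t').
    have -> : map phi t' = [seq x <- t | x \in S]; last by rewrite filter_uniq.
    rewrite /t'; elim: t {ut st mt t'} => //= x t IH; case: ifP => //= xS.
    have := Hpsi x (set_mem xS); case: (psi x) => //= k [->].
    by rewrite IH.
  by rewrite map_inj_uniq.
have E : \sum_(x <- t) (if x \in S then G x else 0) = \sum_(i <- t') G (phi i).
  rewrite -big_mkcond /= -big_filter -(big_map phi xpredT G).
  have -> : map phi t' = [seq x <- t | x \in S]; last by [].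
  rewrite /t'; elim: t {ut st mt t' ut'} => //= x t IH; case: ifP => //= xS.
  have := Hpsi x (set_mem xS); case: (psi x) => //= k [->].
  by rewrite IH.
rewrite E; apply: Hs => // i si; rewrite mt; apply: st; exact: map_f.
Qed.

End real_lemmas.

(** * The Fourier side *)

Section hat_inner_product.
Context (R : realType) (d : nat) (D : 'M[int]_d) (n : int).
Local Notation T := 'cV[R]_d.
Local Notation mu := (cV_lebesgue R d).
Local Notation Z := 'cV[int]_d.
Local Notation M := (mxpow (map_mx intr D : 'M[R]_d) (- n)).
Hypothesis uM : M \in unitmx.
Hypothesis indexE : index_pow R D n = ((fine (mxscale M))%:C)%C.
Context (A : algType R[i]) (star : A -> A) (nrm : A -> R) (j : (Z -> C R) -> A).
Hypothesis gc : group_cstar_algebra star nrm j.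
Let L2sn := @L2norm_sn R d.
Let CTsn := @CT_norm_sn R d.
Local Notation ip := (@Xn_ip R d D n A nrm j).
Local Notation Xn := (@Xn R d D n).
Local Notation gelf := (gelf nrm j).
Local Notation N := (invmx M^T).
Local Notation kp := (fine (mxscale M)).
Implicit Types (u v w : L2 R d).

Let uN : N \in unitmx. Proof. by rewrite unitmx_inv unitmx_tr. Qed.

Lemma iota_hatE xi : iota_hat_n D n xi = torus_proj (M^T *m xi).
Proof. by rewrite /iota_hat_n mxpow_tr. Qed.

Lemma esum_sqr_weighted (a b : Z -> C R) (t : R) : 0 < t ->
  ((\esum_(g in [set: Z]) (normc (a g) ^+ 2)%:E) <=
   (1 + t)%:E * (\esum_(g in [set: Z]) (normc (b g) ^+ 2)%:E) +
   (1 + t^-1)%:E * (\esum_(g in [set: Z]) (normc (a g - b g) ^+ 2)%:E))%E.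
Proof.
move=> t0; have ti : 0 < t^-1 by rewrite invr_gt0.
have t1 : 0 <= 1 + t by lra.
have t2 : 0 <= 1 + t^-1 by lra.
have sq0 (c : Z -> C R) (g : Z) : (0 <= (normc (c g) ^+ 2)%:E)%E by rewrite lee_fin sqr_ge0.
rewrite -(esumZl t1 (fun g => sq0 b g)) -(esumZl t2 (fun g => sq0 (a \- b) g)).
rewrite -esumD => [|g _|g _].
- by apply: le_esum => g _; rewrite -!EFinM -EFinD lee_fin normc_sqr_weighted.
- by rewrite -EFinM lee_fin mulr_ge0 ?sqr_ge0.
- by rewrite -EFinM lee_fin mulr_ge0 ?sqr_ge0.
Qed.

Lemma sub_fast (u : nat -> L2 R d) l (e : nat -> R) : cvg_for (@L2norm R d) u l ->
  (forall i, 0 < e i) -> exists s : nat -> nat, forall i, (i <= s i)%N /\ L2norm (u (s i) - l) < e i.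
Proof.
move=> /(cvg_forP L2sn) ul e0.
have /choice[s Hs] : forall i, exists k, (i <= k)%N /\ L2norm (u k - l) < e i.
  move=> i; have [P HP] := ul _ (e0 i); exists (maxn i P).
  by split; [exact: leq_maxl|apply: HP; exact: leq_maxr].
by exists s.
Qed.

(** For approximants in C_c(R^d) the identity is [poissonM]. Along the subsequence s the fibre sums
    of squared differences decay like 4^-i almost everywhere, while the brackets converge uniformly
    on the torus. *)
Lemma hat_quadratic u : Xn u ->
  {ae mu, forall x, (\esum_(g in [set: Z]) (normc (L2rep (fourierL2 u) (N *m (x + zv R g))) ^+ 2)%:E
     = (kp^-1 * complex.Re (gelf (ip u u) (torus_proj x)))%:E)%E}.
Proof.
move=> Xu; have [f fu] := Xu; have Cf := Xap_Ccr fu; set v := fourierL2 u.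
have Fv := fourierL2P (Xap_Llim fu).
have LF k := Ccr_fourier_L2 (Cf k).
have Lv := L2rep_cL2 v.
have [kNE kN0] := mxscale_fin uN; set kN := fine (mxscale N) in kNE kN0.
(* The substitution by the fibre matrix multiplies squared norms by [kN]; with this e i, [kN] e_i^2
   is at most 16^-i, as [ae_geom] requires. *)
pose e i : R := 4^-1 ^+ i / (kN + 1).
have e0 i : 0 < e i by rewrite divr_gt0 ?exprn_gt0//; lra.
have [s Hs] := sub_fast Fv e0.
pose dif i (y : T) : C R := fourier1 (f (s i)) y - L2rep v y.
have Ld i : cLp 2 (dif i) by exact: cL2B.
pose Dl i x : \bar R := ((\1_(@cube R d) x)%:E *
  \esum_(g in [set: Z]) (normc (dif i (N *m (x + zv R g))) ^+ 2)%:E)%E.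
have mdN i : measurable_fun setT (fun x : T => (normc (dif i (N *m x)) ^+ 2)%:E : \bar R).
  exact: measurable_normc_sqr (cL2_meas (cL2_mulmx uN (Ld i))).
have mcube : measurable_fun setT (fun x : T => (\1_(@cube R d) x)%:E : \bar R).
  by apply/measurable_EFinP; apply: measurable_indic; exact: measurable_cube.
have [E [mE E0] HE] : exists2 E : set T, measurable E /\ mu (~` E) = 0%E &
    forall x, E x -> exists2 K : R, 0 <= K & forall i, (Dl i x <= (K * 4^-1 ^+ i)%:E)%E.
  apply: ae_geom => [i|i x|i].
  - apply: emeasurable_funM mcube _; apply: measurable_esum => [g x|g]; first by rewrite lee_fin sqr_ge0.
    have mD : measurable_fun setT (fun x : T => x + zv R g) by exact: measurable_cVD.
    exact: (measurableT_comp (mdN i) mD).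
  - apply: mule_ge0; first by rewrite lee_fin.
    by apply: esum_ge0 => g _; rewrite lee_fin sqr_ge0.
  (* Integrating the fibre sums over the cube gives the integral over R^d, so their size is an L^2
     distance. *)
  rewrite -(ge0_integral_unfold (F := fun x => (normc (dif i (N *m x)) ^+ 2)%:E)) => [|//|x]; last first.
    by rewrite lee_fin sqr_ge0.
  rewrite (nnE (cL2_mulmx uN (Ld i))) (nn_mulmx uN (Ld i)) -/kN lee_fin.
  have := (Hs i).2; rewrite -[X in L2norm (_ - X)]toL2_rep (L2norm_toL2B (LF _) Lv) -/(dif i) => hi.
  rewrite -n2_sqr (_ : 16^-1 = 4^-1 ^+ 2 :> R); last by field.
  have h2 : n2 (dif i) ^+ 2 <= e i ^+ 2 by apply: lerXn2r; rewrite ?nnegrE ?n2_ge0 1?ltW// e0.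
  apply: le_trans (ler_wpM2l (ltW kN0) h2) _.
  rewrite /e expr_div_n mulrCA exprAC ler_piMr ?exprn_ge0//.
  by rewrite ler_pdivrMr ?mul1r ?exprn_gt0//; [nra|lra].
apply: ae_cube_periodic => [x g|].
  rewrite torus_projD; have -> : (\esum_(h in [set: Z]) (normc (L2rep v (N *m (x + zv R g + zv R h))) ^+ 2)%:E =
    \esum_(h in [set: Z]) (normc (L2rep v (N *m (x + zv R h))) ^+ 2)%:E)%E; last by [].
  rewrite (reindex_esum setT setT (fun h => h - g)); last first.
    split=> //; first by move=> p q _ _; exact: addIr.
    by move=> h _; exists (h + g) => //; rewrite addrK.
  by apply: eq_esum => h _; rewrite zvB -addrA [zv R g + _]addrC subrK.
apply: (ae_of_set mE E0) => x /HE[K K0 HK] cx.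
have [r r0 hr] := gelf_ip_ge0 uM gc (torus_proj x) Xu.
have k0 := kp_gt0 uM.
have PE i := poissonM uM x (Cf (s i)).
apply: (eq_of_weighted (pk := fun i => kp^-1 * tq D n (f (s i)) x) (dk := fun i => K * 4^-1 ^+ i)).
- by apply: esum_ge0 => g _; rewrite lee_fin sqr_ge0.
- by rewrite hr mulr_ge0// invr_ge0 ltW.
- apply: cvgMr; apply/cvgrPdist_lt => eps eps0.
  have [P HP] := (cvg_forP CTsn _ _).1 (gelf_ip_cvg uM gc fu fu) _ eps0.
  exists P => // i /= Pi; rewrite distrC /tq -ReB; apply: le_lt_trans (normc_Re _) _.
  rewrite /tb -(ctrigE x (Ccz_bracket uM (Cf (s i)) (Cf (s i)))) -CTB.
  apply: le_lt_trans (CT_norm_ub _ _) _; apply: HP; exact: leq_trans Pi (Hs i).1.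
- by rewrite -(mulr0 K); apply: cvgMr; apply: cvg_expr; rewrite ger0_norm; lra.
- move=> t i t0; have ti : 0 < t^-1 by rewrite invr_gt0.
  apply: le_trans (esum_sqr_weighted (fun g => L2rep v (N *m (x + zv R g)))
     (fun g => fourier1 (f (s i)) (N *m (x + zv R g))) t0) _.
  have [Q [Q0 tQ ->]] := PE i; rewrite [X in (_ <= X)%E]EFinD; apply: leeD.
    by rewrite -EFinM lee_fin /tq /tb bracketE tQ.
  rewrite EFinM; apply: lee_wpmul2l; first by rewrite lee_fin; lra.
  have := HK i; rewrite /Dl indicE mem_set// mul1e.
  by under eq_esum do rewrite /dif normc_distC.
- move=> t i t0; have ti : 0 < t^-1 by rewrite invr_gt0.
  have := esum_sqr_weighted (fun g => fourier1 (f (s i)) (N *m (x + zv R g)))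
     (fun g => L2rep v (N *m (x + zv R g))) t0.
  have [Q [Q0 tQ ->]] := PE i; rewrite /tq /tb bracketE tQ => h; apply: le_trans h _.
  apply: leeD => //; rewrite EFinM; apply: lee_wpmul2l; first by rewrite lee_fin; lra.
  by have := HK i; rewrite /Dl indicE mem_set// mul1e.
Qed.

Let H u v x : C R := gelf (ip u v) (torus_proj x).

Lemma H_expand u v (c : C R) x : Xn u -> Xn v ->
  H (v + (c : R[i]) *: u) (v + (c : R[i]) *: u) x =
  H v v x + c * H v u x + conjc c * H u v x + conjc c * c * H u u x.
Proof.
move=> Xu Xv; have [m0 mD mZ _ _ _ _ _ _ _ _ ipD ipZ _ ipS _ _] := Xn_ip_module uM gc.
have Xc : Xn ((c : R[i]) *: u) by exact: mZ.
have Xw : Xn (v + (c : R[i]) *: u) by exact: mD.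
have HD a b b' : Xn a -> Xn b -> Xn b' -> H a (b + b') x = H a b x + H a b' x.
  by move=> Xa Xb Xb'; rewrite /H (ipD _ _ _ Xa Xb Xb') (gelfD gc).
have HZ a b (k : C R) : Xn a -> Xn b -> H a ((k : R[i]) *: b) x = k * H a b x.
  by move=> Xa Xb; rewrite /H (ipZ _ _ _ Xa Xb) (gelfZ gc).
have HS a b : Xn a -> Xn b -> H b a x = conjc (H a b x).
  by move=> Xa Xb; rewrite /H -(ipS _ _ Xa Xb) (gelf_star gc).
rewrite (HD _ _ _ Xw Xv Xc) (HZ _ _ _ Xw Xu) (HS _ _ Xv Xw) (HS _ _ Xu Xw).
rewrite (HD _ _ _ Xv Xv Xc) (HD _ _ _ Xu Xv Xc) (HZ _ _ _ Xv Xu) (HZ _ _ _ Xu Xu).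
have := (HS _ _ Xv Xv, HS _ _ Xu Xu, HS _ _ Xu Xv, HS _ _ Xv Xu).
move: (H v v x) (H u u x) (H u v x) (H v u x) => a b e f [[[e1 e2] e3] e4].
by rewrite !cjD !cjM -e1 -e2 -e3 -e4 /=; ring.
Qed.

(** Polarisation: the sum of c |b + c a|^2 over the fourth roots of unity c is 4 conj a b.
    Summability of the products is thus inherited from that of squares. *)
Lemma hsum_polar (I : choiceType) (a b : I -> C R) (s1 s2 s3 s4 : C R) :
  hsum (fun i => ((normc (b i + 1 * a i) ^+ 2)%:C)%C : C R) s1 ->
  hsum (fun i => ((normc (b i + 'i%C * a i) ^+ 2)%:C)%C : C R) s2 ->
  hsum (fun i => ((normc (b i + -1 * a i) ^+ 2)%:C)%C : C R) s3 ->
  hsum (fun i => ((normc (b i + - 'i%C * a i) ^+ 2)%:C)%C : C R) s4 ->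
  hsum (fun i => conjc (a i) * b i)
    (4^-1 * s1 + 4^-1 * ('i%C * s2) + (- 4^-1) * s3 + (- 4^-1) * ('i%C * s4)).
Proof.
move=> h1 h2 h3 h4.
have := hsumD (hsumD (hsumD (hsumZ 4^-1 h1) (hsumZ 4^-1 (hsumZ ('i%C : C R) h2))) (hsumZ (- 4^-1) h3))
  (hsumZ (- 4^-1) (hsumZ ('i%C : C R) h4)).
set G := (X in hsum X _ -> _) => hG; have -> : (fun i => conjc (a i) * b i) = G; last exact: hG.
have i2 : ('i%C : C R) * 'i%C = -1 by apply: eqc; rewrite ?ReM ?ImM /=; ring.
have ci : conjc ('i%C : C R) = - 'i%C by apply: eqc; rewrite /=; ring.
apply/funext => i; rewrite /G -!conj_mul !cjD !cjM !cjN ci conjc1.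
move: (a i) (b i) (conjc (a i)) (conjc (b i)) ('i%C : C R) i2 => x y x' y' ii i2.
by field: i2.
Qed.

Lemma fourierL2_combo u v (c : C R) : Xn u -> Xn v ->
  {ae mu, forall x, L2rep (fourierL2 (v + (c : R[i]) *: u)) x =
     L2rep (fourierL2 v) x + c * L2rep (fourierL2 u) x}.
Proof.
move=> [f fu] [g gv].
rewrite (fourierL2D (Xap_Llim gv) (LlimZ c (Xap_Llim fu))) (fourierL2Z c (Xap_Llim fu)).
have := L2repZ (c : R[i]) (fourierL2 u).
apply: filterS2 (L2repD (fourierL2 v) ((c : R[i]) *: fourierL2 u)) => x ->.
by move=> ->.
Qed.

Lemma hat_fiber_hsum u v (c : C R) : Xn u -> Xn v ->
  {ae mu, forall x, hsum (fun g : Z => ((normc (L2rep (fourierL2 v) (N *m (x + zv R g)) +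
       c * L2rep (fourierL2 u) (N *m (x + zv R g))) ^+ 2)%:C)%C : C R)
     ((kp^-1)%:C%C * H (v + (c : R[i]) *: u) (v + (c : R[i]) *: u) x)}.
Proof.
move=> Xu Xv; have [m0 mD mZ _ _ _ _ _ _ _ _ ipD ipZ _ ipS _ _] := Xn_ip_module uM gc.
have Xw : Xn (v + (c : R[i]) *: u) by apply: mD => //; exact: mZ.
have h1 := ae_lattice uN (fourierL2_combo c Xu Xv).
apply: filterS2 h1 (hat_quadratic Xw) => x Ex.
have [r r0 hr] := gelf_ip_ge0 uM gc (torus_proj x) Xw.
rewrite /H hr /= => Q; rewrite -CrM; apply: hsum_ge0 => [g|]; first exact: sqr_ge0.
by rewrite -Q; apply: eq_esum => g _; congr ((normc _ ^+ 2)%:E); apply: esym; exact: Ex.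
Qed.

(** The fibre sums and the extended brackets are polarised with the same four coefficients. The
    factor [kp]^-1 left by Poisson summation cancels against [index_pow]. *)
Lemma hat_ip_ae u v : Xn u -> Xn v ->
  {ae mu, forall x, gelf (ip u v) (torus_proj x) = index_pow R D n *
    usum [set xi | iota_hat_n D n xi = torus_proj x]
        (fun xi => conjc (L2rep (fourierL2 u) xi) * L2rep (fourierL2 v) xi)}.
Proof.
move=> Xu Xv.
have a1 := hat_fiber_hsum 1 Xu Xv; have a2 := hat_fiber_hsum 'i%C Xu Xv.
have a3 := hat_fiber_hsum (-1) Xu Xv; have a4 := hat_fiber_hsum (- 'i%C) Xu Xv.
apply: filterS2 (filterI a1 a2) (filterI a3 a4) => x [h1 h2] [h3 h4].
have := hsum_polar h1 h2 h3 h4.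
rewrite !(H_expand _ _ Xu Xv).
set l := (X in hsum _ X -> _) => hl.
have lE : l = (kp^-1)%:C%C * H u v x.
  have i2 : ('i%C : C R) * 'i%C = -1 by apply: eqc; rewrite ?ReM ?ImM /=; ring.
  have ci : conjc ('i%C : C R) = - 'i%C by apply: eqc; rewrite /=; ring.
  rewrite /l !cjN ci conjc1; move: (H v v x) (H v u x) (H u v x) (H u u x) ('i%C : C R) i2 ((kp^-1)%:C%C : C R).
  by move=> a b e f ii i2 k; field: i2.
rewrite lE in hl.
have k0 := kp_gt0 uM.
rewrite (usumP (l := (kp^-1)%:C%C * H u v x)); last first.
  apply: (hsum_reindex (phi := fun g : Z => N *m (x + zv R g))) hl.
  - move=> g h /(congr1 (mulmx M^T)); rewrite !mulKVmx ?unitmx_tr// => /addrI; exact: zv_inj.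
  - by move=> g /=; rewrite iota_hatE mulKVmx ?unitmx_tr// torus_projD.
  - move=> xi /=; rewrite iota_hatE => /torus_projP[g hg]; exists g.
    by rewrite -hg mulKmx ?unitmx_tr.
rewrite indexE mulrA -CrM divff ?gt_eqF//; exact: (esym (mul1r _)).
Qed.

(** Two continuous functions on the torus that agree almost everywhere are equal, so the function
    chosen in [Xn_hat_ip] has to be this one. *)
Lemma hat_ipE u v : Xn u -> Xn v -> Xn_hat_ip D n (fourierL2 u) (fourierL2 v) = gelf (ip u v).
Proof.
move=> Xu Xv; have h := hat_ip_ae Xu Xv; rewrite /Xn_hat_ip.
case: xgetP => [k _ Hk|/(_ (gelf (ip u v)))[] //].
by apply: CT_ae_eq; apply: filterS2 Hk h => x -> ->.
Qed.

End hat_inner_product.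

(** * Multiplication operators and the action on the Fourier side *)

Section bounded_multiplier.
Context (R : realType) (d : nat).
Local Notation T := 'cV[R]_d.
Local Notation mu := (cV_lebesgue R d).

Lemma cL2_mul_bounded (f w : T -> C R) (K : R) : 0 <= K -> cLp 2 f -> cmeasurable w ->
  (forall x, normc (w x) <= K) -> cLp 2 (fun x => f x * w x) /\ n2 (fun x => f x * w x) <= K * n2 f.
Proof.
move=> K0 Lf mw wK; have mf := cL2_meas Lf.
have mfw : cmeasurable (fun x => f x * w x) by exact: cmeasurableM.
have h : (\int[mu]_x (normc (f x * w x) ^+ 2)%:E <= (K ^+ 2 * nn f)%:E)%E.
  rewrite EFinM -nnE// -ge0_integralZl//; last 3 first.
  - exact: measurable_normc_sqr.
  - by move=> x _; rewrite lee_fin sqr_ge0.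
  - by rewrite lee_fin sqr_ge0.
  apply: ge0_le_integral => //.
  - by move=> x _; rewrite lee_fin sqr_ge0.
  - exact: measurable_normc_sqr.
  - by apply: measurable_funeM; exact: measurable_normc_sqr.
  - move=> x _; rewrite -EFinM lee_fin normcM' exprMn mulrC ler_wpM2r ?sqr_ge0//.
    by rewrite lerXn2r ?nnegrE ?normc_ge0.
have L : cLp 2 (fun x => f x * w x) by split=> //; apply: le_lt_trans h _; rewrite ltry.
split=> //; apply: n2_le; first by rewrite mulr_ge0 ?n2_ge0.
by rewrite exprMn n2_sqr -lee_fin -nnE.
Qed.

End bounded_multiplier.

Section hat_action.
Context (R : realType) (d : nat) (D : 'M[int]_d) (n : int).
Local Notation T := 'cV[R]_d.
Local Notation Z := 'cV[int]_d.
Local Notation ha := (@Xn_hat_act R d D n).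
Implicit Types (u v w : L2 R d) (h k : CT R d) (f : T -> C R).
Let sn := @L2norm_sn R d.

Let hm f h := fun x : T => f x * h (iota_hat_n D n x).

Lemma CT_iota_hat_measurable h : cmeasurable (fun x : T => h (iota_hat_n D n x)).
Proof.
rewrite /iota_hat_n; apply: (cmeasurable_comp (f := fun x => h (torus_proj x))).
  apply: cmeasurable_continuous; exact: (continuous_torus h).1 (@CT_cont R d h).
exact: measurable_mulmx.
Qed.

Let hm_L2 f h : cLp 2 f -> cLp 2 (hm f h) /\ n2 (hm f h) <= CT_norm h * n2 f.
Proof.
move=> Lf; apply: cL2_mul_bounded => //.
- exact: sn_ge0 (@CT_norm_sn R d) h.
- exact: CT_iota_hat_measurable.
- by move=> x; exact: CT_norm_ub.
Qed.

Lemma Xn_hat_act_toL2 f h : cLp 2 f -> ha (toL2 f) h = toL2 (hm f h).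
Proof.
move=> Lf; apply: toL2_ae; [exact: (hm_L2 _ (L2rep_cL2 _)).1|exact: (hm_L2 _ Lf).1|].
by apply: filterS (L2rep_toL2 Lf) => x; rewrite /hm => ->.
Qed.

Lemma Xn_hat_act_norm u h : L2norm (ha u h) <= CT_norm h * L2norm u.
Proof.
have [L B] := hm_L2 h (L2rep_cL2 u).
by rewrite /Xn_hat_act (L2norm_toL2 L).
Qed.

Lemma Xn_hat_actBl u v h : ha (u - v) h = ha u h - ha v h.
Proof.
have Lu := L2rep_cL2 u; have Lv := L2rep_cL2 v.
rewrite -{1}(toL2_rep u) -{1}(toL2_rep v) -(toL2B Lu Lv) (Xn_hat_act_toL2 _ (cL2B Lu Lv)).
rewrite /Xn_hat_act -(toL2B (hm_L2 h Lu).1 (hm_L2 h Lv).1); congr toL2.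
by apply/funext => x; rewrite /hm mulrBl.
Qed.

Lemma Xn_hat_actBr u h k : ha u (h - k) = ha u h - ha u k.
Proof.
have Lu := L2rep_cL2 u.
rewrite /Xn_hat_act -(toL2B (hm_L2 h Lu).1 (hm_L2 k Lu).1); congr toL2.
by apply/funext => x; rewrite CTB mulrBr.
Qed.

Lemma Xn_hat_act_cvg (w : nat -> L2 R d) v (h : nat -> CT R d) k :
  cvg_for (@L2norm R d) w v -> cvg_for (@CT_norm R d) h k ->
  cvg_for (@L2norm R d) (fun i => ha (w i) (h i)) (ha v k).
Proof.
move=> wv hk; have CTsn := @CT_norm_sn R d.
have [K K0 hK] := cvg_for_bnd CTsn (cvg_for_cauchy CTsn hk).
apply: (@squeeze_cvgr _ _ _ _ (fun=> 0)
   (fun i => K * L2norm (w i - v) + L2norm v * CT_norm (h i - k))).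
- apply: nearW => i; rewrite L2norm_ge0/=.
  have -> : ha (w i) (h i) - ha v k = ha (w i - v) (h i) + ha v (h i - k).
    by rewrite Xn_hat_actBl Xn_hat_actBr addrA subrK.
  apply: le_trans (snD sn _ _) _; apply: lerD.
    by apply: le_trans (Xn_hat_act_norm _ _) _; rewrite ler_wpM2r ?L2norm_ge0.
  by rewrite mulrC; exact: Xn_hat_act_norm.
- exact: cvg_cst.
- have -> : (0 : R) = K * 0 + L2norm v * 0 by rewrite !mulr0 addr0.
  by apply: cvgD; apply: cvgMr; [exact: wv|exact: hk].
Qed.

Local Notation M := (mxpow (map_mx intr D : 'M[R]_d) (- n)).
Hypothesis uM : M \in unitmx.
Context (A : algType R[i]) (star : A -> A) (nrm : A -> R) (j : (Z -> C R) -> A).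
Hypothesis gc : group_cstar_algebra star nrm j.
Local Notation act := (@Xn_act R d D n A nrm j).
Local Notation Xn := (@Xn R d D n).

(** On C_c(R^d) and C_c(Z^d) the transform turns the action into multiplication by [fourier1_circM];
    both sides are continuous in L^2 along approximating sequences. *)
Lemma hat_actE u x : Xn u -> ha (fourierL2 u) (gelf nrm j x) = fourierL2 (act u x).
Proof.
move=> [f fu]; have Cf := Xap_Ccr fu; have [a [ca ax ah]] := gelf_rel_gelf gc x.
apply: (cvg_for_unique sn (@L2norm_eq0 R d) (Xn_hat_act_cvg (fourierL2P (Xap_Llim fu)) ah)).
have := fourierL2P (Xap_Llim (Xn_actP uM gc fu ca ax)); apply: cvg_for_ext => k.
have Lf := Ccr_fourier_L2 (Cf k).
rewrite (Xn_hat_act_toL2 _ Lf); congr toL2; apply/funext => xi.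
rewrite circE /hm (fourier1_circM _ _ (Cf k) (ca k)) iota_hatE.
by rewrite (ctrigE _ (ca k)).
Qed.

End hat_action.

(** * Transport of a Hilbert module to its image *)

Section transport.
Context (R : realType) (A B : algType R[i]) (starA : A -> A) (nrmA : A -> R)
  (starB : B -> B) (nrmB : B -> R) (Phi : A -> B).
Hypothesis Phi_iso : cstar_isomorphism starA nrmA starB nrmB Phi.
Context (V W : lmodType R[i]) (X : set V) (ipX : V -> V -> A) (actX : V -> A -> V)
  (ipY : W -> W -> B) (actY : W -> B -> W) (U : V -> W).
Hypothesis modX : inner_product_module starA X ipX actX setT.
Hypothesis UD : forall x y, X x -> X y -> U (x + y) = U x + U y.
Hypothesis UZ : forall k x, X x -> U (k *: x) = k *: U x.
Hypothesis ipU : forall x y, X x -> X y -> ipY (U x) (U y) = Phi (ipX x y).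
Hypothesis actU : forall x a, X x -> actY (U x) (Phi a) = U (actX x a).
Local Notation Y := (U @` X).

Let PhiS : forall b, exists a, Phi a = b.
Proof. by case: Phi_iso => [[g _ gK] _ _ _ _] b; exists (g b); exact: gK. Qed.

Let PhiD a b : Phi (a + b) = Phi a + Phi b.
Proof. by case: Phi_iso => _ lin _ _ _; have := lin 1 a b; rewrite !scale1r. Qed.

Let Phi0 : Phi 0 = 0.
Proof. by apply: (addrI (Phi 0)); rewrite -PhiD !addr0. Qed.

Let PhiZ k a : Phi (k *: a) = k *: Phi a.
Proof. by case: Phi_iso => _ lin _ _ _; have := lin k a 0; rewrite Phi0 !addr0. Qed.

Let PhiB a b : Phi (a - b) = Phi a - Phi b.
Proof. by rewrite -scaleN1r PhiD PhiZ scaleN1r. Qed.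

Let PhiM a b : Phi (a * b) = Phi a * Phi b.
Proof. by case: Phi_iso => _ _ [_ h] _ _; exact: h. Qed.

Let X0 := ipm_0 modX.

Let XB x y : X x -> X y -> X (x - y).
Proof. by move=> Xx Xy; rewrite -scaleN1r; apply: (ipm_D modX) => //; exact: (ipm_Z modX). Qed.

Let UB x y : X x -> X y -> U (x - y) = U x - U y.
Proof. by move=> Xx Xy; rewrite -scaleN1r UD// ?UZ ?scaleN1r//; rewrite -scaleN1r; exact: (ipm_Z modX). Qed.

Let U0 : U 0 = 0.
Proof. by rewrite -(subrr (0 : V)) UB// subrr. Qed.

Lemma transport_eq0 x : X x -> ipY (U x) (U x) = 0 -> x = 0.
Proof.
case: Phi_iso => [[g gK _] _ _ _ _] Xx; rewrite ipU// -Phi0 => /(can_inj gK).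
exact: (ipm_ip_eq0 modX).
Qed.

(** An element of the kernel has inner product 0 with itself. This provides the inverse of the
    Fourier transform on the image of X_n. *)
Lemma transport_inj x y : X x -> X y -> U x = U y -> x = y.
Proof.
move=> Xx Xy xy; apply/eqP; rewrite -subr_eq0; apply/eqP.
apply: transport_eq0 (XB Xx Xy) _.
have ip00 : ipX 0 0 = 0 by have := ipm_ipZ modX 0 X0 X0; rewrite !scale0r.
by rewrite UB// xy subrr -U0 ipU// ip00 Phi0.
Qed.

Lemma transport_norm x : X x -> hilbert_norm nrmB ipY (U x) = hilbert_norm nrmA ipX x.
Proof. by case: Phi_iso => _ _ _ _ Pn Xx; rewrite /hilbert_norm ipU// Pn. Qed.

(** U intertwines the operations over Phi, and Phi is surjective, so each axiom on the image is an
    axiom of X for chosen preimages of the elements and of the coefficients. *)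
Lemma transport_module : inner_product_module starB Y ipY actY setT.
Proof.
case: (modX) => m0 mD mZ mact mact1 mactM mactDl mactDr mactZl mactZr _ mipD mipZ mipact mstar mpos _.
case: Phi_iso => _ _ [Phi1 _] Pstar _.
split=> //.
- by exists 0.
- by move=> _ _ [x Xx <-] [y Xy <-]; exists (x + y); [exact: mD|exact: UD].
- by move=> k _ [x Xx <-]; exists (k *: x); [exact: mZ|exact: UZ].
- by move=> _ b [x Xx <-] _; have [a <-] := PhiS b; rewrite actU//; exists (actX x a) => //; exact: mact.
- by move=> _ [x Xx <-]; rewrite -Phi1 actU// mact1.
- move=> _ b c [x Xx <-] _ _; have [a <-] := PhiS b; have [a' <-] := PhiS c.
  by rewrite -PhiM !actU ?mactM//; exact: mact.
- move=> _ _ b [x Xx <-] [y Xy <-] _; have [a <-] := PhiS b.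
  by rewrite -UD// !actU ?mactDl ?UD//; [exact: mact|exact: mact|exact: mD].
- move=> _ b c [x Xx <-] _ _; have [a <-] := PhiS b; have [a' <-] := PhiS c.
  by rewrite -PhiD !actU// mactDr// UD//; exact: mact.
- move=> k _ b [x Xx <-] _; have [a <-] := PhiS b.
  by rewrite -UZ// !actU ?mactZl ?UZ//; [exact: mact|exact: mZ].
- move=> k _ b [x Xx <-] _; have [a <-] := PhiS b.
  by rewrite -PhiZ !actU ?mactZr ?UZ//; exact: mact.
- move=> _ _ _ [x Xx <-] [y Xy <-] [z Xz <-].
  by rewrite -UD// !ipU ?mipD ?PhiD//; exact: mD.
- by move=> k _ _ [x Xx <-] [y Xy <-]; rewrite -UZ// !ipU ?mipZ ?PhiZ//; exact: mZ.
- move=> _ _ b [x Xx <-] [y Xy <-] _; have [a <-] := PhiS b.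
  by rewrite actU// !ipU ?mipact ?PhiM//; exact: mact.
- by move=> _ _ [x Xx <-] [y Xy <-]; rewrite !ipU// -Pstar mstar.
- move=> _ [x Xx <-]; rewrite ipU//; have [b ->] := mpos _ Xx.
  by exists (Phi b); rewrite PhiM Pstar.
- by move=> _ [x Xx <-] /(transport_eq0 Xx) ->; rewrite U0.
Qed.

Lemma transport_hilbert : hilbert_module starA nrmA X ipX actX ->
  hilbert_module starB nrmB Y ipY actY.
Proof.
move=> [_ Xc]; split; first exact: transport_module.
move=> u Yu cu; have /choice[v Hv] : forall k, exists x, X x /\ U x = u k.
  by move=> k; have [x Xx <-] := Yu k; exists x.
have Xv k := (Hv k).1; have vu k : u k = U (v k) := esym (Hv k).2.
have [|l Xl vl] := Xc v Xv.
  move=> e /cu[N HN]; exists N => k i Nk Ni; have := HN k i Nk Ni.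
  by rewrite !vu -UB// transport_norm//; exact: XB.
exists (U l); first by exists l.
have := vl; apply: cvg_trans; rewrite (_ : (fun k => _) = fun k => hilbert_norm nrmA ipX (v k - l))//.
by apply/funext => k; rewrite vu -UB// transport_norm//; exact: XB.
Qed.

Lemma transport_full : full_module nrmA X ipX -> full_module nrmB Y ipY.
Proof.
move=> Xf b e e0; have [a <-] := PhiS b; have [x [y [Xx Xy xy]]] := Xf a e e0.
exists (U x), (U y); split; [by exists x|by exists y|].
by case: Phi_iso => _ _ _ _ Pn; rewrite ipU// -PhiB Pn.
Qed.

Lemma transport_unitary : unitary_isomorphism Phi X ipX Y ipY U.
Proof.
split; first by move=> x Xx; exists x.
(* Outside the image the inverse takes the arbitrary value 0. *)
have /choice[us Hus] : forall y, exists x, Y y -> X x /\ U x = y.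
  by move=> y; have [[x Xx <-]|nY] := pselect (Y y); [exists x|exists 0].
exists us; split.
- by move=> y /Hus[].
- by move=> x y Xx Yy; have [Xu uy] := Hus y Yy; rewrite -{1}uy ipU.
- by move=> x Xx; have [|Xu ux] := Hus (U x); [exists x|exact: transport_inj].
- by move=> y /Hus[].
Qed.

End transport.

(** * The Gelfand transform on finite sums, and assembly of the four assertions *)

Lemma CT_gelf_fourierZ (R : realType) (d : nat) (A : algType R[i]) star nrm
    (j : ('cV[int]_d -> C R) -> A) : group_cstar_algebra star nrm j ->
  forall a z, Ccz a -> gelf nrm j (j a) z = fourierZ a z.
Proof.
move=> gc a z ca; move: z; apply: torus_ind => x.
by rewrite (gelf_j gc ca) (ctrigE _ ca) fourierZ_proj.
Qed.

Theorem theorem4p5 (R : realType) (d : nat) (d_gt0 : (0 < d)%N)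
  (D : 'M[int]_d) (D_dil : dilation_matrix R D) (n : int)
  (A : algType R[i]) (star : A -> A) (nrm : A -> R)
  (j : ('cV[int]_d -> R[i]^o) -> A)
  (A_cstar : group_cstar_algebra star nrm j) :
  [/\ (* 1 *)
      inner_product_module star (@Ccr R d)
        (fun f g => j (bracket D n f g))
        (fun f a => circ D n f (Ccz_of j a)) (j @` (@Ccz R d)) /\
      (forall f, Ccr f ->
        Xnorm D n f = hilbert_norm nrm (fun f g => j (bracket D n f g)) f),
      (* 2 *)
      [/\ hilbert_module star nrm (Xn D n) (Xn_ip D n nrm j) (Xn_act D n nrm j),
          full_module nrm (Xn D n) (Xn_ip D n nrm j),
          forall (u : L2 R d) (a : 'cV[int]_d -> R[i]^o),
            Xn D n u -> (l1norm a < +oo)%E ->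
            {ae cV_lebesgue R d, forall x,
              L2rep (Xn_act D n nrm j u (l1_embed nrm j a)) x =
              circ D n (L2rep u) a x} &
          forall (u : nat -> L2 R d) (l : L2 R d),
            (forall k, Xn D n (u k)) -> Xn D n l ->
            cvg_for (hilbert_norm nrm (Xn_ip D n nrm j)) u l ->
            cvg_for (@L2norm R d) u l],
      (* 3 *)
      hilbert_module (@CT_star R d) (@CT_norm R d) (Xn_hat D n)
        (Xn_hat_ip D n) (@Xn_hat_act R d D n) /\
      full_module (@CT_norm R d) (Xn_hat D n) (Xn_hat_ip D n) &
      (* 4 *)
      exists Phi : A -> CT R d,
        [/\ cstar_isomorphism star nrm (@CT_star R d) (@CT_norm R d) Phi,
            forall a z, Ccz a -> Phi (j a) z = fourierZ a z &
            unitary_isomorphism Phi (Xn D n) (Xn_ip D n nrm j)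
              (Xn_hat D n) (Xn_hat_ip D n) (@fourierL2 R d)]].
Proof.
have D0 := dilation_det D_dil.
have uD : (map_mx intr D : 'M[R]_d) \in unitmx.
  by rewrite unitmxE det_map_mx unitfE intr_eq0.
have uM := mxpow_unit (- n) uD; have iE := index_powE n D0 uD.
have gc := A_cstar; have iso := gelf_iso gc.
have hX := Xn_hilbert uM gc; have fX := Xn_full uM gc; have mX := Xn_ip_module uM gc.
have UD (u v : L2 R d) : Xn D n u -> Xn D n v -> fourierL2 (u + v) = fourierL2 u + fourierL2 v.
  by move=> [f fu] [g gv]; exact: fourierL2D (Xap_Llim fu) (Xap_Llim gv).
have UZ (k : R[i]) (u : L2 R d) : Xn D n u -> fourierL2 (k *: u) = k *: fourierL2 u.
  by move=> [f fu]; exact: fourierL2Z (Xap_Llim fu).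
have ipU := hat_ipE uM iE gc.
have actU (u : L2 R d) (x : A) : Xn D n u -> Xn_hat_act D n (fourierL2 u) (gelf nrm j x) = fourierL2 (Xn_act D n nrm j u x).
  by move=> Xu; exact: (hat_actE uM gc x Xu).
split.
- split; first exact: (@Ccr_ip_module R d D n uM A star nrm j gc).
  by move=> f Cf; exact: (@XnormE R d D n uM A star nrm j gc f Cf).
- split=> //.
  + by move=> u a; exact: (@Xn_l1_act R d D n uM A star nrm j gc u a).
  + by move=> u l; exact: (@Xn_cvg_L2 R d D n uM A star nrm j gc u l).
- split; first exact: (transport_hilbert iso mX UD UZ ipU actU hX).
  exact: (transport_full iso ipU fX).
- exists (gelf nrm j); split=> //; first exact: CT_gelf_fourierZ gc.
  exact: (transport_unitary iso mX UD UZ ipU).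
Qed.
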